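(* Assume that $\lambda$ is Lipschitz continuous and that the initial positions are - either i.i.d. according to $m$, with $\int_{\mathbb R}\sqrt{F_0(x)(1-F_0(x))}\,dx<\infty$, - or optimal deterministic, with $m$ compactly supported. Then there exists $C_b<\infty$ such that for all $N\in\mathbb N^*$ and all $h\in[0,T]$, $$\sup_{t\le T}\mathcal W_1\left(\mathbb E[\mu^{N,h}_t],\mu_t\right)\le C_b\left(\frac1N+h\right).$$
   Context: Fix $T>0$, $\sigma>0$, a $C^1$ function $\Lambda:[0,1]\to\mathbb R$ with derivative $\lambda$, and a probability measure $m$ on $\mathbb R$ with cumulative distribution function $F_0$ and quantile function $F_0^{-1}(u)=\inf\{x:F_0(x)\ge u\}$. Limit: $X$ is the unique strong solution of $X_t=X_0+\sigma W_t+\int_0^t\lambda(F(s,X_s))\,ds$ with $F(s,x)=\mathbb P(X_s\le x)$, where $X_0\sim m$ is independent of the Brownian motion $W$; $\mu_t$ is the law of $X_t$. Particles: $(W^i)_{i\ge1}$ are independent standard Brownian motions, independent of the initial positions. For $1\le i\le N$ let $\lambda^N(i)=N(\Lambda(i/N)-\Lambda((i-1)/N))$. For $h>0$ let $\tau^h_s=\lfloor s/h\rfloor h$, and $\tau^0_s=s$. For $h\in[0,T]$, $(X^{i,N,h})_{1\le i\le N}$ solves $$X^{i,N,h}_t=X^i_0+\sigma W^i_t+\int_0^t\lambda^N\Big(\sum_{j=1}^N\mathbf 1_{\{X^{j,N,h}_{\tau^h_s}\le X^{i,N,h}_{\tau^h_s}\}}\Big)ds$$ ($h=0$: the continuous-time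 particle system; $h>0$: its Euler discretization). Put $\mu^{N,h}_t=\frac1N\sum_{i=1}^N\delta_{X^{i,N,h}_t}$; $\mathbb E[\mu^{N,h}_t]$ is the probability measure defined by $\int\varphi\,d\mathbb E[\mu^{N,h}_t]=\mathbb E\left[\int\varphi\,d\mu^{N,h}_t\right]$ for bounded measurable $\varphi$. Initial positions are ''optimal deterministic'' if $X^i_0=F_0^{-1}\left(\frac{2i-1}{2N}\right)$ for $1\le i\le N$; ''i.i.d. according to $m$'' means $(X^i_0)_{i\ge1}$ are i.i.d. with law $m$. $\mathcal W_1(\mu,\nu)$ is the Wasserstein distance of index $1$ on $\mathbb R$, equal to $\int_{\mathbb R}|F_\mu(x)-F_\nu(x)|dx$ for the cumulative distribution functions $F_\mu,F_\nu$. The constant does not depend on $N$, $h$. *)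

(* Defs.v *)
From HB Require Import structures.
From mathcomp Require Import all_boot all_order all_algebra.
From mathcomp Require Import finmap.
From mathcomp Require Import all_classical all_reals all_analysis.
From mathcomp Require Import measurable_realfun.

Set Implicit Arguments.
Unset Strict Implicit.
Unset Printing Implicit Defensive.

Import Order.TTheory GRing.Theory Num.Theory.
Import numFieldNormedType.Exports.

Local Open Scope classical_set_scope.
Local Open Scope ring_scope.

Section measures_on_R.
Context {R : realType}.

Definition cdf_of (m : probability R R) (x : R) : R := fine (m `]-oo, x]%classic).

Definition quantile (m : probability R R) (u : R) : R :=
  inf [set x | u <= cdf_of m x].

(* The infimum is +oo when there is no coupling. *)
Definition wasserstein1 (mu nu : {measure set R -> \bar R}) : \bar R :=
  ereal_inf [set \int[pi]_z `|z.1 - z.2|%:E | pi in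
    [set pi : probability (R * R)%type R |
      forall A : set R, measurable A ->
        pi (fst @^-1` A) = mu A /\ pi (snd @^-1` A) = nu A]]%E.

Definition compactly_supported (m : probability R R) : Prop :=
  exists2 K : set R, compact K & m (~` K) = 0%E.

End measures_on_R.

Section empirical.
Context {R : realType} (N : nat).

Definition empirical (x : 'I_N -> R) (A : set R) : \bar R :=
  ((N%:R^-1)%:E * \sum_(i < N) \d_(x i) A)%E.

Section empirical_measure.
Variable x : 'I_N -> R.

Let empirical0 : empirical x set0 = 0%E.
Proof.
by rewrite /empirical big1 ?mule0// => i _; rewrite diracE in_set0.
Qed.

Let empirical_ge0 A : (0 <= empirical x A)%E.
Proof. by rewrite mule_ge0 ?lee_fin ?invr_ge0// sume_ge0. Qed.

Let empirical_sigma_additive : semi_sigma_additive (empirical x).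
Proof.
move=> F mF tF mUF; rewrite /empirical.
under eq_fun => n.
  rewrite -ge0_sume_distrr; last by move=> k _; exact: sume_ge0.
  rewrite exchange_big/=.
  over.
apply: cvgeZl => //.
apply: cvg_nnesum => [i _|i _]; first by apply: nearW => n; exact: sume_ge0.
exact: (@measure_semi_sigma_additive _ _ _ \d_(x i) F mF tF mUF).
Qed.

HB.instance Definition _ := isMeasure.Build _ _ _ (empirical x)
  empirical0 empirical_ge0 empirical_sigma_additive.

End empirical_measure.
End empirical.

Section mean_empirical.
Context {R : realType} {d} {Omega : measurableType d} (P : probability Omega R).
Context (N : nat).

Definition mean_empirical (X : 'I_N -> {RV P >-> R}) (A : set R) : \bar R :=
  (\int[P]_w empirical (X ^~ w) A)%E.

Lemma measurable_empirical (X : 'I_N -> {RV P >-> R}) (A : set R) :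
  measurable A -> measurable_fun setT (fun w => empirical (X ^~ w) A : \bar R).
Proof.
move=> mA; apply: measurable_funeM; apply: emeasurable_sum => i.
rewrite (_ : (fun _ => _) = (fun w => (\1_(X i @^-1` A) w)%:E)); last first.
  by apply/funext => w; rewrite diracE indicE.
apply/measurable_EFinP; apply: measurable_indic.
by rewrite -[X in measurable X]setTI; exact: measurable_funP.
Qed.

Section mean_empirical_measure.
Variable X : 'I_N -> {RV P >-> R}.

Let mean_empirical0 : mean_empirical X set0 = 0%E.
Proof.
by rewrite /mean_empirical; apply: integral0_eq => w _; rewrite measure0.
Qed.

Let mean_empirical_ge0 A : (0 <= mean_empirical X A)%E.
Proof. by apply: integral_ge0. Qed.

Let mean_empirical_sigma_additive : semi_sigma_additive (mean_empirical X).
Proof.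
move=> F mF tF mUF; rewrite [X in _ --> X](_ : _ =
    \sum_(n <oo) mean_empirical X (F n))%E.
  by apply/cvg_ex; eexists; apply: is_cvg_ereal_nneg_natsum => n _.
rewrite /mean_empirical -integral_nneseries//; last first.
  by move=> n; exact: measurable_empirical.
apply: eq_integral => w _; rewrite measure_semi_bigcup//.
Qed.

HB.instance Definition _ := isMeasure.Build _ _ _ (mean_empirical X)
  mean_empirical0 mean_empirical_ge0 mean_empirical_sigma_additive.

End mean_empirical_measure.
End mean_empirical.

Section mean_empirical_theory.
Context {R : realType} {d} {Omega : measurableType d} (P : probability Omega R).

Lemma mean_empirical_setT (N : nat) (X : 'I_N -> {RV P >-> R}) :
  (0 < N)%N -> mean_empirical X setT = 1%E.
Proof.
move=> N0; rewrite /mean_empirical (eq_integral (cst 1%E)); last first.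
  move=> w _ /=; rewrite /empirical; under eq_bigr do rewrite diracT.
  rewrite sumEFin -EFinM; congr (_%:E).
  by rewrite sumr_const card_ord -mulr_natr mul1r mulVf// pnatr_eq0 -lt0n.
rewrite integral_cst// mul1e.
exact: probability_setT.
Qed.

Let empiricalE (N : nat) (x : 'I_N -> R) (A : set R) :
  empirical x A = ((N%:R^-1)%:E * \sum_(i < N) \d_(x i) A)%E.
Proof. by []. Qed.

Lemma ge0_integral_empirical (N : nat) (x : 'I_N -> R) (phi : R -> \bar R) :
  measurable_fun setT phi -> (forall y, 0 <= phi y)%E ->
  (\int[empirical x]_y phi y = (N%:R^-1)%:E * \sum_(i < N) phi (x i))%E.
Proof.
move=> mphi phi0; case: N x => [|n] x.
  rewrite big_ord0 mule0 (eq_measure_integral mzero) ?integral_measure_zero//.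
  by move=> A mA _; rewrite -[LHS]/(empirical x A) empiricalE big_ord0 mule0.
rewrite (eq_measure_integral (mscale ((n.+1%:R^-1)%:nng : {nonneg R})
   (msum (fun k => \d_(x (inord k))) n.+1))); last first.
  move=> A mA _; rewrite -[LHS]/(empirical x A) empiricalE /= /mscale /msum /=.
  congr (_ * _)%E.
  by apply: eq_bigr => i _; rewrite inord_val.
rewrite ge0_integral_mscale// ge0_integral_measure_sum//=; congr (_ * _)%E.
by apply: eq_bigr => i _; rewrite integral_dirac// diracT mul1e inord_val.
Qed.

(* mean_empirical X is indeed the mean of the random empirical measure. *)
Lemma ge0_integral_mean_empirical (N : nat) (X : 'I_N -> {RV P >-> R})
    (phi : R -> \bar R) :
  measurable_fun setT phi -> (forall y, 0 <= phi y)%E ->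
  (\int[mean_empirical X]_y phi y =
   \int[P]_w \int[empirical (X ^~ w)]_y phi y)%E.
Proof.
move=> mphi phi0.
under [RHS]eq_integral do rewrite ge0_integral_empirical//.
have mphiX i : measurable_fun setT (fun w => phi (X i w)).
  by apply: measurableT_comp => //; exact: measurable_funP.
have mS : measurable_fun setT (fun w => \sum_(i < N) phi (X i w))%E.
  by apply: emeasurable_sum => i; exact: mphiX.
rewrite ge0_integralZl//; last by move=> w _; exact: sume_ge0.
rewrite ge0_integral_sum//.
case: N X mphiX mS => [|n] X mphiX mS.
  rewrite big_ord0 mule0 (eq_measure_integral mzero) ?integral_measure_zero//.
  move=> A mA _; apply: integral0_eq => w _.
  by rewrite empiricalE big_ord0 mule0.
rewrite (eq_measure_integral (mscale ((n.+1%:R^-1)%:nng : {nonneg R})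
   (msum (fun k => distribution P (X (inord k))) n.+1))); last first.
  move=> A mA _; rewrite /= /mscale /msum /=.
  have mXA i : measurable (X i @^-1` A).
    by rewrite -[X in measurable X]setTI; exact: measurable_funP.
  have md i : measurable_fun setT (fun w => \d_(X i w) A : \bar R).
    rewrite (_ : (fun _ => _) = (fun w => (\1_(X i @^-1` A) w)%:E)); last first.
      by apply/funext => w; rewrite diracE indicE.
    by apply/measurable_EFinP; apply: measurable_indic; exact: mXA.
  transitivity (\int[P]_w ((n.+1%:R^-1)%:E * \sum_(i < n.+1) \d_(X i w) A))%E.
    by [].
  rewrite ge0_integralZl//; last 2 first.
    by apply: emeasurable_sum => i; exact: md.
    by move=> w _; exact: sume_ge0.
  rewrite ge0_integral_sum//; congr (_ * _)%E; apply: eq_bigr => i _.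
  rewrite inord_val -[RHS]/(P (X i @^-1` A)).
  by rewrite -[X in _ = P X]setIT -integral_indic.
rewrite ge0_integral_mscale// ge0_integral_measure_sum//=; congr (_ * _)%E.
apply: eq_bigr => i _; rewrite inord_val.
by rewrite ge0_integral_distribution.
Qed.

End mean_empirical_theory.

Section independence.
Context {R : realType} {d} {Omega : measurableType d} (P : probability Omega R).

Definition generated_sigma_algebra (I : Type) (D : set I) (X : I -> Omega -> R)
    : set (set Omega) :=
  <<s \bigcup_(i in D) preimage_set_system setT (X i) measurable >>.

Definition independent2 (G H : set (set Omega)) : Prop :=
  forall A B, G A -> H B -> P (A `&` B) = (P A * P B)%E.

Definition mutually_independent (G : nat -> set (set Omega)) : Prop :=
  forall (J : {fset nat}) (A : nat -> set Omega),
    (forall i, i \in J -> G i (A i)) ->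
    P (\bigcap_(i in [set` J]) A i) = (\prod_(i <- J) P (A i))%E.

Definition has_law (X : Omega -> R) (mu : set R -> \bar R) : Prop :=
  forall A : set R, measurable A -> P (X @^-1` A) = mu A.

Definition null_sets : set (set Omega) :=
  [set A | measurable A /\ P A = 0%E].

(* Sigma-algebra at time t of the P-augmented filtration generated by the
   initial positions xi_i and the processes W_j. *)
Definition augmented_filtration (I J : Type) (xi : I -> Omega -> R)
    (W : J -> R -> Omega -> R) (t : R) : set (set Omega) :=
  <<s generated_sigma_algebra setT xi `|`
      generated_sigma_algebra [set p : J * R | 0 <= p.2 <= t]
        (fun p => W p.1 p.2) `|`
      null_sets >>.

Definition adapted_on (T : R) (F : R -> set (set Omega)) (X : R -> Omega -> R)
    : Prop :=
  forall t, 0 <= t <= T -> forall A : set R, measurable A -> F t (X t @^-1` A).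

End independence.

Section brownian.
Context {R : realType} {d} {Omega : measurableType d} (P : probability Omega R).

Definition brownian_motion (W : R -> {RV P >-> R}) : Prop :=
  [/\ {ae P, forall w, W 0 w = 0},
      forall s t, 0 <= s -> s < t ->
        has_law P (fun w => W t w - W s w) (normal_prob 0 (Num.sqrt (t - s))),
      forall s t, 0 <= s -> s < t ->
        independent2 P
          (generated_sigma_algebra [set r | 0 <= r <= s] (fun r => W r))
          (generated_sigma_algebra [set: unit] (fun _ w => W t w - W s w)) &
      {ae P, forall w, {within `[0, +oo[%classic, continuous (W ^~ w)}}].

Definition independent_brownian_motions (W : nat -> R -> {RV P >-> R}) : Prop :=
  (forall i, brownian_motion (W i)) /\
  mutually_independent P
    (fun i => generated_sigma_algebra [set t | 0 <= t] (fun t => W i t)).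

End brownian.

Section model.
Context {R : realType}.

(* At the endpoints 0 and 1 the derivative is one-sided. *)
Definition C1_on01 (Lam lam : R -> R) : Prop :=
  (forall x, 0 <= x <= 1 ->
    (Lam y - Lam x) / (y - x) @[y --> within `[0, 1]%classic (x^')] --> lam x)
  /\ {within `[0, 1]%classic, continuous lam}.

Context {d} {Omega : measurableType d} (P : probability Omega R).

(* X is a strong solution on [0, T] of the nonlinear SDE
   X_t = X_0 + sigma W_t + int_0^t lam (F (s, X_s)) ds, F(s, x) = P(X_s <= x),
   with X_0 of law m and independent of W. *)
Definition limit_solution (T sigma : R) (lam : R -> R) (m : probability R R)
    (W X : R -> {RV P >-> R}) : Prop :=
  [/\ has_law P (X 0) m,
      independent2 P (generated_sigma_algebra [set: unit] (fun _ => X 0))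
        (generated_sigma_algebra [set t | 0 <= t] (fun t => W t)),
      adapted_on T (augmented_filtration P (fun _ : unit => X 0 : Omega -> R)
        (fun (_ : unit) t => W t)) (fun t => X t),
      {ae P, forall w, {within `[0, T]%classic, continuous (X ^~ w)}} &
      {ae P, forall w, forall t, 0 <= t <= T ->
        X t w = X 0 w + sigma * W t w +
          \int[lebesgue_measure]_(s in `[0, t]%classic)
            lam (fine (cdf (X s) (X s w)))}].

Definition lambdaN (Lam : R -> R) (N i : nat) : R :=
  N%:R * (Lam (i%:R / N%:R) - Lam (i.-1%:R / N%:R)).

Definition tau (h s : R) : R :=
  if h == 0 then s else (Num.floor (s / h))%:~R * h.

Definition rank_of (N : nat) (x : 'I_N -> R) (i : 'I_N) : nat :=
  #|[set j : 'I_N | x j <= x i]%SET|.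

Definition particle_solution (T sigma : R) (Lam : R -> R) (N : nat) (h : R)
    (X0 : 'I_N -> {RV P >-> R}) (W : nat -> R -> {RV P >-> R})
    (X : 'I_N -> R -> {RV P >-> R}) : Prop :=
  forall i : 'I_N,
  [/\ adapted_on T (augmented_filtration P (fun j => X0 j : Omega -> R)
        (fun (j : 'I_N) t => W j t)) (fun t => X i t),
      {ae P, forall w, {within `[0, T]%classic, continuous (X i ^~ w)}} &
      {ae P, forall w, forall t, 0 <= t <= T ->
        X i t w = X0 i w + sigma * W i t w +
          \int[lebesgue_measure]_(s in `[0, t]%classic)
            lambdaN Lam N (rank_of (fun j => X j (tau h s) w) i)}].

(* Particle i : 'I_N of the code is particle i + 1 of the mathematical text;
   X0 N i is its initial position in the system of size N. *)
Definition iid_initial (m : probability R R)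
    (X0 : forall N : nat, 'I_N -> {RV P >-> R}) : Prop :=
  exists Y : nat -> {RV P >-> R},
  [/\ forall i, has_law P (Y i) m,
      mutually_independent P
        (fun i => generated_sigma_algebra [set: unit] (fun _ => Y i)) &
      forall N (i : 'I_N) w, X0 N i w = Y i w].

Definition optimal_deterministic_initial (m : probability R R)
    (X0 : forall N : nat, 'I_N -> {RV P >-> R}) : Prop :=
  forall N (i : 'I_N) w,
    X0 N i w = quantile m ((2 * i.+1%:R - 1) / (2 * N%:R)).

Definition independent_initial (X0 : forall N : nat, 'I_N -> {RV P >-> R})
    (W : nat -> R -> {RV P >-> R}) : Prop :=
  independent2 P
    (generated_sigma_algebra [set: {N : nat & 'I_N}]
      (fun p => X0 (tag p) (tagged p)))
    (generated_sigma_algebra [set p : nat * R | 0 <= p.2]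
      (fun p => W p.1 p.2)).

End model.

Arguments mean_empirical {R d Omega} P {N} X A.
Arguments brownian_motion {R d Omega} P W.
Arguments independent_brownian_motions {R d Omega} P W.
Arguments limit_solution {R d Omega} P T sigma lam m W X.
Arguments particle_solution {R d Omega} P T sigma Lam {N} h X0 W X.
Arguments iid_initial {R d Omega} P m X0.
Arguments optimal_deterministic_initial {R d Omega} P m X0.
Arguments independent_initial {R d Omega} P X0 W.

(* Main.v *)
(* Write g_s for the centred Gaussian density of variance sigma^2 s and K_s for its distribution function. Over a
   grid of step h, expanding K_{t-s}(x - X_s) along the path of a particle gives
     1{X_t <= x} = K_t(x - X_0) + martingale - sum_k h b_k g_{t-kh}(x - X_kh) + rest,
   where the rest is O(h) in L^1(dx) and the martingale increments of different particles or times are orthogonal.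
   Averaging over the particles, the rank structure of the drift telescopes: the empirical mean of
   b_k 1{X_kh <= y} is Lambda(F^N(y)) - Lambda(0). Hence D = F^N - F satisfies a singular Gronwall recursion with
   kernel sqrt(h / (n - k)), first in L^2, where the martingale contributes 1/N; then for E[D] in L^1, where the
   martingale disappears and, by Taylor expansion of Lambda, the nonlinearity costs only E[D^2] = O(1/N + h).
   The rest for the limit is O(h) as well: comparing two grids, it is controlled by Jensen gaps of Lambda under
   Gaussian smoothing, hence by the L^2 modulus of continuity of F, which solves a recursion of the same kind.
   Finally W_1 is bounded by the L^1 distance of the distribution functions through the quantile coupling. *)

From HB Require Import structures.
From mathcomp Require Import all_boot all_order all_algebra.
From mathcomp Require Import finmap.
From mathcomp Require Import all_classical all_reals all_analysis.
From mathcomp Require Import measurable_realfun.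
Require Import Defs.
From mathcomp Require Import ring lra.
Set Implicit Arguments.
Unset Strict Implicit.
Unset Printing Implicit Defensive.
Import Order.TTheory GRing.Theory Num.Theory.
Import numFieldNormedType.Exports.
Local Open Scope classical_set_scope.
Local Open Scope ring_scope.

(** No stochastic integral is used: the expansion is a telescoping sum with one independent Gaussian
    step at a time. For $h>0$ the grid is that of the scheme; for $h=0$ and for the limit it is
    auxiliary. There the drift is only known to be almost surely left-continuous at a fixed time (no
    atoms, no ties), so freezing it over cells converges without a rate: this suffices on grids
    refined to mesh zero but gives no $O(h)$ on a fixed one, whence the separate quadrature estimate
    for the limit. As the particles interact, independence alone does not make their noises
    orthogonal: the past of particle $j$ is enlarged by the other Brownian motions over all times,
    and the increments of $W^j$ stay independent of it. Time 0 is singular, since atoms and ties may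
    occur there and the flux identity may fail; the first cell is always estimated apart. Rests are
    bounded in $L^1(dx)$ with order $h$ and in sup norm with order 1, and the product bounds their
    squares. The record [driven] holds what the limit and the particles have in common. *)

Local Notation measT f := (measurable_fun setT f).

Ltac unEFin := apply/measurable_EFinP.

Ltac mnorm := apply/measurable_EFinP; apply: measurableT_comp => //.

(** * Integral inequalities *)

Section Integrals.
Context d (T : measurableType d) (R : realType).
Variable m : {measure set T -> \bar R}.

(** No integrability is assumed: [Rintegral] is the [fine] part of the integral, hence 0 when the
    latter is infinite, and the bound persists. *)
Lemma abs_Rintegral_le (f : T -> R) : measT f ->
 (`|\int[m]_x f x|%:E <= \int[m]_x `|f x|%:E)%E.
Proof.
move=> mf; apply: (@le_trans _ _ `|\int[m]_x (f x)%:E|%E); last first.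
 by apply: le_abse_integral => //; exact/measurable_EFinP.
by rewrite /Rintegral; case: (\int[m]_x _)%E => [r||] /=; rewrite ?normr0 ?leey ?lee_fin.
Qed.

(* Cauchy--Schwarz for the weight [w]; optimise [2 l f <= l ^ 2 + f ^ 2] in [l]. *)
Lemma weighted_cauchy_schwarz (w f : T -> R) (k : R) :
 measT w -> measT f ->
 (forall x, 0 <= w x) -> (forall x, 0 <= f x) ->
 (\int[m]_x (w x)%:E <= k%:E)%E ->
 ((\int[m]_x (w x * f x)%:E) ^+ 2 <= k%:E * \int[m]_x (w x * f x ^+ 2)%:E)%E.
Proof.
move=> mw mf w0 f0 wk.
have mwf : measT (fun x => w x * f x) by exact: measurable_funM.
have mwf2 : measT (fun x => w x * f x ^+ 2).
 by apply: measurable_funM => //; exact: measurable_funX.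
have k0 : 0 <= k.
 by rewrite -lee_fin; apply: le_trans wk; apply: integral_ge0 => x _; rewrite lee_fin.
set B := (\int[m]_x (w x * f x ^+ 2)%:E)%E.
have B0 : (0 <= B)%E by apply: integral_ge0 => x _; rewrite lee_fin mulr_ge0// sqr_ge0.
set A := (\int[m]_x (w x * f x)%:E)%E.
have A0 : (0 <= A)%E by apply: integral_ge0 => x _; rewrite lee_fin mulr_ge0.
have key l : 0 <= l -> ((2 * l)%:E * A <= (l ^+ 2 * k)%:E + B)%E.
 move=> l0; rewrite /A -ge0_integralZl//; last 3 first.
 - exact/measurable_EFinP.
 - by move=> x _; rewrite lee_fin mulr_ge0.
 - by rewrite lee_fin mulr_ge0.
 apply: (@le_trans _ _ (\int[m]_x ((l ^+ 2)%:E * (w x)%:E + (w x * f x ^+ 2)%:E))%E).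
  apply: ge0_le_integral => //.
  - by move=> x _; rewrite -EFinM lee_fin !mulr_ge0.
  - by apply: measurable_funeM; exact/measurable_EFinP.
  - apply: emeasurable_funD; last exact/measurable_EFinP.
   by apply: measurable_funeM; exact/measurable_EFinP.
  - move=> x _; rewrite -!EFinM -EFinD lee_fin.
   have := mulr_ge0 (w0 x) (sqr_ge0 (l - f x)); nra.
 rewrite ge0_integralD//; last 4 first.
 - by move=> x _; rewrite -EFinM lee_fin mulr_ge0// sqr_ge0.
 - by apply: measurable_funeM; exact/measurable_EFinP.
 - by move=> x _; rewrite lee_fin mulr_ge0// sqr_ge0.
 - exact/measurable_EFinP.
 rewrite leeD2r// ge0_integralZl//; last 3 first.
 - exact/measurable_EFinP.
 - by move=> x _; rewrite lee_fin.
 - by rewrite lee_fin sqr_ge0.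
 by rewrite (EFinM _ k) lee_wpmul2l// lee_fin sqr_ge0.
(* The optimal [l] is [A / k], so [k = 0] is treated apart: the weight then vanishes almost
   everywhere. *)
have [k00|kN0] := eqVneq k 0.
 have A00 : A = 0%E.
  have W : ae_eq m setT (EFin \o w) (cst 0%E).
   apply/ae_eq_integral_abs => //; first exact/measurable_EFinP.
   apply/eqP; rewrite eq_le; apply/andP; split; last exact: integral_ge0.
   apply: (@le_trans _ _ k%:E); last by rewrite k00.
   by under eq_integral do rewrite /= ger0_norm//.
  rewrite /A (ae_eq_integral (cst 0%E))//; last 2 first.
  - exact/measurable_EFinP.
  - apply: filterS W => x /(_ I) /= [wx0] _ ; by rewrite wx0 mul0r.
  by rewrite integral0.
 by rewrite A00 k00 mul0e expe2 mul0e.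
have {}kN0 : 0 < k by rewrite lt_neqAle eq_sym kN0.
case: B B0 key => [B|//|//] B0 key; last first.
 by rewrite mulry gtr0_sg ?mul1e ?leey.
have : (A < +oo)%E.
 have := key 1 ler01; rewrite -EFinD.
 case: (A) => [r|h|//]; first by rewrite ltry.
 by move: h; rewrite mulr1 mulry gtr0_sg// mul1e.
case: A A0 key => [A|//|//] A0 key _.
rewrite -EFin_expe -EFinM lee_fin.
have := key (A / k) _; rewrite -EFinM -EFinD lee_fin divr_ge0 -?lee_fin// => /(_ isT).
have -> : (A / k) ^+ 2 * k = A ^+ 2 / k by field; rewrite gt_eqF.
have -> : 2 * (A / k) * A = 2 * (A ^+ 2 / k) by field; rewrite gt_eqF.
by rewrite !lee_fin => h; rewrite (mulrC k) -ler_pdivrMr//; lra.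
Qed.

End Integrals.

(** * Affine changes of variable for Lebesgue measure *)

Section Affine.
Context (R : realType).
Notation mu := (@lebesgue_measure R).

(** Lebesgue measure is determined by its values on half-open intervals, and the rescaled
    pushforward takes the same values there. *)
Lemma lebesgue_measure_affine (c b : R) (A : set (measurableTypeR R)) : 0 < c -> measurable A ->
 mu A = (c%:E * mu ((fun x : R => c * x + b)%R @^-1` A))%E.
Proof.
move=> c0 mA.
pose phi : measurableTypeR R -> measurableTypeR R := fun x => (c * x + b)%R.
have mphi : measT phi.
 by apply: measurable_funD => //; exact: measurable_funM.
pose pm := measure_function_pushforward__canonical__measure_function_Measure mu mphi.
pose nu : {measure set (measurableTypeR R) -> \bar R} := mscale (NngNum (ltW c0)) pm.
have nuE B : nu B = (c%:E * mu (phi @^-1` B))%E by [].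
rewrite (@lebesgue_measure_unique R nu _ A mA)//.
move=> X [[x y] _ <-]; rewrite nuE /=.
rewrite [in RHS](_ : phi @^-1` _ = `](x - b) / c, (y - b) / c]%classic); last first.
 apply/seteqP; split => z; rewrite /= !in_itv/= ltr_pdivrMr// ler_pdivlMr//;
  rewrite ltrBlDr lerBrDr (mulrC z)//.
rewrite !lebesgue_measure_itv/= !lte_fin.
rewrite ltr_pM2r ?invr_gt0// ltrD2r.
case: ifPn => _; last by rewrite mule0.
rewrite -!EFinB -EFinM; congr (_%:E); field; by rewrite gt_eqF.
Qed.

Lemma ge0_integral_affine (c b : R) (f : R -> \bar R) : 0 < c ->
 measT f -> (forall x, 0 <= f x)%E ->
 (\int[mu]_x f (c * x + b)%R = (c^-1)%:E * \int[mu]_x f x)%E.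
Proof.
move=> c0 mf f0.
pose phi : measurableTypeR R -> measurableTypeR R := fun x => (c * x + b)%R.
have mphi : measT phi.
 by apply: measurable_funD => //; exact: measurable_funM.
pose pm := measure_function_pushforward__canonical__measure_function_Measure mu mphi.
transitivity (\int[pm]_x f x)%E.
 by rewrite ge0_integral_pushforward.
rewrite [in RHS](@eq_measure_integral _ _ _ _ (mscale (NngNum (ltW c0)) pm)).
 rewrite ge0_integral_mscale// muleA -EFinM mulVf ?gt_eqF// mul1e//.
by move=> A mA _; exact: (@lebesgue_measure_affine c b A).
Qed.

Lemma ge0_integral_shift (b : R) (f : R -> \bar R) :
 measT f -> (forall x, 0 <= f x)%E ->
 (\int[mu]_x f (x + b)%R = \int[mu]_x f x)%E.
Proof.
move=> mf f0; have := @ge0_integral_affine 1 b f ltr01 mf f0.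
by rewrite invr1 mul1e => <-; apply: eq_integral => x _; rewrite mul1r.
Qed.

Lemma ge0_integral_opp (f : R -> \bar R) :
 measT f -> (forall x, 0 <= f x)%E ->
 (\int[mu]_x f (- x)%R = \int[mu]_x f x)%E.
Proof.
move=> mf f0.
pose phi : measurableTypeR R -> measurableTypeR R := fun x => (- x)%R.
have mphi : measT phi by apply: measurableT_comp.
pose pm := measure_function_pushforward__canonical__measure_function_Measure mu mphi.
transitivity (\int[pm]_x f x)%E.
 by rewrite ge0_integral_pushforward.
by apply: eq_measure_integral => A mA _; exact: lebesgue_measureN.
Qed.

Lemma ge0_integral_reflect (b : R) (f : R -> \bar R) :
 measT f -> (forall x, 0 <= f x)%E ->
 (\int[mu]_x f (b - x)%R = \int[mu]_x f x)%E.
Proof.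
move=> mf f0.
rewrite -(@ge0_integral_shift b f)// -(@ge0_integral_opp (fun x => f (x + b)))//.
- by apply: eq_integral => x _; rewrite addrC.
- by apply: measurableT_comp => //; exact: measurable_funD.
Qed.

End Affine.

(** * Gaussian kernels *)

Section GaussianKernel.
Context (R : realType).
Notation mu := (@lebesgue_measure R).
Implicit Types v w x y z : R.

(** The parameter is the variance, so that convolution adds parameters, whereas [normal_pdf] takes
    the standard deviation. *)
Definition gk v x : R := normal_pdf 0 (Num.sqrt v) x.
Definition dgk v x : R := - (x / v) * gk v x.

Lemma gkE v x : 0 < v ->
 gk v x = (Num.sqrt (v * pi *+ 2))^-1 * expR (- (x ^+ 2 / (v *+ 2))).
Proof.
move=> v0; rewrite /gk normal_pdfE ?gt_eqF ?sqrtr_gt0// /normal_peak /normal_fun.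
by rewrite sqr_sqrtr ?ltW// subr0 mulNr.
Qed.

Lemma meas_gk v : measT (gk v).
Proof. exact: measurable_normal_pdf. Qed.

Lemma meas_dgk v : measT (dgk v).
Proof.
apply: measurable_funM; last exact: meas_gk.
by apply: measurableT_comp => //; exact: measurable_funM.
Qed.

Lemma gk_ge0 v x : 0 <= gk v x.
Proof. exact: normal_pdf_ge0. Qed.

Lemma integral_gk v : (\int[mu]_x (gk v x)%:E = 1)%E.
Proof. exact: integral_normal_pdf. Qed.

Lemma gkN v x : 0 < v -> gk v (- x) = gk v x.
Proof. by move=> v0; rewrite !gkE// sqrrN. Qed.

Lemma gk_ub v x : 0 < v -> gk v x <= (Num.sqrt v)^-1.
Proof.
move=> v0; rewrite gkE// -[leRHS]mulr1.
apply: ler_pM => //; rewrite ?expR_ge0 ?invr_ge0//.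
 have v2 : v <= v * pi *+ 2 by have := @pi_ge2 R; nra.
 by rewrite lef_pV2 ?posrE ?sqrtr_gt0 ?ler_wsqrtr// (lt_le_trans v0).
rewrite -[leRHS]expR0 ler_expR oppr_le0 divr_ge0 ?sqr_ge0//.
by rewrite mulrn_wge0// ltW.
Qed.

(** Completing the square in [z] factors the integrand into [gk (v + w) x] and the normal density of
    mean [x * w / (v + w)] and variance [v * w / (v + w)]. *)
Lemma gk_semigroup v w x : 0 < v -> 0 < w ->
 (\int[mu]_z (gk v (x - z) * gk w z)%:E = (gk (v + w) x)%:E)%E.
Proof.
move=> v0 w0; have vw0 : 0 < v + w by rewrite addr_gt0.
have s0 : 0 < v * w / (v + w) by rewrite divr_gt0// mulr_gt0.
pose n z := normal_pdf (x * w / (v + w)) (Num.sqrt (v * w / (v + w))) z.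
transitivity (\int[mu]_z ((gk (v + w) x)%:E * (n z)%:E))%E; last first.
 rewrite ge0_integralZl//; last 3 first.
 - by unEFin; exact: measurable_normal_pdf.
 - by move=> z _; rewrite lee_fin normal_pdf_ge0.
 - by rewrite lee_fin gk_ge0.
 by rewrite /n integral_normal_pdf mule1.
apply: eq_integral => z _; rewrite -EFinM; congr (_%:E).
rewrite !gkE// /n normal_pdfE ?gt_eqF ?sqrtr_gt0// /normal_peak /normal_fun.
rewrite sqr_sqrtr ?ltW// mulrACA -expRD [RHS]mulrACA -expRD.
congr (_ * expR _).
 rewrite -!invfM -!sqrtrM; last 2 first.
 - by rewrite mulrn_wge0// mulr_ge0 ?pi_ge0// ltW.
 - by rewrite mulrn_wge0// mulr_ge0 ?pi_ge0// ltW.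
 congr ((Num.sqrt _)^-1); field; by rewrite gt_eqF.
by field; rewrite !gt_eqF.
Qed.

(** Half of the exponent is split off as a spare factor that absorbs polynomial weights; what
    remains is the density of doubled variance. *)
Lemma gk_double v x : 0 < v ->
 gk v x = Num.sqrt 2 * expR (- (x ^+ 2 / (v *+ 4))) * gk (v *+ 2) x.
Proof.
move=> v0; rewrite !gkE ?pmulrn_lgt0//.
have -> : v *+ 2 * pi *+ 2 = 2 * (v * pi *+ 2) :> R by ring.
rewrite [in RHS]sqrtrM// invfM.
have -> : expR (- (x ^+ 2 / (v *+ 2))) =
  expR (- (x ^+ 2 / (v *+ 4))) * expR (- (x ^+ 2 / (v *+ 2 *+ 2))).
 by rewrite -expRD; congr expR; field; rewrite gt_eqF.
have s2 : Num.sqrt 2 != 0 :> R by rewrite gt_eqF// sqrtr_gt0.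
have b0 : Num.sqrt (v * pi *+ 2) != 0.
 by rewrite gt_eqF// sqrtr_gt0 pmulrn_lgt0// mulr_gt0// pi_gt0.
by field; apply/andP.
Qed.

Lemma normr_le_expR (u : R) : `|u| <= expR (u ^+ 2 / 4).
Proof.
apply: le_trans (expR_ge1Dx _); have := sqr_ge0 (`|u| / 2 - 1).
rewrite -(real_normK (num_real u)); nra.
Qed.

(** The weight $|x|/v$ is absorbed by the spare exponential of [gk_double]. The remaining factor
    $v^{-1/2}$ is the singularity of all the Gronwall kernels that follow. *)
Lemma normr_dgk_le v x : 0 < v ->
 `|dgk v x| <= Num.sqrt 2 / Num.sqrt v * gk (v *+ 2) x.
Proof.
move=> v0; have sv0 : 0 < Num.sqrt v by rewrite sqrtr_gt0.
rewrite /dgk normrM normrN (ger0_norm (gk_ge0 _ _)) gk_double// mulrA.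
apply: ler_wpM2r; first exact: gk_ge0.
rewrite mulrCA ler_pM2l ?sqrtr_gt0//.
have := normr_le_expR (x / Num.sqrt v).
rewrite (_ : (x / Num.sqrt v) ^+ 2 / 4 = x ^+ 2 / (v *+ 4)); last first.
 by rewrite expr_div_n sqr_sqrtr ?ltW//; field; rewrite gt_eqF.
rewrite normrM (gtr0_norm (_ : 0 < (Num.sqrt v)^-1)) ?invr_gt0// => h.
rewrite expRN ler_pdivrMr ?expR_gt0// normrM (gtr0_norm (_ : 0 < v^-1)) ?invr_gt0//.
rewrite -{1}(sqr_sqrtr (ltW v0)) expr2 invfM mulrA mulrC ler_pM2l ?invr_gt0//.
Qed.

Lemma sqr_gk_le v x : 0 < v ->
 x ^+ 2 * gk v x <= 4 * Num.sqrt 2 * v * gk (v *+ 2) x.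
Proof.
move=> v0; rewrite gk_double// mulrA; apply: ler_wpM2r; first exact: gk_ge0.
rewrite expRN mulrA ler_pdivrMr ?expR_gt0//.
have h : x ^+ 2 <= 4 * v * expR (x ^+ 2 / (v *+ 4)).
 have -> : 4 * v = v *+ 4 by ring.
 rewrite -ler_pdivrMl ?pmulrn_lgt0// mulrC.
 by apply: le_trans (expR_ge1Dx _); rewrite lerDr.
by have := ler_wpM2l (sqrtr_ge0 (2 : R)) h; nra.
Qed.

Lemma is_derive_gk v x : 0 < v -> is_derive x 1 (gk v) (dgk v x).
Proof.
move=> v0; pose c : R := (Num.sqrt (v * pi *+ 2))^-1; pose e : R := - (v *+ 2)^-1.
have -> : gk v = c *: (expR \o (e *: (@id R) ^+ 2)) :> (R -> R).
 apply/funext => y; rewrite gkE//; congr (_ * expR _).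
 by rewrite /e mulrC -mulNr.
have -> : dgk v x = c *: (expR ((e *: (@id R) ^+ 2) x) * (e *: ((2%:R * x ^+ 1) *: 1))).
 have -> : (e *: (@id R) ^+ 2) x = - (x ^+ 2 / (v *+ 2)).
  by rewrite /e -[LHS]/(_ * x ^+ 2) mulrC mulrN.
 rewrite /dgk gkE// /GRing.scale /= mulr1 expr1 -/c.
 by rewrite /e; field; rewrite gt_eqF.
have h2 : is_derive x 1 ((@id R) ^+ 2) ((2%:R * x ^+ 1) *: 1).
 exact: (@is_deriveX _ _ id 2 x 1 1 (is_derive_id x 1)).
have h3 : is_derive x 1 (e *: (@id R) ^+ 2) (e *: ((2%:R * x ^+ 1) *: 1)).
 exact: is_deriveZ.
have h1 := is_derive_expR ((e *: (@id R) ^+ 2) x).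
have h5 := is_deriveZ c (is_derive1_comp h1 h3).
exact: h5.
Qed.

Lemma continuous_gk v : 0 < v -> continuous (gk v).
Proof. by move=> v0; apply: continuous_normal_pdf; rewrite gt_eqF// sqrtr_gt0. Qed.

Lemma continuous_dgk v : 0 < v -> continuous (dgk v).
Proof.
move=> v0 x; apply: cvgM; last exact: continuous_gk.
by apply: cvgN; apply: cvgM => //; exact: cvg_cst.
Qed.

Lemma cvg_gky v : 0 < v -> gk v x @[x --> +oo%R] --> (0 : R).
Proof.
move=> v0; pose k := (Num.sqrt (v *+ 2))^-1.
have k0 : 0 < k by rewrite invr_gt0 sqrtr_gt0 pmulrn_lgt0.
rewrite (_ : gk v = fun x => (Num.sqrt (v * pi *+ 2))^-1 * gauss_fun (x * k)); last first.
 apply/funext => x; rewrite gkE//; congr (_ * expR _); rewrite exprMn exprVn.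
 by rewrite sqr_sqrtr// mulrn_wge0// ltW.
rewrite -[X in _ --> X](mulr0 (Num.sqrt (v * pi *+ 2))^-1).
apply: cvgM; first exact: cvg_cst.
apply: (cvg_comp (fun x => x * k) (@gauss_fun R)); last exact: cvg_gauss_fun.
by apply: gt0_cvgMly.
Qed.

Lemma Rintegral_reflect (b : R) (f : R -> R) : measT f ->
 \int[mu]_x f (b - x) = \int[mu]_x f x.
Proof.
move=> mf; rewrite /Rintegral; congr fine.
rewrite integralE [RHS]integralE; congr (_ - _)%E.
- rewrite -[RHS](@ge0_integral_reflect _ b (fun x => (f x)%:E)^\+%E)//; last first.
  by apply: measurable_funepos; exact/measurable_EFinP.
 by apply: eq_integral => x _; rewrite !funeposE.
- rewrite -[RHS](@ge0_integral_reflect _ b (fun x => (f x)%:E)^\-%E)//; last first.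
  by apply: measurable_funeneg; exact/measurable_EFinP.
 by apply: eq_integral => x _; rewrite !funenegE.
Qed.

Lemma integrable_dgk v : 0 < v -> mu.-integrable setT (EFin \o dgk v).
Proof.
move=> v0.
apply: (@le_integrable _ _ _ mu _ _ _ (fun x => (Num.sqrt 2 / Num.sqrt v)%:E * (gk (v *+ 2) x)%:E)%E) => //.
- by unEFin; exact: meas_dgk.
- move=> x _; rewrite -EFinM !abse_EFin lee_fin [leRHS]ger0_norm ?normr_dgk_le//.
 by rewrite mulr_ge0 ?gk_ge0// divr_ge0.
- by apply: integrableZl => //; exact: integrable_normal_pdf.
Qed.

Lemma integral_dgk_le v : 0 < v ->
 (\int[mu]_x `|dgk v x|%:E <= (Num.sqrt 2 / Num.sqrt v)%:E)%E.
Proof.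
move=> v0; apply: (@le_trans _ _ (\int[mu]_x ((Num.sqrt 2 / Num.sqrt v)%:E * (gk (v *+ 2) x)%:E))%E).
 apply: ge0_le_integral => //.
 - by do 2 apply: measurableT_comp => //; exact: meas_dgk.
 - by apply: measurable_funeM; unEFin; exact: meas_gk.
 - by move=> x _; rewrite -EFinM lee_fin normr_dgk_le.
rewrite ge0_integralZl//.
- by rewrite integral_gk mule1.
- by unEFin; exact: meas_gk.
- by move=> x _; rewrite lee_fin gk_ge0.
Qed.

(** The improper fundamental theorem of calculus wants an integrand of constant sign, which
    [- dgk v] has only on the positive half-line. For [a < 0] the piece from [a] to 0 is a proper
    integral and is added separately. *)
Lemma Rintegral_dgk_tail v a : 0 < v ->
 \int[mu]_(x in `[a, +oo[) - dgk v x = gk v a.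
Proof.
move=> v0.
have tail b : 0 <= b -> \int[mu]_(x in `[b, +oo[) - dgk v x = gk v b.
 move=> b0.
 rewrite (@Rintegral_ge0_continuous_FTC2y _ _ (fun x => - gk v x) b 0).
 - by rewrite sub0r opprK.
 - move=> x bx; rewrite oppr_ge0 /dgk mulNr oppr_le0 mulr_ge0 ?gk_ge0//.
  by apply: divr_ge0; [exact: le_trans bx|exact: ltW].
 - apply: continuous_subspaceT => x; apply: cvgN; exact: continuous_dgk.
 - by rewrite -oppr0; apply: cvgN; exact: cvg_gky.
 - by move=> x _; apply: derivableN; have [] := is_derive_gk x v0.
 - by apply: cvgN; apply: cvg_at_right_filter; exact: continuous_gk.
 - move=> x _; rewrite derive1E deriveN; last by have [] := is_derive_gk x v0.
  by congr (- _); have [_] := is_derive_gk x v0.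
have [a0|a0] := leP 0 a; first exact: tail.
have ig : mu.-integrable `[a, +oo[ (EFin \o (fun x => - dgk v x)).
 apply: (integrableS measurableT) => //.
 have := integrableN (integrable_dgk v0).
 by apply: eq_integrable.
have := @Rintegral_itvB _ (fun x => - dgk v x) (BLeft a) +oo%O 0 ig.
rewrite !bnd_simp ltW// => /(_ isT isT) /eqP; rewrite subr_eq => /eqP ->.
rewrite Rintegral_itv_obnd_cbnd; last first.
 by apply: (integrableS _ _ _ ig) => //; apply: subset_itvr; rewrite bnd_simp ltW.
rewrite tail//.
rewrite /Rintegral (@continuous_FTC2 _ (fun x => - dgk v x) (fun x => - gk v x))//=.
- by rewrite opprK addrA subrr add0r.
- apply: continuous_subspaceT => x; apply: cvgN; exact: continuous_dgk.
- split.
 + by move=> x _; apply: derivableN; have [] := is_derive_gk x v0.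
 + by apply: cvgN; apply: cvg_at_right_filter; exact: continuous_gk.
 + by apply: cvgN; apply: cvg_at_left_filter; exact: continuous_gk.
- move=> x _; rewrite derive1E deriveN; last by have [] := is_derive_gk x v0.
 by congr (- _); have [_] := is_derive_gk x v0.
Qed.

(** This integration by parts turns a density centred at a position into an indicator smoothed by
    [dgk]; the drifts are summable only against such indicators. *)
Lemma gk_conv v x a : 0 < v ->
 gk v (x - a) = \int[mu]_y (dgk v (x - y) * \1_[set y | a <= y] y).
Proof.
move=> v0.
have dN u : dgk v (- u) = - dgk v u.
 by rewrite /dgk gkN//; ring.
have mf y0 : measT (fun y => dgk v (y0 - y) * \1_[set y | a <= y] y).
 apply: measurable_funM.
  apply: measurableT_comp; first exact: meas_dgk.
  exact: measurable_funB.
 apply: measurable_indic; rewrite (_ : [set y | a <= y] = `[a, +oo[%classic)//.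
 by apply/seteqP; split => y /=; rewrite in_itv/= andbT.
rewrite -(Rintegral_reflect x)// -(Rintegral_reflect 0); last first.
 apply: (@measurableT_comp _ _ _ _ _ _ (fun y => dgk v (x - y) * \1_[set y | a <= y] y)) => //.
 exact: measurable_funB.
rewrite -gkN// opprB -Rintegral_dgk_tail// Rintegral_mkcond.
apply: eq_Rintegral => y _; rewrite sub0r opprK opprD addrA subrr sub0r dN patchE indicE.
have -> : (x + y \in [set y | a <= y]) = (y \in `[a - x, +oo[%classic).
 by apply/idP/idP; rewrite !inE/= in_itv/= andbT; lra.
by case: ifPn => _; rewrite ?mulr1 ?mulr0.
Qed.

End GaussianKernel.

(** * Indicators of half-lines *)

Section Heaviside.
Context (R : realType).
Notation mu := (@lebesgue_measure R).

(** The distribution function at [y] of the unit mass at [a]. *)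
Definition heav (a y : R) : R := (a <= y)%R%:R.

Lemma heav_ge0 a y : 0 <= heav a y. Proof. exact: ler0n. Qed.
Lemma heav_le1 a y : heav a y <= 1. Proof. by rewrite /heav; case: (a <= y). Qed.
Lemma heav_shift a b y : heav (a + b) y = heav a (y - b).
Proof. by rewrite /heav lerBrDr. Qed.

Lemma meas_heav d (T : measurableType d) (f g : T -> R) :
 measT f -> measT g ->
 measT (fun z => heav (f z) (g z)).
Proof.
move=> mf mg; have mb := measurable_fun_ler mf mg.
rewrite (_ : (fun z => heav (f z) (g z)) = (fun z => \1_[set z | f z <= g z] z)); last first.
 by apply/funext => z; rewrite /heav indicE; congr ((_ : bool)%:R);
   apply/idP/idP; rewrite inE.
apply: measurable_indic.
by have := mb measurableT [set true]; rewrite setTI; apply.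
Qed.

Lemma integral_heavB a b : (\int[mu]_y `|heav a y - heav b y|%:E = `|a - b|%:E)%E.
Proof.
wlog ab : a b / a <= b.
 move=> h; have [|/ltW] := leP a b; first exact: h.
 by move=> /h; rewrite distrC => <-; apply: eq_integral => y _; rewrite distrC.
transitivity (\int[mu]_y (\1_(`[a, b[%classic) y)%:E)%E.
 apply: eq_integral => y _; congr (_%:E); rewrite indicE /heav.
 have -> : (y \in `[a, b[%classic) = (a <= y) && ~~ (b <= y).
  by apply/idP/idP; rewrite inE/= in_itv/= ltNge.
 by case: (leP a y) => ay; case: (leP b y) => by0 //=; rewrite ?subrr ?normr0 ?subr0 ?normr1//; lra.
rewrite integral_indic// setIT [LHS]lebesgue_measure_itv/= lte_fin.
rewrite distrC ger0_norm ?subr_ge0//; case: ltP => // ba; congr (_%:E); lra.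
Qed.

End Heaviside.

(** * Fubini and measurability of partial integrals *)

Section Fubini.
Context d1 d2 (T1 : measurableType d1) (T2 : measurableType d2) (R : realType).
Variable m1 : {sigma_finite_measure set T1 -> \bar R}.
Variable m2 : {sigma_finite_measure set T2 -> \bar R}.

Lemma meas_slice1 (f : T1 * T2 -> R) x : measT f ->
 measT (fun y => f (x, y)).
Proof. by move=> mf; apply: measurableT_comp => //; exact: measurable_pair1. Qed.

Lemma meas_slice2 (f : T1 * T2 -> R) y : measT f ->
 measT (fun x => f (x, y)).
Proof. by move=> mf; apply: measurableT_comp => //; exact: measurable_pair2. Qed.

Lemma Rintegral_swap (f : T1 * T2 -> R) :
 measT f ->
 (forall x, m2.-integrable setT (fun y => (f (x, y))%:E)) ->
 (forall y, m1.-integrable setT (fun x => (f (x, y))%:E)) ->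
 (\int[m1]_x \int[m2]_y `|f (x, y)|%:E < +oo)%E ->
 \int[m1]_x \int[m2]_y f (x, y) = \int[m2]_y \int[m1]_x f (x, y).
Proof.
move=> mf i2 i1 fin; rewrite /Rintegral; congr fine.
have intf : (m1 \x m2)%E.-integrable setT (EFin \o f).
 by apply/integrable12ltyP => //; exact/measurable_EFinP.
transitivity (\int[m1]_x \int[m2]_y (EFin \o f) (x, y))%E.
 by apply: eq_integral => x _; rewrite fineK//; exact: integrable_fin_num.
rewrite Fubini//; apply: eq_integral => y _; rewrite fineK//.
exact: integrable_fin_num.
Qed.

Lemma meas_integral1 (f : T1 * T2 -> R) :
 measT f -> (forall z, 0 <= f z) ->
 measT (fun x => \int[m2]_y (f (x, y))%:E)%E.
Proof.
move=> mf f0.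
apply: (@measurable_fun_fubini_tonelli_F _ _ _ _ _ m2 (EFin \o f)) => //.
exact/measurable_EFinP.
Qed.

Lemma meas_integral2 (f : T1 * T2 -> R) :
 measT f -> (forall z, 0 <= f z) ->
 measT (fun y => \int[m1]_x (f (x, y))%:E)%E.
Proof.
move=> mf f0.
apply: (@measurable_fun_fubini_tonelli_G _ _ _ _ _ m1 (EFin \o f)) => //.
exact/measurable_EFinP.
Qed.

Lemma integral_swap (f : T1 * T2 -> R) :
 measT f -> (forall z, 0 <= f z) ->
 (\int[m1]_x \int[m2]_y (f (x, y))%:E = \int[m2]_y \int[m1]_x (f (x, y))%:E)%E.
Proof.
move=> mf f0; rewrite (@fubini_tonelli _ _ _ _ _ m1 m2 (EFin \o f))//.
exact/measurable_EFinP.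
Qed.

(** Positive and negative parts are integrated separately, so that no integrability is required. *)
Lemma meas_Rintegral1 (f : T1 * T2 -> R) :
 measT f ->
 measT (fun x => \int[m2]_y f (x, y)).
Proof.
move=> mf.
rewrite /Rintegral; apply: measurableT_comp => //.
rewrite (_ : (fun x => _) = (fun x => \int[m2]_y ((EFin \o f)^\+ (x, y)) -
  \int[m2]_y ((EFin \o f)^\- (x, y)))%E).
 apply: emeasurable_funB.
 - apply: (@measurable_fun_fubini_tonelli_F _ _ _ _ _ m2 (EFin \o f)^\+%E) => //.
  by apply: measurable_funepos; exact/measurable_EFinP.
 - apply: (@measurable_fun_fubini_tonelli_F _ _ _ _ _ m2 (EFin \o f)^\-%E) => //.
  by apply: measurable_funeneg; exact/measurable_EFinP.
apply/funext => x; rewrite integralE; congr (_ - _)%E;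
 by apply: eq_integral => y _; rewrite ?funeposE ?funenegE.
Qed.

End Fubini.

(** * Convolution on the line *)

Section Convolution.
Context (R : realType).
Notation mu := (@lebesgue_measure R).
Implicit Types (k f : R -> R) (x y : R).

Definition conv k f x : R := \int[mu]_y (k (x - y) * f y).

Lemma meas_subpair : measT (fun z : R * R => z.1 - z.2).
Proof. exact: measurable_funB. Qed.

Lemma meas_convker k f : measT k -> measT f ->
 measT (fun z : R * R => k (z.1 - z.2) * f z.2).
Proof.
move=> mk mf; apply: measurable_funM; last exact: measurableT_comp.
exact: measurableT_comp meas_subpair.
Qed.

Lemma meas_conv k f : measT k -> measT f ->
 measT (conv k f).
Proof.
move=> mk mf; have := meas_Rintegral1 mu (meas_convker mk mf).
exact.
Qed.

Lemma meas_kshift k x : measT k ->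
 measT (fun y => k (x - y)).
Proof. by move=> mk; apply: measurableT_comp => //; exact: measurable_funB. Qed.

Lemma meas_kshift2 k y : measT k ->
 measT (fun x => k (x - y)).
Proof. by move=> mk; apply: measurableT_comp => //; exact: measurable_funB. Qed.

Lemma integral_kshift2 k y : measT k ->
 (\int[mu]_x `|k (x - y)|%:E = \int[mu]_x `|k x|%:E)%E.
Proof.
move=> mk; rewrite (@ge0_integral_shift _ (- y) (fun x => `|k x|%:E))//.
by do 2 apply: measurableT_comp => //.
Qed.

Lemma integral_kshift k x : measT k ->
 (\int[mu]_y `|k (x - y)|%:E = \int[mu]_y `|k y|%:E)%E.
Proof.
move=> mk; rewrite (@ge0_integral_reflect _ x (fun y => `|k y|%:E))//.
by do 2 apply: measurableT_comp => //.
Qed.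

Lemma norm_conv_le k f x : measT k -> measT f ->
 (`|conv k f x|%:E <= \int[mu]_y (`|k (x - y)| * `|f y|)%:E)%E.
Proof.
move=> mk mf; apply: le_trans (abs_Rintegral_le _ _) _.
 by apply: measurable_funM => //; exact: meas_kshift.
by under eq_integral do rewrite normrM.
Qed.

Lemma tonelli_convker k f : measT k -> measT f ->
 (forall x, 0 <= k x) -> (forall x, 0 <= f x) ->
 (\int[mu]_x \int[mu]_y (k (x - y) * f y)%:E = \int[mu]_x (k x)%:E * \int[mu]_y (f y)%:E)%E.
Proof.
move=> mk mf k0 f0.
rewrite (@fubini_tonelli _ _ _ _ _ mu mu (fun z => (k (z.1 - z.2) * f z.2)%:E))/=; last 2 first.
- by unEFin; exact: meas_convker.
- by move=> z; rewrite lee_fin mulr_ge0.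
transitivity (\int[mu]_y (\int[mu]_x (k x)%:E * (f y)%:E))%E; last first.
 rewrite ge0_integralZl//; first exact/measurable_EFinP.
  by move=> x _; rewrite lee_fin.
 by apply: integral_ge0 => x _; rewrite lee_fin.
apply: eq_integral => y _; under eq_integral do rewrite EFinM.
rewrite ge0_integralZr//; last 3 first.
- by unEFin; exact: meas_kshift2.
- by move=> x _; rewrite lee_fin.
- by rewrite lee_fin.
congr (_ * _)%E; rewrite (@ge0_integral_shift _ (- y) (fun x => (k x)%:E))//.
exact/measurable_EFinP.
Qed.

Lemma conv_L1 k f (c : R) : measT k -> measT f ->
 (\int[mu]_x `|k x|%:E <= c%:E)%E ->
 (\int[mu]_x `|conv k f x|%:E <= c%:E * \int[mu]_y `|f y|%:E)%E.
Proof.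
move=> mk mf kc.
have mk' : measT (fun x => `|k x|) by exact: measurableT_comp.
have mf' : measT (fun x => `|f x|) by exact: measurableT_comp.
apply: (@le_trans _ _ (\int[mu]_x \int[mu]_y (`|k (x - y)| * `|f y|)%:E)%E).
 apply: ge0_le_integral => //.
 - by do 2 apply: measurableT_comp => //; exact: meas_conv.
 - apply: (meas_integral1 mu (meas_convker mk' mf')).
  by move=> z; rewrite mulr_ge0.
 - by move=> x _; exact: norm_conv_le.
rewrite (@tonelli_convker (fun x => `|k x|) (fun x => `|f x|))//.
by rewrite lee_wpmul2r//; apply: integral_ge0 => x _; rewrite lee_fin.
Qed.

(** Young's inequality for a kernel in $L^1$: Cauchy--Schwarz with the weight $|k(x-y)|$ produces
    one factor [c], and Tonelli the other. *)
Lemma conv_L2 k f (c : R) : measT k -> measT f ->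
 (\int[mu]_x `|k x|%:E <= c%:E)%E ->
 (\int[mu]_x (conv k f x ^+ 2)%:E <= (c ^+ 2)%:E * \int[mu]_y (f y ^+ 2)%:E)%E.
Proof.
move=> mk mf kc.
have mk' : measT (fun x => `|k x|) by exact: measurableT_comp.
have mf' : measT (fun x => `|f x|) by exact: measurableT_comp.
have mf2 : measT (fun x => f x ^+ 2) by exact: measurable_funX.
have c0 : 0 <= c.
 by rewrite -lee_fin; apply: le_trans kc; apply: integral_ge0 => x _; rewrite lee_fin.
have mI : measT (fun x => \int[mu]_y (`|k (x - y)| * f y ^+ 2)%:E)%E.
 apply: (meas_integral1 mu (meas_convker mk' mf2)).
 by move=> z; rewrite mulr_ge0// sqr_ge0.
apply: (@le_trans _ _ (\int[mu]_x (c%:E * \int[mu]_y (`|k (x - y)| * f y ^+ 2)%:E))%E).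
 apply: ge0_le_integral => //.
 - by move=> x _; rewrite lee_fin sqr_ge0.
 - by unEFin; apply: measurable_funX; exact: meas_conv.
 - exact: measurable_funeM.
 - move=> x _.
  apply: (@le_trans _ _ ((\int[mu]_y (`|k (x - y)| * `|f y|)%:E) ^+ 2)%E).
   rewrite -real_normK ?num_real// EFin_expe.
   rewrite lee_sqr ?norm_conv_le ?lee_fin//.
   by apply: integral_ge0 => y _; rewrite lee_fin mulr_ge0.
  under [in leRHS]eq_integral do rewrite -real_normK ?num_real//.
  apply: weighted_cauchy_schwarz => //; first exact: (meas_kshift x mk').
  by rewrite integral_kshift.
rewrite ge0_integralZl//; last first.
 by move=> x _; apply: integral_ge0 => y _; rewrite lee_fin mulr_ge0// sqr_ge0.
rewrite (@tonelli_convker (fun x => `|k x|) (fun x => f x ^+ 2))//; last first.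
 by move=> x; exact: sqr_ge0.
rewrite expr2 EFinM -muleA lee_wpmul2l ?lee_fin// lee_wpmul2r//.
by apply: integral_ge0 => x _; rewrite lee_fin sqr_ge0.
Qed.

End Convolution.

Section BoundedIntegrable.
Context d (T : measurableType d) (R : realType).

Lemma integrable_bounded (m : {measure set T -> \bar R}) (k f : T -> R) (c : R) :
 m.-integrable setT (EFin \o k) -> measT f ->
 (forall x, `|f x| <= c) -> m.-integrable setT (fun x => (k x * f x)%:E).
Proof.
move=> ik mf fc.
have mk : measT k by unEFin; case/integrableP: ik.
apply: (@le_integrable _ _ _ m _ _ _ (fun x => c%:E * (k x)%:E)%E) => //.
- by unEFin; exact: measurable_funM.
- move=> x _; rewrite -EFinM !abse_EFin lee_fin !normrM mulrC ler_wpM2r//.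
 by rewrite (le_trans (fc x))// ler_norm.
- exact: integrableZl.
Qed.

End BoundedIntegrable.

(** * Gaussian smoothing of indicators *)

Section SmoothedHeaviside.
Context (R : realType).
Notation mu := (@lebesgue_measure R).
Implicit Types (v w x y z a b : R).

Lemma meas_heavr a : measT (heav a).
Proof. exact: (meas_heav (f := cst a) (g := id)). Qed.

Lemma norm_heav_le a y : `|heav a y| <= 1.
Proof. by rewrite ger0_norm ?heav_ge0 ?heav_le1. Qed.

Lemma norm_heavB_le a b y : `|heav a y - heav b y| <= 1.
Proof.
have := heav_ge0 a y; have := heav_ge0 b y; have := heav_le1 a y; have := heav_le1 b y.
by move=> h1 h2 h3 h4; rewrite ler_norml; apply/andP; split; lra.
Qed.

Lemma Rintegral_shift (f : R -> R) b : measT f ->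
 \int[mu]_x f (x + b) = \int[mu]_x f x.
Proof.
move=> mf; rewrite -(Rintegral_reflect b mf) -(Rintegral_reflect 0).
 by apply: eq_Rintegral => y _; rewrite sub0r addrC.
by apply: measurableT_comp => //; exact: measurable_funD.
Qed.

Lemma integrable_gk v : mu.-integrable setT (EFin \o gk v).
Proof. exact: integrable_normal_pdf. Qed.

Lemma integrable_reflect (f : R -> R) b : measT f ->
 mu.-integrable setT (EFin \o f) -> mu.-integrable setT (EFin \o (fun x => f (b - x))).
Proof.
move=> mf /integrableP[_ fi]; apply/integrableP; split.
 by unEFin; exact: meas_kshift.
have := integral_kshift b mf; rewrite /comp /= => ->.
exact: fi.
Qed.

Lemma integrable_convker (k f : R -> R) x (c : R) : measT k ->
 mu.-integrable setT (EFin \o k) -> measT f ->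
 (forall y, `|f y| <= c) -> mu.-integrable setT (fun y => (k (x - y) * f y)%:E).
Proof.
move=> mk ik mf fc; apply: (@integrable_bounded _ _ _ mu (fun y => k (x - y)) f c) => //.
exact: integrable_reflect.
Qed.

Lemma convB (k f g : R -> R) x (c : R) : measT k ->
 mu.-integrable setT (EFin \o k) -> measT f -> measT g ->
 (forall y, `|f y| <= c) -> (forall y, `|g y| <= c) ->
 conv k (fun y => f y - g y) x = conv k f x - conv k g x.
Proof.
move=> mk ik mf mg fc gc; rewrite /conv -RintegralB//; last 2 first.
- exact: (integrable_convker x mk ik mf fc).
- exact: (integrable_convker x mk ik mg gc).
by apply: eq_Rintegral => y _; rewrite mulrBr.
Qed.

Lemma gk_conv_heav v x a : 0 < v -> gk v (x - a) = conv (dgk v) (heav a) x.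
Proof.
move=> v0; rewrite gk_conv//; apply: eq_Rintegral => y _; congr (_ * _).
by rewrite indicE /heav; congr ((_ : bool)%:R); apply/idP/idP; rewrite inE.
Qed.

Lemma gk_shiftB v x a b : 0 < v ->
 gk v (x - a) - gk v (x - b) = conv (dgk v) (fun y => heav a y - heav b y) x.
Proof.
move=> v0; rewrite !gk_conv_heav// (@convB _ _ _ _ 1)//.
- exact: meas_dgk.
- exact: integrable_dgk.
- exact: meas_heavr.
- exact: meas_heavr.
- exact: norm_heav_le.
- exact: norm_heav_le.
Qed.

Lemma integral_gk_shiftB v a b : 0 < v ->
 (\int[mu]_x `|gk v (x - a) - gk v (x - b)|%:E <= (Num.sqrt 2 / Num.sqrt v * `|a - b|)%:E)%E.
Proof.
move=> v0; under eq_integral do rewrite gk_shiftB//.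
apply: le_trans (conv_L1 _ _ (integral_dgk_le v0)) _.
- exact: meas_dgk.
- by apply: measurable_funB; exact: meas_heavr.
- by rewrite integral_heavB EFinM.
Qed.

(** The distribution function of the centred Gaussian law of variance [v]. For [v <= 0] it is the
    indicator itself, so that the end of a telescoping sum, where no variance is left, needs no
    formula of its own. *)
Definition Kc v x : R := if 0 < v then conv (gk v) (heav 0) x else heav 0 x.

Lemma meas_Kc v : measT (Kc v).
Proof.
have [v0|v0] := ltP 0 v.
 rewrite (_ : Kc v = conv (gk v) (heav 0)).
  by apply: meas_conv; [exact: meas_gk|exact: meas_heavr].
 by apply/funext => x; rewrite /Kc v0.
rewrite (_ : Kc v = heav 0); first exact: meas_heavr.
by apply/funext => x; rewrite /Kc ltNge v0.
Qed.

Lemma Kc_shift v x a : 0 < v -> Kc v (x - a) = conv (gk v) (heav a) x.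
Proof.
move=> v0; rewrite /Kc v0 /conv.
rewrite -(Rintegral_shift (- a) (f := fun y => gk v (x - a - y) * heav 0 y)).
 apply: eq_Rintegral => y _; rewrite /heav subr_ge0; congr (gk _ _ * _); ring.
apply: measurable_funM; last exact: meas_heavr.
by apply: meas_kshift; exact: meas_gk.
Qed.

Lemma Kc0_shift v x a : v <= 0 -> Kc v (x - a) = heav a x.
Proof. by move=> v0; rewrite /Kc ltNge v0/= /heav subr_ge0. Qed.

Lemma Kc_ge0 v x : 0 <= Kc v x.
Proof.
rewrite /Kc; case: ifP => _; last exact: heav_ge0.
by apply: Rintegral_ge0 => y _; rewrite mulr_ge0 ?gk_ge0 ?heav_ge0.
Qed.

Lemma Kc_le1 v x : Kc v x <= 1.
Proof.
rewrite /Kc; case: ifP => [v0|_]; last exact: heav_le1.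
have -> : 1 = \int[mu]_y gk v (x - y).
 by rewrite (Rintegral_reflect _ (meas_gk v)) /Rintegral integral_gk.
apply: le_Rintegral => //.
- apply: (@integrable_convker _ _ _ 1).
 + exact: meas_gk.
 + exact: integrable_gk.
 + exact: meas_heavr.
 + exact: norm_heav_le.
- by apply: integrable_reflect; [exact: meas_gk|exact: integrable_gk].
- by move=> y _; rewrite ler_piMr ?gk_ge0 ?heav_le1.
Qed.

Lemma Kc_shiftB v x a b : 0 < v ->
 Kc v (x - a) - Kc v (x - b) = conv (gk v) (fun y => heav a y - heav b y) x.
Proof.
move=> v0; rewrite !Kc_shift// (@convB _ _ _ _ 1)//.
- exact: meas_gk.
- exact: integrable_gk.
- exact: meas_heavr.
- exact: meas_heavr.
- exact: norm_heav_le.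
- exact: norm_heav_le.
Qed.

Lemma integral_norm_gk v : (\int[mu]_x `|gk v x|%:E <= 1%:E)%E.
Proof. by under eq_integral do rewrite ger0_norm ?gk_ge0//; rewrite integral_gk. Qed.

Lemma integral_Kc_shiftB v a b :
 (\int[mu]_x `|Kc v (x - a) - Kc v (x - b)|%:E <= `|a - b|%:E)%E.
Proof.
have [v0|v0] := leP v 0.
 by under eq_integral do rewrite !Kc0_shift//; rewrite integral_heavB.
under eq_integral do rewrite Kc_shiftB//.
apply: le_trans (conv_L1 _ _ (integral_norm_gk v)) _.
- exact: meas_gk.
- by apply: measurable_funB; exact: meas_heavr.
- by rewrite integral_heavB mul1e.
Qed.

Lemma norm_Kc_shiftB v x a b : 0 < v ->
 `|Kc v (x - a) - Kc v (x - b)| <= `|a - b| / Num.sqrt v.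
Proof.
move=> v0; rewrite Kc_shiftB// -lee_fin.
have mh : measT (fun y => heav a y - heav b y).
 by apply: measurable_funB; exact: meas_heavr.
have mh' : measT (fun y => `|heav a y - heav b y|).
 exact: measurableT_comp.
apply: le_trans (norm_conv_le _ _ _) _ => //; first exact: meas_gk.
apply: (@le_trans _ _ (\int[mu]_y ((Num.sqrt v)^-1%:E * `|heav a y - heav b y|%:E))%E).
 apply: ge0_le_integral => //.
 - unEFin; apply: measurable_funM => //.
  by apply: measurableT_comp => //; apply: meas_kshift; exact: meas_gk.
 - by apply: measurable_funeM; exact/measurable_EFinP.
 - move=> y _; rewrite -EFinM lee_fin ler_wpM2r// ger0_norm ?gk_ge0//.
  exact: gk_ub.
rewrite ge0_integralZl//; last exact/measurable_EFinP.
by rewrite integral_heavB -EFinM mulrC.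
Qed.

Lemma integrable_heavB a b : mu.-integrable setT (fun y => (heav a y - heav b y)%:E).
Proof.
apply/integrableP; split.
 by unEFin; apply: measurable_funB; exact: meas_heavr.
by under eq_integral do rewrite abse_EFin; rewrite integral_heavB ltry.
Qed.

Lemma Rintegral_heavB a b : \int[mu]_y (heav a y - heav b y) = b - a.
Proof.
wlog ab : a b / a <= b.
 move=> h; have [|/ltW] := leP a b; first exact: h.
 move=> /h h'; rewrite -[RHS]opprB -h' -[RHS]mulN1r -RintegralZl//.
  by apply: eq_Rintegral => y _; ring.
 exact: integrable_heavB.
have := integral_heavB a b; rewrite distrC ger0_norm ?subr_ge0// => h.
rewrite /Rintegral -[RHS]/(fine (b - a)%:E) -h; congr fine.
apply: eq_integral => y _; rewrite ger0_norm// subr_ge0 /heav.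
by case: (leP b y) => // by0; rewrite (le_trans ab by0).
Qed.

Lemma heavB_neq0 a b y : heav a y - heav b y != 0 -> `|y - b| <= `|a - b|.
Proof.
rewrite /heav; case: (leP a y); case: (leP b y); rewrite ?subrr ?eqxx// => h1 h2 _.
 rewrite ler0_norm ?subr_le0 ?(ltW h1)// ler0_norm; last first.
  by rewrite subr_le0 (le_trans h2)// ltW.
 lra.
rewrite !ger0_norm ?subr_ge0//; first lra.
by rewrite (le_trans h1)// ltW.
Qed.

Section Taylor.
Variables (v a dl : R).
Hypothesis v0 : 0 < v.
Let T x := Kc v (x - (a + dl)) - Kc v (x - a) + dl * gk v (x - a).

Let f y := heav (a + dl) y - heav a y.

Let mf : measT f.
Proof. by apply: measurable_funB; exact: meas_heavr. Qed.

Let mf' : measT (fun y => `|f y|).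
Proof. exact: measurableT_comp. Qed.

Let mg x : measT (fun y => gk v (x - y) - gk v (x - a)).
Proof.
by apply: measurable_funB => //; apply: meas_kshift; exact: meas_gk.
Qed.

Let TE x : T x = \int[mu]_y (f y * (gk v (x - y) - gk v (x - a))).
Proof.
rewrite /T Kc_shiftB//.
have -> : dl * gk v (x - a) = - \int[mu]_y (f y * gk v (x - a)).
 rewrite RintegralZr//; last exact: integrable_heavB.
 by rewrite Rintegral_heavB; ring.
rewrite /conv -RintegralB//.
- by apply: eq_Rintegral => y _; rewrite /f; ring.
- apply: (@integrable_convker _ _ _ 1).
 + exact: meas_gk.
 + exact: integrable_gk.
 + exact: mf.
 + by move=> y; exact: norm_heavB_le.
- have := integrableZl measurableT (gk v (x - a)) (integrable_heavB (a + dl) a).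
 by apply: eq_integrable => // y _; rewrite -EFinM mulrC.
Qed.

(** By [TE] the remainder is an integral of [gk v (x - y) - gk v (x - a)] over the [y] between [a]
    and [a + dl]. Each such difference costs at most $\sqrt2\,|dl|/\sqrt v$ in $L^1(dx)$, hence a
    square of [dl] with a single inverse root of [v]. *)
Lemma integral_Kc_taylor :
 (\int[mu]_x `|Kc v (x - (a + dl)) - Kc v (x - a) + dl * gk v (x - a)|%:E
  <= (Num.sqrt 2 / Num.sqrt v * dl ^+ 2)%:E)%E.
Proof.
pose G (z : R * R) := `|f z.2| * `|gk v (z.1 - z.2) - gk v (z.1 - a)|.
have mG : measT G.
 apply: measurable_funM; first exact: (measurableT_comp mf' measurable_snd).
 apply: measurableT_comp => //; apply: measurable_funB.
  by apply: measurableT_comp; [exact: meas_gk|exact: meas_subpair].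
 apply: measurableT_comp; first exact: meas_gk.
 exact: measurable_funB.
have G0 (q : R * R) : 0 <= G q by rewrite mulr_ge0.
have sv : 0 <= Num.sqrt 2 / Num.sqrt v by rewrite divr_ge0.
apply: (@le_trans _ _ (\int[mu]_x \int[mu]_y (G (x, y))%:E)%E).
 apply: ge0_le_integral => //.
 - do 2 apply: measurableT_comp => //; apply: measurable_funD.
   apply: measurable_funB; apply: meas_kshift2; exact: meas_Kc.
  by apply: measurable_funM => //; apply: meas_kshift2; exact: meas_gk.
 - exact: (meas_integral1 mu mG G0).
 - move=> x _; rewrite -/(T x) TE; apply: le_trans (abs_Rintegral_le _ _) _.
   by apply: measurable_funM => //; exact: mg.
  by under eq_integral do rewrite normrM.
rewrite (integral_swap mu mu mG G0).
apply: (@le_trans _ _ (\int[mu]_y ((Num.sqrt 2 / Num.sqrt v * `|dl|)%:E * `|f y|%:E))%E).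
 apply: ge0_le_integral => //.
 - by move=> y _; apply: integral_ge0 => x _; rewrite lee_fin.
 - exact: (meas_integral2 mu mG G0).
 - by apply: measurable_funeM; exact/measurable_EFinP.
 - move=> y _; rewrite /G /=; under eq_integral do rewrite EFinM.
  rewrite ge0_integralZl//; last first.
   mnorm; apply: measurable_funB;
   by apply: meas_kshift2; exact: meas_gk.
  rewrite muleC; have [->|fy0] := eqVneq (f y) 0; first by rewrite normr0 !mule0.
  rewrite lee_wpmul2r ?lee_fin//.
  apply: le_trans (integral_gk_shiftB y a v0) _.
  rewrite lee_fin ler_wpM2l//; have := heavB_neq0 fy0.
  by rewrite (_ : a + dl - a = dl) //; ring.
rewrite ge0_integralZl//; last exact/measurable_EFinP.
rewrite integral_heavB -EFinM lee_fin (_ : a + dl - a = dl); last by ring.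
by rewrite -[leLHS]mulrA -expr2 real_normK// num_real.
Qed.

Lemma norm_Kc_taylor x :
 `|Kc v (x - (a + dl)) - Kc v (x - a) + dl * gk v (x - a)| <= 2 * `|dl| / Num.sqrt v.
Proof.
apply: le_trans (ler_normD _ _) _.
have h1 := norm_Kc_shiftB x (a + dl) a v0.
rewrite (_ : a + dl - a = dl) in h1; last by ring.
have h2 : `|dl * gk v (x - a)| <= `|dl| / Num.sqrt v.
 by rewrite normrM ler_wpM2l// ger0_norm ?gk_ge0// gk_ub.
lra.
Qed.

End Taylor.

End SmoothedHeaviside.

Lemma integrable_bdd d (T : measurableType d) (R : realType) (P : probability T R)
  (g : T -> R) (c : R) :
 measT g -> (forall w, `|g w| <= c) -> P.-integrable setT (EFin \o g).
Proof.
move=> mg gc; apply: (@eq_integrable _ _ _ P setT measurableT (fun x => (cst 1 x * g x)%:E)).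
 by move=> x _; rewrite /= mul1r.
apply: (integrable_bounded (c := c)) => //.
exact: finite_measure_integrable_cst.
Qed.

(** * Semigroup property of the smoothed indicators *)

Section Semigroup.
Context (R : realType).
Notation mu := (@lebesgue_measure R).
Implicit Types (v w x y z a b : R).

Lemma gk_semigroup_shift v w x y : 0 < v -> 0 < w ->
 (\int[mu]_z (gk w (x - z) * gk v (z - y))%:E = (gk (v + w) (x - y))%:E)%E.
Proof.
move=> v0 w0.
rewrite -(@ge0_integral_shift _ y (fun z => (gk w (x - z) * gk v (z - y))%:E)).
- rewrite addrC -gk_semigroup//; apply: eq_integral => z _.
 by congr ((gk _ _ * gk _ _)%:E); ring.
- unEFin; apply: measurable_funM.
  by apply: meas_kshift; exact: meas_gk.
 by apply: meas_kshift2; exact: meas_gk.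
- by move=> z; rewrite lee_fin mulr_ge0 ?gk_ge0.
Qed.

Lemma integrable_gk_bounded v x (f : R -> R) (c : R) : measT f ->
 (forall y, `|f y| <= c) -> mu.-integrable setT (fun y => (gk v (x - y) * f y)%:E).
Proof.
move=> mf fc; apply: (integrable_convker x _ _ mf fc); first exact: meas_gk.
exact: integrable_gk.
Qed.

Lemma EFin_Kc v x : 0 < v -> ((Kc v x)%:E = \int[mu]_y (gk v (x - y) * heav 0 y)%:E)%E.
Proof.
move=> v0; rewrite /Kc v0 /conv /Rintegral fineK//; apply: integrable_fin_num => //.
apply: integrable_gk_bounded; [exact: meas_heavr|exact: norm_heav_le].
Qed.

Lemma norm_Kc_le v x : `|Kc v x| <= 1.
Proof. by rewrite ger0_norm ?Kc_ge0 ?Kc_le1. Qed.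

Lemma Kc_semigroup v w x : 0 <= v -> 0 < w -> conv (gk w) (Kc v) x = Kc (v + w) x.
Proof.
move=> v0 w0; have vw0 : 0 < v + w by rewrite ltr_wpDl.
move: v0; rewrite le_eqVlt => /predU1P[<-|v0].
 rewrite add0r /Kc w0 /conv; apply: eq_Rintegral => y _.
 by rewrite ltxx.
rewrite [RHS]/Kc vw0 /conv /Rintegral; congr fine.
pose F (q : R * R) := gk w (x - q.1) * (gk v (q.1 - q.2) * heav 0 q.2).
have mF : measT F.
 apply: measurable_funM.
  apply: measurableT_comp; first exact: meas_gk.
  exact: measurable_funB.
 apply: (meas_convker (k := gk v) (f := heav 0)); first exact: meas_gk.
 exact: meas_heavr.
have F0 (q : R * R) : 0 <= F q by rewrite !mulr_ge0 ?gk_ge0 ?heav_ge0.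
transitivity (\int[mu]_z \int[mu]_y (F (z, y))%:E)%E.
 apply: eq_integral => z _; rewrite EFinM EFin_Kc// -ge0_integralZl//.
 - unEFin; apply: measurable_funM; last exact: meas_heavr.
  by apply: meas_kshift; exact: meas_gk.
 - by move=> y _; rewrite lee_fin mulr_ge0 ?gk_ge0 ?heav_ge0.
 - by rewrite lee_fin gk_ge0.
rewrite (integral_swap mu mu mF F0); apply: eq_integral => y _.
rewrite EFinM -gk_semigroup_shift// -ge0_integralZr//.
- by apply: eq_integral => z _; rewrite /F /= mulrA.
- unEFin; apply: measurable_funM.
  by apply: meas_kshift; exact: meas_gk.
 by apply: meas_kshift2; exact: meas_gk.
- by move=> z _; rewrite lee_fin mulr_ge0 ?gk_ge0.
- by rewrite lee_fin heav_ge0.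
Qed.

End Semigroup.

(** * Integration against a density *)

Section Density.
Context d (T : measurableType d) (R : realType).
Variables (nu mu : {measure set T -> \bar R}) (p : T -> R).
Hypothesis mp : measT p.
Hypothesis p0 : forall x, 0 <= p x.
Hypothesis nuE : forall A, measurable A -> nu A = (\int[mu]_(x in A) (p x)%:E)%E.
Import HBNNSimple.

Let integral_density_nnsfun (f : {nnsfun T >-> R}) :
 (\int[nu]_x (f x)%:E = \int[mu]_x (f x * p x)%:E)%E.
Proof.
under [LHS]eq_integral do rewrite fimfunE -fsumEFin//.
rewrite [LHS]ge0_integral_fsum//; last 2 first.
 - by move=> r; exact/measurable_EFinP/measurableT_comp.
 - by move=> n x _; rewrite EFinM nnfun_muleindic_ge0.
under [RHS]eq_integral.
 move=> x xD; rewrite EFinM fimfunE -fsumEFin// ge0_mule_fsuml; last first.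
  by move=> r; rewrite EFinM nnfun_muleindic_ge0.
 over.
rewrite [RHS]ge0_integral_fsum//; last 2 first.
 - move=> r; apply: emeasurable_funM; last exact/measurable_EFinP.
  by apply/measurable_EFinP/measurableT_comp.
 - move=> n x _; apply: mule_ge0; last by rewrite lee_fin.
  by rewrite EFinM nnfun_muleindic_ge0.
apply: eq_fsbigr => r _; rewrite integralZl_indic_nnsfun//= integral_indic// setIT nuE//.
transitivity (r%:E * \int[mu]_x ((\1_(f @^-1` [set r]) x)%:E * (p x)%:E))%E.
 congr (_ * _)%E; rewrite integral_mkcond; apply: eq_integral => x _.
 by rewrite patchE indicE; case: ifPn => _; rewrite ?mul1e ?mul0e.
have [r0|r0] := ltP r 0.
 rewrite preimage_nnfun0//.
 under eq_integral do rewrite indic0 mul0e.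
 under [RHS]eq_integral do rewrite indic0 mulr0 mul0e.
 by rewrite !integral0 mule0.
rewrite -ge0_integralZl//.
- by apply: eq_integral => x _; rewrite EFinM muleA.
- apply: emeasurable_funM; last exact/measurable_EFinP.
 exact/measurable_EFinP.
- by move=> x _; rewrite mule_ge0 ?lee_fin.
Qed.

(** Monotone approximation by simple functions, for which the formula is the definition of the
    density. *)
Lemma ge0_integral_density (f : T -> \bar R) :
 measT f -> (forall x, 0 <= f x)%E ->
 (\int[nu]_x f x = \int[mu]_x (f x * (p x)%:E))%E.
Proof.
move=> mf f0.
pose f_ := nnsfun_approx measurableT mf.
transitivity (lim (\int[nu]_x (f_ n x)%:E @[n --> \oo])%E).
 rewrite -monotone_convergence//=.
 - apply: eq_integral => ? /[!inE] xD; apply/esym/cvg_lim => //=.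
  exact: cvg_nnsfun_approx.
 - by move=> n; exact/measurable_EFinP/measurable_funTS.
 - by move=> n ? _; rewrite lee_fin.
 - by move=> ? _ ? ? mn; rewrite lee_fin; exact/lefP/nd_nnsfun_approx.
transitivity (lim (\int[mu]_x (f_ n x * p x)%:E @[n --> \oo])%E).
 by apply: congr_lim; apply/funext => n /=; exact: integral_density_nnsfun.
rewrite -monotone_convergence//=.
- apply: eq_integral => x _; apply/cvg_lim => //=.
 under eq_fun do rewrite EFinM.
 by apply: cvgeZr => //; exact: cvg_nnsfun_approx.
- by move=> n; apply/measurable_EFinP/measurable_funM.
- by move=> n x _; rewrite lee_fin mulr_ge0.
- by move=> x _ ? ? mn; rewrite lee_fin ler_wpM2r//; exact/lefP/nd_nnsfun_approx.
Qed.

End Density.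

(** * Integrating out an independent Gaussian variable *)

Section GaussianSampling.
Context (R : realType).
Notation mu := (@lebesgue_measure R).

Definition gm (v : R) : probability (measurableTypeR R) R := normal_prob 0 (Num.sqrt v).

Lemma gmE v (A : set R) : gm v A = (\int[mu]_(x in A) (gk v x)%:E)%E.
Proof. by []. Qed.

Lemma ge0_integral_gm v (f : R -> \bar R) :
 measT f -> (forall x, 0 <= f x)%E ->
 (\int[gm v]_x f x = \int[mu]_x (f x * (gk v x)%:E))%E.
Proof.
move=> mf f0; apply: (@ge0_integral_density _ _ _ (gm v) mu (gk v)) => //.
- exact: meas_gk.
- by move=> x; exact: gk_ge0.
Qed.

Lemma gm_scale (s v : R) (B : set R) : 0 < s -> 0 < v -> measurable B ->
 gm v ((fun x => s * x) @^-1` B) = gm (s ^+ 2 * v) B.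
Proof.
move=> s0 v0 mB; rewrite !gmE [LHS]integral_mkcond [RHS]integral_mkcond.
have sv0 : 0 < s ^+ 2 * v by rewrite mulr_gt0// exprn_gt0.
pose F : R -> \bar R := ((fun x => (gk (s ^+ 2 * v) x)%:E) \_ B).
have mF : measT F.
 have H : measurable_fun B (fun x => (gk (s ^+ 2 * v) x)%:E).
  by apply: measurable_funTS; unEFin; exact: meas_gk.
 exact: (measurable_restrictT _ mB).1 H.
have F0 x : (0 <= F x)%E by rewrite /F patchE; case: ifP => // _; rewrite lee_fin gk_ge0.
rewrite -[RHS]mul1e -(mulfV (lt0r_neq0 s0)) EFinM -muleA -(ge0_integral_affine 0 s0 mF F0).
rewrite -ge0_integralZl//; last 2 first.
- apply: (measurableT_comp mF); apply: measurable_funD => //; exact: measurable_funM.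
- by rewrite lee_fin ltW.
apply: eq_integral => x _; rewrite /F !patchE addr0.
have -> : (x \in (fun x => s * x) @^-1` B) = (s * x \in B) by apply/idP/idP; rewrite !inE.
case: ifP => _; rewrite ?mule0// -EFinM; congr (_%:E).
rewrite !gkE//.
have -> : s ^+ 2 * v * pi *+ 2 = s ^+ 2 * (v * pi *+ 2) by ring.
rewrite (sqrtrM _ (sqr_ge0 s)) sqrtr_sqr gtr0_norm// invfM !mulrA mulfV ?gt_eqF// mul1r.
by congr (_ * expR _); field; rewrite !gt_eqF.
Qed.

Context d (Omega : measurableType d) (P : probability Omega R).
Context d' (T' : measurableType d').
Variables (V : Omega -> T') (Z : Omega -> R) (v : R).
Hypothesis mV : measT V.
Hypothesis mZ : measT Z.
Hypothesis VZ : forall A B, measurable A -> measurable B ->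
 P (V @^-1` A `&` Z @^-1` B) = (P (V @^-1` A) * gm v B)%E.

Let Z' : Omega -> measurableTypeR R := Z.

(** The joint law of [V] and [Z] agrees with the product law on rectangles, hence everywhere;
    Tonelli then integrates [Z] out. *)
Lemma ge0_integral_gaussian_sample (f : T' * R -> \bar R) :
 measT f -> (forall x, 0 <= f x)%E ->
 (\int[P]_w f (V w, Z w) = \int[P]_w \int[mu]_z (f (V w, z) * (gk v z)%:E))%E.
Proof.
pose f' : T' * measurableTypeR R -> \bar R := f.
move=> mf0; have {mf0} mf : measT f' by [].
move=> f0; have {f0} : (forall x, 0 <= f' x)%E by [].
rewrite -/f' => f0.
pose V' : {RV P >-> T'} := HB.pack V (isMeasurableFun.Build _ _ _ _ _ mV).
have mVZ : measT (fun w => (V w, Z' w)) by exact: measurable_fun_pair.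
pose VZ' : {RV P >-> (T' * measurableTypeR R)%type} :=
 HB.pack (fun w => (V w, Z' w)) (isMeasurableFun.Build _ _ _ _ _ mVZ).
rewrite -[LHS](ge0_integral_distribution VZ')//.
transitivity (\int[(distribution P V' \x gm v)%E]_q f' q)%E.
 apply: eq_measure_integral => A mA _; apply/esym.
 apply: (@product_measure_unique _ _ _ _ _ (distribution P V') (gm v) (distribution P VZ')) => //.
rewrite fubini_tonelli1// /fubini_F.
rewrite -[RHS](ge0_integral_distribution V' (f := fun y => \int[mu]_z (f' (y, z) * (gk v z)%:E))%E).
- apply: eq_integral => y _; rewrite ge0_integral_gm//.
 by apply: measurableT_comp => //; exact: measurable_pair1.
- apply: (@measurable_fun_fubini_tonelli_F _ _ _ _ _ mu (fun q => f' q * (gk v q.2)%:E)%E).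
  apply: emeasurable_funM => //; unEFin.
  by apply: measurableT_comp => //; exact: meas_gk.
 by move=> q; rewrite mule_ge0// lee_fin gk_ge0.
- by move=> y; apply: integral_ge0 => z _; rewrite mule_ge0// lee_fin gk_ge0.
Qed.

(** Reduced to the nonnegative case by adding [c] to the function, which adds [c] to both sides. *)
Lemma Rintegral_gaussian_sample (f : T' * R -> R) (c : R) :
 measT f -> (forall x, `|f x| <= c) ->
 \int[P]_w f (V w, Z w) = \int[P]_w \int[mu]_z (f (V w, z) * gk v z).
Proof.
move=> mf fc.
have c0 q : 0 <= f q + c by have := fc q; rewrite ler_norml => /andP[]; lra.
have mfc : measT (fun q => f q + c) by exact: measurable_funD.
have mVZ : measT (fun w => (V w, Z w)) by exact: measurable_fun_pair.
have := @ge0_integral_gaussian_sample (fun q => (f q + c)%:E) _ _.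
move=> /(_ _ c0); rewrite measurable_EFinP => /(_ mfc) h.
have gkint : mu.-integrable setT (EFin \o gk v) by exact: integrable_gk.
have fz w : mu.-integrable setT (fun z => (f (V w, z) * gk v z)%:E).
 under eq_fun do rewrite mulrC.
 by apply: (integrable_bounded gkint (c := c)) => //; exact: meas_slice1.
have mI : measT (fun w => \int[mu]_z (f (V w, z) * gk v z)).
 apply: (@meas_Rintegral1 _ _ _ _ _ mu (fun q => f (V q.1, q.2) * gk v q.2)).
 apply: measurable_funM; last by apply: measurableT_comp => //; exact: meas_gk.
 apply: measurableT_comp => //; apply: measurable_fun_pair => //.
 exact: measurableT_comp.
have iI w : (\int[mu]_z ((f (V w, z) + c)%:E * (gk v z)%:E))%E =
  (\int[mu]_z (f (V w, z) * gk v z) + c)%:E.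
 rewrite EFinD /Rintegral fineK; last by apply: integrable_fin_num.
 transitivity (\int[mu]_z ((f (V w, z) * gk v z)%:E + (c * gk v z)%:E))%E.
  by apply: eq_integral => z _; rewrite -EFinM -EFinD mulrDl.
 rewrite integralD//; last first.
  by have := integrableZl measurableT c gkint; apply: eq_integrable => // z _.
 congr (_ + _)%E; under eq_integral do rewrite EFinM.
 by rewrite integralZl// integral_gk mule1.
have bI w : `|\int[mu]_z (f (V w, z) * gk v z)| <= c.
 rewrite -lee_fin; apply: le_trans (abs_Rintegral_le _ _) _.
  apply: measurable_funM; last exact: meas_gk.
  exact: meas_slice1.
 apply: (@le_trans _ _ (\int[mu]_z (c%:E * (gk v z)%:E))%E).
  apply: ge0_le_integral => //.
  - mnorm.
   apply: measurable_funM; last exact: meas_gk.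
   exact: meas_slice1.
  - by apply: measurable_funeM; unEFin; exact: meas_gk.
  - move=> z _; rewrite -EFinM lee_fin normrM (ger0_norm (gk_ge0 _ _)).
   by rewrite ler_wpM2r ?gk_ge0.
 by rewrite integralZl// integral_gk mule1.
have if1 : P.-integrable setT (EFin \o (fun w => f (V w, Z w))).
 by apply: (@integrable_bdd _ _ _ P _ c) => //; exact: measurableT_comp.
have if2 := integrable_bdd P mI bI.
have ic : P.-integrable setT (EFin \o (cst c)) by exact: finite_measure_integrable_cst.
have e1 : \int[P]_w (f (V w, Z w) + c) = \int[P]_w (\int[mu]_z (f (V w, z) * gk v z) + c).
 by congr fine; rewrite h; apply: eq_integral => w _; rewrite iI.
by move: e1; rewrite !RintegralD// => /addIr.
Qed.

End GaussianSampling.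

(** * Independence and Gaussian increments *)

Section PiSystemIndependence.
Context d (Omega : measurableType d) (R : realType) (P : probability Omega R).

(** The finite measures $B\mapsto P(B\cap Z)$ and $B\mapsto P(B)P(Z)$ agree on a pi-system that
    contains the whole space, hence on the sigma-algebra it generates. *)
Lemma independent_pi_system (G : set (set Omega)) (Z : set Omega) :
 G `<=` measurable -> G setT -> setI_closed G -> measurable Z ->
 (forall A, G A -> P (A `&` Z) = P A * P Z)%E ->
 forall A, <<s G >> A -> (P (A `&` Z) = P A * P Z)%E.
Proof.
move=> Gm GT GI mZ GZ A sA.
have fZ : P Z \is a fin_num by exact: fin_num_measure.
pose m1 : {measure set Omega -> \bar R} := mrestr P mZ.
pose m2 : {measure set Omega -> \bar R} := mscale (NngNum (fine_ge0 (measure_ge0 P Z))) P.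
have m2E B : m2 B = (P B * P Z)%E.
 by rewrite -[LHS]/((fine (P Z))%:E * P B)%E fineK// muleC.
have := @g_sigma_algebra_measure_unique _ R _ G Gm (fun=> setT) (fun=> GT) _ m1 m2 GI.
rewrite -m2E => h; apply: h => //.
- by apply/seteqP; split => // x _; exists 0%N.
- by move=> B GB; rewrite m2E; exact: GZ.
- move=> _; rewrite -[X in (X < _)%E]/(P (setT `&` Z)) setTI.
 by rewrite (le_lt_trans (probability_le1 _ _))// ltry.
Qed.

Lemma sigma_algebra_setI_closed (G : set (set Omega)) : setI_closed <<s G >>.
Proof.
by move=> A B sA sB; apply: (@measurableI _ (g_sigma_algebraType G)).
Qed.

Lemma sigma_algebra_setT (G : set (set Omega)) : <<s G >> setT.
Proof. exact: (@measurableT _ (g_sigma_algebraType G)). Qed.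

Lemma g_sigma_sub (G H : set (set Omega)) : G `<=` <<s H >> -> <<s G >> `<=` <<s H >>.
Proof. by move=> GH; apply: smallest_sub => //; exact: smallest_sigma_algebra. Qed.

Lemma g_sigma_measurable (G : set (set Omega)) : G `<=` measurable -> <<s G >> `<=` measurable.
Proof. by move=> GH; apply: smallest_sub => //; exact: sigma_algebra_measurable. Qed.

Variables (A O Q : set (set Omega)) (Z : set Omega).
Hypotheses (mA : A `<=` measurable) (mO : O `<=` measurable) (mQ : Q `<=` measurable).
Hypotheses (AT : A setT) (OT : O setT) (QT : Q setT).
Hypotheses (AI : setI_closed A) (OI : setI_closed O) (QI : setI_closed Q).
Hypothesis mZ : measurable Z.
Hypothesis AOQZ : forall a b q, A a -> O b -> Q q ->
 P (a `&` b `&` q `&` Z) = (P (a `&` b `&` q) * P Z)%E.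

(** The intersections of one set from each family form a pi-system generating the join. A null set
    among the factors makes both sides vanish, so the null sets may be added freely. *)
Lemma independent_join S : <<s A `|` O `|` Q `|` null_sets P >> S ->
 (P (S `&` Z) = P S * P Z)%E.
Proof.
pose N : set (set Omega) := [set n | n = setT \/ null_sets P n].
pose G : set (set Omega) := [set S | exists a o q n,
 [/\ A a, O o, Q q, N n & S = a `&` o `&` q `&` n]].
have NT : N setT by left.
have mN : N `<=` measurable by move=> n [->|[]].
have NI : setI_closed N.
 move=> n1 n2 [->|[m1 z1]]; first by rewrite setTI.
 move=> [->|[m2 z2]]; first by rewrite setIT; right.
 right; split; first exact: measurableI.
 by apply: (subset_measure0 _ _ _ z1) => //; exact: measurableI.
move=> sS; apply: (@independent_pi_system G).
- move=> _ [a [b [q [n [Aa Oo Qq Nn ->]]]]].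
 by do 3 (apply: measurableI; last by auto); exact: mA.
- by exists setT, setT, setT, setT; split; rewrite ?setIT.
- move=> _ _ [a [b [q [n [Aa Oo Qq Nn ->]]]]] [a' [b' [q' [n' [Aa' Oo' Qq' Nn' ->]]]]].
 exists (a `&` a'), (b `&` b'), (q `&` q'), (n `&` n'); split; [exact: AI|exact: OI|exact: QI|exact: NI|].
 by rewrite !setIA; apply/seteqP; split => x /=; tauto.
- exact: mZ.
- move=> _ [a [b [q [n [Aa Oo Qq Nn ->]]]]].
 case: Nn => [->|[mn n0]]; first by rewrite setIT; exact: AOQZ.
 have maoq : measurable (a `&` b `&` q).
  by apply: measurableI; [apply: measurableI|]; auto.
 rewrite (_ : P (a `&` b `&` q `&` n) = 0%E) ?mul0e.
  apply: (subset_measure0 _ _ _ n0) => //; last by move=> x [[]].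
  by apply: measurableI => //; exact: measurableI.
 by apply: (subset_measure0 _ _ _ n0) => //; exact: measurableI.
- apply: g_sigma_sub sS => S' [[[h|h]|h]|h]; apply: sub_sigma_algebra.
 + by exists S', setT, setT, setT; split; rewrite ?setIT.
 + by exists setT, S', setT, setT; split; rewrite ?setIT ?setTI.
 + by exists setT, setT, S', setT; split; rewrite ?setIT ?setTI.
 + by exists setT, setT, setT, S'; split; rewrite ?setIT ?setTI//; right.
Qed.

End PiSystemIndependence.

Section GeneratedSigmaAlgebra.
Context d (Omega : measurableType d) (R : realType) (P : probability Omega R).

Lemma generated_measurable (I : Type) (D : set I) (X : I -> Omega -> R) :
 (forall i, D i -> measT (X i)) ->
 generated_sigma_algebra D X `<=` measurable.
Proof.
move=> mX; apply: g_sigma_measurable => A [i Di [B mB <-]].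
exact: mX.
Qed.

Lemma generated_preimage (I : Type) (D : set I) (X : I -> Omega -> R) i B :
 D i -> measurable B -> generated_sigma_algebra D X (X i @^-1` B).
Proof.
move=> Di mB; apply: sub_sigma_algebra; exists i => //; exists B => //.
by rewrite setTI.
Qed.

Lemma generated_sub (I J : Type) (D : set I) (X : I -> Omega -> R)
  (H : set (set Omega)) :
 (forall i B, D i -> measurable B -> <<s H >> (X i @^-1` B)) ->
 generated_sigma_algebra D X `<=` <<s H >>.
Proof.
move=> h; apply: g_sigma_sub => A [i Di [B mB <-]]; rewrite setTI.
exact: h.
Qed.

(** Finite intersections over index sets avoiding [j] form a generating pi-system. On them the claim
    is the quotient of two product formulas, over an index set and over the same set with [j]
    added. *)
Lemma mutually_independent_others (G : nat -> set (set Omega)) (j : nat) :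
 (forall i, G i `<=` measurable) -> (forall i, setI_closed (G i)) ->
 (forall i, G i setT) ->
 mutually_independent P G ->
 forall O Z, <<s \bigcup_(i in [set i | i <> j]) G i >> O -> G j Z ->
 (P (O `&` Z) = P O * P Z)%E.
Proof.
move=> Gm GI GT indG O Z sO GZ.
pose Pi : set (set Omega) := [set S | exists (J : {fset nat}) (C : nat -> set Omega),
 [/\ j \notin J, forall i, G i (C i) & S = \bigcap_(i in [set` J]) C i]].
have PiZ S : Pi S -> (P (S `&` Z) = P S * P Z)%E.
 move=> [J [C [jJ GC ->]]].
 pose C' i := if i == j then Z else C i.
 have CC' i : i \in J -> C' i = C i.
  by rewrite /C'; case: eqP => // ->; rewrite (negbTE jJ).
 have h1 : P (\bigcap_(i in [set` J]) C i) = (\prod_(i <- J) P (C i))%E by apply: indG.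
 have h2 : P (\bigcap_(i in [set` (j |` J)%fset]) C' i) = (\prod_(i <- (j |` J)%fset) P (C' i))%E.
  apply: indG => i _; rewrite /C'; case: eqP => // ->; exact: GZ.
 have -> : (\bigcap_(i in [set` J]) C i) `&` Z = \bigcap_(i in [set` (j |` J)%fset]) C' i.
  apply/seteqP; split => x.
  + move=> [h zx] i /=; rewrite !inE => /orP[/eqP ->|iJ]; first by rewrite /C' eqxx.
   by rewrite CC'//; exact: h.
  + move=> h; split.
    by move=> i /= iJ; rewrite -CC'//; apply: h => /=; rewrite !inE iJ orbT.
   have := h j; rewrite /C' eqxx; apply; by rewrite /= !inE eqxx.
 rewrite h2 h1 big_fsetU1//= /C' eqxx muleC; congr (_ * _)%E.
 by rewrite big_seq [RHS]big_seq; apply: eq_bigr => i iJ; rewrite -/(C' i) CC'.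
have mPi : Pi `<=` measurable.
 move=> _ [J [C [jJ GC ->]]]; apply: fin_bigcap_measurable => // i _.
 by apply: (Gm i); exact: GC.
apply: (@independent_pi_system _ _ _ P Pi) => //.
- by exists fset0, (fun=> setT); split => //; apply/seteqP; split.
- move=> _ _ [J1 [C1 [j1 G1 ->]]] [J2 [C2 [j2 G2 ->]]].
 exists (J1 `|` J2)%fset, (fun i => (if i \in J1 then C1 i else setT) `&`
   (if i \in J2 then C2 i else setT)); split.
 + by rewrite inE negb_or j1 j2.
 + by move=> i; apply: GI; case: ifP.
 + apply/seteqP; split => x.
   move=> [h1 h2] i /= _; split; case: ifP => // iJ; [exact: h1|exact: h2].
  move=> h; split => i /= iJ; have := h i; rewrite /= inE iJ ?orbT => /(_ isT) [].
   by [].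
  by [].
- exact: (Gm j).
- apply: g_sigma_sub sO => S [i /= ij GS]; apply: sub_sigma_algebra.
 exists [fset i]%fset, (fun k => if k == i then S else setT); split.
 + by rewrite inE; apply/eqP => ji; apply: ij.
 + by move=> k; case: eqP => // ->.
 + apply/seteqP; split => x.
   by move=> Sx k /=; rewrite inE => /eqP ->; rewrite eqxx.
  by move=> /(_ i); rewrite /= inE eqxx; apply.
Qed.

End GeneratedSigmaAlgebra.

Section Adapted.
Context d (Omega : measurableType d) (R : realType).

(** Stated through preimages, which is how adaptedness is given; [sub_measurableP] identifies it
    with measurability on [g_sigma_algebraType G], so that the usual closure lemmas apply. *)
Definition sub_measurable (G : set (set Omega)) d' (T' : measurableType d') (V : Omega -> T') :=
 forall B, measurable B -> <<s G >> (V @^-1` B).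

Variable G : set (set Omega).

Lemma sub_measurableP d' (T' : measurableType d') (V : Omega -> T') :
 sub_measurable G V <-> measT (V : g_sigma_algebraType G -> T').
Proof.
split => [h _ B mB|h B mB]; first by rewrite setTI; exact: h.
by have := h measurableT B mB; rewrite setTI.
Qed.

Lemma sub_measurable_mono (H : set (set Omega)) d' (T' : measurableType d') (V : Omega -> T') :
 <<s G >> `<=` <<s H >> -> sub_measurable G V -> sub_measurable H V.
Proof. by move=> GH h B mB; apply: GH; exact: h. Qed.

End Adapted.

Opaque Kc gk.

(** * One Gaussian step: mean and variance *)

Section GaussianStep.
Context (R : realType).
Notation mu := (@lebesgue_measure R).
Context d (Omega : measurableType d) (P : probability Omega R).

Definition clip (c x : R) : R := Num.max (- c) (Num.min c x).

Lemma clip_id (c x : R) : `|x| <= c -> clip c x = x.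
Proof.
by rewrite ler_norml => /andP[h1 h2]; rewrite /clip min_r// max_r.
Qed.

Lemma norm_clip (c x : R) : 0 <= c -> `|clip c x| <= c.
Proof.
move=> c0; rewrite ler_norml /clip le_max lexx/= ge_max ge_min lexx/=.
by rewrite andbT; lra.
Qed.

Lemma meas_clip (c : R) : measT (clip c).
Proof. by apply: measurable_maxr => //; exact: measurable_minr. Qed.

(** The bound is required only on the range of [V]: clipping the values of [f] at [c] changes
    neither side. *)
Lemma Rintegral_gaussian_sample_range d' (T' : measurableType d') (V : Omega -> T')
  (Z : Omega -> R) (v : R) (f : T' * R -> R) (c : R) :
 measT V -> measT Z ->
 (forall A B, measurable A -> measurable B ->
  P (V @^-1` A `&` Z @^-1` B) = (P (V @^-1` A) * gm v B)%E) ->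
 measT f -> (forall w z, `|f (V w, z)| <= c) ->
 \int[P]_w f (V w, Z w) = \int[P]_w \int[mu]_z (f (V w, z) * gk v z).
Proof.
move=> mV mZ VZ mf fc.
have [[w0 _]|h] := pselect (exists w : Omega, True); last first.
 have h0 (w : Omega) : False by apply: h; exists w.
 by apply: eq_Rintegral => w; have := h0 w.
have c0 : 0 <= c by rewrite (le_trans _ (fc w0 0)).
have mcf : measT (fun q => clip c (f q)).
 by apply: measurableT_comp => //; exact: meas_clip.
have := @Rintegral_gaussian_sample _ _ _ P _ _ V Z v mV mZ VZ _ c mcf (fun q => norm_clip (f q) c0).
under eq_Rintegral do rewrite clip_id//.
move=> ->; apply: eq_Rintegral => w _; apply: eq_Rintegral => z _.
by rewrite clip_id.
Qed.

(** Independence and law in a single formula: the choice of the whole space for [S] says that [Z] is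
    centred Gaussian of variance [v]. *)
Definition gaussian_indep (G : set (set Omega)) (Z : Omega -> R) (v : R) :=
 forall S B, <<s G >> S -> measurable B -> (P (S `&` Z @^-1` B) = P S * gm v B)%E.

Lemma Kc_mean (s w u : R) : 0 <= s -> 0 < w ->
 \int[mu]_z (Kc s (u - z) * gk w z) = Kc (s + w) u.
Proof.
move=> s0 w0; rewrite -Kc_semigroup// /conv.
rewrite -[RHS](Rintegral_reflect u); last first.
 apply: measurable_funM; last exact: meas_Kc.
 by apply: meas_kshift; exact: meas_gk.
apply: eq_Rintegral => z _; rewrite mulrC; congr (gk _ _ * _); ring.
Qed.

Lemma integrable_Kc_gk (s w u : R) :
 mu.-integrable setT (fun z => (Kc s (u - z) * gk w z)%:E).
Proof.
under eq_fun do rewrite mulrC.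
apply: (@integrable_bounded _ _ _ mu (gk w) _ 1); first exact: integrable_gk.
- by apply: meas_kshift; exact: meas_Kc.
- by move=> z; exact: norm_Kc_le.
Qed.

Section Step.
Variables (G : set (set Omega)) (Z : Omega -> R) (w : R).
Hypothesis Gm : G `<=` measurable.
Hypothesis w0 : 0 < w.
Hypothesis mZ : measT Z.
Hypothesis GZ : gaussian_indep G Z w.

Lemma sub_measurable_measurable d' (T' : measurableType d') (V : Omega -> T') :
 sub_measurable G V -> measT V.
Proof.
by move=> h _ B mB; rewrite setTI; apply: (g_sigma_measurable Gm); exact: h.
Qed.

Lemma sub_measurable_pair d1 (T1 : measurableType d1) d2 (T2 : measurableType d2)
  (V1 : Omega -> T1) (V2 : Omega -> T2) :
 sub_measurable G V1 -> sub_measurable G V2 -> sub_measurable G (fun x => (V1 x, V2 x)).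
Proof.
move=> /sub_measurableP h1 /sub_measurableP h2; apply/sub_measurableP.
exact: measurable_fun_pair.
Qed.

(** By the semigroup property [Kc (s + w) (x - Y)] is the conditional mean of [Kc s (x - (Y + Z))]
    given the past. The difference is a martingale increment, orthogonal to bounded variables of the
    past. *)
Lemma gaussian_step_orthogonal (s x c : R) (Phi Y : Omega -> R) : 0 <= s ->
 sub_measurable G Phi -> sub_measurable G Y -> (forall o, `|Phi o| <= c) ->
 \int[P]_o (Phi o * (Kc s (x - (Y o + Z o)) - Kc (s + w) (x - Y o))) = 0.
Proof.
move=> s0 aPhi aY Pc.
have aV := sub_measurable_pair aPhi aY.
pose f (q : (R * R) * R) := q.1.1 * (Kc s (x - (q.1.2 + q.2)) - Kc (s + w) (x - q.1.2)).
have mf : measT f.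
 apply: measurable_funM; first exact: measurableT_comp.
 apply: measurable_funB.
 - apply: measurableT_comp; first exact: meas_Kc.
  apply: measurable_funB => //; apply: measurable_funD => //.
  exact: measurableT_comp.
 - apply: measurableT_comp; first exact: meas_Kc.
  by apply: measurable_funB => //; exact: measurableT_comp.
have fc o z : `|f ((Phi o, Y o), z)| <= c * 2.
 rewrite /f /= normrM ler_pM// (le_trans (ler_normB _ _))//.
 by have := norm_Kc_le s (x - (Y o + z)); have := norm_Kc_le (s + w) (x - Y o); lra.
rewrite (@Rintegral_gaussian_sample_range _ _ _ Z w f (c * 2) (sub_measurable_measurable aV) mZ _ mf fc); last first.
 by move=> A B mA mB; apply: GZ => //; exact: aV.
rewrite (@eq_Rintegral _ _ _ _ _ (cst 0)); first by rewrite Rintegral_cst// mul0r.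
move=> o _; rewrite /f /=.
have -> : \int[mu]_z (Phi o * (Kc s (x - (Y o + z)) - Kc (s + w) (x - Y o)) * gk w z) =
  \int[mu]_z (Phi o * (Kc s (x - Y o - z) * gk w z - Kc (s + w) (x - Y o) * gk w z)).
 apply: eq_Rintegral => z _; rewrite -mulrA -mulrBl; congr (_ * ((Kc _ _ - _) * _)); ring.
rewrite RintegralZl//; last first.
 have := integrableB measurableT (integrable_Kc_gk s w (x - Y o))
  (integrableZl measurableT (Kc (s + w) (x - Y o)) (integrable_gk w)).
 by apply: eq_integrable.
rewrite RintegralB//; last 2 first.
- exact: integrable_Kc_gk.
- by have := integrableZl measurableT (Kc (s + w) (x - Y o)) (integrable_gk w); apply: eq_integrable.
rewrite Kc_mean// RintegralZl//; last exact: integrable_gk.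
by rewrite /Rintegral integral_gk/= mulr1 subrr mulr0.
Qed.

End Step.

(** The mean minimises the quadratic deviation; the two sides differ by $(m-a)^2$. *)
Lemma variance_le (w a m c : R) (phi : R -> R) : measT phi ->
 (forall z, `|phi z| <= c) -> \int[mu]_z (phi z * gk w z) = m ->
 (\int[mu]_z ((phi z - m) ^+ 2 * gk w z)%:E <= \int[mu]_z ((phi z - a) ^+ 2 * gk w z)%:E)%E.
Proof.
move=> mphi phic mE.
have sq b : mu.-integrable setT (fun z => ((phi z - b) ^+ 2 * gk w z)%:E).
 under eq_fun do rewrite mulrC.
 apply: (@integrable_bounded _ _ _ mu (gk w) _ ((c + `|b|) ^+ 2)); first exact: integrable_gk.
 - by apply: measurable_funX; exact: measurable_funB.
 - move=> z; rewrite normrX; apply: lerXn2r; rewrite ?nnegrE//.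
   by rewrite addr_ge0// (le_trans _ (phic z)).
  by rewrite (le_trans (ler_normB _ _))// lerD2r.
have ip : mu.-integrable setT (fun z => (phi z * gk w z)%:E).
 under eq_fun do rewrite mulrC.
 by apply: (@integrable_bounded _ _ _ mu (gk w) _ c) => //; exact: integrable_gk.
rewrite -[leLHS]fineK ?integrable_fin_num// -[leRHS]fineK ?integrable_fin_num//.
rewrite lee_fin -/(Rintegral _ _ _) -subr_ge0 -[X in _ - X]/(Rintegral _ _ _) -[X in X - _]/(Rintegral _ _ _).
rewrite -RintegralB; [|by []|exact: sq|exact: sq].
have -> : \int[mu]_z ((phi z - a) ^+ 2 * gk w z - (phi z - m) ^+ 2 * gk w z) =
 \int[mu]_z ((2 * (m - a)) * (phi z * gk w z) + (a ^+ 2 - m ^+ 2) * gk w z).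
 by apply: eq_Rintegral => z _; ring.
rewrite RintegralD//; last 2 first.
- by have := integrableZl measurableT (2 * (m - a)) ip; apply: eq_integrable.
- by have := integrableZl measurableT (a ^+ 2 - m ^+ 2) (integrable_gk w); apply: eq_integrable.
rewrite (RintegralZl _ measurableT ip) (RintegralZl _ measurableT (integrable_gk w)).
rewrite mE /Rintegral integral_gk /= mulr1.
have -> : 2 * (m - a) * m + (a ^+ 2 - m ^+ 2) = (m - a) ^+ 2 by ring.
exact: sqr_ge0.
Qed.

Lemma sqrt2_le : Num.sqrt 2 <= 3 / 2 :> R.
Proof.
have h : (0 : R) <= 3 / 2 by lra.
by rewrite -[leRHS](ger0_norm h) -sqrtr_sqr ler_wsqrtr//; lra.
Qed.

(** The exact value is [w]; the constant 6 is $4\cdot\frac32\ge4\sqrt2$, left over from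
    [sqr_gk_le]. *)
Lemma integral_sqr_gk (w : R) : 0 < w ->
 (\int[mu]_z (z ^+ 2 * gk w z)%:E <= (6 * w)%:E)%E.
Proof.
move=> w0.
apply: (@le_trans _ _ (\int[mu]_z ((6 * w)%:E * (gk (w *+ 2) z)%:E))%E).
 apply: ge0_le_integral => //.
 - by move=> z _; rewrite lee_fin mulr_ge0 ?sqr_ge0 ?gk_ge0.
 - by unEFin; apply: measurable_funM; [exact: measurable_funX|exact: meas_gk].
 - by apply: measurable_funeM; unEFin; exact: meas_gk.
 - move=> z _; rewrite -EFinM lee_fin; apply: le_trans (sqr_gk_le _ w0) _.
  apply: ler_wpM2r; first exact: gk_ge0.
  by have := ler_wpM2l (ltW w0) sqrt2_le; nra.
by rewrite integralZl ?integral_gk ?mule1//; exact: integrable_gk.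
Qed.

Lemma meas_KcB (s s' : R) :
 measT (fun q : R * R => Kc s (q.2 - q.1) - Kc s' q.2).
Proof.
apply: measurable_funB.
 apply: (measurableT_comp (meas_Kc s)); exact: measurable_funB.
exact: (measurableT_comp (meas_Kc s')).
Qed.

(** Bound for the variance, integrated in $x$, of a Gaussian step of variance [w] seen through
    [Kc s]. If [s > 0], the sup bound $|z|/\sqrt s$ multiplies the $L^1$ bound $|z|$ and leaves a
    second moment over $\sqrt s$. If [s = 0], the sup bound is 1 and only a first moment, of order
    $\sqrt w$, is gained. *)
Definition step_var (s w : R) : R := if 0 < s then 6 * w / Num.sqrt s else 4 * Num.sqrt w.

Lemma integral_Kc_sqr_shift (s w : R) : 0 < w ->
 (\int[mu]_z ((\int[mu]_x ((Kc s (x - z) - Kc s x) ^+ 2)%:E) * (gk w z)%:E) <= (step_var s w)%:E)%E.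
Proof.
move=> w0.
pose F (q : R * R) := (Kc s (q.2 - q.1) - Kc s q.2) ^+ 2.
have mF : measT F.
 by apply: measurable_funX; exact: meas_KcB.
have F0 (q : R * R) : 0 <= F q by exact: sqr_ge0.
have mI := meas_integral1 mu mF F0.
(* In the second case $|z|\le(z^2/\sqrt w+\sqrt w)/2$, so that second moments suffice in both. *)
pose rho z : R := if 0 < s then z ^+ 2 / Num.sqrt s else (z ^+ 2 / Num.sqrt w + Num.sqrt w) / 2.
have mrho : measT rho.
 rewrite /rho; case: (0 < s).
  by apply: measurable_funM => //; exact: measurable_funX.
 apply: measurable_funM => //; apply: measurable_funD => //.
 by apply: measurable_funM => //; exact: measurable_funX.
have sw0 : 0 < Num.sqrt w by rewrite sqrtr_gt0.
have rho0 z : 0 <= rho z.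
 rewrite /rho; case: ifPn => s0; first by rewrite divr_ge0 ?sqr_ge0.
 by rewrite divr_ge0// addr_ge0// divr_ge0 ?sqr_ge0.
have key z : (\int[mu]_x ((Kc s (x - z) - Kc s x) ^+ 2)%:E <= (rho z)%:E)%E.
 have [b [b0 bP zb]] : exists b, [/\ 0 <= b, (forall x, `|Kc s (x - z) - Kc s x| <= b) &
   b * `|z| <= rho z].
  rewrite /rho; case: ifPn => s0.
   exists (`|z| / Num.sqrt s); split; first exact: divr_ge0.
    by move=> x; have := norm_Kc_shiftB x z 0 s0; rewrite !subr0.
   by rewrite mulrAC -expr2 real_normK// num_real.
  exists 1; split => //.
   move=> x; rewrite ler_norml.
   have := Kc_ge0 s (x - z); have := Kc_le1 s (x - z); have := Kc_ge0 s x; have := Kc_le1 s x.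
   by move=> *; apply/andP; split; lra.
  rewrite mul1r ler_pdivlMr// -(ler_pM2r sw0) mulrDl divfK ?gt_eqF//.
  rewrite -(real_normK (num_real z)); have := sqr_ge0 (`|z| - Num.sqrt w); nra.
 apply: (@le_trans _ _ (\int[mu]_x (b%:E * `|Kc s (x - z) - Kc s x|%:E))%E).
  apply: ge0_le_integral => //.
  - by move=> x _; rewrite lee_fin sqr_ge0.
  - unEFin; apply: measurable_funX; apply: measurable_funB;
    [apply: meas_kshift2|]; exact: meas_Kc.
  - apply: measurable_funeM; mnorm.
   by apply: measurable_funB; [apply: meas_kshift2|]; exact: meas_Kc.
  - move=> x _; rewrite -EFinM lee_fin -real_normK ?num_real// expr2.
   by rewrite ler_wpM2r.
 rewrite ge0_integralZl//; last first.
  mnorm.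
  by apply: measurable_funB; [apply: meas_kshift2|]; exact: meas_Kc.
 have h := integral_Kc_shiftB s z 0.
 apply: (@le_trans _ _ (b%:E * `|z|%:E)%E); last by rewrite -EFinM lee_fin.
 rewrite lee_wpmul2l ?lee_fin//; move: h; rewrite subr0 => h; apply: le_trans h.
 by under [leRHS]eq_integral do rewrite subr0.
apply: (@le_trans _ _ (\int[mu]_z ((rho z)%:E * (gk w z)%:E))%E).
 apply: ge0_le_integral => //.
 - move=> z _; rewrite mule_ge0 ?lee_fin ?gk_ge0//.
  by apply: integral_ge0 => x _; rewrite lee_fin sqr_ge0.
 - by apply: emeasurable_funM => //; unEFin; exact: meas_gk.
 - by apply: emeasurable_funM; apply/measurable_EFinP => //; exact: meas_gk.
 - by move=> z _; rewrite lee_wpmul2r// lee_fin gk_ge0.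
have i2 := integral_sqr_gk w0.
have i2m : measT (fun z : R => (z ^+ 2 * gk w z)%:E).
 by unEFin; apply: measurable_funM; [exact: measurable_funX|exact: meas_gk].
rewrite /rho /step_var; case: ifPn => s0.
 have -> : (\int[mu]_z ((z ^+ 2 / Num.sqrt s)%:E * (gk w z)%:E) =
   (Num.sqrt s)^-1%:E * \int[mu]_z (z ^+ 2 * gk w z)%:E)%E.
  rewrite -ge0_integralZl//.
  - by apply: eq_integral => z _; rewrite -!EFinM; congr (_%:E); ring.
  - by move=> z _; rewrite lee_fin mulr_ge0 ?sqr_ge0 ?gk_ge0.
 by rewrite [leRHS]EFinM muleC lee_wpmul2r// lee_fin.
have -> : (\int[mu]_z (((z ^+ 2 / Num.sqrt w + Num.sqrt w) / 2)%:E * (gk w z)%:E) =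
  (2 * Num.sqrt w)^-1%:E * \int[mu]_z (z ^+ 2 * gk w z)%:E + (Num.sqrt w / 2)%:E)%E.
 have c1 : (0 <= (2 * Num.sqrt w)^-1%:E)%E by rewrite lee_fin invr_ge0 mulr_ge0.
 have c2 : (0 <= (Num.sqrt w / 2)%:E)%E by rewrite lee_fin divr_ge0.
 have z0 z : [set: R] z -> (0 <= (z ^+ 2 * gk w z)%:E)%E.
  by move=> _; rewrite lee_fin mulr_ge0 ?sqr_ge0 ?gk_ge0.
 have g0 z : [set: R] z -> (0 <= (gk w z)%:E)%E by rewrite lee_fin gk_ge0.
 have mg : measT (fun z => (gk w z)%:E).
  by unEFin; exact: meas_gk.
 rewrite -[X in (_ + X)%E]mule1 -(integral_gk w).
 rewrite -(ge0_integralZl mu measurableT i2m z0 c1) -(ge0_integralZl mu measurableT mg g0 c2).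
 rewrite -ge0_integralD//; last 4 first.
 - by move=> z _; rewrite mule_ge0// z0.
 - exact: measurable_funeM.
 - by move=> z _; rewrite mule_ge0// g0.
 - exact: measurable_funeM.
 apply: eq_integral => z _; rewrite -!EFinM -EFinD; congr (_%:E); field; by rewrite gt_eqF.
apply: (@le_trans _ _ ((2 * Num.sqrt w)^-1%:E * (6 * w)%:E + (Num.sqrt w / 2)%:E)%E).
 by rewrite leeD2r// lee_wpmul2l// lee_fin invr_ge0 mulr_ge0.
rewrite -EFinM -EFinD lee_fin.
have -> : (2 * Num.sqrt w)^-1 * (6 * w) = 3 * Num.sqrt w.
 by rewrite -{2}(sqr_sqrtr (ltW w0)); field; rewrite gt_eqF.
lra.
Qed.

(** Translation invariance of $dx$ removes [Y], and replacing the mean [Kc (s + w) x] by [Kc s x]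
    only increases the quadratic deviation. *)
Lemma gaussian_step_variance (G : set (set Omega)) (Z Y : Omega -> R) (s w : R) :
 G `<=` measurable -> 0 <= s -> 0 < w -> measT Z ->
 gaussian_indep G Z w -> sub_measurable G Y ->
 (\int[P]_o \int[mu]_x ((Kc s (x - (Y o + Z o)) - Kc (s + w) (x - Y o)) ^+ 2)%:E
  <= (step_var s w)%:E)%E.
Proof.
move=> Gm s0 w0 mZ GZ aY.
pose F (q : R * R) := (Kc s (q.2 - q.1) - Kc (s + w) q.2) ^+ 2.
have mF : measT F.
 by apply: measurable_funX; exact: meas_KcB.
have F0 (q : R * R) : 0 <= F q by exact: sqr_ge0.
have mI := meas_integral1 mu mF F0.
pose f (q : R * R) : \bar R := (\int[mu]_x (F (q.2, x))%:E)%E.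
have mY := sub_measurable_measurable Gm aY.
have mf : measT f by exact: (measurableT_comp mI).
have f0 q : (0 <= f q)%E by apply: integral_ge0 => x _; rewrite lee_fin.
have -> : (\int[P]_o \int[mu]_x ((Kc s (x - (Y o + Z o)) - Kc (s + w) (x - Y o)) ^+ 2)%:E =
  \int[P]_o f (Y o, Z o))%E.
 apply: eq_integral => o _; rewrite /f /F /=.
 rewrite -(@ge0_integral_shift _ (Y o) (fun x => ((Kc s (x - (Y o + Z o)) - Kc (s + w) (x - Y o)) ^+ 2)%:E)).
 - apply: eq_integral => x _; congr ((_ ^+ 2)%:E); congr (Kc _ _ - Kc _ _); ring.
 - unEFin; apply: measurable_funX; apply: measurable_funB;
   apply: meas_kshift2; exact: meas_Kc.
 - by move=> x; rewrite lee_fin sqr_ge0.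
rewrite (@ge0_integral_gaussian_sample _ _ _ P _ _ Y Z w mY mZ _ f mf f0); last first.
 by move=> A B mA mB; apply: GZ => //; exact: aY.
pose I0 := (\int[mu]_z ((\int[mu]_x (F (z, x))%:E) * (gk w z)%:E))%E.
rewrite (_ : (\int[P]_o _)%E = (\int[P]_o (cst I0 o))%E); last by [].
rewrite integral_cst// (_ : (I0 * _)%E = I0); last first.
 by rewrite -[RHS]mule1; congr (_ * _)%E; exact: probability_setT.
pose F1 (q : R * R) := F q * gk w q.1.
pose F2 (q : R * R) := (Kc s (q.2 - q.1) - Kc s q.2) ^+ 2 * gk w q.1.
have mg : measT (fun q : R * R => gk w q.1).
 by apply: measurableT_comp => //; exact: meas_gk.
have mF1 : measT F1 by exact: (measurable_funM mF mg).
have mF2 : measT F2.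
 by apply: measurable_funM mg; apply: measurable_funX; exact: meas_KcB.
have F10 (q : R * R) : 0 <= F1 q by rewrite mulr_ge0 ?gk_ge0.
have F20 (q : R * R) : 0 <= F2 q by rewrite mulr_ge0 ?gk_ge0 ?sqr_ge0.
have mKx (z : R) : measT (fun x : R => Kc s (x - z)).
 by apply: meas_kshift2; exact: meas_Kc.
have E1 : I0 = (\int[mu]_x \int[mu]_z (F1 (z, x))%:E)%E.
 rewrite /I0 -(integral_swap mu mu mF1 F10); apply: eq_integral => z _.
 rewrite -ge0_integralZr//.
 - by unEFin; exact: meas_slice1.
 - by move=> x _; rewrite lee_fin.
 - by rewrite lee_fin gk_ge0.
have E2 : (\int[mu]_z ((\int[mu]_x ((Kc s (x - z) - Kc s x) ^+ 2)%:E) * (gk w z)%:E) =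
  \int[mu]_x \int[mu]_z (F2 (z, x))%:E)%E.
 rewrite -(integral_swap mu mu mF2 F20); apply: eq_integral => z _.
 rewrite -ge0_integralZr//.
 - unEFin; apply: measurable_funX.
  by apply: measurable_funB; [exact: mKx|exact: meas_Kc].
 - by move=> x _; rewrite lee_fin sqr_ge0.
 - by rewrite lee_fin gk_ge0.
rewrite E1; apply: le_trans (integral_Kc_sqr_shift s w0); rewrite [leRHS]E2.
apply: ge0_le_integral; first exact: measurableT.
- by move=> x _; apply: integral_ge0 => z _; rewrite lee_fin.
- exact: (meas_integral2 mu mF1 F10).
- exact: (meas_integral2 mu mF2 F20).
- move=> x _; rewrite /F1 /F2 /F /=.
 apply: (@variance_le w (Kc s x) (Kc (s + w) x) 1 (fun z => Kc s (x - z))).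
 + by apply: meas_kshift; exact: meas_Kc.
 + by move=> z; exact: norm_Kc_le.
 + exact: Kc_mean.
Qed.

End GaussianStep.

(** * Singular discrete Gronwall inequality *)

Section Sums.
Context (R : realType).

(** The Gronwall weight $n^{-1/2}$, with [isq 0 = 0] because the inverse of 0 is 0. *)
Definition isq (n : nat) : R := (Num.sqrt n%:R)^-1.

Lemma isq_ge0 n : 0 <= isq n. Proof. by rewrite invr_ge0. Qed.

Lemma sqrt_isq n : (0 < n)%N -> Num.sqrt n%:R * isq n = 1 :> R.
Proof. by move=> n0; rewrite /isq mulfV// gt_eqF// sqrtr_gt0 ltr0n. Qed.

Lemma isq_le_diff n : isq n.+1 <= 2 * (Num.sqrt n.+1%:R - Num.sqrt n%:R).
Proof.
set a := Num.sqrt n.+1%:R; set b := Num.sqrt n%:R.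
have s1 : 0 < a by rewrite sqrtr_gt0 ltr0n.
have s0 : 0 <= b by exact: sqrtr_ge0.
have e0 : b ^+ 2 = n%:R by rewrite sqr_sqrtr.
have e1 : a ^+ 2 = n%:R + 1 by rewrite sqr_sqrtr// -natr1.
rewrite /isq -/a -(ler_pM2r s1) mulVf ?gt_eqF//.
have := sqr_ge0 (a - b); nra.
Qed.

Lemma sum_isq n : \sum_(1 <= j < n.+1) isq j <= 2 * Num.sqrt n%:R.
Proof.
elim: n => [|n IH]; first by rewrite big_geq// mulr_ge0.
by rewrite big_nat_recr//=; have := isq_le_diff n; lra.
Qed.

Lemma sum_isq_lt n : \sum_(1 <= j < n) isq j <= 2 * Num.sqrt n%:R.
Proof.
case: n => [|n]; first by rewrite big_geq// mulr_ge0.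
by apply: le_trans (sum_isq n) _; rewrite ler_wpM2l// ler_wsqrtr// ler_nat.
Qed.

Lemma sum_isq_rev n : \sum_(1 <= j < n) isq (n - j) = \sum_(1 <= j < n) isq j.
Proof.
rewrite big_nat_rev/= add1n; apply: eq_big_nat => i /andP[i1 i2].
by rewrite subSS subKn// ltnW.
Qed.

(** Discrete form of the integral $\int_0^1 (s(1-s))^{-1/2}ds$. The inequality $\sqrt
    n\le\sqrt{n-k}+\sqrt k$ turns the product of two weights into their sum over $\sqrt n$, and each
    of the two sums is at most $2\sqrt n$. *)
Lemma beta_sum_le n : \sum_(1 <= k < n) isq (n - k) * isq k <= 4.
Proof.
have [->|n0] := posnP n; first by rewrite big_geq.
have s0 : 0 < Num.sqrt n%:R :> R by rewrite sqrtr_gt0 ltr0n.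
have key k : (1 <= k < n)%N -> Num.sqrt n%:R * (isq (n - k) * isq k) <= isq (n - k) + isq k.
 move=> /andP[k1 kn].
 have a0 : 0 < Num.sqrt (n - k)%:R :> R by rewrite sqrtr_gt0 ltr0n subn_gt0.
 have b0 : 0 < Num.sqrt k%:R :> R by rewrite sqrtr_gt0 ltr0n.
 have sub : Num.sqrt n%:R <= Num.sqrt (n - k)%:R + Num.sqrt k%:R :> R.
  rewrite -(ler_pXn2r (n := 2))// ?nnegrE ?addr_ge0// sqrrD !sqr_sqrtr//.
  have e : n%:R = (n - k)%:R + k%:R :> R by rewrite -natrD subnK// ltnW.
  have := mulr_ge0 (ltW a0) (ltW b0); rewrite {1}e; lra.
 have := ler_wpM2r (mulr_ge0 (isq_ge0 (n - k)) (isq_ge0 k)) sub.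
 have e1 : Num.sqrt (n - k)%:R * isq (n - k) = 1 by rewrite sqrt_isq ?subn_gt0.
 have e2 := sqrt_isq k1.
 have -> : (Num.sqrt (n - k)%:R + Num.sqrt k%:R) * (isq (n - k) * isq k) =
  (Num.sqrt (n - k)%:R * isq (n - k)) * isq k + (Num.sqrt k%:R * isq k) * isq (n - k) by ring.
 by rewrite e1 e2 !mul1r addrC.
rewrite -(ler_pM2l s0) mulr_sumr.
apply: (@le_trans _ _ (\sum_(1 <= k < n) (isq (n - k) + isq k))).
 by rewrite big_nat [leRHS]big_nat; apply: ler_sum => k hk; exact: key.
rewrite big_split/= sum_isq_rev; have := sum_isq_lt n; lra.
Qed.

Section Gronwall.
Variables (c T : R).
Hypotheses (c0 : 0 <= c) (T0 : 0 <= T).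

(** The exponent is the rate [4 * c ^+ 2 * h] per step of the once iterated recursion, accumulated
    over [m * h <= T]. *)
Definition gronwall_const : R :=
 1 + expR (4 * c ^+ 2 * T) * (1 + 6 * c * Num.sqrt T + 8 * c ^+ 2 * T).

Lemma gronwall_const_ge0 : 0 <= gronwall_const.
Proof.
apply: addr_ge0 => //; apply: mulr_ge0; first exact: expR_ge0.
by rewrite !addr_ge0// !mulr_ge0// ?sqr_ge0.
Qed.

Variables (f : nat -> R) (A B h : R) (m : nat).
Hypotheses (A0 : 0 <= A) (B0 : 0 <= B) (h0 : 0 <= h).
Hypothesis (f0 : forall n, 0 <= f n) (hm : m%:R * h <= T).
Hypothesis frec : forall n, (1 <= n <= m)%N ->
 f n <= A + B * isq n + c * Num.sqrt h * \sum_(1 <= k < n) isq (n - k) * f k.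

Let sqh n : (n <= m)%N -> Num.sqrt h * Num.sqrt n%:R <= Num.sqrt T.
Proof.
move=> nm; rewrite -sqrtrM// ler_wsqrtr// (le_trans _ hm)// mulrC ler_wpM2r//.
by rewrite ler_nat.
Qed.

(** The recursion is inserted into itself. The iterated kernel is bounded by [beta_sum_le], so that
    an ordinary, non-singular Gronwall recursion remains. *)
Let once n : (1 <= n <= m)%N -> f n <= A * (1 + 2 * c * Num.sqrt T) + 4 * c * B * Num.sqrt h +
 B * isq n + 4 * c ^+ 2 * h * \sum_(1 <= l < n) f l.
Proof.
move=> /andP[n1 nm]; apply: le_trans (frec _) _; first by rewrite n1.
set rh := Num.sqrt h.
have rh0 : 0 <= rh by exact: sqrtr_ge0.
have rhh : rh ^+ 2 = h by rewrite sqr_sqrtr.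
have h1 : \sum_(1 <= k < n) isq (n - k) * f k <= \sum_(1 <= k < n) isq (n - k) *
  (A + B * isq k + c * rh * \sum_(1 <= l < k) isq (k - l) * f l).
 rewrite big_nat [leRHS]big_nat; apply: ler_sum => k /andP[k1 kn].
 apply: ler_wpM2l; first exact: isq_ge0.
 by apply: frec; rewrite k1 (leq_trans (ltnW kn)).
have h2 : \sum_(1 <= k < n) isq (n - k) *
  (A + B * isq k + c * rh * \sum_(1 <= l < k) isq (k - l) * f l) =
 A * (\sum_(1 <= k < n) isq (n - k)) + B * (\sum_(1 <= k < n) isq (n - k) * isq k) +
 c * rh * \sum_(1 <= k < n) isq (n - k) * \sum_(1 <= l < k) isq (k - l) * f l.
 rewrite !mulr_sumr -!big_split/=; apply: eq_bigr => k _; ring.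
(* The two sums are exchanged; for fixed [l] the sum over [k] is a beta sum of length [n - l]. *)
have h3 : \sum_(1 <= k < n) isq (n - k) * (\sum_(1 <= l < k) isq (k - l) * f l) <=
  4 * \sum_(1 <= l < n) f l.
 under eq_bigr do rewrite mulr_sumr.
 have -> : \sum_(1 <= k < n) \sum_(1 <= l < k) isq (n - k) * (isq (k - l) * f l) =
   \sum_(1 <= l < n) \sum_(l.+1 <= k < n) isq (n - k) * (isq (k - l) * f l).
  transitivity (\sum_(1 <= k < n) \sum_(1 <= l < n | (l < k)%N) isq (n - k) * (isq (k - l) * f l)).
   apply: eq_big_nat => k /andP[_ kn]; rewrite (big_nat_widen 1 k n)//; exact: ltnW.
  rewrite (exchange_big_dep_nat xpredT)//=.
  apply: eq_big_nat => l /andP[l1 ln].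
  by rewrite [RHS](big_nat_widenl l.+1 1).
 rewrite mulr_sumr big_nat [leRHS]big_nat; apply: ler_sum => l /andP[l1 ln].
 under eq_bigr do rewrite mulrA.
 rewrite -mulr_suml; apply: ler_wpM2r => //.
 apply: le_trans (beta_sum_le (n - l)).
 rewrite -{1}(add1n l) -{1}(subnK (ltnW ln)) big_addn addnK.
 rewrite le_eqVlt; apply/orP; left; apply/eqP; apply: eq_big_nat => k /andP[k1 k2].
 by rewrite addnK subnDA subnAC.
have s1 := sum_isq_lt n; rewrite -sum_isq_rev in s1.
have s2 := beta_sum_le n.
have sn := sqh nm; rewrite -/rh in sn.
have crh : 0 <= c * rh by rewrite mulr_ge0.
have p1 : c * rh * (A * \sum_(1 <= k < n) isq (n - k)) <= 2 * c * A * Num.sqrt T.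
 apply: (@le_trans _ _ (2 * c * A * (rh * Num.sqrt n%:R))).
  by have := ler_wpM2l (mulr_ge0 crh A0) s1; lra.
 by rewrite ler_wpM2l// !mulr_ge0.
have p2 : c * rh * (B * \sum_(1 <= k < n) isq (n - k) * isq k) <= 4 * c * B * rh.
 by have := ler_wpM2l (mulr_ge0 crh B0) s2; lra.
have p3 : c * rh * (c * rh * \sum_(1 <= k < n) isq (n - k) *
  \sum_(1 <= l < k) isq (k - l) * f l) <= 4 * c ^+ 2 * h * \sum_(1 <= l < n) f l.
 have := ler_wpM2l (mulr_ge0 crh crh) h3.
 have -> : c * rh * (c * rh) * (4 * \sum_(1 <= l < n) f l) = 4 * c ^+ 2 * h * \sum_(1 <= l < n) f l.
  by rewrite -rhh; ring.
 by rewrite !mulrA.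
have := ler_wpM2l crh h1; rewrite h2 2!mulrDr; lra.
Qed.

Lemma singular_gronwall n : (1 <= n <= m)%N -> f n <= gronwall_const * (A + B * isq n).
Proof.
move=> /andP[n1 nm].
set rh := Num.sqrt h; set rT := Num.sqrt T; set e := 4 * c ^+ 2.
have rh0 : 0 <= rh by exact: sqrtr_ge0.
have rT0 : 0 <= rT by exact: sqrtr_ge0.
have e0 : 0 <= e by rewrite mulr_ge0 ?sqr_ge0.
have eh0 : 0 <= e * h by rewrite mulr_ge0.
(* [A'] gathers the terms without singularity and [G] adds the accumulated sum; the singular term
   [B * isq] is kept outside, so that the growth of [G] is geometric. *)
pose A' := A * (1 + 2 * c * rT) + 4 * c * B * rh.
have A'0 : 0 <= A' by rewrite !(addr_ge0, mulr_ge0).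
pose G k := A' + e * h * \sum_(1 <= l < k) f l.
have fG k : (1 <= k <= m)%N -> f k <= G k + B * isq k.
 by move=> /once; rewrite -/rh -/rT -/e -/A' /G; lra.
have GB k : (1 <= k <= m)%N ->
  G k <= (1 + e * h) ^+ k * (A' + e * h * B * \sum_(1 <= l < k) isq l).
 elim: k => [//|k IH] /andP[_ km].
 have [->|k0] := posnP k.
  rewrite /G !big_geq// !mulr0 !addr0 ler_peMl// expr1; lra.
 have kk : (1 <= k <= m)%N by rewrite k0 ltnW.
 have GS : G k.+1 = G k + e * h * f k by rewrite /G big_nat_recr//=; ring.
 have := fG k kk; have := IH kk; rewrite big_nat_recr//= exprS GS => h1 h2.
 have p1 : 1 <= (1 + e * h) ^+ k by rewrite exprn_ege1//; lra.
 have p2 := ler_wpM2l eh0 h2.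
 have p3 : (1 + e * h) * G k <= (1 + e * h) * ((1 + e * h) ^+ k * (A' + e * h * B * \sum_(1 <= l < k) isq l)).
  by rewrite ler_wpM2l//; lra.
 have p4 : e * h * (B * isq k) <= (1 + e * h) * (1 + e * h) ^+ k * (e * h * B * isq k).
  have -> : e * h * (B * isq k) = e * h * B * isq k by ring.
  rewrite ler_peMl ?mulr_ge0 ?isq_ge0// mulr_ege1//; lra.
 lra.
have := fG n; rewrite n1 nm => /(_ isT) h1.
have := GB n; rewrite n1 nm => /(_ isT) h2.
have ex : (1 + e * h) ^+ n <= expR (e * T).
 apply: (@le_trans _ _ (expR (e * h) ^+ n)).
  by rewrite lerXn2r ?nnegrE ?expR_ge0 ?expR_ge1Dx ?addr_ge0.
 rewrite -expRM_natl ler_expR mulrCA ler_wpM2l//.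
 by rewrite (le_trans _ hm)// ler_wpM2r// ler_nat.
set E := expR (e * T); have E0 : 0 <= E by exact: expR_ge0.
have rTT : rT ^+ 2 = T by rewrite sqr_sqrtr.
have rhh : rh ^+ 2 = h by rewrite sqr_sqrtr.
set q := isq n; have q0 : 0 <= q by exact: isq_ge0.
(* Since $nh\le T$, a term of size $B\sqrt h$ is absorbed by $B\,n^{-1/2}$. *)
have rhq : rh <= rT * q.
 by have := ler_wpM2r q0 (sqh nm); rewrite -/rh -/rT -mulrA sqrt_isq// mulr1.
have S2 : e * h * B * \sum_(1 <= l < n) isq l <= 2 * e * B * T * q.
 have := ler_wpM2l (mulr_ge0 eh0 B0) (sum_isq_lt n).
 have := ler_wpM2l (mulr_ge0 (mulr_ge0 e0 B0) rh0) (sqh nm); rewrite -/rh -/rT.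
 have := ler_wpM2l (mulr_ge0 (mulr_ge0 e0 B0) rT0) rhq.
 have -> : e * B * rT * (rT * q) = e * B * T * q by rewrite -rTT; ring.
 have -> : e * B * rh * (rh * Num.sqrt n%:R) = e * h * B * Num.sqrt n%:R by rewrite -rhh; ring.
 have -> : e * B * rh * rT = e * B * rT * rh; first by ring.
 by move=> a1 a2 a3; lra.
have A'le : A' <= A * (1 + 2 * c * rT) + 4 * c * B * (rT * q).
 by rewrite /A' lerD2l ler_wpM2l// !mulr_ge0.
have S0 : 0 <= e * h * B * \sum_(1 <= l < n) isq l.
 by rewrite !mulr_ge0// sumr_ge0// => l _; exact: isq_ge0.
have h3 : (1 + e * h) ^+ n * (A' + e * h * B * \sum_(1 <= l < n) isq l) <=
  E * (A * (1 + 2 * c * rT) + 4 * c * B * (rT * q) + 2 * e * B * T * q).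
 apply: ler_pM => //; [by rewrite exprn_ge0// addr_ge0|by rewrite addr_ge0|lra].
apply: (le_trans h1); apply: (@le_trans _ _ (E * (A * (1 + 2 * c * rT) + 4 * c * B * (rT * q) + 2 * e * B * T * q) + B * q)).
 by rewrite lerD2r (le_trans h2).
rewrite /gronwall_const -/rT -/e -/E -subr_ge0.
have -> : (1 + E * (1 + 6 * c * rT + 8 * c ^+ 2 * T)) * (A + B * q) -
 (E * (A * (1 + 2 * c * rT) + 4 * c * B * (rT * q) + 2 * e * B * T * q) + B * q) =
 A + E * (A * (4 * c * rT + 8 * c ^+ 2 * T)) + E * (B * q * (1 + 2 * c * rT)).
 by rewrite /e; ring.
by rewrite !(addr_ge0, mulr_ge0)// sqr_ge0.
Qed.

End Gronwall.
End Sums.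

(** * Pathwise expansion of the distribution function *)

Section PathExpansion.
Context (R : realType).
Notation mu := (@lebesgue_measure R).

(** The effect of the Gaussian step [z], taken from the position [y] already displaced by the drift.
    The remaining variance drops by one unit [w], which makes the mean given the past equal to 0. *)
Definition noise_term (w : R) (n k : nat) (y z x : R) : R :=
 Kc ((n - k.+1)%:R * w) (x - (y + z)) - Kc ((n - k)%:R * w) (x - y).

Definition drift_term (w : R) (n k : nat) (b y x : R) : R :=
 b * gk ((n - k)%:R * w) (x - y).

(** Defined as whatever the expansion leaves over, so that the expansion itself is an identity;
    [expansion_restE] shows what it consists of. *)
Definition expansion_rest (w h : R) (n : nat) (X b z : nat -> R) (x : R) : R :=
 heav (X n) x - Kc (n%:R * w) (x - X 0%N)
 - \sum_(0 <= k < n) noise_term w n k (X k + h * b k) (z k) x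
 + h * \sum_(0 <= k < n) drift_term w n k (b k) (X k) x.

Lemma sum_isq_rev0 n : \sum_(0 <= k < n) isq R (n - k) <= 2 * Num.sqrt n%:R.
Proof.
apply: le_trans (sum_isq R n); rewrite big_nat_rev/= big_add1/= le_eqVlt; apply/orP; left.
by apply/eqP; apply: eq_big_nat => k /andP[_ kn]; rewrite add0n subKn.
Qed.

Lemma sum_isq_rev1 n : \sum_(0 <= k < n) isq R (n - k.+1) <= 2 * Num.sqrt n%:R.
Proof.
case: n => [|n]; first by rewrite big_geq// mulr_ge0.
rewrite big_nat_recr//= subnn.
have -> : isq R 0 = 0 by rewrite /isq sqrtr0 invr0.
rewrite addr0; under eq_bigr do rewrite subSS.
by apply: le_trans (sum_isq_rev0 n) _; rewrite ler_wpM2l// ler_wsqrtr// ler_nat.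
Qed.

Variables (w h L kap : R) (n : nat) (X b z e : nat -> R).
Hypotheses (w0 : 0 < w) (h0 : 0 <= h) (L0 : 0 <= L).
Hypothesis hkap : h * Num.sqrt n%:R / Num.sqrt w <= kap.
Hypothesis XS : forall k, (k < n)%N -> X k.+1 = X k + h * b k + z k + e k.
Hypothesis bL : forall k, (k < n)%N -> `|b k| <= L.
Hypothesis eL : forall k, (k < n)%N -> `|e k| <= 2 * L * h.

Let v j : R := j%:R * w.

Let v_gt0 j : (0 < j)%N -> 0 < v j.
Proof. by move=> j0; rewrite mulr_gt0// ltr0n. Qed.

Let sqv j : (Num.sqrt (v j))^-1 = isq R j / Num.sqrt w.
Proof. by rewrite sqrtrM// invfM. Qed.

(** [E k] is the effect of the defect [e k] of the Euler step, and [T k] the second-order remainder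
    of the displacement [h * b k]. *)
Let E k x := Kc (v (n - k.+1)) (x - X k.+1) - Kc (v (n - k.+1)) (x - (X k + h * b k + z k)).
Let T k x := Kc (v (n - k)) (x - (X k + h * b k)) - Kc (v (n - k)) (x - X k) +
 h * b k * gk (v (n - k)) (x - X k).

(** Telescoping of [Kc (v (n - k)) (x - X k)] from [k = 0] to [k = n], where no variance is left and
    the indicator of the final position appears. Each increment splits into noise, drift, defect and
    Taylor remainder. *)
Lemma expansion_restE x : expansion_rest w h n X b z x = \sum_(0 <= k < n) (E k x + T k x).
Proof.
rewrite /expansion_rest.
have -> : heav (X n) x - Kc (n%:R * w) (x - X 0%N) =
  \sum_(0 <= k < n) (Kc (v (n - k.+1)) (x - X k.+1) - Kc (v (n - k)) (x - X k)).
 have := telescope_sumr (fun k => Kc (v (n - k)) (x - X k)) (leq0n n).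
 by move=> ->; rewrite subnn subn0 [in RHS]Kc0_shift ?/v ?mul0r.
rewrite mulr_sumr -sumrB -big_split/=; apply: eq_bigr => k _.
by rewrite /E /T /noise_term /drift_term -/(v _) -/(v _); ring.
Qed.

Lemma meas_E k : measT (E k).
Proof. by apply: measurable_funB; apply: meas_kshift2; exact: meas_Kc. Qed.

Lemma meas_T k : measT (T k).
Proof.
apply: measurable_funD; first by apply: measurable_funB; apply: meas_kshift2; exact: meas_Kc.
by apply: measurable_funM => //; apply: meas_kshift2; exact: meas_gk.
Qed.

Lemma integral_E k : (k < n)%N -> (\int[mu]_x `|E k x|%:E <= `|e k|%:E)%E.
Proof.
move=> kn; apply: le_trans (integral_Kc_shiftB _ _ _) _.
by rewrite lee_fin XS// [X in `|X|](_ : _ = e k)//; ring.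
Qed.

Lemma integral_T k : (k < n)%N ->
 (\int[mu]_x `|T k x|%:E <= (3 / 2 * (h * L) ^+ 2 / Num.sqrt w * isq R (n - k))%:E)%E.
Proof.
move=> kn; apply: le_trans (integral_Kc_taylor _ _ (v_gt0 _)) _; first by rewrite subn_gt0.
rewrite lee_fin sqv.
have hb : (h * b k) ^+ 2 <= (h * L) ^+ 2.
 rewrite -(real_normK (num_real (h * b k))) lerXn2r ?nnegrE ?mulr_ge0//.
 by rewrite normrM ger0_norm// ler_wpM2l// bL.
have -> : Num.sqrt 2 * (isq R (n - k) / Num.sqrt w) * (h * b k) ^+ 2 =
 (Num.sqrt 2 * (h * b k) ^+ 2) * (isq R (n - k) / Num.sqrt w) by ring.
have -> : 3 / 2 * (h * L) ^+ 2 / Num.sqrt w * isq R (n - k) =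
 (3 / 2 * (h * L) ^+ 2) * (isq R (n - k) / Num.sqrt w) by ring.
apply: ler_wpM2r; first by rewrite mulr_ge0 ?isq_ge0// invr_ge0.
by apply: ler_pM => //; [exact: sqr_ge0|exact: sqrt2_le].
Qed.

(** In the last step no variance is left to smooth, and the trivial bound 1 replaces the Lipschitz
    bound; this happens for one index only. *)
Lemma norm_E k x : (k < n)%N ->
 `|E k x| <= (k.+1 == n)%:R + 2 * L * h / Num.sqrt w * isq R (n - k.+1).
Proof.
move=> kn; have [kn1|kn1] := eqVneq k.+1 n.
 apply: ler_wpDr; first by rewrite !mulr_ge0 ?isq_ge0// invr_ge0.
 rewrite /= /E ler_norml; set a := Kc _ _; set c := Kc _ _.
 have := Kc_ge0 (v (n - k.+1)) (x - X k.+1); have := Kc_le1 (v (n - k.+1)) (x - X k.+1).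
 have := Kc_ge0 (v (n - k.+1)) (x - (X k + h * b k + z k)).
 have := Kc_le1 (v (n - k.+1)) (x - (X k + h * b k + z k)).
 by rewrite -/a -/c => *; apply/andP; split; lra.
rewrite add0r; apply: le_trans (norm_Kc_shiftB _ _ _ (v_gt0 _)) _.
 by rewrite subn_gt0 ltn_neqAle kn1.
rewrite sqv XS// [X in `|X|](_ : _ = e k); last by ring.
have -> : 2 * L * h / Num.sqrt w * isq R (n - k.+1) = 2 * L * h * (isq R (n - k.+1) / Num.sqrt w) by ring.
by apply: ler_wpM2r; rewrite ?eL// mulr_ge0 ?isq_ge0// invr_ge0.
Qed.

Lemma norm_T k x : (k < n)%N -> `|T k x| <= 2 * L * h / Num.sqrt w * isq R (n - k).
Proof.
move=> kn; apply: le_trans (norm_Kc_taylor _ _ (v_gt0 _) _) _; first by rewrite subn_gt0.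
rewrite -mulrA sqv.
have -> : 2 * L * h / Num.sqrt w * isq R (n - k) = 2 * (L * h * (isq R (n - k) / Num.sqrt w)) by ring.
rewrite ler_wpM2l// ler_wpM2r ?mulr_ge0 ?isq_ge0 ?invr_ge0//.
by rewrite normrM ger0_norm// mulrC ler_wpM2r// bL.
Qed.

Lemma meas_expansion_rest : measT (expansion_rest w h n X b z).
Proof.
rewrite (_ : expansion_rest w h n X b z = fun x => \sum_(0 <= k < n) (E k x + T k x)); last first.
 by apply/funext => x; exact: expansion_restE.
apply: measurable_sum => k; apply: measurable_funD; [exact: meas_E|exact: meas_T].
Qed.

(** A Taylor remainder costs a multiple of $h^2w^{-1/2}(n-k)^{-1/2}$. Summed over [k] this is $h$
    times $h\sqrt n/\sqrt w$, and the second factor is at most [kap]. *)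
Lemma integral_expansion_rest :
 (\int[mu]_x `|expansion_rest w h n X b z x|%:E <=
  (\sum_(0 <= k < n) `|e k| + 3 * L ^+ 2 * kap * h)%:E)%E.
Proof.
have mET k : measT (fun x => `|E k x|%:E + `|T k x|%:E)%E.
 apply: emeasurable_funD; mnorm;
  [exact: meas_E|exact: meas_T].
apply: (@le_trans _ _ (\int[mu]_x \sum_(0 <= k < n) (`|E k x|%:E + `|T k x|%:E))%E).
 apply: ge0_le_integral => //.
 - by mnorm; exact: meas_expansion_rest.
 - by apply: emeasurable_sum.
 - move=> x _; under [leRHS]eq_bigr do rewrite -EFinD.
  rewrite expansion_restE sumEFin lee_fin.
  apply: le_trans (ler_norm_sum _ _ _) _; apply: ler_sum => k _; exact: ler_normD.
rewrite ge0_integral_sum//; last by move=> k x _; rewrite -EFinD lee_fin.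
apply: (@le_trans _ _ (\sum_(0 <= k < n) (`|e k| + 3 / 2 * (h * L) ^+ 2 / Num.sqrt w * isq R (n - k))%:E)%E).
 rewrite big_nat [leRHS]big_nat; apply: lee_sum => k /andP[_ kn].
 rewrite ge0_integralD//; last 2 first.
 - by mnorm; exact: meas_E.
 - by mnorm; exact: meas_T.
 by rewrite EFinD; apply: leeD; [exact: integral_E|exact: integral_T].
rewrite sumEFin lee_fin big_split/= lerD2l -mulr_sumr.
have c0 : 0 <= 3 / 2 * (h * L) ^+ 2 / Num.sqrt w by rewrite !mulr_ge0 ?sqr_ge0 ?invr_ge0.
apply: le_trans (ler_wpM2l c0 (sum_isq_rev0 n)) _.
have -> : 3 / 2 * (h * L) ^+ 2 / Num.sqrt w * (2 * Num.sqrt n%:R) =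
 3 * L ^+ 2 * h * (h * Num.sqrt n%:R / Num.sqrt w) by field; rewrite gt_eqF// sqrtr_gt0.
have -> : 3 * L ^+ 2 * kap * h = 3 * L ^+ 2 * h * kap by ring.
by rewrite ler_wpM2l// !mulr_ge0 ?sqr_ge0.
Qed.

(** A bound without smallness. Multiplied by the $L^1$ bound, it controls the square of the rest. *)
Lemma norm_expansion_rest x : `|expansion_rest w h n X b z x| <= 1 + 8 * L * kap.
Proof.
rewrite expansion_restE; apply: le_trans (ler_norm_sum _ _ _) _.
pose a := 2 * L * h / Num.sqrt w.
have a0 : 0 <= a by rewrite !mulr_ge0 ?invr_ge0.
apply: (@le_trans _ _ (\sum_(0 <= k < n) ((k.+1 == n)%:R + a * isq R (n - k.+1) + a * isq R (n - k)))).
 rewrite big_nat [leRHS]big_nat; apply: ler_sum => k /andP[_ kn].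
 by apply: le_trans (ler_normD _ _) _; apply: lerD; [exact: norm_E|exact: norm_T].
rewrite !big_split/= -!mulr_sumr.
have i1 : \sum_(0 <= k < n) (k.+1 == n)%:R <= 1 :> R.
 case: (n) => [|m]; first by rewrite big_geq.
 rewrite big_nat_recr//= eqxx big1_seq ?add0r//.
 by move=> k; rewrite mem_index_iota /= eqSS => km; rewrite ltn_eqF.
have i2 := ler_wpM2l a0 (sum_isq_rev0 n); have i3 := ler_wpM2l a0 (sum_isq_rev1 n).
have i4 : a * (2 * Num.sqrt n%:R) <= 4 * L * kap.
 have -> : a * (2 * Num.sqrt n%:R) = 4 * L * (h * Num.sqrt n%:R / Num.sqrt w) by rewrite /a; ring.
 by rewrite ler_wpM2l// mulr_ge0.
lra.
Qed.

End PathExpansion.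

(** * Bounded random variables and their expectations *)

Section BoundedMeasurable.
Context d (Omega : measurableType d) (R : realType) (P : probability Omega R).
Implicit Types f g : Omega -> R.

(** A class closed under all the operations needed, on which expectation is linear without
    integrability conditions. *)
Definition bmf f := measT f /\ exists c, forall w, `|f w| <= c.

Lemma bmf_integrable f : bmf f -> P.-integrable setT (EFin \o f).
Proof. by move=> [mf [c fc]]; apply: integrable_bdd fc. Qed.

Lemma bmf_cst c : bmf (cst c).
Proof. by split => //; exists `|c|. Qed.

Lemma bmfD f g : bmf f -> bmf g -> bmf (fun w => f w + g w).
Proof.
move=> [mf [c fc]] [mg [e ge]]; split; first exact: measurable_funD.
exists (c + e) => w; apply: le_trans (ler_normD _ _) _; exact: lerD.
Qed.

Lemma bmfN f : bmf f -> bmf (fun w => - f w).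
Proof.
move=> [mf [c fc]]; split; first exact: measurableT_comp.
by exists c => w; rewrite normrN.
Qed.

Lemma bmfB f g : bmf f -> bmf g -> bmf (fun w => f w - g w).
Proof. by move=> hf hg; apply: bmfD hf (bmfN hg). Qed.

Lemma bmfM f g : bmf f -> bmf g -> bmf (fun w => f w * g w).
Proof.
move=> [mf [c fc]] [mg [e ge]]; split; first exact: measurable_funM.
by exists (c * e) => w; rewrite normrM ler_pM.
Qed.

Lemma bmfZ c f : bmf f -> bmf (fun w => c * f w).
Proof. exact: (bmfM (bmf_cst c)). Qed.

Lemma bmfX f n : bmf f -> bmf (fun w => f w ^+ n).
Proof.
move=> [mf [c fc]]; split; first exact: measurable_funX.
exists (c ^+ n) => w; rewrite normrX; apply: lerXn2r; rewrite ?nnegrE//.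
by rewrite (le_trans _ (fc w)).
Qed.

Lemma bmf_norm f : bmf f -> bmf (fun w => `|f w|).
Proof.
move=> [mf [c fc]]; split; first exact: measurableT_comp.
by exists c => w; rewrite normr_id.
Qed.

Lemma bmf_sum (I : Type) (s : seq I) (F : I -> Omega -> R) :
 (forall i, bmf (F i)) -> bmf (fun w => \sum_(i <- s) F i w).
Proof.
move=> h; elim: s => [|i s IH].
 by under eq_fun do rewrite big_nil; exact: bmf_cst.
by under eq_fun do rewrite big_cons; exact: bmfD.
Qed.

Lemma bmf_heav (X Y : Omega -> R) : measT X -> measT Y ->
 bmf (fun w => heav (X w) (Y w)).
Proof.
move=> mX mY; split; first exact: meas_heav.
by exists 1 => w; exact: norm_heav_le.
Qed.

Lemma bmf_comp (k : R -> R) (X : Omega -> R) c : measT k ->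
 (forall x, `|k x| <= c) -> measT X -> bmf (fun w => k (X w)).
Proof. by move=> mk kc mX; split; [exact: measurableT_comp|exists c]. Qed.

Notation "''Ex' f" := (\int[P]_w f w) (at level 10, f at level 9).

Lemma Ex_cst c : 'Ex (fun=> c) = c.
Proof.
rewrite (Rintegral_cst P measurableT) -[RHS]mulr1; congr (_ * _).
by transitivity (fine (1%E : \bar R)) => //; congr fine; exact: probability_setT.
Qed.

Lemma ExD f g : bmf f -> bmf g -> 'Ex (fun w => f w + g w) = 'Ex f + 'Ex g.
Proof. by move=> hf hg; rewrite RintegralD//; exact: bmf_integrable. Qed.

Lemma ExB f g : bmf f -> bmf g -> 'Ex (fun w => f w - g w) = 'Ex f - 'Ex g.
Proof. by move=> hf hg; rewrite RintegralB//; exact: bmf_integrable. Qed.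

Lemma ExZ c f : bmf f -> 'Ex (fun w => c * f w) = c * 'Ex f.
Proof. by move=> hf; rewrite RintegralZl//; exact: bmf_integrable. Qed.

Lemma Ex_sum (I : Type) (s : seq I) (F : I -> Omega -> R) :
 (forall i, bmf (F i)) -> 'Ex (fun w => \sum_(i <- s) F i w) = \sum_(i <- s) 'Ex (F i).
Proof.
move=> h; elim: s => [|i s IH].
 by under eq_Rintegral do rewrite big_nil; rewrite big_nil Ex_cst.
under eq_Rintegral do rewrite big_cons.
by rewrite ExD ?IH ?big_cons//; exact: bmf_sum.
Qed.

Lemma Ex_le f g : bmf f -> bmf g -> (forall w, f w <= g w) -> 'Ex f <= 'Ex g.
Proof. by move=> hf hg fg; apply: le_Rintegral => //; exact: bmf_integrable. Qed.

Lemma Ex_ge0 f : (forall w, 0 <= f w) -> 0 <= 'Ex f.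
Proof. by move=> f0; exact: Rintegral_ge0. Qed.

Lemma Ex_norm f : bmf f -> `|'Ex f| <= 'Ex (fun w => `|f w|).
Proof. by move=> hf; apply: le_normr_Rintegral => //; exact: bmf_integrable. Qed.

Lemma Ex_bound f c : bmf f -> (forall w, `|f w| <= c) -> `|'Ex f| <= c.
Proof.
move=> hf fc; apply: le_trans (Ex_norm hf) _; rewrite -[leRHS]Ex_cst.
by apply: Ex_le => //; [exact: bmf_norm|exact: bmf_cst].
Qed.

Lemma EFin_Ex f : bmf f -> (('Ex f)%:E = \int[P]_w (f w)%:E)%E.
Proof.
by move=> hf; rewrite /Rintegral fineK//; apply: integrable_fin_num => //; exact: bmf_integrable.
Qed.

Lemma Ex_ae_eq f g : measT f -> measT g ->
 {ae P, forall w, f w = g w} -> 'Ex f = 'Ex g.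
Proof.
move=> mf mg fg; congr fine; apply: ae_eq_integral => //; try exact/measurable_EFinP.
by apply: filterS fg => w h _; rewrite /= h.
Qed.


End BoundedMeasurable.

(** * The flux function *)

Section FluxFunction.
Context (R : realType).
Variables (Lam lam : R -> R).

Definition in01 (u : R) := 0 <= u <= 1.

(** The only properties of [Lam] and [lam] that later estimates refer to: [L] bounds [lam] on
    $[0,1]$ and [k] is a Lipschitz constant. The Taylor bound has [k] instead of [k / 2] because it
    comes from the mean value theorem. *)
Record flux_bounds (L k : R) : Prop := FluxBounds {
 fluxL0 : 0 <= L;
 fluxk0 : 0 <= k;
 flux_lam : forall u, in01 u -> `|lam u| <= L;
 flux_lip : forall u v, in01 u -> in01 v -> `|lam u - lam v| <= k * `|u - v|;
 flux_Lam : forall u v, in01 u -> in01 v -> `|Lam v - Lam u| <= L * `|v - u|;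
 flux_taylor : forall u v, in01 u -> in01 v ->
  `|Lam v - Lam u - lam u * (v - u)| <= k * (v - u) ^+ 2 }.

Hypothesis Lam_C1 : C1_on01 Lam lam.

Let expand x e : in01 x -> 0 < e -> exists2 dl, 0 < dl & forall y, in01 y -> `|y - x| < dl ->
 `|Lam y - Lam x - lam x * (y - x)| <= e * `|y - x|.
Proof.
move=> x01 e0; have h := Lam_C1.1 x x01.
move/cvgrPdist_lt: h => /(_ e e0).
rewrite /= near_withinE /dnbhs near_withinE => /nbhs_ballP[dl /= dl0 H].
exists dl => // y y01 yx.
have [->|yNx] := eqVneq y x; first by rewrite !subrr mulr0 subr0 normr0 mulr0.
have q0 : y - x != 0 by rewrite subr_eq0.
have := H y; rewrite /ball/= distrC => /(_ yx yNx); rewrite in_itv/= => /(_ y01) hy.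
have -> : Lam y - Lam x - lam x * (y - x) = - ((lam x - (Lam y - Lam x) / (y - x)) * (y - x)).
 by field.
by rewrite normrN normrM ler_wpM2r// ltW.
Qed.

Let is_derive_Lam (x : R) : x \in `]0, 1[ -> is_derive x 1 Lam (lam x).
Proof.
rewrite in_itv/= => /andP[x0 x1].
have x01 : in01 x by rewrite /in01 !ltW.
have q : (t^-1 *: (Lam (t *: 1 + x) - Lam x)) @[t --> (0 : R)^'] --> lam x.
 apply/cvgrPdist_le => e e0; have [dl dl0 H] := expand x01 e0.
 near=> t.
 have t0 : t != 0 by near: t; exact: nbhs_dnbhs_neq.
 rewrite /GRing.scale/= mulr1 distrC.
 have y01 : in01 (t + x).
  have : `|t| < Num.min x (1 - x).
   by near: t; apply: dnbhs0_lt; rewrite lt_min x0/= subr_gt0.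
  rewrite lt_min !ltr_norml => /andP[/andP[a1 a2] /andP[a3 a4]].
  by rewrite /in01; apply/andP; split; lra.
 have tt : t + x - x = t by ring.
 have := H (t + x) y01; rewrite tt => /(_ _) h.
 have -> : t^-1 * (Lam (t + x) - Lam x) - lam x = t^-1 * (Lam (t + x) - Lam x - lam x * t) by field.
 rewrite normrM normfV ler_pdivrMl ?normr_gt0// [leRHS]mulrC; apply: h.
 by near: t; exact: dnbhs0_lt.
apply: DeriveDef; first by apply/cvg_ex; exists (lam x).
exact/cvg_lim.
Unshelve. all: by end_near. Qed.

Let cont_Lam x : in01 x -> forall e, 0 < e -> exists2 dl, 0 < dl & forall y, in01 y -> `|y - x| < dl ->
 `|Lam x - Lam y| <= e.
Proof.
move=> x01 e e0; have [dl dl0 H] := expand x01 ltr01.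
have c0 : 0 < `|lam x| + 1 by rewrite ltr_wpDl.
exists (Num.min dl (e / (`|lam x| + 1))); first by rewrite lt_min dl0 divr_gt0.
move=> y y01; rewrite lt_min => /andP[h1 h2].
rewrite distrC; apply: (@le_trans _ _ ((`|lam x| + 1) * `|y - x|)).
 have := H y y01 h1; rewrite mul1r => h.
 have -> : Lam y - Lam x = (Lam y - Lam x - lam x * (y - x)) + lam x * (y - x) by ring.
 by apply: le_trans (ler_normD _ _) _; rewrite normrM; lra.
by rewrite mulrC -ler_pdivlMr// ltW.
Qed.

(** The derivative is two-sided only in the open interval; at [u] and [v], which may be 0 or 1, the
    mean value theorem wants mere one-sided continuity, supplied by [cont_Lam]. *)
Let mvt (u v : R) : in01 u -> in01 v -> u < v ->
 exists2 c, u <= c <= v & Lam v - Lam u = lam c * (v - u).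
Proof.
move=> /andP[u0 u1] /andP[v0 v1] uv.
have [||c] := @MVT R Lam lam u v uv.
- by move=> x; rewrite in_itv/= => /andP[a b]; apply: is_derive_Lam; rewrite in_itv/=; apply/andP; split; lra.
- apply/continuous_within_itvP => //; split.
 + move=> x; rewrite in_itv/= => /andP[a b].
  have [dx _] : is_derive x 1 Lam (lam x).
   by apply: is_derive_Lam; rewrite in_itv/=; apply/andP; split; lra.
  by apply: differentiable_continuous; apply/derivable1_diffP.
 + apply/cvgrPdist_le => e e0.
  have [|dl dl0 H] := cont_Lam (x := u) _ e0; first by rewrite /in01 u0.
  near=> y.
  have y1 : u < y by near: y; exact: nbhs_right_gt.
  have y2 : y < u + dl by near: y; apply: nbhs_right_lt; lra.
  have y3 : y < v by near: y; exact: nbhs_right_lt.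
  apply: H; first by rewrite /in01; apply/andP; split; lra.
  by rewrite ger0_norm; lra.
 + apply/cvgrPdist_le => e e0.
  have [|dl dl0 H] := cont_Lam (x := v) _ e0; first by rewrite /in01 v0.
  near=> y.
  have y1 : y < v by near: y; exact: nbhs_left_lt.
  have y2 : v - dl < y by near: y; apply: nbhs_left_gt; lra.
  have y3 : u < y by near: y; exact: nbhs_left_gt.
  apply: H; first by rewrite /in01; apply/andP; split; lra.
  by rewrite ler0_norm; lra.
by rewrite in_itv/= => /andP[a b] ->; exists c => //; rewrite !ltW.
Unshelve. all: by end_near. Qed.

Lemma flux_boundsP : [lipschitz lam x | x in `[0, 1]%classic] -> exists L k, flux_bounds L k.
Proof.
move=> [M [_ hM]].
(* The Lipschitz property is stated for all constants above some [M]; this one is moreover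
   nonnegative. *)
have {hM} := hM (`|M| + 1) _; rewrite (le_lt_trans (ler_norm M)) ?ltrDl// => /(_ isT) hk.
set k := `|M| + 1 in hk; have k0 : 0 <= k by rewrite addr_ge0.
have lip u v : in01 u -> in01 v -> `|lam u - lam v| <= k * `|u - v|.
 by move=> u01 v01; apply: (hk (u, v)); split; rewrite /= in_itv/=.
have z01 : in01 0 by rewrite /in01 lexx ler01.
have mvt' u v : in01 u -> in01 v -> exists c, [/\ in01 c, `|c - u| <= `|v - u| & Lam v - Lam u = lam c * (v - u)].
 move=> u01 v01; have [uv|vu|->] := ltgtP u v.
 - have [c /andP[c1 c2] E] := mvt u01 v01 uv; exists c; split => //.
   by move: u01 v01 => /andP[? ?] /andP[? ?]; rewrite /in01; apply/andP; split; lra.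
  by rewrite !ger0_norm; lra.
 - have [c /andP[c1 c2] E] := mvt v01 u01 vu; exists c; split => //.
   by move: u01 v01 => /andP[? ?] /andP[? ?]; rewrite /in01; apply/andP; split; lra.
   by rewrite !ler0_norm; lra.
  by rewrite -[LHS]opprB E; ring.
 - by exists v; split => //; rewrite !subrr ?mulr0.
have Lb u : in01 u -> `|lam u| <= `|lam 0| + k.
 move=> u01; have -> : lam u = lam 0 + (lam u - lam 0) by ring.
 apply: le_trans (ler_normD _ _) _; rewrite lerD2l (le_trans (lip _ _ u01 z01))//.
 rewrite subr0 -[leRHS]mulr1 ler_wpM2l//; case/andP: u01 => u0 u1; by rewrite ger0_norm.
exists (`|lam 0| + k), k; split => //.
- by rewrite addr_ge0.
- move=> u v u01 v01; have [c [c01 _ ->]] := mvt' u v u01 v01.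
 by rewrite normrM ler_wpM2r// Lb.
- move=> u v u01 v01; have [c [c01 cu ->]] := mvt' u v u01 v01.
 rewrite -mulrBl normrM -(real_normK (num_real (v - u))) expr2 mulrA ler_wpM2r//.
 by apply: le_trans (lip _ _ c01 u01) _; rewrite ler_wpM2l.
Qed.

End FluxFunction.

(** * Ranks and the empirical distribution function *)

Section Ranks.
Context (R : realType).
Variables (N : nat) (x : 'I_N -> R).
Hypothesis x_inj : forall i j, x i = x j -> i = j.

Lemma rank_of_gt0 i : (0 < rank_of x i)%N.
Proof. by apply/card_gt0P; exists i; rewrite inE. Qed.

Lemma rank_of_inj : injective (rank_of x).
Proof.
have H i k : x i < x k -> rank_of x i <> rank_of x k.
 move=> ik; rewrite /rank_of => E.
 have : [set j | x j <= x i]%SET \proper [set j | x j <= x k]%SET.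
  apply/properP; split.
   by apply/fintype.subsetP => j; rewrite !inE => /le_trans; apply; exact: ltW.
  by exists k; rewrite !inE ?lexx// -ltNge.
 by move/proper_card; rewrite E ltnn.
move=> i k E; apply: x_inj; case: (ltgtP (x i) (x k)) => // ik.
- by case: (H _ _ ik E).
- by case: (H _ _ ik (esym E)).
Qed.

(** Without ties the ranks of the particles at or below [y] are distinct and lie between 1 and the
    number of these particles, so they exhaust this range. *)
Lemma sum_rank_of (V : nmodType) (g : nat -> V) (y : R) :
 \sum_(i < N | x i <= y) g (rank_of x i) =
 \sum_(1 <= r < #|[set i | x i <= y]%SET|.+1) g r.
Proof.
set S := [set i | x i <= y]%SET.
transitivity (\sum_(r <- [seq rank_of x i | i <- enum S]) g r).
 by rewrite big_map big_enum_cond/=; apply: eq_bigl => i; rewrite !inE andbT.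
apply: perm_big; apply: uniq_perm; [|exact: iota_uniq|].
 by rewrite map_inj_uniq ?enum_uniq//; exact: rank_of_inj.
have sz : size (index_iota 1 #|S|.+1) = size [seq rank_of x i | i <- enum S].
 by rewrite size_map size_iota -cardE subn1.
have sub : {subset [seq rank_of x i | i <- enum S] <= index_iota 1 #|S|.+1}.
 move=> r /mapP[i]; rewrite mem_enum inE => xiy ->.
 rewrite mem_index_iota rank_of_gt0 ltnS; apply: subset_leq_card.
 by apply/fintype.subsetP => j; rewrite !inE => /le_trans; apply.
have un : uniq [seq rank_of x i | i <- enum S].
 by rewrite map_inj_uniq ?enum_uniq//; exact: rank_of_inj.
by have [] := uniq_min_size un sub; rewrite sz.
Qed.

End Ranks.

Section EmpiricalCdf.
Context (R : realType).

Definition empcdf (N : nat) (x : 'I_N -> R) (y : R) : R :=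
 N%:R^-1 * \sum_(i < N) heav (x i) y.

Lemma sum_heav_card (N : nat) (x : 'I_N -> R) (y : R) :
 \sum_(i < N) heav (x i) y = #|[set i | x i <= y]%SET|%:R.
Proof.
rewrite /heav -natr_sum; congr (_%:R); rewrite -sum1_card big_mkcond/= [RHS]big_mkcond/=.
by apply: eq_bigr => i _; rewrite inE; case: (x i <= y).
Qed.

Lemma empcdf_in01 (N : nat) (x : 'I_N -> R) (y : R) : in01 (empcdf x y).
Proof.
rewrite /in01 /empcdf sum_heav_card mulr_ge0 ?invr_ge0//=.
case: N x => [|n] x; first by rewrite invr0 mul0r.
rewrite mulrC ler_pdivrMr ?ltr0n// mul1r ler_nat -[leqRHS]card_ord.
exact: max_card.
Qed.

(** The increments of [Lam] telescope over the ranks $1,\dots,m$. With ties, several particles would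
    share the largest of their ranks and some increments would be missing. *)
Lemma sum_lambdaN_heav (N : nat) (x : 'I_N -> R) (Lam : R -> R) (y : R) :
 (0 < N)%N -> (forall i j, x i = x j -> i = j) ->
 N%:R^-1 * \sum_(i < N) lambdaN Lam N (rank_of x i) * heav (x i) y =
 Lam (empcdf x y) - Lam 0.
Proof.
move=> N0 inj; have NR : N%:R != 0 :> R by rewrite pnatr_eq0 -lt0n.
have -> : \sum_(i < N) lambdaN Lam N (rank_of x i) * heav (x i) y =
  \sum_(i < N | x i <= y) lambdaN Lam N (rank_of x i).
 rewrite [RHS]big_mkcond/=; apply: eq_bigr => i _; rewrite /heav.
 by case: (x i <= y); rewrite ?mulr1 ?mulr0.
rewrite (sum_rank_of inj (lambdaN Lam N)) mulr_sumr big_add1/=.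
rewrite /empcdf sum_heav_card; set m := #|_|.
under eq_bigr do rewrite /lambdaN mulrA mulVf// mul1r /=.
rewrite (telescope_sumr (fun k => Lam (k%:R / N%:R)))// mul0r.
by rewrite mulrC.
Qed.

Lemma norm_lambdaN (Lam lam : R -> R) L k (N r : nat) : flux_bounds Lam lam L k ->
 (0 < r <= N)%N -> `|lambdaN Lam N r| <= L.
Proof.
move=> fb /andP[r0 rN]; have N0 : (0 < N)%N by exact: leq_trans rN.
have NR : 0 < N%:R :> R by rewrite ltr0n.
have i1 q : (q <= N)%N -> in01 (q%:R / N%:R :> R).
 by move=> qN; rewrite /in01 divr_ge0//= ler_pdivrMr// mul1r ler_nat.
rewrite /lambdaN normrM ger0_norm//.
apply: le_trans (ler_wpM2l _ (flux_Lam fb _ _)) _; [by []|apply: i1|exact: i1|].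
 by rewrite (leq_trans (leq_pred _)).
rewrite -mulrBl -[in r%:R](prednK r0) -natr1 addrC addKr mul1r ger0_norm ?invr_ge0//.
by rewrite mulrC -mulrA mulVf ?mulr1// gt_eqF.
Qed.

Lemma rank_of_le (N : nat) (x : 'I_N -> R) i : (rank_of x i <= N)%N.
Proof. by rewrite /rank_of -[leqRHS]card_ord; exact: max_card. Qed.

End EmpiricalCdf.

(** * Flux identity for a continuous distribution function *)

Section CdfFlux.
Context d (Omega : measurableType d) (R : realType) (P : probability Omega R).
Variables (X : Omega -> R) (mX : measT X).
Variables (Lam lam : R -> R) (L k : R).
Hypothesis fb : flux_bounds Lam lam L k.
Notation "''Ex' f" := (\int[P]_w f w) (at level 10, f at level 9).

Definition rcdf (y : R) : R := 'Ex (fun w => heav (X w) y).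

Lemma bmf_heavX y : bmf (fun w => heav (X w) y).
Proof. by apply: bmf_heav. Qed.

Lemma rcdf_ge0 y : 0 <= rcdf y.
Proof. by apply: Ex_ge0 => w; exact: heav_ge0. Qed.

Lemma rcdf_le1 y : rcdf y <= 1.
Proof.
rewrite -(Ex_cst P 1); apply: Ex_le => //; [exact: bmf_heavX|exact: bmf_cst|].
by move=> w; exact: heav_le1.
Qed.

Lemma rcdf_in01 y : in01 (rcdf y).
Proof. by rewrite /in01 rcdf_ge0 rcdf_le1. Qed.

Lemma heav_mono (a y z : R) : y <= z -> heav a y <= heav a z.
Proof.
by move=> yz; rewrite /heav; case: (leP a y) => // ay; rewrite (le_trans ay yz).
Qed.

Lemma rcdf_mono y z : y <= z -> rcdf y <= rcdf z.
Proof.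
move=> yz; apply: Ex_le; [exact: bmf_heavX|exact: bmf_heavX|].
by move=> w; exact: heav_mono.
Qed.

Lemma meas_rcdf : measT rcdf.
Proof. by apply: nondecreasing_measurable => // y z; exact: rcdf_mono. Qed.

Lemma EFin_rcdf y : ((rcdf y)%:E = P (X @^-1` `]-oo, y]))%E.
Proof.
rewrite /rcdf EFin_Ex; last exact: bmf_heavX.
have mA : measurable (X @^-1` `]-oo, y]).
 by rewrite -[X in measurable X]setTI; exact: mX.
transitivity (\int[P]_w (\1_(X @^-1` `]-oo, y]) w)%:E)%E; last first.
 by rewrite integral_indic// setIT.
apply: eq_integral => w _; congr (_%:E).
by rewrite indicE /heav; congr ((_ : bool)%:R); apply/idP/idP; rewrite inE/= in_itv.
Qed.

Lemma rcdf_Ny e : 0 < e -> exists q, rcdf q <= e.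
Proof.
move=> e0; pose X' : {RV P >-> R} := HB.pack X (isMeasurableFun.Build _ _ _ _ _ mX).
have := cvg_cdfNy0 X'.
move=> /fine_cvgP[_] /cvgrPdist_le /(_ e e0) [M [_ HM]].
exists (M - 1); have := HM (M - 1); rewrite /= sub0r normrN ltrBlDr ltrDl ltr01 => /(_ isT).
have -> : fine (cdf X' (M - 1)) = rcdf (M - 1).
 by rewrite -[RHS]/(fine (rcdf (M - 1))%:E) EFin_rcdf.
by move=> /(le_trans (ler_norm _)).
Qed.

(* Continuity of [lam] is only known on [0, 1]. *)
Definition clip01 (u : R) : R := Num.max 0 (Num.min 1 u).

Lemma clip01_in01 u : in01 (clip01 u).
Proof.
by rewrite /in01 /clip01 le_max lexx/= ge_max ler01 ge_min lexx.
Qed.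

Lemma clip01_id u : in01 u -> clip01 u = u.
Proof. by move=> /andP[u0 u1]; rewrite /clip01 min_r// max_r. Qed.

Lemma continuous_lam_clip01 : continuous (fun u => lam (clip01 u)).
Proof.
have lipc u v : `|lam (clip01 u) - lam (clip01 v)| <= k * `|u - v|.
 apply: le_trans (flux_lip fb (clip01_in01 u) (clip01_in01 v)) _.
 rewrite ler_wpM2l ?(fluxk0 fb)//.
 have mm (a b c : R) : `|Num.min a b - Num.min a c| <= `|b - c|.
  have n1 := ler_norm (b - c); have n2 := ler_norm (- (b - c)); rewrite normrN in n2.
  rewrite ler_norml !minEle; case: (leP a b) => h1; case: (leP a c) => h2;
   apply/andP; split; lra.
 have MM (a b c : R) : `|Num.max a b - Num.max a c| <= `|b - c|.
  have n1 := ler_norm (b - c); have n2 := ler_norm (- (b - c)); rewrite normrN in n2.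
  rewrite ler_norml !maxEle; case: (leP a b) => h1; case: (leP a c) => h2;
   apply/andP; split; lra.
 by rewrite /clip01 (le_trans (MM _ _ _)).
move=> u; apply/cvgrPdist_le => e e0.
have k1 : 0 < k + 1 by rewrite ltr_wpDl// (fluxk0 fb).
near=> v; apply: le_trans (lipc _ _) _; apply: (@le_trans _ _ ((k + 1) * `|u - v|)).
 by rewrite ler_wpM2r// lerDl.
rewrite -ler_pdivlMl//; near: v; apply: cvgr_dist_le => //.
by rewrite mulr_gt0 ?invr_gt0.
Unshelve. all: by end_near. Qed.

Definition lamF (y : R) : R := lam (rcdf y).

Lemma meas_lamF : measT lamF.
Proof.
rewrite (_ : lamF = (fun u => lam (clip01 u)) \o rcdf); last first.
 by apply/funext => y; rewrite /= clip01_id// rcdf_in01.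
apply: measurableT_comp; last exact: meas_rcdf.
by apply: continuous_measurable_fun; exact: continuous_lam_clip01.
Qed.

Lemma norm_lamF y : `|lamF y| <= L.
Proof. by apply: (flux_lam fb); exact: rcdf_in01. Qed.

Lemma bmf_lamF : bmf (fun w => lamF (X w)).
Proof. exact: (bmf_comp meas_lamF norm_lamF mX). Qed.

Hypothesis unif_cont : forall e, 0 < e -> exists2 dl, 0 < dl & forall y, rcdf (y + dl) - rcdf y <= e.

(** A change of variables without a density. The difference [phi] of the two sides has increments
    quadratic in those of the distribution function; over a subdivision along which the latter stay
    below [e'], they add up to a multiple of [e']. *)
Lemma Ex_lamF_heav y : 'Ex (fun w => lamF (X w) * heav (X w) y) = Lam (rcdf y) - Lam 0.
Proof.
pose phi q := 'Ex (fun w => lamF (X w) * heav (X w) q) - (Lam (rcdf q) - Lam 0).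
have k0 := fluxk0 fb.
have bm q : bmf (fun w => lamF (X w) * heav (X w) q) by apply: bmfM; [exact: bmf_lamF|exact: bmf_heavX].
have bh := bmf_heavX.
have z01 : in01 (0 : R) by rewrite /in01 lexx ler01.
(* On the event $q\le X\le r$ the drift differs from its value at [q] by at most [k] times the
   increment of the distribution function, and [Lam] leaves its tangent by at most [k] times the
   square. *)
have step q r : q <= r -> `|phi r - phi q| <= 2 * k * (rcdf r - rcdf q) ^+ 2.
 move=> qr; have dF : 0 <= rcdf r - rcdf q by rewrite subr_ge0 rcdf_mono.
 have ht := flux_taylor fb (rcdf_in01 q) (rcdf_in01 r).
 have bd : bmf (fun w => (lamF (X w) - lam (rcdf q)) * (heav (X w) r - heav (X w) q)).
  by apply: bmfM; apply: bmfB => //; [exact: bmf_lamF|exact: bmf_cst].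
 have E1 : phi r - phi q = 'Ex (fun w => (lamF (X w) - lam (rcdf q)) * (heav (X w) r - heav (X w) q))
   - (Lam (rcdf r) - Lam (rcdf q) - lam (rcdf q) * (rcdf r - rcdf q)).
  have -> : 'Ex (fun w => (lamF (X w) - lam (rcdf q)) * (heav (X w) r - heav (X w) q)) =
    'Ex (fun w => (lamF (X w) * heav (X w) r - lamF (X w) * heav (X w) q) -
     lam (rcdf q) * (heav (X w) r - heav (X w) q)).
   by apply: eq_Rintegral => w _; ring.
  rewrite ExB; [|exact: bmfB|by apply: bmfZ; exact: bmfB].
  rewrite ExB// ExZ; last exact: bmfB.
  by rewrite ExB// -/(rcdf r) -/(rcdf q) /phi; ring.
 have h2 : `|'Ex (fun w => (lamF (X w) - lam (rcdf q)) * (heav (X w) r - heav (X w) q))| <=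
   k * (rcdf r - rcdf q) ^+ 2.
  apply: (le_trans (Ex_norm P bd)).
  apply: (@le_trans _ _ ('Ex (fun w => (k * (rcdf r - rcdf q)) * (heav (X w) r - heav (X w) q)))).
   apply: Ex_le; [exact: bmf_norm|by apply: bmfZ; exact: bmfB|].
   move=> w; rewrite normrM [X in _ * X]ger0_norm ?subr_ge0 ?heav_mono//.
   have [->|nz] := eqVneq (heav (X w) r - heav (X w) q) 0; first by rewrite !mulr0.
   rewrite ler_wpM2r ?subr_ge0 ?heav_mono//.
   have [xq xr] : q <= X w /\ X w <= r.
    move: nz; rewrite /heav; case: (leP (X w) r) => h3; case: (leP (X w) q) => h4; rewrite ?subrr ?eqxx//.
     by split => //; exact: ltW.
    by have := le_trans h4 qr; rewrite leNgt h3.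
   apply: le_trans (flux_lip fb (rcdf_in01 _) (rcdf_in01 _)) _.
   rewrite ler_wpM2l// ger0_norm ?subr_ge0 ?rcdf_mono// lerD2r rcdf_mono//.
  rewrite ExZ; last exact: bmfB.
  by rewrite ExB// -/(rcdf r) -/(rcdf q) expr2 mulrA.
 by rewrite E1; apply: le_trans (ler_normB _ _) _; lra.
have tail q : `|phi q| <= 2 * k * rcdf q ^+ 2.
 have ht := flux_taylor fb z01 (rcdf_in01 q); rewrite subr0 in ht.
 have bd : bmf (fun w => (lamF (X w) - lam 0) * heav (X w) q).
  by apply: bmfM => //; apply: bmfB; [exact: bmf_lamF|exact: bmf_cst].
 have E1 : phi q = 'Ex (fun w => (lamF (X w) - lam 0) * heav (X w) q)
   - (Lam (rcdf q) - Lam 0 - lam 0 * rcdf q).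
  have -> : 'Ex (fun w => (lamF (X w) - lam 0) * heav (X w) q) =
    'Ex (fun w => lamF (X w) * heav (X w) q - lam 0 * heav (X w) q).
   by apply: eq_Rintegral => w _; ring.
  rewrite ExB//; last exact: bmfZ.
  by rewrite ExZ// -/(rcdf q) /phi; ring.
 have h2 : `|'Ex (fun w => (lamF (X w) - lam 0) * heav (X w) q)| <= k * rcdf q ^+ 2.
  apply: (le_trans (Ex_norm P bd)).
  apply: (@le_trans _ _ ('Ex (fun w => (k * rcdf q) * heav (X w) q))).
   apply: Ex_le; [exact: bmf_norm|exact: bmfZ|].
   move=> w; rewrite normrM [X in _ * X]ger0_norm ?heav_ge0//.
   have [xq|xq] := leP (X w) q; last by rewrite /heav (leNgt (X w)) xq/= !mulr0.
   rewrite ler_wpM2r ?heav_ge0//.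
   apply: le_trans (flux_lip fb (rcdf_in01 _) z01) _.
   by rewrite subr0 ler_wpM2l// ger0_norm ?rcdf_ge0// rcdf_mono.
  by rewrite ExZ// -/(rcdf q) expr2 mulrA.
 by rewrite E1; apply: le_trans (ler_normB _ _) _; lra.
suff : `|phi y| <= 0 by rewrite normr_le0 /phi subr_eq0 => /eqP.
apply/ler_addgt0Pr => e e0; rewrite add0r.
have c0 : 0 < 4 * k + 1 by rewrite ltr_wpDl// mulr_ge0.
(* The chain and the left tail each contribute [2 * k * e']. The bound [e' <= 1] dominates the
   square in [tail], and the additional 1 keeps the denominator positive. *)
pose e' := Num.min 1 (e / (4 * k + 1)).
have e'0 : 0 < e' by rewrite lt_min ltr01 divr_gt0.
have [dl dl0 Hdl] := unif_cont e'0.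
have [q Hq] := rcdf_Ny e'0.
have chain j : `|phi y - phi (y - j%:R * dl)| <= 2 * k * e' * (rcdf y - rcdf (y - j%:R * dl)).
 elim: j => [|j IH]; first by rewrite mul0r subr0 !subrr normr0 mulr0.
 set a := y - j%:R * dl in IH; set b := y - j.+1%:R * dl.
 have ab : a = b + dl by rewrite /a /b -natr1; ring.
 have ba : b <= a by rewrite ab lerDl ltW.
 have -> : phi y - phi b = (phi y - phi a) + (phi a - phi b) by ring.
 apply: le_trans (ler_normD _ _) _.
 have h1 := step _ _ ba.
 have h2 : (rcdf a - rcdf b) ^+ 2 <= e' * (rcdf a - rcdf b).
  by rewrite expr2 ler_wpM2r ?subr_ge0 ?rcdf_mono// ab.
 have := ler_wpM2l (mulr_ge0 (ler0n R 2) k0) h2; lra.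
have [j hj] : exists j : nat, y - j%:R * dl <= q.
 exists (Num.trunc ((y - q) / dl)).+1.
 have := ltW (truncnS_gt ((y - q) / dl)); rewrite ler_pdivrMr//; lra.
have Fs : rcdf (y - j%:R * dl) <= e' by apply: le_trans Hq; exact: rcdf_mono.
have e'1 : e' <= 1 by rewrite ge_min lexx.
have t1 := tail (y - j%:R * dl); have c1 := chain j.
have f0 := rcdf_ge0 (y - j%:R * dl); have f1 := rcdf_le1 y.
have s1 : 2 * k * rcdf (y - j%:R * dl) ^+ 2 <= 2 * k * e'.
 by rewrite ler_wpM2l ?mulr_ge0//; nra.
have s2 : 2 * k * e' * (rcdf y - rcdf (y - j%:R * dl)) <= 2 * k * e'.
 rewrite ler_piMr ?mulr_ge0//; [exact: ltW|lra].
have -> : phi y = (phi y - phi (y - j%:R * dl)) + phi (y - j%:R * dl) by ring.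
apply: le_trans (ler_normD _ _) _; apply: (@le_trans _ _ ((4 * k + 1) * e')).
 have := ltW e'0; lra.
by rewrite mulrC -ler_pdivlMr// ge_min lexx orbT.
Qed.

End CdfFlux.

(** * Wasserstein distance on the line *)

Section Quantile.
Context (R : realType) (m : probability R R).
Notation F := (cdf_of m).

Let idR : R -> R := idfun.
#[local] HB.instance Definition _ :=
 @isMeasurableFun.Build _ _ _ _ idR (@measurable_id _ R setT).
Let X : {RV m >-> R} := idR.

Let fcdfE : fine \o cdf X = F. Proof. by []. Qed.

Let cdf_fin r : cdf X r \is a fin_num.
Proof. by rewrite fin_num_measure. Qed.

Lemma cdf_of_mono x y : x <= y -> F x <= F y.
Proof. by move=> xy; rewrite -fcdfE /= fine_le// cdf_nondecreasing. Qed.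

Lemma cdf_of_ge0 x : 0 <= F x. Proof. by rewrite fine_ge0. Qed.

Lemma cdf_of_le1 x : F x <= 1.
Proof.
rewrite -fcdfE /= -[leRHS]/(fine 1%E) fine_le//; exact: cdf_le1.
Qed.

Lemma cdf_of_right x e : 0 < e -> exists2 dl, 0 < dl &
 forall y, x <= y < x + dl -> F y <= F x + e.
Proof.
move=> e0; have : F y @[y --> x^'+] --> F x.
 by rewrite -fcdfE; apply: fine_cvg; rewrite fineK//; exact: cdf_right_continuous.
move/cvgrPdist_le => /(_ e e0); rewrite /at_right near_withinE => /nbhs_ballP[dl /= dl0 H].
exists dl => // y /andP[]; rewrite le_eqVlt => /orP[/eqP <- _|xy yd].
 by rewrite lerDl ltW.
have yb : ball x dl y by rewrite /ball/= distrC ger0_norm; lra.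
have := H y yb xy.
by rewrite ler_distlC => /andP[_].
Qed.

Lemma cdf_of_Ny e : 0 < e -> exists x, F x < e.
Proof.
move=> e0; have : F y @[y --> -oo] --> (0 : R).
 by rewrite -fcdfE; apply/fine_cvg/cvg_cdfNy0.
move=> /cvgrPdist_lt /(_ e e0) [M [_ HM]]; exists (M - 1).
have := HM (M - 1); rewrite /= sub0r normrN ltrBlDr ltrDl ltr01 => /(_ isT).
exact: le_lt_trans (ler_norm _).
Qed.

Lemma cdf_of_y e : 0 < e -> exists x, 1 - e < F x.
Proof.
move=> e0; have : F y @[y --> +oo] --> (1 : R).
 by rewrite -fcdfE; apply/fine_cvg/cvg_cdfy1.
move=> /cvgrPdist_lt /(_ e e0) [M [_ HM]]; exists (M + 1).
have := HM (M + 1); rewrite /= ltrDl ltr01 => /(_ isT).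
by move/(le_lt_trans (ler_norm _)); lra.
Qed.

(** Right continuity of the distribution function makes the infimum attained, so that quantile and
    distribution function form a Galois connection. *)
Lemma quantile_le u x : 0 < u < 1 -> (quantile m u <= x) = (u <= F x).
Proof.
move=> /andP[u0 u1]; pose S := [set x | u <= F x].
have [a Ha] := cdf_of_Ny u0.
have [b Hb] : exists b, 1 - (1 - u) < F b by apply: cdf_of_y; rewrite subr_gt0.
have S0 : S !=set0 by exists b; rewrite /S/=; lra.
have lbS : has_lbound S.
 exists a => y; rewrite /S/= => uy; rewrite leNgt; apply/negP => ya.
 by have := cdf_of_mono (ltW ya); lra.
have hS : has_inf S by [].
apply/idP/idP => [|ux]; last exact: ge_inf.
move/cdf_of_mono; apply: le_trans.
rewrite leNgt; apply/negP => lt.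
have [|dl dl0 H] := @cdf_of_right (quantile m u) ((u - F (quantile m u)) / 2).
 by rewrite divr_gt0// subr_gt0.
have [y Sy yl] := inf_adherent dl0 hS.
have qy : quantile m u <= y by exact: ge_inf.
by have := H y; rewrite qy yl => /(_ isT); move: Sy; rewrite /S/=; lra.
Qed.

(** Set to 0 outside $(0,1)$, where the infimum may run over an empty or unbounded set. *)
Definition quantile01 u : R := if 0 < u < 1 then quantile m u else 0.

Lemma meas_quantile01 : measT quantile01.
Proof.
apply: (measurability (@RGenOInfty.G R)) => [|/= _ [_] [r] -> <-].
 exact: RGenOInfty.measurableE.
rewrite setTI (_ : _ @^-1` _ = (`]0, 1[ `&` `]F r, +oo[) `|`
  (if r < 0 then ~` `]0, 1[ else set0)).
 by apply: measurableU; [exact: measurableI|case: ifP => // _; exact: measurableC].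
have E u : 0 < u < 1 -> (r < quantile m u) = (F r < u).
 by move=> u01; rewrite !ltNge quantile_le.
apply/seteqP; split => u /=; rewrite /quantile01 !in_itv/= !andbT.
 case: ifP => u01; first by rewrite E// => h; left.
 by move=> ->; right; rewrite /= in_itv/= u01.
move=> [[u01]|]; first by rewrite u01 E.
by case: ifP => // r0; rewrite /= in_itv/= => /negP/negbTE ->.
Qed.

End Quantile.

Section Coupling.
Context (R : realType).
Notation mu := (@lebesgue_measure R).

Let U : probability (measurableTypeR R) R := uniform_prob (@ltr01 R).

Lemma integral_U (f : R -> \bar R) : measT f -> (forall x, 0 <= f x)%E ->
 (\int[U]_u f u = \int[mu]_(u in `]0%R, 1%R[) f u)%E.
Proof.
move=> mf f0; rewrite integral_uniform// subr0 invr1 mul1e.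
rewrite integral_itv_obnd_cbnd; last exact: measurable_funTS.
by rewrite integral_itv_bndo_bndc//; exact: measurable_funTS.
Qed.

(** Half-lines and the whole line form a generating pi-system, on which [quantile_le] computes the
    law of the quantile of a uniform variable. *)
Lemma U_quantile (m : probability R R) (A : set R) : measurable A ->
 U (quantile01 m @^-1` A) = m A.
Proof.
move=> mA; have mq : measurable_fun [set: measurableTypeR R] (quantile01 m) by exact: meas_quantile01.
pose q' : {mfun measurableTypeR R >-> R} := HB.pack (quantile01 m) (isMeasurableFun.Build _ _ _ _ _ mq).
pose G : set (set R) := [set S | S = setT \/ exists x, S = `]-oo, x]%classic].
pose m1 : probability R R := distribution U q'.
have GmE : <<s G >> = @measurable _ R.
 apply/seteqP; split.
  apply: smallest_sub; first exact: sigma_algebra_measurable.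
  by move=> S [->|[x ->]] //.
 rewrite -[X in X `<=` _]/((@ocitv R).-sigma.-measurable) RGenOInfty.measurableE.
 apply: smallest_sub; first exact: smallest_sigma_algebra.
 move=> _ [x ->]; rewrite -setCitvl; apply: (@measurableC _ (g_sigma_algebraType G)).
 by apply: sub_sigma_algebra; right; exists x.
have := @g_sigma_algebra_measure_unique _ R _ G _ (fun=> setT) _ _ m1 m.
rewrite GmE -[U _]/(m1 A); apply => //.
- by move=> S [->|[x ->]].
- by left.
- by apply/seteqP; split => // x _; exists 0%N.
- move=> _ _ [->|[x ->]] [->|[y ->]]; rewrite ?setTI ?setIT; [by left|by right; exists y|by right; exists x|].
 right; exists (Num.min x y); apply/seteqP; split => z /=; rewrite !in_itv/= le_min.
  by move=> [-> ->].
 by move=> /andP[].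
- move=> S [->|[x ->]].
  by rewrite [LHS]probability_setT [RHS]probability_setT.
 rewrite -[LHS]/(U (quantile01 m @^-1` _)) -(setTI (_ @^-1` _)).
 have mS : measurable (setT `&` quantile01 m @^-1` `]-oo, x]) by apply: (@meas_quantile01 R m).
 set B := setT `&` _ in mS *.
 have -> : U B = (\int[U]_u (\1_B u)%:E)%E by rewrite integral_indic// setIT.
 rewrite integral_U; [|by unEFin; exact: measurable_indic|by move=> u; rewrite lee_fin].
 rewrite /B.
 have F0 := cdf_of_ge0 m x; have F1 := cdf_of_le1 m x.
 transitivity (\int[mu]_(u in `]0%R, 1%R[) (\1_`]-oo, cdf_of m x] u)%:E)%E.
  apply: eq_integral => u; rewrite inE/= => u01; rewrite setTI !indicE; congr (_%:R%:E).
  have u01' : 0 < u < 1 by move: u01; rewrite in_itv.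
  by congr (nat_of_bool _); apply/idP/idP; rewrite !inE/= /quantile01 u01' !in_itv/= quantile_le.
 rewrite integral_indic//.
 transitivity ((cdf_of m x)%:E); last by rewrite fineK ?fin_num_measure.
 have [F1'|F1'] := eqVneq (cdf_of m x) 1.
  rewrite (_ : _ `&` _ = `]0, 1[%classic); last first.
   by rewrite F1'; apply/setIidr => u /=; rewrite !in_itv/= => /andP[_ /ltW].
  by apply: (etrans (lebesgue_measure_itv _)); rewrite /= lte_fin ltr01 F1' oppr0 adde0.
 rewrite (_ : _ `&` _ = `]0, cdf_of m x]%classic); last first.
  apply/seteqP; split => u /=; rewrite !in_itv/=.
   by move=> [-> /andP[->]].
  move=> /andP[-> uF]; rewrite uF; split => //; rewrite (le_lt_trans uF)//.
  by rewrite lt_neqAle F1'.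
 apply: (etrans (lebesgue_measure_itv _)); rewrite /= lte_fin; case: ltP => [_|]; first by rewrite oppr0 adde0.
 by move=> F0'; congr (_%:E); apply/eqP; rewrite eq_le F0 F0'.
- by move=> _; rewrite (le_lt_trans (probability_le1 _ _))// ltry.
Qed.

(** The pair of quantiles of one uniform variable is a coupling. Writing $|a-b|$ as $\int|1_{a\le
    y}-1_{b\le y}|dy$ and exchanging the integrals turns its cost into the $L^1$ distance of the
    distribution functions. *)
Lemma wasserstein1_le_prob (m n : probability R R) :
 (wasserstein1 m n <= \int[mu]_y `|cdf_of m y - cdf_of n y|%:E)%E.
Proof.
pose f u : R * R := (quantile01 m u, quantile01 n u).
have mf : measurable_fun [set: measurableTypeR R] f.
 by apply: measurable_fun_pair; exact: meas_quantile01.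
pose f' : {mfun measurableTypeR R >-> (R * R)%type} := HB.pack f (isMeasurableFun.Build _ _ _ _ _ mf).
pose pi : probability (R * R)%type R := distribution U f'.
have mD : measT (fun z : R * R => `|z.1 - z.2|%:E).
 mnorm.
 exact: measurable_funB.
apply: (@le_trans _ _ (\int[pi]_z `|z.1 - z.2|%:E)%E).
 apply: ereal_inf_lbound; exists pi => // A mA; split.
  by transitivity (U (quantile01 m @^-1` A)); [|exact: U_quantile].
 by transitivity (U (quantile01 n @^-1` A)); [|exact: U_quantile].
rewrite ge0_integral_distribution//=.
pose H := fun z : measurableTypeR R * R => `|heav (quantile01 m z.1) z.2 - heav (quantile01 n z.1) z.2|.
have mH : measT H.
 apply: measurableT_comp => //; apply: measurable_funB; apply: meas_heav => //;
  by apply: measurableT_comp => //; exact: meas_quantile01.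
have H0 z : 0 <= H z by exact: normr_ge0.
rewrite (eq_integral (fun u => \int[mu]_y (H (u, y))%:E)%E); last first.
 by move=> u _; rewrite /H/= integral_heavB.
rewrite (@integral_swap _ _ _ _ _ U mu H mH H0).
apply: ge0_le_integral => //.
- by move=> y _; apply: integral_ge0 => u _; rewrite lee_fin.
- by apply: (@meas_integral2 _ _ _ _ _ U H mH H0).
- mnorm; apply: measurable_funB;
  by apply: nondecreasing_measurable => // x y; exact: cdf_of_mono.
move=> y _; rewrite integral_U; [|by unEFin; exact: (meas_slice2 y mH)|by move=> u; rewrite lee_fin].
(* [quantile_le] yields the indicator of [u <= F y], oriented opposite to [heav]; both sides are
   negated and the integral is reflected afterwards. *)
rewrite [leLHS](_ : _ = \int[mu]_(u in `]0%R, 1%R[) `|heav (- cdf_of m y) (0 - u) - heav (- cdf_of n y) (0 - u)|%:E)%E; last first.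
 apply: eq_integral => u; rewrite inE/= in_itv/= => u01; congr (`|_ - _|%:E);
  by rewrite /heav sub0r lerN2 /quantile01 u01 quantile_le.
have mh : measT (fun v => `|heav (- cdf_of m y) v - heav (- cdf_of n y) v|%:E).
 by mnorm; apply: measurable_funB; exact: meas_heavr.
apply: (@le_trans _ _ (\int[mu]_u `|heav (- cdf_of m y) (0 - u) - heav (- cdf_of n y) (0 - u)|%:E)%E).
 apply: ge0_subset_integral => //; apply: (measurableT_comp mh).
 exact: measurable_funB.
rewrite (ge0_integral_reflect 0 mh)// integral_heavB lee_fin.
by rewrite opprK addrC distrC.
Qed.

(** An alias carrying the proof that the mass is 1, so that a mere measure, such as the mean
    empirical measure, receives the structure of a probability. *)
Definition as_probability (M : {measure set R -> \bar R}) of M setT = 1%E : set R -> \bar R := M.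

Section AsProbability.
Variables (M : {measure set R -> \bar R}) (M1 : M setT = 1%E).
HB.instance Definition _ := isMeasure.Build _ _ _ (as_probability M1)
 (measure0 M) (measure_ge0 M) (@measure_semi_sigma_additive _ _ _ M).
HB.instance Definition _ := Measure_isProbability.Build _ _ _ (as_probability M1) M1.
End AsProbability.

Lemma wasserstein1_le (M : {measure set R -> \bar R}) (n : probability R R) : M setT = 1%E ->
 (wasserstein1 M n <= \int[mu]_y `|fine (M `]-oo, y]%classic) - cdf_of n y|%:E)%E.
Proof. by move=> M1; exact: (wasserstein1_le_prob (as_probability M1) n). Qed.

End Coupling.

(** * Filtrations of the limit and of the particles *)

Section BrownianPast.
Context d (Omega : measurableType d) (R : realType) (P : probability Omega R).

Lemma gen_setT (I : Type) (D : set I) (X : I -> Omega -> R) : generated_sigma_algebra D X setT.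
Proof. exact: sigma_algebra_setT. Qed.

Lemma gen_setI (I : Type) (D : set I) (X : I -> Omega -> R) :
 setI_closed (generated_sigma_algebra D X).
Proof. exact: sigma_algebra_setI_closed. Qed.

Section OneMotion.
Variables (W : R -> {RV P >-> R}) (A O : set (set Omega)).
Hypothesis BM : brownian_motion P W.
Hypotheses (mA : A `<=` measurable) (mO : O `<=` measurable).
Hypotheses (AT : A setT) (OT : O setT) (AI : setI_closed A) (OI : setI_closed O).
Notation whole := (generated_sigma_algebra [set r | 0 <= r] (fun r => W r)).
Hypothesis AW : forall a S, A a -> <<s O `|` whole >> S -> (P (a `&` S) = P a * P S)%E.
Hypothesis OW : forall o S, O o -> whole S -> (P (o `&` S) = P o * P S)%E.

(** [A] stands for the initial positions and [O] for the other driving processes, over all times;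
    only [W] is stopped at [s]. The null sets are included because the solutions are adapted to an
    augmented filtration. *)
Definition brownian_past (s : R) : set (set Omega) :=
 A `|` O `|` generated_sigma_algebra [set r | 0 <= r <= s] (fun r => W r) `|` null_sets P.

Lemma meas_brownian_past s : brownian_past s `<=` measurable.
Proof.
move=> S [[[/mA//|/mO//]|]|[]//].
by apply: generated_measurable => r _; exact: measurable_funP.
Qed.

Lemma brownian_past_mono s t : s <= t -> <<s brownian_past s >> `<=` <<s brownian_past t >>.
Proof.
move=> st; apply: g_sigma_sub => S [[[h|h]|h]|h]; try (apply: sub_sigma_algebra; by [left; left; left|left; left; right|right]).
apply: sub_sigma_algebra; left; right; apply: g_sigma_sub h => B [r /= /andP[r0 rs] h].
by apply: sub_sigma_algebra; exists r => //=; rewrite r0 (le_trans rs).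
Qed.

Lemma past_brownian s r : 0 <= r <= s -> sub_measurable (brownian_past s) (W r).
Proof.
by move=> rs B mB; apply: sub_sigma_algebra; left; right; apply: generated_preimage.
Qed.

(** Three independences are combined: of [A] from everything else, of [O] from [W], and of the
    increment from the past of [W]. They give the product formula on triple intersections, which
    [independent_join] extends. *)
Lemma brownian_increment_indep s t c : 0 <= s -> s < t -> 0 < c ->
 gaussian_indep P (brownian_past s) (fun w => c * (W t w - W s w)) (c ^+ 2 * (t - s)).
Proof.
move=> s0 st c0 S B sS mB; have [_ law ind _] := BM.
have mq : measT (fun x : R => c * x) by exact: measurable_funM.
have mcB : measurable ((fun x : R => c * x) @^-1` B).
 by rewrite -[X in measurable X]setTI; exact: mq.
pose D w := W t w - W s w.
have mD : measT D by apply: measurable_funB; exact: measurable_funP.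
pose Z := (fun w => c * (W t w - W s w)) @^-1` B.
have ZE : Z = D @^-1` ((fun x => c * x) @^-1` B) by [].
have PZ : P Z = gm (c ^+ 2 * (t - s)) B.
 apply: (etrans (law s t s0 st _ mcB)); apply: (gm_scale c0 _ mB); by rewrite subr_gt0.
have mZ : measurable Z by rewrite ZE -[X in measurable X]setTI; exact: mD.
have gW (I : Type) (E : set I) (f : I -> R) : generated_sigma_algebra E (fun i => W (f i)) `<=` measurable.
 by apply: generated_measurable => r _; exact: measurable_funP.
rewrite -PZ; apply: (@independent_join _ _ _ P A O
 (generated_sigma_algebra [set r | 0 <= r <= s] (fun r => W r))) => //.
- exact: gen_setT.
- exact: gen_setI.
move=> a o q Aa Oo Qq.
have wq : whole q.
 apply: g_sigma_sub Qq => E [r /= /andP[r0 _] h]; apply: sub_sigma_algebra.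
 by exists r.
have wZ : whole Z.
 apply: (@generated_sub _ _ _ unit (\bigcup_(i in [set r | 0 <= r]) preimage_set_system setT (W i) measurable) setT (fun _ => D)); last first.
  exact: (@generated_preimage _ _ _ unit setT (fun _ => D) tt _ I mcB).
 move=> _ E _ mE.
 have mW r : 0 <= r -> measT (W r : g_sigma_algebraType (\bigcup_(i in [set r | 0 <= r]) preimage_set_system setT (W i) measurable) -> R).
  by move=> r0; apply/sub_measurableP => F mF; exact: generated_preimage.
 have : measT (D : g_sigma_algebraType (\bigcup_(i in [set r | 0 <= r]) preimage_set_system setT (W i) measurable) -> R).
  by apply: measurable_funB; apply: mW => //; rewrite (le_trans s0) ?ltW.
 by move/sub_measurableP; exact.
have qZ : P (q `&` Z) = (P q * P Z)%E.
 apply: (ind s t) => //.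
 exact: (@generated_preimage _ _ _ unit setT (fun _ => D) tt _ I mcB).
have wqZ : whole (q `&` Z) by exact: gen_setI.
have sO S' : whole S' -> <<s O `|` whole >> S' by move=> h; apply: sub_sigma_algebra; right.
have sOo : <<s O `|` whole >> o by apply: sub_sigma_algebra; left.
rewrite -!setIA AW//; last by apply: sigma_algebra_setI_closed => //; exact: sO.
rewrite OW// qZ [in RHS]AW//; last by apply: sigma_algebra_setI_closed => //; exact: sO.
by rewrite OW// !muleA.
Qed.

Lemma brownian_past_A s S : A S -> <<s brownian_past s >> S.
Proof. by move=> h; apply: sub_sigma_algebra; left; left; left. Qed.

Lemma brownian_past_O s S : O S -> <<s brownian_past s >> S.
Proof. by move=> h; apply: sub_sigma_algebra; left; left; right. Qed.

Lemma brownian_past_null s S : null_sets P S -> <<s brownian_past s >> S.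
Proof. by move=> h; apply: sub_sigma_algebra; right. Qed.

End OneMotion.

Section LimitPast.
Variables (T sigma : R) (lam : R -> R) (m : probability R R) (W X : R -> {RV P >-> R}).
Hypothesis BM : brownian_motion P W.
Hypothesis sol : limit_solution P T sigma lam m W X.

(** A single Brownian motion drives the limit, so the component of other processes is trivial. *)
Definition limit_past (s : R) : set (set Omega) :=
 brownian_past W (generated_sigma_algebra [set: unit] (fun _ => X 0)) [set setT] s.

Let mX0 : generated_sigma_algebra [set: unit] (fun _ => X 0 : Omega -> R) `<=` measurable.
Proof. by apply: generated_measurable => i _; exact: measurable_funP. Qed.

Lemma meas_limit_past s : limit_past s `<=` measurable.
Proof. by apply: meas_brownian_past => // S ->. Qed.

Lemma limit_increment_indep s t c : 0 <= s -> s < t -> 0 < c ->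
 gaussian_indep P (limit_past s) (fun w => c * (W t w - W s w)) (c ^+ 2 * (t - s)).
Proof.
apply: brownian_increment_indep => //.
- by move=> S ->.
- exact: gen_setT.
- exact: gen_setI.
- by move=> S1 S2 -> ->; rewrite setTI.
- move=> a S ga gS; have [_ ind _ _ _] := sol; apply: ind => //.
 apply: g_sigma_sub gS => B [->|]; first exact: gen_setT.
 by move=> h; apply: (@smallest_sub _ _ _ _ _ _ _ h) => //; exact: smallest_sigma_algebra.
- by move=> o S -> _; rewrite setTI probability_setT mul1e.
Qed.

Lemma limit_adapted s : 0 <= s <= T -> sub_measurable (limit_past s) (X s).
Proof.
move=> sT B mB; have [_ _ ad _ _] := sol.
have := ad s sT B mB; apply: g_sigma_sub => S [[h|h]|h].
- exact: brownian_past_A.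
- apply: sub_sigma_algebra; left; right.
 by apply: g_sigma_sub h => E [[j r] /= rs h]; apply: sub_sigma_algebra; exists r.
- exact: brownian_past_null.
Qed.

End LimitPast.

Section ParticlePast.
Variables (W : nat -> R -> {RV P >-> R}) (X0 : forall N : nat, 'I_N -> {RV P >-> R}) (N : nat).
Hypothesis BM : independent_brownian_motions P W.
Hypothesis indep0 : independent_initial P X0 W.

Definition others (j : nat) : set (set Omega) :=
 <<s \bigcup_(i in [set i | i <> j]) generated_sigma_algebra [set t | 0 <= t] (fun t => W i t) >>.

(** It contains the other Brownian motions over all times. All positions up to time [s] and the
    simultaneous noises of the other particles are thus in the past of [j], while increments of
    [W j] after [s] remain independent of it. *)
Definition particle_past (j : nat) (s : R) : set (set Omega) :=
 brownian_past (W j) (generated_sigma_algebra [set: 'I_N] (fun i => X0 i)) (others j) s.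

Let mW i : generated_sigma_algebra [set t | 0 <= t] (fun t => W i t : Omega -> R) `<=` measurable.
Proof. by apply: generated_measurable => r _; exact: measurable_funP. Qed.

Let mX0 : generated_sigma_algebra [set: 'I_N] (fun i => X0 i : Omega -> R) `<=` measurable.
Proof. by apply: generated_measurable => i _; exact: measurable_funP. Qed.

Let mO j : others j `<=` measurable.
Proof. by apply: g_sigma_measurable => S [i _]; exact: mW. Qed.

Lemma meas_particle_past j s : particle_past j s `<=` measurable.
Proof. exact: meas_brownian_past. Qed.

Lemma particle_past_mono j s t : s <= t -> <<s particle_past j s >> `<=` <<s particle_past j t >>.
Proof. exact: brownian_past_mono. Qed.

Lemma particle_increment_indep j s t c : 0 <= s -> s < t -> 0 < c ->
 gaussian_indep P (particle_past j s) (fun w => c * (W j t w - W j s w)) (c ^+ 2 * (t - s)).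
Proof.
have [BMj ind] := BM.
apply: brownian_increment_indep => //.
- exact: gen_setT.
- exact: sigma_algebra_setT.
- exact: gen_setI.
- exact: sigma_algebra_setI_closed.
- move=> a S ga gS; apply: indep0.
  apply: g_sigma_sub ga => B [i _ h]; apply: sub_sigma_algebra.
  by exists (existT (fun N => 'I_N) N i).
 have all_W i : generated_sigma_algebra [set t | 0 <= t] (fun t => W i t : Omega -> R) `<=`
   generated_sigma_algebra [set p : nat * R | 0 <= p.2] (fun p => W p.1 p.2 : Omega -> R).
  by apply: g_sigma_sub => B [r r0 h]; apply: sub_sigma_algebra; exists (i, r).
 apply: (@smallest_sub _ _ _ _ _ _ _ gS); first exact: smallest_sigma_algebra.
 move=> B [|]; last exact: all_W.
 by move=> h; apply: (@smallest_sub _ _ _ _ _ _ _ h); [exact: smallest_sigma_algebra|move=> E [i _]; exact: all_W].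
- apply: (mutually_independent_others (G := fun i => generated_sigma_algebra [set t | 0 <= t] (fun t => W i t : Omega -> R))) => //.
 + by move=> i; exact: gen_setI.
 + by move=> i; exact: gen_setT.
Qed.

Lemma particle_past_brownian (i j : nat) s r : 0 <= r -> (i <> j \/ r <= s) ->
 sub_measurable (particle_past j s) (W i r).
Proof.
move=> r0 h B mB; have [ij|ij] := eqVneq i j.
 subst i; case: h => // rs; apply: past_brownian => //; by rewrite r0.
apply: brownian_past_O; apply: sub_sigma_algebra; exists i; first by apply/eqP.
exact: generated_preimage.
Qed.

Lemma particle_filtration (j : nat) s :
 augmented_filtration P (fun i : 'I_N => X0 i : Omega -> R)
  (fun (i : 'I_N) t => W i t) s `<=` <<s particle_past j s >>.
Proof.
apply: g_sigma_sub => S [[h|h]|h].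
- exact: brownian_past_A.
- apply: (@smallest_sub _ _ _ _ _ _ _ h); first exact: smallest_sigma_algebra.
 move=> E [[i r] /= /andP[r0 rs] [B mB <-]]; rewrite setTI.
 by apply: particle_past_brownian => //; right.
- exact: brownian_past_null.
Qed.

End ParticlePast.

End BrownianPast.

(** * Expansion over a grid *)

Opaque Kc gk dgk.

Section MeanDrift.
Context d (Omega : measurableType d) (R : realType) (P : probability Omega R).
Notation mu := (@lebesgue_measure R).
Notation "''Ex' f" := (\int[P]_w f w) (at level 10, f at level 9).

Lemma meas_joint_kernel (k : R -> R) (X : Omega -> R) : measT k ->
 measT X -> measT (fun q : Omega * R => k (q.2 - X q.1)).
Proof.
move=> mk mX; apply: measurableT_comp => //; apply: measurable_funB => //.
exact: measurableT_comp.
Qed.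

Lemma meas_fst_comp (f : Omega -> R) : measT f ->
 measT (fun q : Omega * R => f q.1).
Proof. by move=> mf; apply: measurableT_comp. Qed.

Lemma Ex_sum_nat (F : nat -> Omega -> R) n : (forall k, (k < n)%N -> bmf (F k)) ->
 bmf (fun w => \sum_(0 <= k < n) F k w) /\
 'Ex (fun w => \sum_(0 <= k < n) F k w) = \sum_(0 <= k < n) 'Ex (F k).
Proof.
elim: n => [|n IH] hF.
 rewrite big_geq//; split; last by under eq_Rintegral do rewrite big_geq//; rewrite Ex_cst.
 by under eq_fun do rewrite big_geq//; exact: bmf_cst.
have [h1 h2] := IH (fun k kn => hF k (ltnW kn)).
rewrite big_nat_recr//= -h2; split.
 by under eq_fun do rewrite big_nat_recr//=; apply: bmfD => //; exact: hF.
under eq_Rintegral do rewrite big_nat_recr//=.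
by rewrite ExD//; exact: hF.
Qed.

Lemma meas_Ex (f : Omega * R -> R) : measT f ->
 measT (fun x => 'Ex (fun w => f (w, x))).
Proof.
move=> mf; pose g (q : R * Omega) := f (q.2, q.1).
have mg : measT g.
 by apply: measurableT_comp => //; apply: measurable_fun_pair.
exact: (@meas_Rintegral1 _ _ _ _ R P g mg).
Qed.

Lemma integral_Ex_le (f : Omega * R -> R) : measT f ->
 (\int[mu]_x `|'Ex (fun w => f (w, x))|%:E <= \int[P]_w \int[mu]_x `|f (w, x)|%:E)%E.
Proof.
move=> mf.
have mnf : measT (fun q => `|f q|) by exact: measurableT_comp.
rewrite (@integral_swap _ _ _ _ R P mu (fun q => `|f q|) mnf (fun q => normr_ge0 _)).
apply: ge0_le_integral => //.
- by mnorm; exact: meas_Ex.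
- by apply: (@meas_integral2 _ _ _ _ R P (fun q => `|f q|) mnf) => q; exact: normr_ge0.
- by move=> x _; apply: abs_Rintegral_le; exact: meas_slice2.
Qed.

Lemma Ex_conv (kk : R -> R) (b X : Omega -> R) x : measT kk ->
 mu.-integrable setT (EFin \o kk) -> bmf b -> measT X ->
 'Ex (fun w => b w * conv kk (heav (X w)) x) = conv kk (fun y => 'Ex (fun w => b w * heav (X w) y)) x.
Proof.
move=> mk ik [mb [c bc]] mX.
have mkx : measT (fun y : R => kk (x - y)) by exact: meas_kshift.
have ikx : mu.-integrable setT (fun y => (kk (x - y))%:E) by exact: integrable_reflect.
pose f (q : Omega * R) := kk (x - q.2) * (b q.1 * heav (X q.1) q.2).
have mf : measT f.
 apply: measurable_funM; first exact: (measurableT_comp mkx).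
 apply: measurable_funM; first exact: meas_fst_comp.
 by apply: meas_heav => //; exact: meas_fst_comp.
have bh w y : `|b w * heav (X w) y| <= c.
 by rewrite normrM -[leRHS]mulr1 ler_pM// norm_heav_le.
have fle q : `|f q| <= `|kk (x - q.2)| * c by rewrite normrM ler_wpM2l.
have if1 w : mu.-integrable setT (fun y => (f (w, y))%:E).
 apply: (@integrable_bounded _ _ _ mu (fun y => kk (x - y)) (fun y => b w * heav (X w) y) c) => //.
 by apply: measurable_funM => //; exact: meas_heavr.
have -> : 'Ex (fun w => b w * conv kk (heav (X w)) x) = 'Ex (fun w => \int[mu]_y f (w, y)).
 apply: eq_Rintegral => w _; rewrite /conv -RintegralZl//; last first.
  by apply: (@integrable_bounded _ _ _ mu (fun y => kk (x - y)) (heav (X w)) 1) => //;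
   [exact: meas_heavr|exact: norm_heav_le].
 by apply: eq_Rintegral => y _; rewrite /f/=; ring.
rewrite (@Rintegral_swap _ _ _ _ R P mu f mf)//.
- rewrite /conv; apply: eq_Rintegral => y _; rewrite -ExZ//.
 split; last by exists c.
 by apply: measurable_funM => //; apply: meas_heav.
- move=> y; apply: (@integrable_bdd _ _ _ P (fun w => f (w, y)) (`|kk (x - y)| * c)).
  exact: meas_slice2.
 by move=> w; exact: fle.
- have c0 : 0 <= c by rewrite (le_trans _ (bc point)).
 have mnk : measT (fun y : R => `|kk (x - y)|%:E) by unEFin; exact: measurableT_comp.
 have kfin : (\int[mu]_y `|kk (x - y)|%:E < +oo)%E by case/integrableP: ikx.
 apply: (@le_lt_trans _ _ (\int[P]_w (c%:E * \int[mu]_y `|kk (x - y)|%:E))%E); last first.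
  rewrite integral_cst//= probability_setT mule1; exact: lte_mul_pinfty.
 have mnf : measT (fun q => `|f q|) by exact: measurableT_comp.
 apply: ge0_le_integral => //.
 + by move=> w _; apply: integral_ge0 => y _; rewrite lee_fin.
 + by apply: (@meas_integral1 _ _ _ _ R mu (fun q => `|f q|) mnf) => q; exact: normr_ge0.
 have c0' : (0 <= c%:E)%E by rewrite lee_fin.
 have k0 (y : R) : (0 <= `|kk (x - y)|%:E)%E by rewrite lee_fin.
 move=> w _; rewrite -(ge0_integralZl mu measurableT mnk (fun y _ => k0 y) c0').
 apply: ge0_le_integral => //.
 * by unEFin; exact: (meas_slice1 w mnf).
 * exact: measurable_funeM.
 * by move=> y _; rewrite -EFinM lee_fin mulrC; exact: fle.
Qed.

(** [gk_conv_heav] under the expectation: the mean drift term depends on the joint law of drift and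
    position only through the flux $E[b\,1_{X\le y}]$. *)
Lemma Ex_drift_conv (b X : Omega -> R) v x : 0 < v -> bmf b -> measT X ->
 'Ex (fun w => b w * gk v (x - X w)) = conv (dgk v) (fun y => 'Ex (fun w => b w * heav (X w) y)) x.
Proof.
move=> v0 bb mX; rewrite -(Ex_conv x (meas_dgk v) (integrable_dgk v0) bb mX).
by apply: eq_Rintegral => w _; rewrite gk_conv_heav.
Qed.

End MeanDrift.

(** * Processes sampled on a grid *)

Section GridProcess.
Context d (Omega : measurableType d) (R : realType) (P : probability Omega R).
Notation mu := (@lebesgue_measure R).
Notation "''Ex' f" := (\int[P]_w f w) (at level 10, f at level 9).
Variables (w h L kap : R) (m : nat).

(** An Euler scheme up to a defect. The crude almost sure bound [2 * L * h] on the defect serves the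
    sup bound of the rest; its mean size is left as a separate hypothesis of the $L^1$ bounds,
    because it vanishes for a genuine scheme. *)
Record grid_process (G : nat -> set (set Omega)) (X b z : nat -> Omega -> R) : Prop := GridProcess {
 gpG : forall k, G k `<=` measurable;
 gpX : forall k, (k < m)%N -> sub_measurable (G k) (X k);
 gpb : forall k, (k < m)%N -> sub_measurable (G k) (b k);
 gpXm : forall k, measT (X k);
 gpbm : forall k, measT (b k);
 gpzm : forall k, measT (z k);
 gpbL : forall k o, `|b k o| <= L;
 gpi : forall k, (k < m)%N -> gaussian_indep P (G k) (z k) w;
 gpe : {ae P, forall o, forall k, (k < m)%N ->
  `|X k.+1 o - (X k o + h * b k o + z k o)| <= 2 * L * h} }.

Hypotheses (w0 : 0 < w) (h0 : 0 <= h) (L0 : 0 <= L).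
Hypothesis hkap : h * Num.sqrt m%:R / Num.sqrt w <= kap.
Variables (G : nat -> set (set Omega)) (X b z : nat -> Omega -> R).
Hypothesis gp : grid_process G X b z.

Let kap0 : 0 <= kap.
Proof. by apply: le_trans hkap; rewrite !mulr_ge0 ?invr_ge0. Qed.

Definition grid_noise n k (q : Omega * R) :=
 noise_term w n k (X k q.1 + h * b k q.1) (z k q.1) q.2.
Definition grid_drift n k (q : Omega * R) := drift_term w n k (b k q.1) (X k q.1) q.2.
Definition grid_rest n (q : Omega * R) :=
 expansion_rest w h n (X ^~ q.1) (b ^~ q.1) (z ^~ q.1) q.2.
Definition grid_defect k (o : Omega) := X k.+1 o - (X k o + h * b k o + z k o).

Lemma grid_expansionE n q : heav (X n q.1) q.2 = Kc (n%:R * w) (q.2 - X 0%N q.1)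
 + \sum_(0 <= k < n) grid_noise n k q - h * \sum_(0 <= k < n) grid_drift n k q + grid_rest n q.
Proof. by rewrite /grid_rest /expansion_rest -/(grid_noise n _ q) -/(grid_drift n _ q); ring. Qed.

Let mKc s (Y : Omega -> R) : measT Y ->
 measT (fun q : Omega * R => Kc s (q.2 - Y q.1)).
Proof. by move=> mY; apply: meas_joint_kernel => //; exact: meas_Kc. Qed.

Let mhb k : measT (fun o => X k o + h * b k o).
Proof. by apply: measurable_funD; [exact: gpXm gp k|apply: measurable_funM => //; exact: gpbm gp k]. Qed.

Lemma meas_grid_noise n k : measT (grid_noise n k).
Proof.
apply: measurable_funB; last exact: (mKc ((n - k)%:R * w) (mhb k)).
apply: (mKc ((n - k.+1)%:R * w) (Y := fun o => X k o + h * b k o + z k o)).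
by apply: measurable_funD => //; exact: gpzm gp k.
Qed.

Lemma meas_grid_drift n k : measT (grid_drift n k).
Proof.
apply: measurable_funM; first by apply: meas_fst_comp; exact: gpbm gp k.
by apply: meas_joint_kernel; [exact: meas_gk|exact: gpXm gp k].
Qed.

Lemma meas_grid_rest n : measT (grid_rest n).
Proof.
apply: measurable_funD.
 apply: measurable_funB; last by apply: measurable_sum => k; exact: meas_grid_noise.
 apply: measurable_funB; last by apply: mKc; exact: gpXm gp _.
 by apply: meas_heav => //; apply: meas_fst_comp; exact: gpXm gp n.
by apply: measurable_funM => //; apply: measurable_sum => k; exact: meas_grid_drift.
Qed.

Lemma norm_grid_noise n k q : `|grid_noise n k q| <= 1.
Proof.
rewrite /grid_noise /noise_term; set s := (n - k.+1)%:R * w; set s' := (n - k)%:R * w.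
set x := q.2 - _; set x' := q.2 - _.
have := Kc_ge0 s x; have := Kc_le1 s x; have := Kc_ge0 s' x'; have := Kc_le1 s' x'.
by rewrite ler_norml => *; apply/andP; split; lra.
Qed.

Let nk_gt0 n k : (k < n)%N -> 0 < (n - k)%:R * w.
Proof. by move=> kn; rewrite mulr_gt0// ltr0n subn_gt0. Qed.

Lemma norm_grid_drift n k q : (k < n)%N -> `|grid_drift n k q| <= L / Num.sqrt ((n - k)%:R * w).
Proof.
move=> kn; rewrite normrM ler_pM//; first exact: gpbL gp k q.1.
by rewrite ger0_norm ?gk_ge0//; apply: gk_ub; exact: nk_gt0.
Qed.

Lemma bmf_grid_noise n k x : bmf (fun o => grid_noise n k (o, x)).
Proof.
split; first exact: (meas_slice2 x (meas_grid_noise n k)).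
by exists 1 => o; exact: norm_grid_noise.
Qed.

Lemma bmf_grid_drift n k x : (k < n)%N -> bmf (fun o => grid_drift n k (o, x)).
Proof.
move=> kn; split; first exact: (meas_slice2 x (meas_grid_drift n k)).
by exists (L / Num.sqrt ((n - k)%:R * w)) => o; exact: norm_grid_drift.
Qed.

Lemma bmf_KcX s k x : bmf (fun o => Kc s (x - X k o)).
Proof.
split; first by apply: (meas_slice2 x (mKc s (Y := X k) _)); exact: gpXm gp k.
by exists 1 => o; exact: norm_Kc_le.
Qed.

Lemma bmf_grid_rest n x : bmf (fun o => grid_rest n (o, x)).
Proof.
have [h1 _] := @Ex_sum_nat _ _ _ P (fun k o => grid_noise n k (o, x)) n (fun k _ => bmf_grid_noise n k x).
have [h2 _] := @Ex_sum_nat _ _ _ P (fun k o => grid_drift n k (o, x)) n (fun k kn => bmf_grid_drift x kn).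
apply: bmfD; last exact: bmfZ.
apply: bmfB => //; apply: bmfB; last exact: bmf_KcX.
by apply: bmf_heav => //; exact: gpXm gp n.
Qed.

Lemma Ex_grid_noise_orthogonal n k x (Phi : Omega -> R) c : (k < n)%N -> (k < m)%N ->
 sub_measurable (G k) Phi -> (forall o, `|Phi o| <= c) ->
 'Ex (fun o => Phi o * grid_noise n k (o, x)) = 0.
Proof.
move=> kn km mPhi Phic.
have nkE : (n - k)%:R * w = (n - k.+1)%:R * w + w by rewrite -(subnSK kn) -natr1 mulrDl mul1r.
have s0 : 0 <= (n - k.+1)%:R * w by rewrite mulr_ge0// ltW.
have mY : sub_measurable (G k) (fun o => X k o + h * b k o).
 apply/sub_measurableP; apply: measurable_funD.
  by apply/sub_measurableP; exact: gpX gp k km.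
 by apply: measurable_funM => //; apply/sub_measurableP; exact: gpb gp k km.
have := @gaussian_step_orthogonal _ _ _ P (G k) (z k) w (gpG gp (k := k)) w0 (gpzm gp k) (gpi gp km)
 ((n - k.+1)%:R * w) x c Phi _ s0 mPhi mY Phic.
by move=> E; rewrite -[in RHS]E; apply: eq_Rintegral => o _; rewrite /grid_noise /noise_term nkE.
Qed.

Lemma Ex_grid_noise n k x : (k < n)%N -> (k < m)%N -> 'Ex (fun o => grid_noise n k (o, x)) = 0.
Proof.
move=> kn km; rewrite -(@Ex_grid_noise_orthogonal n k x (fun=> 1) 1 kn km).
- by apply: eq_Rintegral => o _; rewrite mul1r.
- by apply/sub_measurableP; exact: measurable_cst.
- by move=> o; rewrite normr1.
Qed.

Lemma grid_mean_expansion n x : (n <= m)%N ->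
 'Ex (fun o => heav (X n o) x) = 'Ex (fun o => Kc (n%:R * w) (x - X 0%N o))
 - h * \sum_(0 <= k < n) 'Ex (fun o => grid_drift n k (o, x)) + 'Ex (fun o => grid_rest n (o, x)).
Proof.
move=> nm.
have [b1 e1] := @Ex_sum_nat _ _ _ P (fun k o => grid_noise n k (o, x)) n (fun k _ => bmf_grid_noise n k x).
have [b2 e2] := @Ex_sum_nat _ _ _ P (fun k o => grid_drift n k (o, x)) n (fun k kn => bmf_grid_drift x kn).
have e1' : \sum_(0 <= k < n) 'Ex (fun o => grid_noise n k (o, x)) = 0.
 rewrite big_nat big1// => k /andP[_ kn]; apply: Ex_grid_noise => //; exact: leq_trans nm.
have -> : 'Ex (fun o => heav (X n o) x) = 'Ex (fun o => Kc (n%:R * w) (x - X 0%N o)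
  + \sum_(0 <= k < n) grid_noise n k (o, x) - h * \sum_(0 <= k < n) grid_drift n k (o, x)
  + grid_rest n (o, x)).
 by apply: eq_Rintegral => o _; rewrite (grid_expansionE n (o, x)).
have b3 := bmfZ h b2; have b4 := bmf_KcX (n%:R * w) 0%N x.
rewrite ExD; [|by apply: bmfB => //; exact: bmfD|exact: bmf_grid_rest].
rewrite ExB//; last exact: bmfD.
by rewrite ExD// ExZ// e1 e2 e1' addr0.
Qed.

Let hkapn n : (n <= m)%N -> h * Num.sqrt n%:R / Num.sqrt w <= kap.
Proof.
move=> nm; apply: le_trans hkap; rewrite ler_wpM2r ?invr_ge0//.
by rewrite ler_wpM2l// ler_wsqrtr// ler_nat.
Qed.

Lemma ae_norm_grid_rest n : (n <= m)%N ->
 {ae P, forall o, forall x, `|grid_rest n (o, x)| <= 1 + 8 * L * kap}.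
Proof.
move=> nm; apply: filterS (gpe gp) => o ho x.
apply: (@norm_expansion_rest R w h L kap n (X ^~ o) (b ^~ o) (z ^~ o) (fun k => grid_defect k o)) => //.
- exact: hkapn.
- by move=> k kn; rewrite /grid_defect; ring.
- by move=> k kn; exact: gpbL gp k o.
- by move=> k kn; apply: ho; exact: leq_trans nm.
Qed.

Lemma meas_grid_defect k : measT (grid_defect k).
Proof.
apply: measurable_funB; first exact: gpXm gp k.+1.
by apply: measurable_funD => //; exact: gpzm gp k.
Qed.

Lemma integral_grid_rest n eta : (n <= m)%N ->
 (\sum_(0 <= k < n) \int[P]_o `|grid_defect k o|%:E <= eta%:E)%E ->
 (\int[P]_o \int[mu]_x `|grid_rest n (o, x)|%:E <= (eta + 3 * L ^+ 2 * kap * h)%:E)%E.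
Proof.
move=> nm hd.
have mnr : measT (fun q => `|grid_rest n q|).
 by apply: measurableT_comp => //; exact: meas_grid_rest.
have md k : measT (fun o => `|grid_defect k o|%:E).
 by mnorm; exact: meas_grid_defect.
have c0 : 0 <= 3 * L ^+ 2 * kap * h by rewrite !mulr_ge0// sqr_ge0.
apply: (@le_trans _ _ (\int[P]_o (\sum_(0 <= k < n) `|grid_defect k o|%:E + (3 * L ^+ 2 * kap * h)%:E))%E).
 apply: ae_ge0_le_integral => //.
 - by move=> o _; apply: integral_ge0 => x _; rewrite lee_fin.
 - by apply: (@meas_integral1 _ _ _ _ R mu _ mnr) => q; exact: normr_ge0.
 - by move=> o _; rewrite adde_ge0 ?lee_fin// sume_ge0.
 - by apply: emeasurable_funD => //; exact: emeasurable_sum.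
 apply: filterS (gpe gp) => o ho _.
 have := @integral_expansion_rest R w h L kap n (X ^~ o) (b ^~ o) (z ^~ o) (fun k => grid_defect k o) w0 h0.
 rewrite sumEFin -EFinD; apply.
 - exact: L0.
 - exact: hkapn.
 - by move=> k kn; rewrite /grid_defect; ring.
 - by move=> k kn; exact: gpbL gp k o.
rewrite ge0_integralD//; last 2 first.
- by move=> o _; rewrite sume_ge0.
- exact: emeasurable_sum.
rewrite ge0_integral_sum// integral_cst//= probability_setT mule1 EFinD.
exact: leeD2r.
Qed.

Lemma integral_Ex_grid_rest n eta : (n <= m)%N ->
 (\sum_(0 <= k < n) \int[P]_o `|grid_defect k o|%:E <= eta%:E)%E ->
 (\int[mu]_x `|'Ex (fun o => grid_rest n (o, x))|%:E <= (eta + 3 * L ^+ 2 * kap * h)%:E)%E.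
Proof.
move=> nm hd; apply: le_trans (integral_grid_rest nm hd).
by apply: integral_Ex_le; exact: meas_grid_rest.
Qed.

Lemma norm_Ex_grid_rest n x : (n <= m)%N -> `|'Ex (fun o => grid_rest n (o, x))| <= 1 + 8 * L * kap.
Proof.
move=> nm; set c := 1 + 8 * L * kap.
have c0 : 0 <= c by rewrite addr_ge0// !mulr_ge0.
have mr := meas_slice2 x (meas_grid_rest n).
(* The bound on the rest holds only almost surely; clipping gives a version bounded everywhere with
   the same expectation. *)
have mc : measT (fun o => clip c (grid_rest n (o, x))).
 by apply: measurableT_comp => //; exact: meas_clip.
rewrite (@Ex_ae_eq _ _ _ P _ (fun o => clip c (grid_rest n (o, x)))) //.
 apply: Ex_bound; first by split => //; exists c => o; exact: norm_clip.
 by move=> o; exact: norm_clip.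
by apply: filterS (ae_norm_grid_rest nm) => o ho; rewrite clip_id.
Qed.

End GridProcess.

Section ExtendedGronwall.
Context (R : realType).

(** Finiteness is not assumed: the right-hand side of the recursion involves earlier indices only,
    so it follows by strong induction and the real-valued inequality applies. *)
Lemma esingular_gronwall (c T A B h : R) (m : nat) (f : nat -> \bar R) :
 0 <= c -> 0 <= T -> 0 <= A -> 0 <= B -> 0 <= h -> (forall n, 0 <= f n)%E -> m%:R * h <= T ->
 (forall n, (1 <= n <= m)%N ->
  (f n <= (A + B * isq R n)%:E +
    (c * Num.sqrt h)%:E * \sum_(1 <= k < n) (isq R (n - k))%:E * f k)%E) ->
 forall n, (1 <= n <= m)%N -> (f n <= (gronwall_const c T * (A + B * isq R n))%:E)%E.
Proof.
move=> c0 T0 A0 B0 h0 f0 hm frec.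
have fin n : (1 <= n <= m)%N -> (f n < +oo)%E.
 elim/ltn_ind: n => n IH hn; apply: le_lt_trans (frec n hn) _.
 apply: lte_add_pinfty; rewrite ?ltry// lte_mul_pinfty ?lee_fin ?mulr_ge0//.
 rewrite big_nat; apply: lte_sum_pinfty => k /andP[k1 kn].
 rewrite lte_mul_pinfty ?lee_fin ?isq_ge0//; apply: IH => //; rewrite k1/=.
 by rewrite (leq_trans (ltnW kn)); case/andP: hn.
have fE k : (1 <= k <= m)%N -> f k = (fine (f k))%:E.
 by move=> hk; rewrite fineK// ge0_fin_numE// fin.
move=> n hn; rewrite fE// lee_fin.
apply: (@singular_gronwall R c T c0 T0 (fine \o f) A B h m) => //.
 by move=> k; exact: fine_ge0.
move=> {hn}n hn; have := frec n hn; rewrite fE//=.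
have -> : (\sum_(1 <= k < n) (isq R (n - k))%:E * f k =
  (\sum_(1 <= k < n) isq R (n - k) * fine (f k))%:E)%E.
 rewrite -sumEFin big_nat [RHS]big_nat; apply: eq_bigr => k /andP[k1 kn].
 by rewrite {1}fE// k1 (leq_trans (ltnW kn)); case/andP: hn.
by rewrite -EFinM -EFinD lee_fin.
Qed.

End ExtendedGronwall.

(** * Variance of the averaged noise *)

Section FamilyNoise.
Context d (Omega : measurableType d) (R : realType) (P : probability Omega R).
Notation mu := (@lebesgue_measure R).
Notation "''Ex' f" := (\int[P]_w f w) (at level 10, f at level 9).

Lemma Ex_sqr_sum (I : finType) (F : I -> Omega -> R) : (forall i, bmf (F i)) ->
 (forall i j, i != j -> 'Ex (fun w => F i w * F j w) = 0) ->
 'Ex (fun w => (\sum_i F i w) ^+ 2) = \sum_i 'Ex (fun w => F i w ^+ 2).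
Proof.
move=> hF orth.
have -> : 'Ex (fun w => (\sum_i F i w) ^+ 2) = 'Ex (fun w => \sum_i \sum_j F i w * F j w).
 by apply: eq_Rintegral => w _; rewrite expr2 big_distrlr.
rewrite Ex_sum; last by move=> i; apply: bmf_sum => j; exact: bmfM.
apply: eq_bigr => i _; rewrite Ex_sum; last by move=> j; exact: bmfM.
rewrite (bigD1 i)//= big1 ?addr0; first by apply: eq_Rintegral => w _; rewrite expr2.
by move=> j ji; apply: orth; rewrite eq_sym.
Qed.

Variables (w h L : R) (m N : nat).
Hypotheses (w0 : 0 < w) (N0 : (0 < N)%N).
Variables (G : 'I_N -> nat -> set (set Omega)) (X b z : 'I_N -> nat -> Omega -> R).
Hypothesis gp : forall i, grid_process P w h L m (G i) (X i) (b i) (z i).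
Hypothesis cross : forall i j k l, (l < m)%N -> (k < l)%N \/ (k = l /\ i <> j) ->
 [/\ sub_measurable (G j l) (X i k), sub_measurable (G j l) (b i k) & sub_measurable (G j l) (z i k)].

Notation noise n i k := (grid_noise w h (X i) (b i) (z i) n k).

Lemma sub_measurable_noise i j k l n x : (l < m)%N -> (k < l)%N \/ (k = l /\ i <> j) ->
 sub_measurable (G j l) (fun o => noise n i k (o, x)).
Proof.
move=> lm h'; have [hX hb hz] := cross lm h'.
have mY : measT ((fun o => X i k o + h * b i k o) : g_sigma_algebraType (G j l) -> R).
 apply: measurable_funD; first exact/sub_measurableP.
 by apply: measurable_funM => //; exact/sub_measurableP.
have mK (s : R) : measT (fun y : R => Kc s (x - y)).
 by apply: meas_kshift; exact: meas_Kc.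
apply/sub_measurableP; apply: measurable_funB; last exact: (measurableT_comp (mK _)).
apply: (measurableT_comp (mK _)); apply: measurable_funD => //; exact/sub_measurableP.
Qed.

(** Of two distinct pairs of particle and step, one has the later step, or the steps agree and the
    particles differ. In either case one noise belongs to the past of the particle that carries the
    other. *)
Lemma Ex_noise_orthogonal n i j k l x : (n <= m)%N -> (k < n)%N -> (l < n)%N -> (i, k) != (j, l) ->
 'Ex (fun o => noise n i k (o, x) * noise n j l (o, x)) = 0.
Proof.
move=> nm; wlog kl : i j k l / (k < l)%N \/ (k = l /\ i <> j).
 move=> H kn ln ne; have [kl|kl|kl] := ltngtP k l.
 - by apply: H => //; left.
 - rewrite -[RHS](H j i l k _ ln kn); [|by left|by rewrite eq_sym].
  by apply: eq_Rintegral => o _; rewrite mulrC.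
 - by apply: H => //; right; split => // ij; move: ne; rewrite kl ij eqxx.
move=> kn ln _; apply: (@Ex_grid_noise_orthogonal _ _ _ P w h L m w0 _ _ _ _ (gp j) n l x _ 1) => //.
- exact: leq_trans nm.
- by apply: sub_measurable_noise => //; exact: leq_trans nm.
- by move=> o; exact: norm_grid_noise.
Qed.

Let noise_var n i k : (n <= m)%N -> (k < n)%N ->
 (\int[mu]_x ('Ex (fun o => noise n i k (o, x) ^+ 2))%:E <= (step_var ((n - k.+1)%:R * w) w)%:E)%E.
Proof.
move=> nm kn; have km : (k < m)%N by exact: leq_trans nm.
have mn2 : measT (fun q => noise n i k q ^+ 2).
 by apply: measurable_funX; exact: meas_grid_noise (gp i) n k.
have n0 q : 0 <= noise n i k q ^+ 2 by exact: sqr_ge0.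
have -> : (\int[mu]_x ('Ex (fun o => noise n i k (o, x) ^+ 2))%:E =
  \int[mu]_x \int[P]_o (noise n i k (o, x) ^+ 2)%:E)%E.
 by apply: eq_integral => x _; rewrite EFin_Ex//; apply: bmfX; exact: bmf_grid_noise (gp i) n k x.
rewrite -(@integral_swap _ _ _ _ R P mu _ mn2 n0).
have nkE : (n - k)%:R * w = (n - k.+1)%:R * w + w by rewrite -(subnSK kn) -natr1 mulrDl mul1r.
have := @gaussian_step_variance R _ _ P (G i k) (z i k) (fun o => X i k o + h * b i k o)
 ((n - k.+1)%:R * w) w (gpG (gp i) (k := k)).
rewrite /grid_noise /noise_term nkE /=; apply => //.
- by rewrite mulr_ge0// ltW.
- exact: gpzm (gp i) k.
- exact: (gpi (gp i) km).
- apply/sub_measurableP; apply: measurable_funD.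
  by apply/sub_measurableP; exact: gpX (gp i) k km.
 by apply: measurable_funM => //; apply/sub_measurableP; exact: gpb (gp i) k km.
Qed.

Lemma sum_step_var n : \sum_(0 <= k < n) step_var ((n - k.+1)%:R * w) w <=
 4 * Num.sqrt w + 12 * Num.sqrt w * Num.sqrt n%:R.
Proof.
have s0 : 0 < Num.sqrt w by rewrite sqrtr_gt0.
apply: (@le_trans _ _ (\sum_(0 <= k < n) ((k.+1 == n)%:R * (4 * Num.sqrt w) + 6 * Num.sqrt w * isq R (n - k.+1)))).
 rewrite big_nat [leRHS]big_nat; apply: ler_sum => k /andP[_ kn].
 have [kn1|kn1] := eqVneq k.+1 n.
  by rewrite kn1 subnn mul0r /step_var ltxx mul1r lerDl !mulr_ge0 ?isq_ge0// ltW.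
 have nk : (0 < n - k.+1)%N by rewrite subn_gt0 ltn_neqAle kn1.
 rewrite mul0r add0r /step_var mulr_gt0 ?ltr0n// sqrtrM// invfM /isq.
 rewrite le_eqVlt; apply/orP; left; apply/eqP.
 have ww : w = Num.sqrt w ^+ 2 by rewrite sqr_sqrtr// ltW.
 by rewrite {1}ww; field; rewrite !gt_eqF// sqrtr_gt0 ltr0n.
rewrite big_split/= -mulr_suml -mulr_sumr lerD//.
 rewrite -[leRHS]mul1r ler_wpM2r ?mulr_ge0 ?(ltW s0)//.
 case: (n) => [|p]; first by rewrite big_geq.
 rewrite big_nat_recr//= eqxx big1_seq ?add0r//.
 by move=> k; rewrite mem_index_iota /= eqSS => km; rewrite ltn_eqF.
have -> : 12 * Num.sqrt w * Num.sqrt n%:R = 6 * Num.sqrt w * (2 * Num.sqrt n%:R) by ring.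
by rewrite ler_wpM2l ?sum_isq_rev1// mulr_ge0// ltW.
Qed.

(** Orthogonality leaves the diagonal of the double sum: [N] equal bounds divided by the square of
    [N]. *)
Lemma family_noise_variance n : (n <= m)%N ->
 (\int[mu]_x ('Ex (fun o => (N%:R^-1 * \sum_(i < N) \sum_(0 <= k < n) noise n i k (o, x)) ^+ 2))%:E
  <= (N%:R^-1 * (4 * Num.sqrt w + 12 * Num.sqrt w * Num.sqrt n%:R))%:E)%E.
Proof.
move=> nm.
have NR : 0 < N%:R :> R by rewrite ltr0n.
have bn i k x : bmf (fun o => noise n i k (o, x)) by exact: bmf_grid_noise (gp i) n k x.
have E x : 'Ex (fun o => (N%:R^-1 * \sum_(i < N) \sum_(0 <= k < n) noise n i k (o, x)) ^+ 2) =
  N%:R^-2 * \sum_(i < N) \sum_(k < n) 'Ex (fun o => noise n i k (o, x) ^+ 2).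
 pose F (p : 'I_N * 'I_n) o := noise n p.1 p.2 (o, x).
 have -> : 'Ex (fun o => (N%:R^-1 * \sum_(i < N) \sum_(0 <= k < n) noise n i k (o, x)) ^+ 2) =
   'Ex (fun o => N%:R^-2 * (\sum_p F p o) ^+ 2).
  apply: eq_Rintegral => o _; rewrite exprMn exprVn; congr (_ * _ ^+ 2).
  rewrite -(pair_bigA _ (fun i (k : 'I_n) => noise n i k (o, x)))/=.
  by apply: eq_bigr => i _; rewrite big_mkord.
 rewrite ExZ; last by apply: bmfX; apply: bmf_sum => p; exact: bn.
 rewrite Ex_sqr_sum; last 2 first.
 - by move=> p; exact: bn.
 - move=> [i k] [j l] ne; exact: Ex_noise_orthogonal.
 by rewrite -(pair_bigA _ (fun i (k : 'I_n) => 'Ex (fun o => noise n i k (o, x) ^+ 2))).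
have mv i k : measT (fun x => ('Ex (fun o => noise n i k (o, x) ^+ 2))%:E).
 unEFin; apply: (@meas_Ex _ _ _ P (fun q => noise n i k q ^+ 2)).
 by apply: measurable_funX; exact: meas_grid_noise (gp i) n k.
have v0 i k x : (0 <= ('Ex (fun o => noise n i k (o, x) ^+ 2))%:E)%E.
 by rewrite lee_fin; apply: Ex_ge0 => o; exact: sqr_ge0.
pose g (x : R) : \bar R := (\sum_(i < N) \sum_(k < n) ('Ex (fun o => noise n i k (o, x) ^+ 2))%:E)%E.
have -> : (\int[mu]_x ('Ex (fun o => (N%:R^-1 * \sum_(i < N) \sum_(0 <= k < n) noise n i k (o, x)) ^+ 2))%:E
  = \int[mu]_x ((N%:R^-2)%:E * g x))%E.
 apply: eq_integral => x _; rewrite E EFinM; congr (_ * _)%E.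
 by rewrite -sumEFin; apply: eq_bigr => i _; rewrite -sumEFin.
have mgi (i : 'I_N) : measT (fun x => (\sum_(k < n) ('Ex (fun o => noise n i k (o, x) ^+ 2))%:E)%E).
 by apply: emeasurable_sum => k.
have mg : measT g by apply: emeasurable_sum => i.
have gi0 (i : 'I_N) x : (0 <= \sum_(k < n) ('Ex (fun o => noise n i k (o, x) ^+ 2))%:E)%E by exact: sume_ge0.
have g0 x : (0 <= g x)%E by apply: sume_ge0 => i _.
have N2 : (0 <= (N%:R^-2)%:E :> \bar R)%E by rewrite lee_fin invr_ge0 exprn_ge0.
rewrite (ge0_integralZl mu measurableT mg (fun x _ => g0 x) N2) /g.
rewrite (ge0_integral_sum mu measurableT mgi (fun i x _ => gi0 i x)).
set S := 4 * Num.sqrt w + _.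
apply: (@le_trans _ _ ((N%:R^-2)%:E * \sum_(i < N) S%:E)%E).
 apply: lee_wpmul2l; first by rewrite lee_fin invr_ge0 exprn_ge0.
 apply: lee_sum => i _.
 rewrite (ge0_integral_sum mu measurableT (fun k : 'I_n => mv i k) (fun k x _ => v0 i k x)).
 apply: le_trans (_ : ((\sum_(k < n) step_var ((n - k.+1)%:R * w) w)%:E <= S%:E)%E); last first.
  by rewrite lee_fin -(big_mkord xpredT (fun k => step_var ((n - k.+1)%:R * w) w)); exact: sum_step_var.
 by rewrite -sumEFin; apply: lee_sum => k _; exact: noise_var.
rewrite sumEFin sumr_const card_ord -EFinM lee_fin -[S *+ N]mulr_natr.
rewrite le_eqVlt; apply/orP; left; apply/eqP; field; by rewrite gt_eqF.
Qed.

End FamilyNoise.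

(** * Diffusions with bounded adapted drift *)

Section GridFloor.
Context (R : realType).
Implicit Types (dl s : R).

Definition cell dl k : set R := `[k%:R * dl, k.+1%:R * dl[%classic.

Lemma meas_cell dl k : measurable (cell dl k).
Proof. exact: measurable_itv. Qed.

Lemma meas_cell_indic dl k : measT (\1_(cell dl k) : R -> R).
Proof. by apply: measurable_indic; exact: meas_cell. Qed.

Lemma cellP dl k s : 0 < dl -> (s \in cell dl k) = (0 <= s) && (Num.trunc (s / dl) == k).
Proof.
move=> dl0; rewrite /cell mem_setE in_itv/= -ler_pdivlMr// -ltr_pdivrMr//.
apply/idP/andP => [/andP[h1 h2]|[s0 /eqP <-]]; last first.
 by rewrite truncn_itv// divr_ge0// ltW.
have q0 : 0 <= s / dl by rewrite (le_trans _ h1).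
have E : s / dl * dl = s by rewrite divfK// gt_eqF.
split; first by rewrite -E mulr_ge0// ltW.
by apply/eqP; apply: truncn_def; rewrite h1.
Qed.

(** For [0 <= s] and [0 < dl], the left end of the cell that contains [s]. *)
Definition gfl dl s : R := (Num.trunc (s / dl))%:R * dl.

Lemma gfl_itv dl s : 0 < dl -> 0 <= s -> gfl dl s <= s < gfl dl s + dl.
Proof.
move=> dl0 s0; have /truncn_itv/andP[h1 h2] : 0 <= s / dl by rewrite divr_ge0// ltW.
rewrite /gfl -ler_pdivlMr// h1/= -[X in _ < _ + X]mul1r -mulrDl natr1.
by rewrite -ltr_pdivrMr.
Qed.

Lemma gfl_ge0 dl s : 0 < dl -> 0 <= gfl dl s.
Proof. by move=> dl0; rewrite mulr_ge0// ltW. Qed.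

Lemma sum_cell (V : lmodType R) dl m (F : nat -> V) s : 0 < dl -> 0 <= s -> s < m%:R * dl ->
 \sum_(k < m) (\1_(cell dl k) s : R) *: F k = F (Num.trunc (s / dl)).
Proof.
move=> dl0 s0 sm; have km : (Num.trunc (s / dl) < m)%N.
 rewrite -(ltr_nat R); apply: le_lt_trans (_ : s / dl < _); last by rewrite ltr_pdivrMr.
 by rewrite truncn_le divr_ge0// ltW.
rewrite (bigD1 (Ordinal km))//= indicE cellP// s0 eqxx scale1r big1 ?addr0// => k kE.
rewrite indicE cellP// s0/= (_ : (_ == _) = false) ?scale0r//.
by apply/negbTE; apply: contra kE => /eqP E; apply/eqP/val_inj.
Qed.

Lemma gfl_cvg t s : 0 < t -> 0 <= s -> gfl (t / r.+1%:R) s @[r --> \oo] --> s.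
Proof.
move=> t0 s0; apply/cvgrPdist_le => e e0.
near=> r.
have dl0 : 0 < t / r.+1%:R by rewrite divr_gt0.
have /andP[h1 h2] := gfl_itv dl0 s0.
rewrite ger0_norm ?subr_ge0//; apply: (@le_trans _ _ (t / r.+1%:R)); first by rewrite lerBlDl ltW.
rewrite ler_pdivrMr// mulrC -ler_pdivrMr//.
near: r; exists (Num.trunc (t / e)).+1 => // r /= hr.
by rewrite (le_trans (ltW (truncnS_gt _)))// ler_nat (leq_trans hr).
Unshelve. all: by end_near. Qed.

End GridFloor.

(** * Jointly measurable versions *)

Section JointVersion.
Context d (Omega : measurableType d) (R : realType) (P : probability Omega R).
Notation mu := (@lebesgue_measure R).

Lemma within_continuous_seq (T : R) (f : R -> R) (u : nat -> R) s :
 {within `[0, T], continuous f} -> 0 <= s <= T -> (forall j, 0 <= u j <= T) ->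
 u @ \oo --> s -> f (u j) @[j --> \oo] --> f s.
Proof.
move=> /subspace_continuousP fc sT uT us.
have := fc s; rewrite /= in_itv/= => /(_ sT) h.
apply/cvgrPdist_lt => e e0.
have /cvgrPdist_lt/(_ e e0) := h; rewrite near_withinE => hs.
have hj : \forall j \near \oo, `[0, T]%classic (u j) -> `|f s - f (u j)| < e := us _ hs.
by apply: filterS hj => j /=; apply; rewrite in_itv/= uT.
Qed.

Variables (T : R) (X : R -> {RV P >-> R}).
Hypothesis T0 : 0 < T.
Hypothesis Xc : {ae P, forall w, {within `[0, T], continuous (X ^~ w)}}.

(** A family of random variables carries no joint measurability. By continuity of paths the process
    is almost surely a limit of step processes; the upper limit of these is measurable everywhere
    and equals the limit where it exists. *)
Lemma joint_version : exists Y : R * Omega -> R, measT Y /\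
 {ae P, forall w, forall s, 0 <= s <= T -> Y (s, w) = X s w}.
Proof.
pose dl n : R := T / n.+1%:R.
have dl0 n : 0 < dl n by rewrite divr_gt0.
(* One cell more than the [n.+1] that fill $[0,T)$, so that the end point [T] is covered. *)
pose Yn n (q : R * Omega) : R := \sum_(k < n.+2) \1_(cell (dl n) k) q.1 * X (k%:R * dl n) q.2.
have mYn n : measT (fun q => (Yn n q)%:E).
 unEFin; apply: measurable_sum => k; apply: measurable_funM.
  by apply: (measurableT_comp (meas_cell_indic _ _)).
 by apply: measurableT_comp => //; exact: measurable_funP.
exists (fun q => fine (limn_esup (fun n => (Yn n q)%:E))); split.
 by apply: measurableT_comp => //; exact: (@measurable_fun_limn_esup _ _ _ setT (fun n q => (Yn n q)%:E)).
apply: filterS Xc => w cw s sT.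
have /andP[s0 sT'] := sT.
have YE n : Yn n (s, w) = X (gfl (dl n) s) w.
 rewrite /Yn/= (@sum_cell R R^o (dl n) n.+2 (fun k => X (k%:R * dl n) w))//.
 apply: (le_lt_trans sT'); rewrite /dl mulrCA ltr_pMr// ltr_pdivlMr// mul1r ltr_nat//.
have cv : (Yn n (s, w))%:E @[n --> \oo] --> (X s w)%:E.
 apply/cvg_EFin; first by apply: nearW.
 under eq_fun do rewrite YE.
 apply: (within_continuous_seq (u := fun n => gfl (dl n) s) cw sT).
  move=> j; rewrite gfl_ge0//=; have /andP[h1 _] := gfl_itv (dl0 j) s0; exact: le_trans sT'.
 exact: gfl_cvg.
by have [_ ->] := cvg_limn_einf_sup cv.
Qed.

End JointVersion.

(** * Vanishing of the grid defects *)

Section Defects.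
Context d (Omega : measurableType d) (R : realType) (P : probability Omega R).
Notation mu := (@lebesgue_measure R).
Variables (t L : R) (b : R * Omega -> R).
Hypotheses (t0 : 0 < t) (mb : measT b) (bL : forall q, `|b q| <= L).
Hypothesis b_left : forall s (u : nat -> R), 0 < s < t -> (forall j, 0 <= u j <= s) ->
 u @ \oo --> s -> {ae P, forall w, b (u j, w) @[j --> \oo] --> b (s, w)}.

(** Mean error, over one cell, of freezing the drift at its left end. *)
Definition cell_defect (dl : R) (k : nat) : \bar R :=
 (\int[P]_w \int[mu]_s (\1_(cell dl k) s * `|b (s, w) - b (k%:R * dl, w)|)%:E)%E.

Let L0 : 0 <= L. Proof. by rewrite (le_trans _ (bL point)). Qed.

Let phi (u s : R) : \bar R := (\int[P]_w `|b (s, w) - b (u, w)|%:E)%E.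

Let mb2 u : measT (fun w => b (u, w)).
Proof. exact: meas_slice1. Qed.

Let bB q q' : `|b q - b q'| <= 2 * L.
Proof. by apply: le_trans (ler_normB _ _) _; have := bL q; have := bL q'; lra. Qed.

Let mdiff u : measT (fun q : R * Omega => `|b q - b (u, q.2)|).
Proof.
apply: measurableT_comp => //; apply: measurable_funB => //.
exact: (measurableT_comp (mb2 u)).
Qed.

Let mphi u : measT (phi u).
Proof.
exact: (@meas_integral1 _ _ _ _ R P _ (mdiff u) (fun q => normr_ge0 _)).
Qed.

Let phi_ge0 u s : (0 <= phi u s)%E.
Proof. by apply: integral_ge0 => w _; rewrite lee_fin. Qed.

Let phi_le u s : (phi u s <= (2 * L)%:E)%E.
Proof.
apply: (@le_trans _ _ (\int[P]_w (2 * L)%:E)%E).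
 apply: ge0_le_integral => //.
 - by unEFin; exact: (meas_slice1 s (mdiff u)).
 - by move=> w _; rewrite lee_fin; exact: bB.
by rewrite integral_cst//= probability_setT mule1.
Qed.

Lemma cell_defectE dl k : (cell_defect dl k = \int[mu]_s ((\1_(cell dl k) s)%:E * phi (k%:R * dl) s))%E.
Proof.
pose f (q : R * Omega) := \1_(cell dl k) q.1 * `|b q - b (k%:R * dl, q.2)| : R.
have mf : measT f.
 by apply: measurable_funM => //; apply: (measurableT_comp (meas_cell_indic _ _)).
have f0 q : 0 <= f q by rewrite mulr_ge0.
rewrite /cell_defect.
have /esym -> := @integral_swap _ _ _ _ R mu P f mf f0.
apply: eq_integral => s _; rewrite /f/=.
under eq_integral do rewrite EFinM.
rewrite ge0_integralZl//.
by unEFin; exact: (meas_slice1 s (mdiff (k%:R * dl))).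
Qed.

(** The sum is the integral in [s] of the mean distance between the drift at [s] and at the left end
    of its cell. The left ends tend to [s] from below, and dominated convergence is used first on
    the probability space, then in [s]; no rate results. *)
Lemma cell_defect_cvg : (\sum_(k < r.+1) cell_defect (t / r.+1%:R) k)%E @[r --> \oo] --> 0%E.
Proof.
pose dl r : R := t / r.+1%:R.
have dl0 r : 0 < dl r by rewrite divr_gt0.
pose g r s := (\sum_(k < r.+1) ((\1_(cell (dl r) k) s)%:E * phi (k%:R * dl r) s))%E.
have mterm r k : measT (fun s => (\1_(cell (dl r) k) s)%:E * phi (k%:R * dl r) s)%E.
 by apply: emeasurable_funM => //; unEFin; exact: meas_cell_indic.
have term0 r k s : (0 <= (\1_(cell (dl r) k) s)%:E * phi (k%:R * dl r) s)%E.
 by rewrite mule_ge0// lee_fin.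
have mg r : measT (g r) by exact: emeasurable_sum.
have -> : (fun r => \sum_(k < r.+1) cell_defect (t / r.+1%:R) k)%E = (fun r => \int[mu]_s g r s)%E.
 apply/funext => r; rewrite /g (ge0_integral_sum mu measurableT (fun k : 'I_r.+1 => mterm r k) (fun k s _ => term0 r k s)).
 by apply: eq_bigr => k _; rewrite cell_defectE.
have gE r s : 0 <= s < t -> g r s = phi (gfl (dl r) s) s.
 move=> /andP[s0 st].
 have E : (g r s = (\sum_(k < r.+1) \1_(cell (dl r) k) s * fine (phi (k%:R * dl r) s))%:E)%E.
  rewrite /g -sumEFin; apply: eq_bigr => k _; rewrite EFinM fineK// ge0_fin_numE//.
  by apply: le_lt_trans (phi_le _ _) _; rewrite ltry.
 rewrite E (@sum_cell R R^o (dl r) r.+1 (fun k => fine (phi (k%:R * dl r) s)))//.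
  rewrite fineK// ge0_fin_numE//.
  by apply: le_lt_trans (phi_le _ _) _; rewrite ltry.
 by rewrite /dl mulrCA mulfV ?mulr1// pnatr_eq0.
have g0 r s : ~ (0 <= s < t) -> g r s = 0%E.
 move=> ns; rewrite /g big1// => k _; rewrite indicE.
 have [sk|] := boolP (s \in _); last by rewrite mul0e.
 exfalso; apply: ns; move: sk; rewrite /cell mem_setE in_itv/= => /andP[h1 h2].
 apply/andP; split; first by rewrite (le_trans _ h1)// mulr_ge0// ltW.
 apply: (lt_le_trans h2); rewrite /dl mulrA ler_pdivrMr// [leLHS]mulrC ler_wpM2l ?(ltW t0)//.
 by rewrite ler_nat; exact: ltn_ord.
have gle r s : (`|g r s| <= (\1_(`[0, t[%classic) s * (2 * L))%:E)%E.
 rewrite gee0_abs; last exact: sume_ge0.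
 rewrite indicE mem_setE in_itv/=; have [h|h] := boolP (0 <= s < t).
  by rewrite mul1r gE.
 by rewrite mul0r g0//; apply/negP.
have H1 : {ae mu, forall s, setT s -> g^~ s @ \oo --> 0%E}.
 (* Time 0 is excluded, since left continuity is assumed only at positive times. *)
 exists [set 0]; split => //; first exact: lebesgue_measure_set1.
 move=> s /=; apply: contra_notP => s0 _.
 have [|ns] := boolP (0 < s < t); last first.
  rewrite (_ : g^~ s = fun=> 0%E); first exact: cvg_cst.
  apply/funext => r; apply: g0; apply/negP; apply: contra ns => /andP[]; rewrite le_eqVlt => /orP[/eqP E|-> //].
  by case: s0.
 move=> st; have /andP[sp st'] := st.
 have E : g^~ s = fun r => phi (gfl (dl r) s) s.
  by apply/funext => r; rewrite gE// ltW.
 rewrite E.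
 have uc : gfl (dl r) s @[r --> \oo] --> s by apply: gfl_cvg => //; exact: ltW.
 have ub r : 0 <= gfl (dl r) s <= s.
  by rewrite gfl_ge0//=; have /andP[] := gfl_itv (dl0 r) (ltW sp).
 have K0 r : measT (fun w => `|b (s, w) - b (gfl (dl r) s, w)|%:E).
  by unEFin; exact: (meas_slice1 s (mdiff _)).
 have K1 : {ae P, forall w, setT w -> (fun r => `|b (s, w) - b (gfl (dl r) s, w)|%:E) @ \oo --> 0%E}.
  apply: filterS (b_left st ub uc) => w cw _.
  apply/cvg_EFin; first exact: nearW.
  rewrite -[X in _ --> X](normr0 R) -(subrr (b (s, w))).
  by apply: cvg_norm; apply: cvgB => //; exact: cvg_cst.
 have K2 : P.-integrable setT (fun=> (2 * L)%:E) by apply: finite_measure_integrable_cst.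
 have K3 : {ae P, forall w n, setT w -> (`| `|b (s, w) - b (gfl (dl n) s, w)|%:E | <= (2 * L)%:E)%E}.
  by apply: nearW => w n _; rewrite gee0_abs ?lee_fin.
 have [_ _ h2] := @dominated_convergence _ _ R P setT measurableT _ (cst 0%E) _ K0 (measurable_cst _) K1 K2 K3.
 by rewrite integral0 in h2.
have H2 : mu.-integrable setT (fun s => (\1_(`[0, t[%classic) s * (2 * L))%:E).
 have -> : (fun s => (\1_(`[0, t[%classic) s * (2 * L))%:E) = (fun s => (\1_(`[0, t[%classic) s)%:E * (2 * L)%:E)%E.
  by apply/funext => s; rewrite EFinM.
 apply: integrableZr => //; exact: integrable_indic_itv.
have H3 : {ae mu, forall s n, setT s -> (`|g n s| <= (\1_(`[0, t[%classic) s * (2 * L))%:E)%E}.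
 exact: nearW.
have [_ _ h] := @dominated_convergence _ _ R mu setT measurableT g (cst 0%E) _ mg (measurable_cst _) H1 H2 H3.
by rewrite integral0 in h.
Qed.

Lemma cell_defect_eventually e : 0 < e -> exists r0, forall r, (r0 <= r)%N -> (0 < r)%N ->
 (\sum_(k < r) cell_defect (t / r%:R) k <= e%:E)%E.
Proof.
move=> e0; have /fine_cvgP[hf /cvgrPdist_le/(_ e e0) hc] := cell_defect_cvg.
have [r0 _ hr] : \forall r \near \oo, (\sum_(k < r.+1) cell_defect (t / r.+1%:R) k <= e%:E)%E.
 near=> r; have h1 : (\sum_(k < r.+1) cell_defect (t / r.+1%:R) k)%E \is a fin_num by near: r.
 rewrite -(fineK h1) lee_fin.
 have : `|0 - fine (\sum_(k < r.+1) cell_defect (t / r.+1%:R) k)%E| <= e by near: r.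
 by rewrite sub0r normrN => /(le_trans (ler_norm _)).
by exists r0.+1 => -[//|r] hr' _; apply: hr.
Unshelve. all: by end_near. Qed.

End Defects.

(** * Absence of atoms and of ties *)

Section Concentration.
Context d (Omega : measurableType d) (R : realType) (P : probability Omega R).
Notation "''Ex' f" := (\int[P]_w f w) (at level 10, f at level 9).

(** Conditioning on the past makes the distribution function of [Y + Z] the mean of [Kc v (x - Y)],
    which is Lipschitz with constant $v^{-1/2}$. *)
Lemma gaussian_rcdf_lip (G : set (set Omega)) (Y Z : Omega -> R) (v x r : R) :
 G `<=` measurable -> 0 < v -> 0 <= r -> measT Z ->
 gaussian_indep P G Z v -> sub_measurable G Y ->
 rcdf P (fun w => Y w + Z w) (x + r) - rcdf P (fun w => Y w + Z w) x <= r / Num.sqrt v.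
Proof.
move=> Gm v0 r0 mZ ind sY.
have mY : measT Y by exact: sub_measurable_measurable sY.
have mYZ : measT (fun w => Y w + Z w) by exact: measurable_funD.
have s1 : sub_measurable G (fun _ : Omega => 1 : R) by apply/sub_measurableP; exact: measurable_cst.
have bK s q (V : Omega -> R) : measT V -> bmf (fun w => Kc s (q - V w)).
 move=> mV; apply: (@bmf_comp _ _ _ (fun y => Kc s (q - y)) V 1) => //.
  by apply: meas_kshift; exact: meas_Kc.
 by move=> y; exact: norm_Kc_le.
have E q : rcdf P (fun w => Y w + Z w) q = 'Ex (fun w => Kc v (q - Y w)).
 have := @gaussian_step_orthogonal _ _ _ P G Z v Gm v0 mZ ind 0 q 1 (fun=> 1) Y (lexx 0) s1 sY.
 rewrite normr1 => /(_ (fun=> lexx 1)).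
 have -> : 'Ex (fun o => 1 * (Kc 0 (q - (Y o + Z o)) - Kc (0 + v) (q - Y o))) =
   'Ex (fun o => Kc 0 (q - (Y o + Z o)) - Kc v (q - Y o)).
  by apply: eq_Rintegral => o _; rewrite mul1r add0r.
 rewrite ExB; [|exact: bK|exact: bK].
 move/eqP; rewrite subr_eq0 => /eqP <-; apply: eq_Rintegral => o _.
 by rewrite Kc0_shift.
rewrite !E -ExB; [|exact: bK|exact: bK].
rewrite -[leRHS](Ex_cst P); apply: Ex_le; [by apply: bmfB; exact: bK|exact: bmf_cst|].
move=> w; apply: le_trans (ler_norm _) _.
have -> : x + r - Y w = x - (Y w - r) by ring.
apply: le_trans (norm_Kc_shiftB _ _ _ v0) _.
by rewrite ler_wpM2r ?invr_ge0// (_ : _ - _ - _ = - r) ?normrN ?ger0_norm//; ring.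
Qed.

Lemma rcdf_close (D V : Omega -> R) (r y z : R) : measT D -> measT V ->
 {ae P, forall w, `|D w - V w| <= r} -> rcdf P D y - rcdf P D z <= rcdf P V (y + r) - rcdf P V (z - r).
Proof.
move=> mD mV ae.
have H : forall q q' : R, q' - q = r -> forall A B : Omega -> R, measT A -> measT B ->
  {ae P, forall w, `|A w - B w| <= r} -> rcdf P A q <= rcdf P B q'.
 move=> q q' qq A B mA mB aeAB.
 rewrite -lee_fin !EFin_rcdf//.
 have mp (C : Omega -> R) (u : R) : measT C -> measurable (C @^-1` `]-oo, u]).
  by move=> mC; rewrite -[X in measurable X]setTI; exact: mC.
 have [S [mS S0 SE]] := aeAB.
 apply: (@le_trans _ _ (P ((B @^-1` `]-oo, q']) `|` S))).
  apply: le_measure; rewrite ?inE; [exact: mp|by apply: measurableU => //; exact: mp|].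
  move=> w /=; rewrite !in_itv/= => Aq.
  have [Bq|Bq] := leP (B w) q'; [by left|right; apply: SE => /= h].
  by move: h; rewrite ler_norml => /andP[h1 h2]; lra.
 apply: (@le_trans _ _ (P (B @^-1` `]-oo, q']) + P S)%E); last by rewrite S0 adde0.
 by apply: measureU2 => //; exact: mp.
have h1 : rcdf P D y <= rcdf P V (y + r) by apply: H => //; ring.
have h2 : rcdf P V (z - r) <= rcdf P D z.
 by apply: H => //; [ring|apply: filterS ae => w; rewrite distrC].
lra.
Qed.

(** The mass at [c] is at most the mass that [D] puts on an interval of length [r] ending there,
    hence at most the mass that the nearby variable [V] puts on an interval of length [3 * r]. *)
Lemma ae_neq_of_close (D : Omega -> R) (c : R) : measT D ->
 (forall e, 0 < e -> exists (V : Omega -> R) (r : R), [/\ measT V, 0 < r,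
   {ae P, forall w, `|D w - V w| <= r} & rcdf P V (c + r) - rcdf P V (c - 2 * r) <= e]) ->
 {ae P, forall w, D w <> c}.
Proof.
move=> mD H.
have mc : measurable (D @^-1` [set c]) by rewrite -[X in measurable X]setTI; exact: mD.
exists (D @^-1` [set c]); split => //; last by move=> w /= /contrapT.
apply/eqP; rewrite eq_le measure_ge0 andbT; apply/lee_addgt0Pr => e e0; rewrite add0e.
have [V [r [mV r0 ae He]]] := H e e0.
apply: (@le_trans _ _ (rcdf P D c - rcdf P D (c - r))%:E); last first.
 rewrite lee_fin; apply: le_trans (rcdf_close c (c - r) mD mV ae) _.
 by rewrite (_ : c - r - r = c - 2 * r)//; ring.
have bD q : bmf (fun w => heav (D w) q) by apply: bmf_heav.
rewrite /rcdf -ExB// EFin_Ex; last exact: bmfB.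
have -> : P (D @^-1` [set c]) = (\int[P]_w (\1_(D @^-1` [set c]) w)%:E)%E by rewrite integral_indic// setIT.
have hB w : 0 <= heav (D w) c - heav (D w) (c - r) by rewrite subr_ge0 heav_mono// lerBlDr lerDl ltW.
apply: ge0_le_integral => //.
- by unEFin; exact: measurable_indic.
- by unEFin; have [] := bmfB (bD c) (bD (c - r)).
move=> w _; rewrite lee_fin indicE.
have [/set_mem/= ->|_] := boolP (w \in _); last by rewrite subr_ge0 heav_mono// lerBlDr lerDl ltW.
by rewrite /heav lexx (_ : (c <= c - r) = false) ?subr0//; apply/negbTE; rewrite -ltNge ltrBlDr ltrDl.
Qed.

Lemma small_sqrt (s e K : R) : 0 < s -> 0 < e -> 0 <= K -> exists2 a, 0 < a <= s & K * Num.sqrt a <= e.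
Proof.
move=> s0 e0 K0; have K1 : 0 < K + 1 by rewrite ltr_wpDl.
exists (Num.min s ((e / (K + 1)) ^+ 2)).
 by rewrite lt_min s0 exprn_gt0 ?divr_gt0//= ge_min lexx.
apply: (@le_trans _ _ (K * (e / (K + 1)))).
 rewrite ler_wpM2l//; apply: (@le_trans _ _ (Num.sqrt ((e / (K + 1)) ^+ 2))).
  by rewrite ler_wsqrtr// ge_min lexx orbT.
 by rewrite sqrtr_sqr ger0_norm// divr_ge0 ?ltW.
by rewrite mulrCA ler_piMr ?ltW// ltr_pdivrMr//; lra.
Qed.

End Concentration.

(** * Driven processes and their grids *)

Section Driven.
Context d (Omega : measurableType d) (R : realType) (P : probability Omega R).
Notation mu := (@lebesgue_measure R).
Notation "''Ex' f" := (\int[P]_w f w) (at level 10, f at level 9).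
Variables (T sigma L : R).

(* [b] is a jointly measurable version of the adapted drift [B]. *)
Record driven (past : R -> set (set Omega)) (W X : R -> Omega -> R) (b : R * Omega -> R)
  (B : R -> Omega -> R) : Prop := Driven {
 dv_past : forall s, past s `<=` measurable;
 dv_X : forall s, 0 <= s <= T -> sub_measurable (past s) (X s);
 dv_B : forall s, 0 <= s <= T -> sub_measurable (past s) (B s);
 dv_Wm : forall s, measT (W s);
 dv_Xm : forall s, measT (X s);
 dv_Bm : forall s, measT (B s);
 dv_BL : forall s w, `|B s w| <= L;
 dv_b : measT b;
 dv_bL : forall q, `|b q| <= L;
 dv_bB : {ae P, forall w s, 0 <= s <= T -> b (s, w) = B s w};
 dv_ind : forall s t, 0 <= s -> s < t ->
  gaussian_indep P (past s) (fun w => sigma * (W t w - W s w)) (sigma ^+ 2 * (t - s));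
 dv_eq : {ae P, forall w s t, 0 <= s -> s <= t -> t <= T ->
  X t w = X s w + sigma * (W t w - W s w) + \int[mu]_(u in `]s, t]) b (u, w)} }.

Lemma lebesgue_measure_itv_oc (s t : R) : s <= t -> mu `]s, t] = (t - s)%:E.
Proof.
move=> st; apply: (etrans (lebesgue_measure_itv _)); rewrite /= lte_fin.
by case: ltgtP st => // -> _; rewrite subrr.
Qed.

Lemma bounded_itv_integrable (f : R -> R) (s t : R) : measT f -> (forall u, `|f u| <= L) ->
 mu.-integrable `]s, t] (EFin \o f).
Proof.
move=> mf fL; apply: measurable_bounded_integrable => //.
- rewrite -[X in (X < _)%E]/(mu `]s, t]).
 by have [/lebesgue_measure_itv_oc ->|ts] := leP s t; rewrite ?ltry// set_itv_ge ?measure0 ?ltry// bnd_simp -leNgt ltW.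
- exact: measurable_funTS.
- by exists L; split => [|M LM u _]; [exact: num_real|apply: le_trans (fL u) _; exact: ltW].
Qed.

Lemma norm_Rintegral_itv (f : R -> R) (s t : R) : s <= t -> measT f ->
 (forall u, `|f u| <= L) -> `|\int[mu]_(u in `]s, t]) f u| <= L * (t - s).
Proof.
move=> st mf fL; have L0 : 0 <= L by rewrite (le_trans _ (fL 0)).
apply: le_trans (le_normr_Rintegral _ _) _ => //; first exact: bounded_itv_integrable.
have -> : L * (t - s) = \int[mu]_(u in `]s, t]) L.
 by rewrite Rintegral_cst// -[X in fine X]/(mu `]s, t]) lebesgue_measure_itv_oc.
apply: le_Rintegral => //.
- apply: bounded_itv_integrable; first exact: measurableT_comp.
 by move=> u; rewrite normr_id.
- apply: bounded_itv_integrable => // u; by rewrite ger0_norm.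
Qed.

Hypotheses (T0 : 0 < T) (sigma0 : 0 < sigma).
Variables (past : R -> set (set Omega)) (W X : R -> Omega -> R) (b : R * Omega -> R) (B : R -> Omega -> R).
Hypothesis dv : driven past W X b B.

Let L0 : 0 <= L. Proof. by rewrite (le_trans _ (dv_bL dv point)). Qed.

Let mb1 w : measT (fun s => b (s, w)).
Proof. exact: meas_slice2 (dv_b dv). Qed.

Definition increment (s t : R) (w : Omega) := sigma * (W t w - W s w).

Lemma meas_increment s t : measT (increment s t).
Proof.
by apply: measurable_funM => //; apply: measurable_funB; [exact: (dv_Wm dv t)|exact: (dv_Wm dv s)].
Qed.

Lemma driven_step : {ae P, forall w s t, 0 <= s -> s <= t -> t <= T ->
 `|X t w - (X s w + increment s t w)| <= L * (t - s)}.
Proof.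
apply: filterS (dv_eq dv) => w h s t s0 st tT.
rewrite (h s t)// (_ : _ - _ = \int[mu]_(u in `]s, t]) b (u, w)); last by rewrite /increment; ring.
by apply: norm_Rintegral_itv => // u; exact: (dv_bL dv).
Qed.

Lemma driven_ind s a : 0 < a <= s ->
 gaussian_indep P (past (s - a)) (increment (s - a) s) (sigma ^+ 2 * a).
Proof.
move=> /andP[a0 as_]; have hi : gaussian_indep P (past (s - a)) (increment (s - a) s) (sigma ^+ 2 * (s - (s - a))).
 by apply: (dv_ind dv); rewrite ?subr_ge0// ltrBlDr ltrDl.
by rewrite subKr in hi.
Qed.

Lemma driven_rcdf_lip s a x r : 0 < a <= s -> s <= T -> 0 <= r ->
 rcdf P (fun w => X (s - a) w + increment (s - a) s w) (x + r) -
 rcdf P (fun w => X (s - a) w + increment (s - a) s w) x <= r / (sigma * Num.sqrt a).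
Proof.
move=> /andP[a0 as_] sT r0.
have -> : sigma * Num.sqrt a = Num.sqrt (sigma ^+ 2 * a).
 by rewrite sqrtrM ?sqr_ge0// sqrtr_sqr gtr0_norm.
apply: (@gaussian_rcdf_lip _ _ _ P (past (s - a))) => //.
- exact: (dv_past dv).
- by rewrite mulr_gt0// exprn_gt0.
- exact: meas_increment.
- by apply: driven_ind; rewrite a0.
- by apply: (dv_X dv); rewrite subr_ge0 as_/=; lra.
Qed.

Lemma driven_close s a : 0 < a <= s -> s <= T ->
 {ae P, forall w, `|X s w - (X (s - a) w + increment (s - a) s w)| <= L * a}.
Proof.
move=> /andP[a0 as_] sT; apply: filterS driven_step => w h.
by have := h (s - a) s; rewrite subr_ge0 subKr => /(_ as_ _ sT); apply; lra.
Qed.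

Let mV s a : measT (fun w => X (s - a) w + increment (s - a) s w).
Proof. by apply: measurable_funD; [exact: (dv_Xm dv)|exact: meas_increment]. Qed.

Let sqr_sqrt_a a : 0 < a -> a / (sigma * Num.sqrt a) = Num.sqrt a / sigma.
Proof.
move=> a0; have s0 : 0 < Num.sqrt a by rewrite sqrtr_gt0.
rewrite -{1}(sqr_sqrtr (ltW a0)); field; by rewrite !gt_eqF.
Qed.

(** Over the last [a] units of time the process gains a Gaussian of variance $\sigma^2a$ and a drift
    of at most $La$. At the scale $a$ the increments of the distribution function are therefore at
    most $(1+2L)\sqrt a/\sigma$. *)
Lemma driven_unif_cont s : 0 < s <= T -> forall e, 0 < e ->
 exists2 dl, 0 < dl & forall y, rcdf P (X s) (y + dl) - rcdf P (X s) y <= e.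
Proof.
move=> /andP[s0 sT] e e0; have K0 : 0 <= 1 + 2 * L by rewrite addr_ge0// mulr_ge0.
have [a aP ha] := small_sqrt s0 (mulr_gt0 e0 sigma0) K0.
have /andP[a0 as_] := aP.
exists a => // y; apply: le_trans (rcdf_close _ _ (dv_Xm dv s) (mV s a) (driven_close aP sT)) _.
have -> : y + a + L * a = y - L * a + (1 + 2 * L) * a by ring.
apply: le_trans (driven_rcdf_lip _ aP sT _) _; first by rewrite mulr_ge0// ltW.
by rewrite -mulrA sqr_sqrt_a// mulrA ler_pdivrMr.
Qed.

Lemma driven_no_atom s c : 0 < s <= T -> {ae P, forall w, X s w <> c}.
Proof.
move=> /andP[s0 sT]; apply: ae_neq_of_close; first exact: (dv_Xm dv).
move=> e e0; have K0 : 0 <= 3 * (1 + L) by rewrite mulr_ge0// addr_ge0.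
have [a aP ha] := small_sqrt s0 (mulr_gt0 e0 sigma0) K0.
have /andP[a0 as_] := aP.
(* The radius [(1 + L) * a] dominates the displacement by the drift and stays positive when
   [L = 0]. *)
exists (fun w => X (s - a) w + increment (s - a) s w), ((1 + L) * a); split => //.
- by rewrite mulr_gt0// ltr_wpDr.
- apply: filterS (driven_close aP sT) => w h; apply: le_trans h _.
 by rewrite mulrDl mul1r lerDr ltW.
have -> : c + (1 + L) * a = c - 2 * ((1 + L) * a) + (3 * (1 + L)) * a by ring.
apply: le_trans (driven_rcdf_lip _ aP sT _) _; first by rewrite mulr_ge0// ltW.
by rewrite -(mulrA (3 * (1 + L))) sqr_sqrt_a// mulrA ler_pdivrMr.
Qed.

(** The difference of the two processes is the last Gaussian increment of the first one, plus a
    variable in its past, plus two small drifts. The past contains the second Brownian motion beyond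
    the current time, which is why the increment of the second is no obstacle. *)
Lemma driven_no_tie past' W' X' b' B' s : driven past' W' X' b' B' ->
 (forall r, 0 <= r <= T -> sub_measurable (past r) (X' r)) ->
 (forall r u, 0 <= r -> 0 <= u -> sub_measurable (past r) (W' u)) ->
 0 < s <= T -> {ae P, forall w, X s w <> X' s w}.
Proof.
move=> dv' sX' sW' /andP[s0 sT].
have : {ae P, forall w, X s w - X' s w <> 0}; last first.
 by apply: filterS => w h E; apply: h; rewrite E subrr.
apply: ae_neq_of_close; first by apply: measurable_funB; [exact: (dv_Xm dv)|exact: (dv_Xm dv')].
move=> e e0; have K0 : 0 <= 3 * (1 + 2 * L) by rewrite mulr_ge0// addr_ge0// mulr_ge0.
have [a aP ha] := small_sqrt s0 (mulr_gt0 e0 sigma0) K0.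
have /andP[a0 as_] := aP.
have sa0 : 0 <= s - a by rewrite subr_ge0.
have saT : 0 <= s - a <= T by rewrite sa0/=; lra.
pose Y w := X (s - a) w - (X' (s - a) w + sigma * (W' s w - W' (s - a) w)).
have sY : sub_measurable (past (s - a)) Y.
 apply/sub_measurableP; apply: measurable_funB; first by apply/sub_measurableP; exact: (dv_X dv).
 apply: measurable_funD; first by apply/sub_measurableP; exact: sX'.
 apply: measurable_funM => //; apply: measurable_funB; apply/sub_measurableP; apply: sW' => //; exact: ltW.
exists (fun w => Y w + increment (s - a) s w), ((1 + 2 * L) * a); split => //.
- apply: measurable_funD; last exact: meas_increment.
 by apply: (sub_measurable_measurable _ sY); exact: (dv_past dv).
- by rewrite mulr_gt0// ltr_wpDr// mulr_ge0.
- have h1 : {ae P, forall w, `|X' s w - (X' (s - a) w + sigma * (W' s w - W' (s - a) w))| <= L * a}.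
  apply: filterS (dv_eq dv') => w hw; rewrite (hw (s - a) s)//; last by rewrite lerBlDr lerDl ltW.
  rewrite (_ : _ - _ = \int[mu]_(u in `]s - a, s]) b' (u, w)); last by ring.
  rewrite -[X in L * X](subKr s); apply: norm_Rintegral_itv.
  - by rewrite lerBlDr lerDl ltW.
  - exact: meas_slice2 (dv_b dv').
  - by move=> u; exact: (dv_bL dv').
 apply: filterS2 (driven_close aP sT) h1 => w h1 h2.
 have -> : X s w - X' s w - (Y w + increment (s - a) s w) =
  (X s w - (X (s - a) w + increment (s - a) s w)) - (X' s w - (X' (s - a) w + sigma * (W' s w - W' (s - a) w))).
  by rewrite /Y; ring.
 apply: le_trans (ler_normB _ _) _; apply: le_trans (lerD h1 h2) _; have := ltW a0; lra.
have -> : 0 + (1 + 2 * L) * a = 0 - 2 * ((1 + 2 * L) * a) + (3 * (1 + 2 * L)) * a by ring.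
have -> : e = e * sigma / sigma by field; rewrite gt_eqF.
apply: (@le_trans _ _ (3 * (1 + 2 * L) * a / (sigma * Num.sqrt a))); last first.
 by rewrite -mulrA sqr_sqrt_a// mulrA ler_wpM2r// invr_ge0 ltW.
have -> : sigma * Num.sqrt a = Num.sqrt (sigma ^+ 2 * a).
 by rewrite sqrtrM ?sqr_ge0// sqrtr_sqr gtr0_norm.
apply: (@gaussian_rcdf_lip _ _ _ P (past (s - a))) => //.
- exact: (dv_past dv).
- by rewrite mulr_gt0// exprn_gt0.
- by rewrite mulr_ge0// ltW.
- exact: meas_increment.
- by apply: driven_ind; rewrite a0.
Qed.

Section Grid.
Variables (h : R) (m : nat).
Hypotheses (h0 : 0 < h) (mhT : m%:R * h <= T).

Let kT k : (k <= m)%N -> 0 <= k%:R * h <= T.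
Proof.
move=> km; rewrite mulr_ge0 ?(ltW h0)//=; apply: (le_trans _ mhT).
by rewrite ler_wpM2r ?ler_nat// ltW.
Qed.

Let kS k : k.+1%:R * h = k%:R * h + h. Proof. by rewrite -natr1 mulrDl mul1r. Qed.

Notation GX := (fun k => X (k%:R * h)).
Notation GB := (fun k => B (k%:R * h)).
Notation Gz := (fun k => increment (k%:R * h) (k.+1%:R * h)).

Lemma driven_defect_eq : {ae P, forall w k, (k < m)%N ->
 grid_defect h GX GB Gz k w = \int[mu]_(u in `]k%:R * h, k.+1%:R * h]) (b (u, w) - b (k%:R * h, w))}.
Proof.
apply: filterS2 (dv_eq dv) (dv_bB dv) => w he hb k km.
have /andP[k0 kT1] := kT (ltnW km); have /andP[k0' kT2] := kT km.
rewrite RintegralB//; last 2 first.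
- by apply: bounded_itv_integrable => // u; exact: (dv_bL dv).
- by apply: (bounded_itv_integrable (f := fun=> _)) => // u; exact: (dv_bL dv).
rewrite /grid_defect (he (k%:R * h) (k.+1%:R * h))//; last by rewrite kS lerDl ltW.
rewrite Rintegral_cst// -[X in fine X]/(mu `]k%:R * h, k.+1%:R * h]) lebesgue_measure_itv_oc; last by rewrite kS lerDl ltW.
rewrite /= hb ?k0// /increment kS; ring.
Qed.

(** The constant 2 in the almost sure bound on the defect adds the integral of the drift over a cell
    and its frozen value times the length, each at most [L * h]. *)
Lemma driven_grid : grid_process P (sigma ^+ 2 * h) h L m (fun k => past (k%:R * h)) GX GB Gz.
Proof.
split.
- by move=> k; exact: (dv_past dv).
- by move=> k km; apply: (dv_X dv); apply: kT; exact: ltnW.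
- by move=> k km; apply: (dv_B dv); apply: kT; exact: ltnW.
- by move=> k; exact: (dv_Xm dv).
- by move=> k; exact: (dv_Bm dv).
- by move=> k; exact: meas_increment.
- by move=> k o; exact: (dv_BL dv).
- move=> k km; have -> : sigma ^+ 2 * h = sigma ^+ 2 * (k.+1%:R * h - k%:R * h) by rewrite kS; ring.
 by apply: (dv_ind dv); [case/andP: (kT (ltnW km))|rewrite kS ltrDl].
apply: filterS driven_defect_eq => w hw k km.
rewrite -/(grid_defect h GX GB Gz k w) hw//.
have -> : 2 * L * h = (2 * L) * (k.+1%:R * h - k%:R * h) by rewrite kS; ring.
have le : k%:R * h <= k.+1%:R * h by rewrite kS lerDl ltW.
have mf : measT (fun u => b (u, w) - b (k%:R * h, w)) by exact: measurable_funB.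
have fL u : `|b (u, w) - b (k%:R * h, w)| <= 2 * L.
 by apply: le_trans (ler_normB _ _) _; have := dv_bL dv (u, w); have := dv_bL dv (k%:R * h, w); lra.
have i1 : mu.-integrable `]k%:R * h, k.+1%:R * h] (EFin \o (fun u => b (u, w) - b (k%:R * h, w))).
 apply: (@integrableB _ _ _ mu _ _ (fun u => (b (u, w))%:E) (fun u => (b (k%:R * h, w))%:E)) => //.
 - by apply: bounded_itv_integrable => // u; exact: (dv_bL dv).
 - by apply: (bounded_itv_integrable (f := fun=> _)) => // u; exact: (dv_bL dv).
rewrite (_ : \int[mu]_(u in _) _ = \int[mu]_(u in `]k%:R * h, k.+1%:R * h]) b (u, w) - h * b (k%:R * h, w)).
 have h1 := @norm_Rintegral_itv (fun u => b (u, w)) _ _ le (mb1 w) (fun u => dv_bL dv (u, w)).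
 apply: le_trans (ler_normB _ _) _; rewrite normrM (gtr0_norm h0).
 have := ler_wpM2l (ltW h0) (dv_bL dv (k%:R * h, w)); move: h1.
 rewrite kS (_ : k%:R * h + h - k%:R * h = h); last by ring.
 lra.
rewrite RintegralB//; last 2 first.
- by apply: bounded_itv_integrable => // u; exact: (dv_bL dv).
- by apply: (bounded_itv_integrable (f := fun=> _)) => // u; exact: (dv_bL dv).
rewrite Rintegral_cst// -[X in fine X]/(mu `]k%:R * h, k.+1%:R * h]) lebesgue_measure_itv_oc; last by rewrite kS lerDl ltW.
rewrite /= kS; ring.
Qed.

Lemma driven_defect_le k : (k < m)%N ->
 (\int[P]_w `|grid_defect h GX GB Gz k w|%:E <= cell_defect P b h k)%E.
Proof.
move=> km.
have mdef : measT (fun w => `|grid_defect h GX GB Gz k w|%:E).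
 mnorm; exact: meas_grid_defect driven_grid k.
pose f (q : R * Omega) := \1_(cell h k) q.1 * `|b q - b (k%:R * h, q.2)| : R.
have mbk : measT (fun w => b (k%:R * h, w)) by exact: meas_slice1 (dv_b dv).
have mf : measT f.
 apply: measurable_funM; first exact: (measurableT_comp (meas_cell_indic _ _)).
 apply: measurableT_comp => //; apply: measurable_funB; first exact: (dv_b dv).
 exact: (measurableT_comp mbk).
have f0 q : 0 <= f q by rewrite mulr_ge0.
apply: ae_ge0_le_integral => //.
- by move=> w _; apply: integral_ge0 => s _; rewrite lee_fin; exact: (f0 (s, w)).
- exact: (@meas_integral2 _ _ _ _ R mu f mf f0).
apply: filterS driven_defect_eq => w hw _; rewrite hw//.
have mg : measT (fun u => b (u, w) - b (k%:R * h, w)) by exact: measurable_funB.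
have mng : measT (fun u => `|b (u, w) - b (k%:R * h, w)|%:E).
 by unEFin; exact: measurableT_comp.
rewrite Rintegral_mkcond.
apply: le_trans (abs_Rintegral_le _ _) _.
 by apply/(measurable_restrictT (D := `]k%:R * h, k.+1%:R * h]%classic)) => //; exact: measurable_funTS.
rewrite [leLHS](_ : _ = \int[mu]_(u in `](k%:R * h)%R, (k.+1%:R * h)%R]) `|b (u, w) - b (k%:R * h, w)|%:E)%E; last first.
 rewrite [RHS]integral_mkcond; apply: eq_integral => u _; rewrite /patch.
 by case: ifP => //; rewrite normr0.
rewrite integral_itv_obnd_cbnd; last exact: measurable_funTS.
rewrite -integral_itv_bndo_bndc; last exact: measurable_funTS.
rewrite integral_mkcond; apply: ge0_le_integral => //.
- by move=> u _; rewrite /patch; case: ifP.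
- by apply/(measurable_restrictT (D := `[k%:R * h, k.+1%:R * h[%classic)) => //; exact: measurable_funTS.
- by unEFin; exact: (meas_slice2 w mf).
by move=> u _; rewrite /patch /f/= indicE /cell; case: (u \in _); rewrite ?mul1r ?mul0r.
Qed.

End Grid.

End Driven.

(** * Regularity of the limit *)

Section DriftNorms.
Context (R : realType).
Notation mu := (@lebesgue_measure R).

Lemma sum_cauchy_schwarz (s : seq nat) (a u : nat -> R) : (forall k, k \in s -> 0 < a k) ->
 (\sum_(k <- s) u k) ^+ 2 <= (\sum_(k <- s) a k) * (\sum_(k <- s) u k ^+ 2 / a k).
Proof.
elim: s => [|k s IH] a0; first by rewrite !big_nil expr0n/= mul0r.
have sub j : j \in s -> 0 < a j by move=> js; apply: a0; rewrite inE js orbT.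
have ak : 0 < a k by apply: a0; rewrite inE eqxx.
rewrite !big_cons; have {}IH := IH sub.
set U := \sum_(_ <- _) u _ in IH *; set A := \sum_(_ <- _) a _ in IH *; set V := \sum_(_ <- _) (_ / _) in IH *.
have A0 : 0 <= A by rewrite /A big_seq sumr_ge0// => j /sub/ltW.
have V0 : 0 <= V by rewrite /V big_seq sumr_ge0// => j /sub/ltW ?; rewrite divr_ge0// sqr_ge0.
set p := u k; set x := a k in ak *.
suff : 2 * p * U <= x * V + A * (p ^+ 2 / x).
 have -> : (x + A) * (p ^+ 2 / x + V) = p ^+ 2 + A * V + (x * V + A * (p ^+ 2 / x)).
  by field; rewrite gt_eqF.
 by rewrite sqrrD -mulr_natl; lra.
have q0 : 0 <= A * (p ^+ 2 / x) by rewrite mulr_ge0// divr_ge0 ?sqr_ge0// ltW.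
have r0 : 0 <= x * V by rewrite mulr_ge0// ltW.
apply: le_trans (ler_norm _) _; rewrite -(ler_pXn2r (n := 2))// ?nnegrE ?addr_ge0//.
rewrite real_normK ?num_real//.
have e1 : (2 * p * U) ^+ 2 = 4 * p ^+ 2 * U ^+ 2 by ring.
have e2 : x * V * (A * (p ^+ 2 / x)) = p ^+ 2 * (A * V) by field; rewrite gt_eqF.
have h1 := ler_wpM2l (sqr_ge0 p) IH.
have := sqr_ge0 (x * V - A * (p ^+ 2 / x)); rewrite e1 sqrrB sqrrD -mulr_natl e2; lra.
Qed.

Lemma sum_isq_le (p n : nat) : \sum_(p <= k < n) isq R (n - k) <= 2 * Num.sqrt n%:R.
Proof.
apply: le_trans (sum_isq_rev0 R n).
have [pn|np] := leqP p n; last by rewrite big_geq ?(ltnW np)// sumr_ge0// => k _; exact: isq_ge0.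
rewrite [leRHS](big_cat_nat (n := p))//= lerDr sumr_ge0// => k _; exact: isq_ge0.
Qed.

Lemma sub_intervals_isq_gt0 (p n k : nat) : k \in index_iota p n -> 0 < isq R (n - k).
Proof.
rewrite mem_index_iota => /andP[_ kn].
by rewrite /isq invr_gt0 sqrtr_gt0 ltr0n subn_gt0.
Qed.

Variables (w h kap : R) (p n : nat) (phi : nat -> R -> R).
Hypotheses (w0 : 0 < w) (h0 : 0 <= h).
Hypothesis mphi : forall k, measT (phi k).

Let v k : R := (n - k)%:R * w.
Let cv k x := conv (dgk (v k)) (phi k) x.

(** The lower index [p] is 0 for the regularity of the limit and 1 for the comparison with the
    particles, where time 0 is treated apart. *)
Definition drift_sum x := h * \sum_(p <= k < n) conv (dgk ((n - k)%:R * w)) (phi k) x.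

Let mcv k : measT (cv k).
Proof. by apply: meas_conv => //; exact: meas_dgk. Qed.

Lemma meas_drift_sum : measT drift_sum.
Proof. by apply: measurable_funM => //; apply: measurable_sum => k; exact: mcv. Qed.

Let v0 k : (k < n)%N -> 0 < v k.
Proof. by move=> kn; rewrite mulr_gt0// ltr0n subn_gt0. Qed.

Let dgk_le k : (k < n)%N -> (\int[mu]_x `|dgk (v k) x|%:E <= (3 / 2 / Num.sqrt w * isq R (n - k))%:E)%E.
Proof.
move=> kn; apply: le_trans (integral_dgk_le (v0 kn)) _; rewrite lee_fin /v sqrtrM// invfM.
have := sqrt2_le R; rewrite -/(isq R (n - k)) => h2.
have -> : 3 / 2 / Num.sqrt w * isq R (n - k) = 3 / 2 * (isq R (n - k) / Num.sqrt w) by ring.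
by rewrite ler_wpM2r// mulr_ge0 ?isq_ge0// invr_ge0.
Qed.

Lemma drift_L1 : (\int[mu]_x `|drift_sum x|%:E <=
 (3 / 2 * (h / Num.sqrt w))%:E * \sum_(p <= k < n) (isq R (n - k))%:E * \int[mu]_x `|phi k x|%:E)%E.
Proof.
have mcvn k : measT (fun x => `|cv k x|%:E).
 by unEFin; exact: measurableT_comp.
have mS : measT (fun x => \sum_(p <= k < n) `|cv k x|%:E)%E by exact: emeasurable_sum.
apply: (@le_trans _ _ (\int[mu]_x (h%:E * \sum_(p <= k < n) `|cv k x|%:E))%E).
 apply: ge0_le_integral => //.
 - by mnorm; exact: meas_drift_sum.
 - exact: measurable_funeM.
 - move=> x _; rewrite sumEFin -EFinM lee_fin normrM ger0_norm// ler_wpM2l//.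
  exact: ler_norm_sum.
rewrite ge0_integralZl//; last by move=> x _; exact: sume_ge0.
rewrite ge0_integral_sum//.
have -> : 3 / 2 * (h / Num.sqrt w) = h * (3 / 2 / Num.sqrt w) by ring.
rewrite EFinM -muleA lee_wpmul2l// ge0_sume_distrr; last first.
 by move=> k _; rewrite mule_ge0 ?lee_fin ?isq_ge0//; apply: integral_ge0 => x _; rewrite lee_fin.
rewrite big_nat [leRHS]big_nat; apply: lee_sum => k /andP[_ kn].
rewrite muleA -EFinM; apply: conv_L1 => //; [exact: meas_dgk|exact: dgk_le].
Qed.

Hypothesis hkap : h * Num.sqrt n%:R / Num.sqrt w <= kap.

(** Cauchy--Schwarz over [k] with weights [isq (n - k)], of total at most $2\sqrt n$. The
    convolution bound contributes the square of the weight, divided by the weight: the singular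
    kernel keeps its shape. *)
Lemma drift_L2 : (\int[mu]_x (drift_sum x ^+ 2)%:E <=
 (9 / 2 * kap * (h / Num.sqrt w))%:E * \sum_(p <= k < n) (isq R (n - k))%:E * \int[mu]_x (phi k x ^+ 2)%:E)%E.
Proof.
pose C := 2 * h ^+ 2 * Num.sqrt n%:R.
have C0 : 0 <= C by rewrite !mulr_ge0// sqr_ge0.
have iq0 k : 0 <= (isq R (n - k))^-1 by rewrite invr_ge0 isq_ge0.
have mcv2 k : measT (fun x => ((isq R (n - k))^-1 * cv k x ^+ 2)%:E).
 by unEFin; apply: measurable_funM => //; exact: measurable_funX.
have cv20 k x : (0 <= ((isq R (n - k))^-1 * cv k x ^+ 2)%:E)%E by rewrite lee_fin mulr_ge0// sqr_ge0.
have mS : measT (fun x => \sum_(p <= k < n) ((isq R (n - k))^-1 * cv k x ^+ 2)%:E)%E by exact: emeasurable_sum.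
apply: (@le_trans _ _ (\int[mu]_x (C%:E * \sum_(p <= k < n) ((isq R (n - k))^-1 * cv k x ^+ 2)%:E))%E).
 apply: ge0_le_integral => //.
 - by move=> x _; rewrite lee_fin sqr_ge0.
 - by unEFin; apply: measurable_funX; exact: meas_drift_sum.
 - exact: measurable_funeM.
 - move=> x _; rewrite sumEFin -EFinM lee_fin /drift_sum exprMn.
  have cs := @sum_cauchy_schwarz (index_iota p n) (fun k => isq R (n - k)) (cv^~ x) (@sub_intervals_isq_gt0 p n).
  have -> : C = h ^+ 2 * (2 * Num.sqrt n%:R) by rewrite /C; ring.
  rewrite -(mulrA (h ^+ 2)); apply: ler_wpM2l; first exact: sqr_ge0.
  apply: le_trans cs _.
  have -> : \sum_(p <= k < n) cv k x ^+ 2 / isq R (n - k) = \sum_(p <= k < n) (isq R (n - k))^-1 * cv k x ^+ 2.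
   by apply: eq_bigr => k _; rewrite mulrC.
  by rewrite ler_wpM2r ?sum_isq_le// sumr_ge0// => k _; rewrite mulr_ge0// sqr_ge0.
rewrite ge0_integralZl//; last by move=> x _; exact: sume_ge0.
rewrite ge0_integral_sum//.
have S0 : (0 <= \sum_(p <= k < n) (isq R (n - k))%:E * \int[mu]_x (phi k x ^+ 2)%:E)%E.
 by apply: sume_ge0 => k _; rewrite mule_ge0 ?lee_fin ?isq_ge0//; apply: integral_ge0 => x _; rewrite lee_fin sqr_ge0.
apply: (@le_trans _ _ ((C * (3 / 2 / Num.sqrt w) ^+ 2)%:E * \sum_(p <= k < n) (isq R (n - k))%:E * \int[mu]_x (phi k x ^+ 2)%:E)%E).
 rewrite (EFinM C) -muleA lee_wpmul2l// ge0_sume_distrr; last first.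
  by move=> k _; rewrite mule_ge0 ?lee_fin ?isq_ge0//; apply: integral_ge0 => x _; rewrite lee_fin sqr_ge0.
 rewrite big_nat [leRHS]big_nat; apply: lee_sum => k kpn.
 have kn : (k < n)%N by case/andP: kpn.
 have i0 : 0 < isq R (n - k) by rewrite /isq invr_gt0 sqrtr_gt0 ltr0n subn_gt0.
 under eq_integral do rewrite EFinM.
 have mc2 : measT (fun x => (cv k x ^+ 2)%:E).
  by unEFin; apply: measurable_funX; exact: mcv.
 have c20 x : (0 <= (cv k x ^+ 2)%:E)%E by rewrite lee_fin sqr_ge0.
 have i0' : (0 <= (isq R (n - k))^-1%:E)%E by rewrite lee_fin.
 rewrite (ge0_integralZl mu measurableT mc2 (fun x _ => c20 x) i0').
 apply: (@le_trans _ _ ((isq R (n - k))^-1%:E * (((3 / 2 / Num.sqrt w * isq R (n - k)) ^+ 2)%:E * \int[mu]_x (phi k x ^+ 2)%:E))%E).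
  rewrite lee_wpmul2l ?lee_fin//; apply: conv_L2 => //; [exact: meas_dgk|exact: dgk_le].
 rewrite !muleA -!EFinM le_eqVlt; apply/orP; left; apply/eqP; congr (_%:E * _)%E.
 rewrite exprMn expr2 (expr2 (isq R (n - k))); field; rewrite ?(gt_eqF i0) ?gt_eqF ?sqrtr_gt0//.
apply: lee_wpmul2r => //; rewrite lee_fin /C.
have s0 : 0 < Num.sqrt w by rewrite sqrtr_gt0.
have -> : 2 * h ^+ 2 * Num.sqrt n%:R * (3 / 2 / Num.sqrt w) ^+ 2 =
 9 / 2 * (h / Num.sqrt w) * (h * Num.sqrt n%:R / Num.sqrt w) by field; rewrite gt_eqF.
have -> : 9 / 2 * kap * (h / Num.sqrt w) = 9 / 2 * (h / Num.sqrt w) * kap by ring.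
by rewrite ler_wpM2l// !mulr_ge0 ?invr_ge0 // ltW.
Qed.

End DriftNorms.

Section ConvShift.
Context (R : realType).
Notation mu := (@lebesgue_measure R).

Lemma conv_shift (k f : R -> R) x a : measT k -> measT f ->
 conv k f (x + a) = conv k (fun y => f (y + a)) x.
Proof.
move=> mk mf; rewrite /conv.
rewrite -(@Rintegral_shift R (fun y => k (x + a - y) * f y) a); last first.
 by apply: measurable_funM => //; exact: meas_kshift.
by apply: eq_Rintegral => y _; congr (k _ * _); ring.
Qed.

Lemma sqr_sum3_le (a b c : R) : (a + b + c) ^+ 2 <= 3 * (a ^+ 2 + b ^+ 2 + c ^+ 2).
Proof. have := sqr_ge0 (a - b); have := sqr_ge0 (a - c); have := sqr_ge0 (b - c); nra. Qed.

Lemma sqr_sum4_le (a b c e : R) : (a + b + c + e) ^+ 2 <= 4 * (a ^+ 2 + b ^+ 2 + c ^+ 2 + e ^+ 2).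
Proof.
have := sqr_ge0 (a - b); have := sqr_ge0 (a - c); have := sqr_ge0 (b - c).
have := sqr_ge0 (a - e); have := sqr_ge0 (b - e); have := sqr_ge0 (c - e); nra.
Qed.

Lemma integral_sqr_le (f : R -> R) (c B : R) : measT f -> 0 <= c ->
 (forall x, `|f x| <= c) -> (\int[mu]_x `|f x|%:E <= B%:E)%E ->
 (\int[mu]_x (f x ^+ 2)%:E <= (c * B)%:E)%E.
Proof.
move=> mf c0 fc fB; apply: (@le_trans _ _ (\int[mu]_x (c%:E * `|f x|%:E))%E).
 apply: ge0_le_integral => //.
 - by move=> x _; rewrite lee_fin sqr_ge0.
 - by unEFin; exact: measurable_funX.
 - by apply: measurable_funeM; unEFin; exact: measurableT_comp.
 - by move=> x _; rewrite -EFinM lee_fin -(real_normK (num_real (f x))) expr2 ler_wpM2r.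
rewrite ge0_integralZl//; last by unEFin; exact: measurableT_comp.
by rewrite EFinM lee_wpmul2l.
Qed.

Lemma integral_sum3_sqr_le (A B C : R -> R) : measT A -> measT B ->
 measT C ->
 (\int[mu]_x ((A x + B x + C x) ^+ 2)%:E <=
  3%:E * (\int[mu]_x (A x ^+ 2)%:E + \int[mu]_x (B x ^+ 2)%:E + \int[mu]_x (C x ^+ 2)%:E))%E.
Proof.
move=> mA mB mC.
have mX (f : R -> R) : measT f -> measT (fun x => (f x ^+ 2)%:E).
 by move=> mf; unEFin; exact: measurable_funX.
have X0 (f : R -> R) x : (0 <= (f x ^+ 2)%:E)%E by rewrite lee_fin sqr_ge0.
have mAB : measT (fun x => (A x ^+ 2)%:E + (B x ^+ 2)%:E)%E by apply: emeasurable_funD; exact: mX.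
have AB0 x : (0 <= (A x ^+ 2)%:E + (B x ^+ 2)%:E)%E by rewrite adde_ge0.
rewrite -(ge0_integralD mu measurableT (fun x _ => X0 A x) (mX A mA) (fun x _ => X0 B x) (mX B mB)).
rewrite -(ge0_integralD mu measurableT (fun x _ => AB0 x) mAB (fun x _ => X0 C x) (mX C mC)).
have mABC : measT (fun x => (A x ^+ 2)%:E + (B x ^+ 2)%:E + (C x ^+ 2)%:E)%E.
 by apply: emeasurable_funD => //; exact: mX.
have ABC0 x : (0 <= (A x ^+ 2)%:E + (B x ^+ 2)%:E + (C x ^+ 2)%:E)%E by rewrite !adde_ge0.
have t0 : (0 <= 3%:E :> \bar R)%E by rewrite lee_fin.
rewrite -(ge0_integralZl mu measurableT mABC (fun x _ => ABC0 x) t0).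
apply: ge0_le_integral => //.
- by unEFin; apply: measurable_funX; apply: measurable_funD => //; exact: measurable_funD.
- by apply: measurable_funeM; apply: emeasurable_funD => //; exact: mX.
- by move=> x _; rewrite -!EFinD -EFinM lee_fin; exact: sqr_sum3_le.
Qed.

End ConvShift.

Opaque Kc gk dgk gronwall_const.

(** Bound for $h\sqrt n/\sqrt w$ with $w=\sigma^2h$ and $nh\le T$; see [grid_kappa]. Constants are
    locked so that they stay atoms for the arithmetic tactics. *)
HB.lock Definition kappa (R : realType) (T sigma : R) : R := Num.sqrt T / sigma.

(** The factor $27/2$ is the 3 of a sum of three squares times the $9/2$ of [drift_L2]. *)
HB.lock Definition shift_rate (R : realType) (T sigma L : R) : R :=
 27 / 2 * kappa T sigma * L ^+ 2 / sigma.

HB.lock Definition shift_const (R : realType) (T sigma L : R) : R :=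
 gronwall_const (shift_rate T sigma L) T * (3 / sigma).

Section GridConstants.
Context (R : realType).
Variables (T sigma : R).
Hypotheses (T0 : 0 < T) (sigma0 : 0 < sigma).

Lemma kappa_ge0 : 0 <= kappa T sigma.
Proof. by rewrite kappa.unlock divr_ge0// ltW. Qed.

Lemma sqrt_grid_var h : Num.sqrt (sigma ^+ 2 * h) = sigma * Num.sqrt h.
Proof. by rewrite sqrtrM ?sqr_ge0// sqrtr_sqr gtr0_norm. Qed.

Lemma div_grid_var h : 0 < h -> h / Num.sqrt (sigma ^+ 2 * h) = Num.sqrt h / sigma.
Proof.
move=> h0; rewrite sqrt_grid_var -{1}(sqr_sqrtr (ltW h0)).
by field; rewrite !gt_eqF// sqrtr_gt0.
Qed.

Lemma grid_kappa h m : 0 < h -> m%:R * h <= T -> h * Num.sqrt m%:R / Num.sqrt (sigma ^+ 2 * h) <= kappa T sigma.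
Proof.
move=> h0 hm; rewrite kappa.unlock mulrAC div_grid_var// mulrAC ler_wpM2r ?invr_ge0 ?(ltW sigma0)//.
by rewrite -sqrtrM ?(ltW h0)// ler_wsqrtr// mulrC.
Qed.

End GridConstants.

Section ShiftDifference.
Context (R : realType).
Notation mu := (@lebesgue_measure R).

Lemma integral_shiftB_le (f : R -> R) (a e : R) : measT f ->
 (\int[mu]_x `|f x|%:E <= e%:E)%E -> (\int[mu]_x `|f (x + a) - f x|%:E <= (2 * e)%:E)%E.
Proof.
move=> mf fe.
have mfa : measT (fun x : R => f (x + a)).
 by apply: measurableT_comp => //; exact: measurable_funD.
have m1 : measT (fun x => `|f x|%:E).
 by unEFin; exact: measurableT_comp.
have m2 : measT (fun x : R => `|f (x + a)|%:E).
 by unEFin; exact: measurableT_comp.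
apply: (@le_trans _ _ (\int[mu]_x (`|f (x + a)|%:E + `|f x|%:E))%E).
 apply: ge0_le_integral => //.
 - by mnorm; exact: measurable_funB.
 - exact: emeasurable_funD.
 - by move=> x _; rewrite -EFinD lee_fin; exact: ler_normB.
rewrite ge0_integralD// (@ge0_integral_shift R a (fun x => `|f x|%:E))//.
by rewrite mulr_natl mulr2n EFinD; exact: leeD.
Qed.

End ShiftDifference.

(** * Flux of a drift *)

Section MeanFlux.
Context d (Omega : measurableType d) (R : realType) (P : probability Omega R).
Notation mu := (@lebesgue_measure R).
Notation "''Ex' f" := (\int[P]_w f w) (at level 10, f at level 9).
Variables (X B : Omega -> R) (L : R).
Hypotheses (mX : measT X) (mB : measT B) (BL : forall w, `|B w| <= L).

Definition mean_flux (y : R) : R := 'Ex (fun w => B w * heav (X w) y).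

Let L0 : 0 <= L. Proof. by rewrite (le_trans _ (BL point)). Qed.

Let bB : bmf B. Proof. by split => //; exists L. Qed.
Let bH y : bmf (fun w => heav (X w) y). Proof. exact: bmf_heav. Qed.
Let bBH y : bmf (fun w => B w * heav (X w) y). Proof. exact: bmfM. Qed.

Lemma meas_mean_flux : measT mean_flux.
Proof.
apply: (@meas_Ex _ _ _ P (fun q => B q.1 * heav (X q.1) q.2)).
apply: measurable_funM; first exact: meas_fst_comp.
by apply: meas_heav => //; exact: meas_fst_comp.
Qed.

Lemma norm_mean_flux y : `|mean_flux y| <= L.
Proof.
by apply: Ex_bound => // w; rewrite normrM -[leRHS]mulr1 ler_pM// norm_heav_le.
Qed.

Lemma mean_fluxB_le y y' : `|mean_flux y' - mean_flux y| <= L * `|rcdf P X y' - rcdf P X y|.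
Proof.
wlog yy : y y' / y <= y'.
 move=> H; have [|/ltW] := leP y y'; first exact: H.
 by move=> /H; rewrite distrC [X in _ <= L * X]distrC.
have dh w : 0 <= heav (X w) y' - heav (X w) y by rewrite subr_ge0 heav_mono.
have bd : bmf (fun w => heav (X w) y' - heav (X w) y) by exact: bmfB.
have -> : mean_flux y' - mean_flux y = 'Ex (fun w => B w * (heav (X w) y' - heav (X w) y)).
 by rewrite /mean_flux -ExB//; apply: eq_Rintegral => w _; ring.
apply: le_trans (Ex_norm P (bmfM bB bd)) _.
rewrite ger0_norm ?subr_ge0 ?rcdf_mono// /rcdf -ExB// -ExZ//.
apply: Ex_le; [by apply: bmf_norm; exact: bmfM|exact: bmfZ|].
by move=> w; rewrite normrM (ger0_norm (dh w)) ler_wpM2r.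
Qed.

Lemma integral_rcdf_shift a : (\int[mu]_x `|rcdf P X (x + a) - rcdf P X x|%:E <= `|a|%:E)%E.
Proof.
pose f (q : Omega * R) := heav (X q.1) (q.2 + a) - heav (X q.1) q.2.
have mf : measT f.
 apply: measurable_funB; apply: meas_heav => //; try exact: meas_fst_comp.
 exact: measurable_funD.
have -> : (\int[mu]_x `|rcdf P X (x + a) - rcdf P X x|%:E = \int[mu]_x `|'Ex (fun w => f (w, x))|%:E)%E.
 by apply: eq_integral => x _; rewrite /rcdf -ExB.
apply: le_trans (integral_Ex_le P mf) _.
rewrite (eq_integral (fun=> `|a|%:E)) ?integral_cst//= ?probability_setT ?mule1//.
move=> w _; rewrite /f/=.
have E x : heav (X w) (x + a) = heav (X w - a) x by rewrite heav_shift opprK.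
under eq_integral do rewrite E.
by rewrite integral_heavB -normrN; congr (`|_|%:E); ring.
Qed.

End MeanFlux.

(** * Modulus of continuity of the distribution functions in $L^2$ *)

Section ShiftRegularity.
Context d (Omega : measurableType d) (R : realType) (P : probability Omega R).
Notation mu := (@lebesgue_measure R).
Notation "''Ex' f" := (\int[P]_w f w) (at level 10, f at level 9).
Variables (T sigma L : R).
Hypotheses (T0 : 0 < T) (sigma0 : 0 < sigma).
Variables (past : R -> set (set Omega)) (W X : R -> Omega -> R) (b : R * Omega -> R) (B : R -> Omega -> R).
Hypothesis dv : driven P T sigma L past W X b B.
Hypothesis b_left : forall s (u : nat -> R), 0 < s < T -> (forall j, 0 <= u j <= s) ->
 u @ \oo --> s -> {ae P, forall w, b (u j, w) @[j --> \oo] --> b (s, w)}.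

Notation kap := (kappa T sigma).
Notation F := (fun s => rcdf P (X s)).

Let L0 : 0 <= L. Proof. by rewrite (le_trans _ (dv_bL dv point)). Qed.
Let kap0 : 0 <= kap. Proof. exact: kappa_ge0. Qed.

Notation srate := (shift_rate T sigma L).
Notation sconst := (shift_const T sigma L).

Lemma shift_rate_ge0 : 0 <= srate.
Proof. by rewrite shift_rate.unlock !mulr_ge0 ?sqr_ge0// invr_ge0 ltW. Qed.

Lemma shift_const_ge0 : 0 <= sconst.
Proof.
rewrite shift_const.unlock mulr_ge0 ?divr_ge0// ?(ltW sigma0)//.
by apply: gronwall_const_ge0; [exact: shift_rate_ge0|exact: ltW].
Qed.

Section FineGrid.
Variables (h a eta : R) (r : nat).
Hypotheses (h0 : 0 < h) (rhT : r%:R * h <= T) (eta0 : 0 <= eta).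
Hypothesis def_eta : (\sum_(k < r) cell_defect P b h k <= eta%:E)%E.

Notation w := (sigma ^+ 2 * h).
Notation GX := (fun k => X (k%:R * h)).
Notation GB := (fun k => B (k%:R * h)).
Notation Gz := (fun k => increment sigma W (k%:R * h) (k.+1%:R * h)).

Let w0 : 0 < w. Proof. by rewrite mulr_gt0// exprn_gt0. Qed.
Let gp := driven_grid dv h0 rhT.
Let hk : h * Num.sqrt r%:R / Num.sqrt w <= kap. Proof. exact: grid_kappa. Qed.

Lemma grid_defect_sum n : (n <= r)%N ->
 (\sum_(0 <= k < n) \int[P]_o `|grid_defect h GX GB Gz k o|%:E <= eta%:E)%E.
Proof.
move=> nr; apply: le_trans def_eta; rewrite -(big_mkord xpredT (fun k => cell_defect P b h k)).
have cd0 k : (0 <= cell_defect P b h k)%E.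
 apply: integral_ge0 => o _; apply: integral_ge0 => s _; rewrite lee_fin mulr_ge0//.
rewrite [leRHS](big_cat_nat (n := n))//=.
rewrite -[leLHS]adde0; apply: leeD; last exact: sume_ge0.
rewrite big_nat [leRHS]big_nat; apply: lee_sum => k /andP[_ kn].
by apply: (driven_defect_le dv h0 rhT); exact: leq_trans nr.
Qed.

Let H k y := mean_flux P (X (k%:R * h)) (B (k%:R * h)) y.
Let mH k : measT (H k).
Proof. by apply: meas_mean_flux; [exact: (dv_Xm dv)|exact: (dv_Bm dv)]. Qed.
Let HL k y : `|H k y| <= L.
Proof. by apply: norm_mean_flux; [exact: (dv_Xm dv)|exact: (dv_Bm dv)|exact: (dv_BL dv)]. Qed.

Let rest n x := 'Ex (fun o => grid_rest w h GX GB Gz n (o, x)).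
Let K0 n x := 'Ex (fun o => Kc (n%:R * w) (x - X (0%:R * h) o)).

Lemma driven_mean_expansion n x : (n <= r)%N ->
 F (n%:R * h) x = K0 n x - h * \sum_(0 <= k < n) conv (dgk ((n - k)%:R * w)) (H k) x + rest n x.
Proof.
move=> nr; rewrite /rcdf (grid_mean_expansion w0 gp x nr); congr (_ - _ * _ + _).
rewrite big_nat [RHS]big_nat; apply: eq_bigr => k /andP[_ kn].
apply: Ex_drift_conv; last exact: (dv_Xm dv).
 by rewrite mulr_gt0// ltr0n subn_gt0.
by split; [exact: (dv_Bm dv)|exists L => o; exact: (dv_BL dv)].
Qed.

Lemma integral_driven_rest n : (n <= r)%N ->
 (\int[mu]_x `|rest n x|%:E <= (eta + 3 * L ^+ 2 * kap * h)%:E)%E.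
Proof.
move=> nr; apply: (integral_Ex_grid_rest w0 (ltW h0) L0 hk gp nr).
exact: grid_defect_sum.
Qed.

Lemma norm_driven_rest n x : (n <= r)%N -> `|rest n x| <= 1 + 8 * L * kap.
Proof. by move=> nr; apply: (norm_Ex_grid_rest w0 (ltW h0) L0 hk gp x nr). Qed.

Lemma meas_driven_rest n : measT (rest n).
Proof. by apply: meas_Ex; exact: (meas_grid_rest gp n). Qed.

Let mKq s k : measT (fun q : Omega * R => Kc s (q.2 - X (k%:R * h) q.1)).
Proof. by apply: meas_joint_kernel; [exact: meas_Kc|exact: (dv_Xm dv)]. Qed.

Let mK0 n : measT (K0 n).
Proof. exact: (meas_Ex P (mKq (n%:R * w) 0%N)). Qed.

Let mshift (f : R -> R) : measT f -> measT (fun x : R => f (x + a)).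
Proof. by move=> mf; apply: measurableT_comp => //; exact: measurable_funD. Qed.

Let bK s k x : bmf (fun o => Kc s (x - X (k%:R * h) o)).
Proof. exact: (bmf_KcX gp s k x). Qed.

Let intA n : (1 <= n)%N ->
 (\int[mu]_x ((K0 n (x + a) - K0 n x) ^+ 2)%:E <= (a ^+ 2 / Num.sqrt (n%:R * w))%:E)%E.
Proof.
move=> n1; have nw : 0 < n%:R * w by rewrite mulr_gt0// ltr0n.
have xa x o : x + a - X (0%:R * h) o = x - (X (0%:R * h) o - a) by ring.
have dE x : K0 n (x + a) - K0 n x = 'Ex (fun o => Kc (n%:R * w) (x + a - X (0%:R * h) o) - Kc (n%:R * w) (x - X (0%:R * h) o)).
 by rewrite /K0 -ExB.
have mf : measT (fun q : Omega * R => Kc (n%:R * w) (q.2 + a - X (0%:R * h) q.1) - Kc (n%:R * w) (q.2 - X (0%:R * h) q.1)).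
 apply: measurable_funB; last exact: mKq.
 have := @meas_joint_kernel _ Omega R (fun y => Kc (n%:R * w) (y + a)) (X (0%:R * h)) _ (dv_Xm dv _).
 rewrite (_ : (fun q : Omega * R => Kc (n%:R * w) (q.2 + a - X (0%:R * h) q.1)) = (fun q => Kc (n%:R * w) (q.2 - X (0%:R * h) q.1 + a))).
  by apply; apply: mshift; exact: meas_Kc.
 by apply/funext => q; congr Kc; ring.
have mnf : measT (fun q : Omega * R => `|Kc (n%:R * w) (q.2 + a - X (0%:R * h) q.1) - Kc (n%:R * w) (q.2 - X (0%:R * h) q.1)|).
 exact: measurableT_comp.
have -> : a ^+ 2 / Num.sqrt (n%:R * w) = (`|a| / Num.sqrt (n%:R * w)) * `|a|.
 by rewrite -(real_normK (num_real a)); ring.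
apply: integral_sqr_le.
- by apply: measurable_funB => //; exact: mshift.
- by rewrite divr_ge0.
- move=> x; rewrite dE; apply: Ex_bound; first exact: bmfB.
 move=> o; rewrite xa; apply: le_trans (norm_Kc_shiftB _ _ _ nw) _.
 by rewrite (_ : _ - _ - _ = - a) ?normrN//; ring.
have -> : (\int[mu]_x `|K0 n (x + a) - K0 n x|%:E = \int[mu]_x `|'Ex (fun o => Kc (n%:R * w) (x + a - X (0%:R * h) o) - Kc (n%:R * w) (x - X (0%:R * h) o))|%:E)%E.
 by apply: eq_integral => x _; rewrite dE.
apply: le_trans (integral_Ex_le P mf) _.
apply: (@le_trans _ _ (\int[P]_o (`|a|)%:E)%E).
 apply: ge0_le_integral => //.
 - by move=> o _; apply: integral_ge0 => x _; rewrite lee_fin.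
 - by apply: (@meas_integral1 _ _ _ _ R mu _ mnf) => q; exact: normr_ge0.
 - move=> o _; rewrite /=; under eq_integral do rewrite xa.
  apply: le_trans (integral_Kc_shiftB _ _ _) _.
  by rewrite (_ : _ - _ - _ = - a) ?normrN//; ring.
by rewrite integral_cst//= probability_setT mule1.
Qed.

Let f n : \bar R := (\int[mu]_x ((F (n%:R * h) (x + a) - F (n%:R * h) x) ^+ 2)%:E)%E.

Let phi k y := H k (y + a) - H k y.

Let mphi k : measT (phi k).
Proof. by apply: measurable_funB => //; exact: mshift. Qed.

Let intphi k : (\int[mu]_y (phi k y ^+ 2)%:E <= (L ^+ 2)%:E * f k)%E.
Proof.
have mF : measT (fun y : R => F (k%:R * h) (y + a) - F (k%:R * h) y).
 by apply: measurable_funB; [apply: (mshift (f := F (k%:R * h)))|]; apply: meas_rcdf; exact: (dv_Xm dv).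
have mF2 : measT (fun y : R => ((F (k%:R * h) (y + a) - F (k%:R * h) y) ^+ 2)%:E).
 by unEFin; exact: measurable_funX.
have L20 : (0 <= (L ^+ 2)%:E :> \bar R)%E by rewrite lee_fin sqr_ge0.
have F20 y : (0 <= ((F (k%:R * h) (y + a) - F (k%:R * h) y) ^+ 2)%:E)%E by rewrite lee_fin sqr_ge0.
rewrite /f -(ge0_integralZl mu measurableT mF2 (fun y _ => F20 y) L20).
apply: ge0_le_integral => //.
- by move=> y _; rewrite lee_fin sqr_ge0.
- by unEFin; apply: measurable_funX; exact: mphi.
- exact: measurable_funeM.
move=> y _; rewrite -EFinM lee_fin -exprMn.
rewrite -(real_normK (num_real (phi k y))) -[leRHS](real_normK (num_real _)).
rewrite lerXn2r ?nnegrE// normrM (ger0_norm L0).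
by apply: mean_fluxB_le; [exact: (dv_Xm dv)|exact: (dv_Bm dv)|exact: (dv_BL dv)].
Qed.

(** The mean expansion is translated by [a] and subtracted. The initial term has sup norm
    $|a|/\sqrt{nw}$ and $L^1$ norm $|a|$; the flux moves by at most [L] times the distribution
    function, which closes the recursion; the rest is small with [eta] and [h]. The factor 3
    throughout is that of a sum of three squares. *)
Lemma shift_recursion n : (1 <= n <= r)%N ->
 (f n <= (12 * (1 + 8 * L * kap) * (eta + 3 * L ^+ 2 * kap * h) +
    (3 * a ^+ 2 / (sigma * Num.sqrt h) + srate * Num.sqrt h * `|a|) * isq R n)%:E +
   (srate * Num.sqrt h)%:E * \sum_(1 <= k < n) (isq R (n - k))%:E * f k)%E.
Proof.
move=> /andP[n1 nr].
pose A x := K0 n (x + a) - K0 n x.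
pose D x := - drift_sum w h 0 n phi x.
pose C x := rest n (x + a) - rest n x.
have E x : F (n%:R * h) (x + a) - F (n%:R * h) x = A x + D x + C x.
 rewrite (driven_mean_expansion (x + a) nr) (driven_mean_expansion x nr) /A /D /C /drift_sum.
 have -> : \sum_(0 <= k < n) conv (dgk ((n - k)%:R * w)) (phi k) x =
   \sum_(0 <= k < n) conv (dgk ((n - k)%:R * w)) (H k) (x + a) - \sum_(0 <= k < n) conv (dgk ((n - k)%:R * w)) (H k) x.
  rewrite -sumrB big_nat [RHS]big_nat; apply: eq_bigr => k /andP[_ kn].
  have vk : 0 < (n - k)%:R * w by rewrite mulr_gt0// ltr0n subn_gt0.
  rewrite (conv_shift _ _ (meas_dgk _) (mH k)).
  rewrite /phi (@convB R (dgk ((n - k)%:R * w)) (fun y => H k (y + a)) (H k) x L)//.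
  - exact: meas_dgk.
  - exact: integrable_dgk.
  - exact: mshift.
 have ring_id (k1 k2 s1 s2 r1 r2 : R) :
  k1 - h * s1 + r1 - (k2 - h * s2 + r2) = (k1 - k2) + - (h * (s1 - s2)) + (r1 - r2) by ring.
 exact: ring_id.
have mA : measT A by apply: measurable_funB => //; exact: mshift.
have mD : measT D by apply: measurableT_comp => //; exact: meas_drift_sum.
have mC : measT C by apply: measurable_funB; [apply: mshift|]; exact: meas_driven_rest.
have hA := intA n1.
have hkn : h * Num.sqrt n%:R / Num.sqrt w <= kap.
 apply: grid_kappa => //; apply: le_trans rhT; by rewrite ler_wpM2r ?ler_nat// ltW.
have hD : (\int[mu]_x (D x ^+ 2)%:E <= (9 / 2 * kap * (h / Num.sqrt w))%:E *
  \sum_(0 <= k < n) (isq R (n - k))%:E * \int[mu]_x (phi k x ^+ 2)%:E)%E.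
 have hD0 := @drift_L2 R w h kap 0 n phi w0 (ltW h0) mphi hkn.
 have -> : (\int[mu]_x (D x ^+ 2)%:E = \int[mu]_x (drift_sum w h 0 n phi x ^+ 2)%:E)%E.
  by apply: eq_integral => x _; rewrite /D sqrrN.
 exact: hD0.
have hC : (\int[mu]_x (C x ^+ 2)%:E <= (4 * (1 + 8 * L * kap) * (eta + 3 * L ^+ 2 * kap * h))%:E)%E.
 set c := 1 + 8 * L * kap; set e := eta + _.
 have c0 : 0 <= c by rewrite addr_ge0// !mulr_ge0.
 have -> : 4 * c * e = (2 * c) * (2 * e) by ring.
 apply: integral_sqr_le => //; first by rewrite mulr_ge0.
  move=> x; apply: le_trans (ler_normB _ _) _.
  rewrite (_ : 2 * c = c + c); last by rewrite mulr_natl mulr2n.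
  by apply: lerD; exact: norm_driven_rest.
 exact: (integral_shiftB_le a (meas_driven_rest n) (integral_driven_rest nr)).
have ff k : (0 <= f k)%E by apply: integral_ge0 => x _; rewrite lee_fin sqr_ge0.
(* At time 0 the law may have atoms and only the first power of [a] is available. This term carries
   a factor $\sqrt h$ and disappears when the grid is refined. *)
have f00 : (f 0%N <= `|a|%:E)%E.
 rewrite -[X in (_ <= X%:E)%E]mul1r; apply: integral_sqr_le => //.
 - by apply: measurable_funB; [apply: (mshift (f := F (0%:R * h)))|]; apply: meas_rcdf; exact: (dv_Xm dv).
 - move=> x; have m0 := dv_Xm dv (0%:R * h).
  have := rcdf_ge0 P (X (0%:R * h)) (x + a); have := rcdf_le1 P m0 (x + a).
  have := rcdf_ge0 P (X (0%:R * h)) x; have := rcdf_le1 P m0 x.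
  by rewrite ler_norml => *; apply/andP; split; lra.
 - by apply: integral_rcdf_shift; exact: (dv_Xm dv).
have s0 : 0 < Num.sqrt h by rewrite sqrtr_gt0.
have sn : 0 < Num.sqrt n%:R :> R by rewrite sqrtr_gt0 ltr0n.
have hD' : (3%:E * \int[mu]_x (D x ^+ 2)%:E <= (srate * Num.sqrt h)%:E *
  \sum_(0 <= k < n) (isq R (n - k))%:E * f k)%E.
 apply: (@le_trans _ _ (3%:E * ((9 / 2 * kap * (h / Num.sqrt w))%:E *
   \sum_(0 <= k < n) (isq R (n - k))%:E * ((L ^+ 2)%:E * f k)))%E).
  rewrite lee_wpmul2l//; apply: le_trans hD _.
  rewrite lee_wpmul2l//; first by rewrite lee_fin !mulr_ge0 ?invr_ge0// ltW.
  by apply: lee_sum => k _; rewrite lee_wpmul2l ?lee_fin ?isq_ge0.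
 rewrite div_grid_var// muleA -EFinM.
 under eq_bigr do rewrite muleCA.
 rewrite -ge0_sume_distrr; last by move=> k _; rewrite mule_ge0 ?lee_fin ?isq_ge0.
 rewrite muleA -EFinM le_eqVlt; apply/orP; left; apply/eqP; congr (_%:E * _)%E.
 by rewrite shift_rate.unlock; ring.
have sr0 : (0 <= (srate * Num.sqrt h)%:E)%E by rewrite lee_fin mulr_ge0 ?shift_rate_ge0.
rewrite /f; under eq_integral do rewrite E.
apply: le_trans (integral_sum3_sqr_le mA mD mC) _.
have muls (x y z : \bar R) : (0 <= x -> 0 <= y -> 0 <= z -> 3%:E * (x + y + z) = 3%:E * x + 3%:E * y + 3%:E * z)%E.
 by move=> x0 y0 z0; rewrite ge0_muleDr ?adde_ge0// ge0_muleDr.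
have sq0 (g : R -> R) : (0 <= \int[mu]_x (g x ^+ 2)%:E)%E.
 by apply: integral_ge0 => x _; rewrite lee_fin sqr_ge0.
rewrite (muls _ _ _ (sq0 A) (sq0 D) (sq0 C)).
apply: (@le_trans _ _ ((3 * a ^+ 2 / (sigma * Num.sqrt h) * isq R n)%:E +
  ((srate * Num.sqrt h * `|a| * isq R n)%:E + (srate * Num.sqrt h)%:E * \sum_(1 <= k < n) (isq R (n - k))%:E * f k) +
  (12 * (1 + 8 * L * kap) * (eta + 3 * L ^+ 2 * kap * h))%:E)%E); last first.
 rewrite addeC addeA addeA -!EFinD leeD2r// lee_fin; lra.
apply: leeD; [apply: leeD|].
- apply: (@le_trans _ _ (3%:E * (a ^+ 2 / Num.sqrt (n%:R * w))%:E)%E); first by apply: lee_wpmul2l.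
 rewrite -EFinM lee_fin le_eqVlt; apply/orP; left; apply/eqP.
 rewrite sqrtrM// sqrt_grid_var// /isq; field; by rewrite !gt_eqF.
- have t0 : (0 <= (isq R n)%:E * f 0%N)%E by rewrite mule_ge0 ?lee_fin ?isq_ge0.
 have tS : (0 <= \sum_(1 <= k < n) (isq R (n - k))%:E * f k)%E.
  by apply: sume_ge0 => k _; rewrite mule_ge0 ?lee_fin ?isq_ge0.
 apply: le_trans hD' _; rewrite big_ltn// subn0 (ge0_muleDr _ t0 tS).
 rewrite leeD2r// muleA -EFinM; apply: (@le_trans _ _ ((srate * Num.sqrt h * isq R n)%:E * `|a|%:E)%E).
  by apply: lee_wpmul2l => //; rewrite lee_fin !mulr_ge0 ?isq_ge0 ?shift_rate_ge0.
 by rewrite -EFinM lee_fin; lra.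
- apply: (@le_trans _ _ (3%:E * (4 * (1 + 8 * L * kap) * (eta + 3 * L ^+ 2 * kap * h))%:E)%E); first by apply: lee_wpmul2l.
 by rewrite -EFinM lee_fin; lra.
Qed.

Lemma shift_gronwall : (1 <= r)%N ->
 (f r <= (gronwall_const srate T * (12 * (1 + 8 * L * kap) * (eta + 3 * L ^+ 2 * kap * h) +
    (3 * a ^+ 2 / (sigma * Num.sqrt h) + srate * Num.sqrt h * `|a|) * isq R r))%:E)%E.
Proof.
move=> r1; apply: (@esingular_gronwall R srate T _ _ h r f).
- exact: shift_rate_ge0.
- exact: ltW.
- by rewrite !mulr_ge0// ?addr_ge0// !mulr_ge0// ?sqr_ge0 ?ltW.
- apply: addr_ge0; last by rewrite !mulr_ge0 ?shift_rate_ge0.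
 by apply: divr_ge0; [rewrite mulr_ge0 ?sqr_ge0|rewrite mulr_ge0 ?(ltW sigma0)].
- exact: ltW.
- by move=> n; apply: integral_ge0 => x _; rewrite lee_fin sqr_ge0.
- exact: rhT.
- exact: shift_recursion.
- by rewrite r1 leqnn.
Qed.

End FineGrid.

(** The grid on $[0,\tau]$ is refined: all terms containing the mesh or the defect vanish and the
    smoothed initial law alone remains. The bound says that the density of the law at time [tau] is
    in $L^2$, with a norm of order $\tau^{-1/4}$. *)
Lemma shift_L2 tau a : 0 < tau <= T ->
 (\int[mu]_x ((F tau (x + a) - F tau x) ^+ 2)%:E <= (sconst * a ^+ 2 / Num.sqrt tau)%:E)%E.
Proof.
move=> /andP[tau0 tauT]; apply/lee_addgt0Pr => e e0.
set g := gronwall_const srate T.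
have g0 : 0 <= g by apply: gronwall_const_ge0; [exact: shift_rate_ge0|exact: ltW].
(* [D] collects the coefficients of everything bounded by [ep]; [r] is then chosen so that both the
   defect and the inverse of [r] are below [ep]. *)
pose D := g * (12 * (1 + 8 * L * kap) * (1 + 3 * L ^+ 2 * kap * tau) + srate * Num.sqrt tau * `|a|).
have sr0 := shift_rate_ge0.
have c0 : 0 <= 1 + 8 * L * kap by rewrite addr_ge0// !mulr_ge0.
have c1 : 0 <= 3 * L ^+ 2 * kap * tau by rewrite !mulr_ge0// ?sqr_ge0// ltW.
have D0 : 0 <= D by rewrite mulr_ge0// addr_ge0// !mulr_ge0// addr_ge0.
have D1 : 0 < D + 1 by rewrite ltr_wpDl.
pose ep := e / (D + 1); have ep0 : 0 < ep by rewrite divr_gt0.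
have bl s u : 0 < s < tau -> (forall j, 0 <= u j <= s) -> u @ \oo --> s ->
  {ae P, forall w, b (u j, w) @[j --> \oo] --> b (s, w)}.
 by move=> /andP[s0 st]; apply: b_left; rewrite s0 (lt_le_trans st).
have [r0 hr0] := cell_defect_eventually tau0 (dv_b dv) (dv_bL dv) bl ep0.
pose r := (maxn r0 (Num.trunc ep^-1).+1).
have r_gt0 : (0 < r)%N by rewrite leq_max orbT.
have rR : 0 < r%:R :> R by rewrite ltr0n.
have rinv : r%:R^-1 <= ep.
 rewrite -[leRHS]invrK lef_pV2 ?posrE ?invr_gt0//.
 by apply: (le_trans (ltW (truncnS_gt _))); rewrite ler_nat leq_maxr.
have h0 : 0 < tau / r%:R by rewrite divr_gt0.
have rh : r%:R * (tau / r%:R) = tau by rewrite mulrCA mulfV ?mulr1// gt_eqF.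
have rhT : r%:R * (tau / r%:R) <= T by rewrite rh.
have := @shift_gronwall (tau / r%:R) a ep r h0 rhT (ltW ep0) (hr0 r (leq_maxl _ _) r_gt0) r_gt0.
rewrite rh => /le_trans; apply; rewrite -EFinD lee_fin -/g.
have st : 0 < Num.sqrt tau by rewrite sqrtr_gt0.
have sr : 0 < Num.sqrt r%:R :> R by rewrite sqrtr_gt0.
have sh : Num.sqrt (tau / r%:R) = Num.sqrt tau / Num.sqrt r%:R.
 by rewrite sqrtrM ?ltW// sqrtrV// ltW.
have e1 : 3 * a ^+ 2 / (sigma * Num.sqrt (tau / r%:R)) * isq R r = 3 / sigma * a ^+ 2 / Num.sqrt tau.
 by rewrite sh /isq; field; rewrite !gt_eqF.
have e2 : srate * Num.sqrt (tau / r%:R) * `|a| * isq R r = srate * Num.sqrt tau * `|a| / r%:R.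
 by rewrite sh /isq -{3}(sqr_sqrtr (ltW rR)); field; rewrite !gt_eqF.
rewrite [X in g * (_ + X)](_ : _ = 3 / sigma * a ^+ 2 / Num.sqrt tau + srate * Num.sqrt tau * `|a| / r%:R); last by rewrite mulrDl e1 e2.
have -> : 3 * L ^+ 2 * kap * (tau / r%:R) = 3 * L ^+ 2 * kap * tau / r%:R by rewrite mulrA.
have i1 : srate * Num.sqrt tau * `|a| / r%:R <= srate * Num.sqrt tau * `|a| * ep.
 by rewrite ler_wpM2l// !mulr_ge0.
have i2 : 3 * L ^+ 2 * kap * tau / r%:R <= 3 * L ^+ 2 * kap * tau * ep by rewrite ler_wpM2l.
have c0' : 0 <= 12 * (1 + 8 * L * kap) by rewrite mulr_ge0.
have i3 := ler_wpM2l c0' (lerD (lexx ep) i2).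
have Dep : D * ep <= e.
 by rewrite /ep mulrCA ler_piMr ?ltW// ltr_pdivrMr//; lra.
apply: (@le_trans _ _ (g * (3 / sigma * a ^+ 2 / Num.sqrt tau) + D * ep)); last first.
 by rewrite lerD// shift_const.unlock -/g; lra.
have -> : g * (3 / sigma * a ^+ 2 / Num.sqrt tau) + D * ep =
  g * (12 * (1 + 8 * L * kap) * (ep + 3 * L ^+ 2 * kap * tau * ep) +
   (3 / sigma * a ^+ 2 / Num.sqrt tau + srate * Num.sqrt tau * `|a| * ep)).
 by rewrite /D; ring.
by rewrite ler_wpM2l// lerD// lerD.
Qed.

End ShiftRegularity.

(** * Conditional means over one Gaussian step *)

Section GaussianMeans.
Context d (Omega : measurableType d) (R : realType) (P : probability Omega R).
Notation mu := (@lebesgue_measure R).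
Notation "''Ex' f" := (\int[P]_w f w) (at level 10, f at level 9).
Variables (G : set (set Omega)) (Z Y Phi : Omega -> R) (w c : R).
Hypotheses (Gm : G `<=` measurable) (w0 : 0 < w) (mZ : measT Z).
Hypothesis GZ : gaussian_indep P G Z w.
Hypotheses (sY : sub_measurable G Y) (sPhi : sub_measurable G Phi) (Pc : forall o, `|Phi o| <= c).

Let mY : measT Y. Proof. exact: sub_measurable_measurable Gm _ _ _ sY. Qed.
Let mPhi : measT Phi. Proof. exact: sub_measurable_measurable Gm _ _ _ sPhi. Qed.
Let c0 : 0 <= c. Proof. by rewrite (le_trans _ (Pc point)). Qed.

Let sample (f : (R * R) * R -> R) (e : R) : measT f ->
 (forall o z, `|f ((Phi o, Y o), z)| <= e) ->
 'Ex (fun o => f ((Phi o, Y o), Z o)) = 'Ex (fun o => \int[mu]_z (f ((Phi o, Y o), z) * gk w z)).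
Proof.
move=> mf fe; have aV := sub_measurable_pair sPhi sY.
apply: (@Rintegral_gaussian_sample_range _ _ _ P _ _ _ Z w f e _ mZ _ mf fe).
 exact: (sub_measurable_measurable Gm aV).
by move=> A B mA mB; apply: GZ => //; exact: aV.
Qed.

Lemma gaussian_kernel_mean v x : 0 < v ->
 'Ex (fun o => Phi o * gk v (x - (Y o + Z o))) = 'Ex (fun o => Phi o * gk (v + w) (x - Y o)).
Proof.
move=> v0; pose f (q : (R * R) * R) := q.1.1 * gk v (x - (q.1.2 + q.2)).
have mf : measT f.
 apply: measurable_funM; first exact: measurableT_comp.
 apply: measurableT_comp; first exact: meas_gk.
 by apply: measurable_funB => //; apply: measurable_funD => //; exact: measurableT_comp.
have fe o z : `|f ((Phi o, Y o), z)| <= c * (Num.sqrt v)^-1.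
 by rewrite /f/= normrM ler_pM ?Pc// ger0_norm ?gk_ge0//; exact: gk_ub.
rewrite (sample mf fe); apply: eq_Rintegral => o _; rewrite /f/=.
have -> : \int[mu]_z (Phi o * gk v (x - (Y o + z)) * gk w z) =
  \int[mu]_z (Phi o * (gk v (x - Y o - z) * gk w z)).
 by apply: eq_Rintegral => z _; rewrite -mulrA; congr (_ * (gk _ _ * _)); ring.
rewrite RintegralZl//.
 by congr (_ * _); rewrite /Rintegral gk_semigroup.
apply/integrableP; split.
 unEFin; apply: measurable_funM; last exact: meas_gk.
 by apply: meas_kshift; exact: meas_gk.
under eq_integral do rewrite /= ger0_norm ?mulr_ge0 ?gk_ge0//.
by rewrite gk_semigroup// ltry.
Qed.

Lemma gaussian_heav_mean y : 'Ex (fun o => Phi o * heav (Y o + Z o) y) =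
 \int[mu]_z ('Ex (fun o => Phi o * heav (Y o) (y - z)) * gk w z).
Proof.
pose f (q : (R * R) * R) := q.1.1 * heav (q.1.2 + q.2) y.
have mf : measT f.
 apply: measurable_funM; first exact: measurableT_comp.
 by apply: meas_heav => //; apply: measurable_funD => //; exact: measurableT_comp.
have fe o z : `|f ((Phi o, Y o), z)| <= c.
 by rewrite /f/= normrM -[leRHS]mulr1 ler_pM ?Pc// norm_heav_le.
rewrite (sample mf fe).
pose g (q : Omega * R) := Phi q.1 * heav (Y q.1) (y - q.2) * gk w q.2.
have mg : measT g.
 apply: measurable_funM; last by apply: measurableT_comp => //; exact: meas_gk.
 apply: measurable_funM; first exact: meas_fst_comp.
 by apply: meas_heav; [exact: meas_fst_comp|exact: measurable_funB].
have ge q : `|g q| <= c * gk w q.2.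
 rewrite /g normrM [X in _ * X]ger0_norm ?gk_ge0// ler_wpM2r ?gk_ge0//.
 by rewrite normrM -[leRHS]mulr1 ler_pM ?Pc// norm_heav_le.
have -> : 'Ex (fun o => \int[mu]_z (f ((Phi o, Y o), z) * gk w z)) = 'Ex (fun o => \int[mu]_z g (o, z)).
 by apply: eq_Rintegral => o _; apply: eq_Rintegral => z _; rewrite /f /g/= heav_shift.
have bP z : bmf (fun o => Phi o * heav (Y o) (y - z)).
 by apply: bmfM; [split => //; exists c|exact: bmf_heav].
rewrite (@Rintegral_swap _ _ _ _ R P mu g mg).
- apply: eq_Rintegral => z _; rewrite /g/= mulrC -ExZ//.
 by apply: eq_Rintegral => o _; rewrite mulrC.
- move=> o; apply: (@le_integrable _ _ _ mu _ _ _ (fun z => (c * gk w z)%:E)) => //.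
 + by unEFin; exact: (meas_slice1 o mg).
 + by move=> z _; rewrite /= lee_fin (le_trans (ge (o, z)))// ler_norm.
 + by have := integrableZl measurableT c (integrable_gk w); apply: eq_integrable.
- move=> z; apply: (@integrable_bdd _ _ _ P (fun o => g (o, z)) (c * gk w z)).
  exact: meas_slice2.
 by move=> o; exact: (ge (o, z)).
- apply: (@le_lt_trans _ _ (\int[P]_o c%:E)%E); last first.
  by rewrite integral_cst//= probability_setT mule1 ltry.
 have mng : measT (fun q => `|g q|) by exact: measurableT_comp.
 apply: ge0_le_integral => //.
 + by move=> o _; apply: integral_ge0 => z _; rewrite lee_fin.
 + by apply: (@meas_integral1 _ _ _ _ R mu _ mng) => q; exact: normr_ge0.
 move=> o _; apply: (@le_trans _ _ (\int[mu]_z (c%:E * (gk w z)%:E))%E).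
  apply: ge0_le_integral => //.
  * by unEFin; exact: (meas_slice1 o mng).
  * by apply: measurable_funeM; unEFin; exact: meas_gk.
  * by move=> z _; rewrite -EFinM lee_fin; exact: (ge (o, z)).
 have mgk : measT (fun z => (gk w z)%:E) by unEFin; exact: meas_gk.
 have gk0 z : (0 <= (gk w z)%:E)%E by rewrite lee_fin gk_ge0.
 have c0' : (0 <= c%:E)%E by rewrite lee_fin.
 by rewrite (ge0_integralZl mu measurableT mgk (fun z _ => gk0 z) c0') integral_gk mule1.
Qed.

End GaussianMeans.

Section Clip.
Context (R : realType).

Lemma clip01_lip (u v : R) : `|clip01 u - clip01 v| <= `|u - v|.
Proof.
have mm (a b c : R) : `|Num.min a b - Num.min a c| <= `|b - c|.
 have n1 := ler_norm (b - c); have n2 := ler_norm (- (b - c)); rewrite normrN in n2.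
 rewrite ler_norml !minEle; case: (leP a b) => h1; case: (leP a c) => h2;
  apply/andP; split; lra.
have MM (a b c : R) : `|Num.max a b - Num.max a c| <= `|b - c|.
 have n1 := ler_norm (b - c); have n2 := ler_norm (- (b - c)); rewrite normrN in n2.
 rewrite ler_norml !maxEle; case: (leP a b) => h1; case: (leP a c) => h2;
  apply/andP; split; lra.
by rewrite /clip01 (le_trans (MM _ _ _)).
Qed.

End Clip.

(** * Jensen gap of the flux under Gaussian smoothing *)

Section Jensen.
Context (R : realType).
Notation mu := (@lebesgue_measure R).
Variables (Lam lam : R -> R) (L k : R).
Hypothesis fb : flux_bounds Lam lam L k.
Variables (w : R) (F H : R -> R).
Hypotheses (w0 : 0 < w) (mF : measT F) (mH : measT H).
Hypotheses (F01 : forall y, in01 (F y)) (HE : forall y, H y = Lam (F y) - Lam 0).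

Let k0 : 0 <= k. Proof. exact: fluxk0 fb. Qed.
Let z01 : in01 (0 : R). Proof. by rewrite /in01 lexx ler01. Qed.

Let FB y : `|F y| <= 1.
Proof. by have /andP[? ?] := F01 y; rewrite ger0_norm. Qed.

Let HB y : `|H y| <= L.
Proof.
rewrite HE; apply: le_trans (flux_Lam fb z01 (F01 y)) _; rewrite subr0.
by rewrite -[leRHS]mulr1 ler_wpM2l ?FB// (fluxL0 fb).
Qed.

Definition gaussian_mean (f : R -> R) y := \int[mu]_z (f (y - z) * gk w z).

Let mshift (f : R -> R) y : measT f -> measT (fun z : R => f (y - z)).
Proof. by move=> mf; exact: meas_kshift. Qed.

Lemma integrable_gaussian (f : R -> R) (c : R) : measT f -> (forall z, `|f z| <= c) ->
 mu.-integrable setT (fun z => (f z * gk w z)%:E).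
Proof.
move=> mf fc; under eq_fun do rewrite mulrC.
by apply: (@integrable_bounded _ _ _ mu (gk w) _ c) => //; exact: integrable_gk.
Qed.

Lemma gaussian_mean_in01 y : in01 (gaussian_mean F y).
Proof.
have iF := integrable_gaussian (mshift y mF) (fun z => FB (y - z)).
apply/andP; split; first by apply: Rintegral_ge0 => z _; rewrite mulr_ge0 ?gk_ge0//; case/andP: (F01 (y - z)).
have -> : 1 = \int[mu]_z gk w z :> R by rewrite /Rintegral integral_gk.
apply: le_Rintegral => //; first exact: integrable_gk.
by move=> z _; rewrite -[leRHS]mul1r ler_wpM2r ?gk_ge0//; case/andP: (F01 (y - z)).
Qed.

(** Expanding [Lam] at the smoothed value [m], the first-order term integrates to 0 and the
    remainder is at most [k] times a variance. The variance is then enlarged to the quadratic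
    deviation from [F y], which is a translation modulus. *)
Lemma jensen_gap y : (`|gaussian_mean H y - (Lam (gaussian_mean F y) - Lam 0)|%:E <=
 k%:E * \int[mu]_z ((F (y - z) - F y) ^+ 2 * gk w z)%:E)%E.
Proof.
set m := gaussian_mean F y; have m01 : in01 m by exact: gaussian_mean_in01.
have iF := integrable_gaussian (mshift y mF) (fun z => FB (y - z)).
have iH := integrable_gaussian (mshift y mH) (fun z => HB (y - z)).
have i1 : \int[mu]_z gk w z = 1 :> R by rewrite /Rintegral integral_gk.
pose q z := H (y - z) - (Lam m - Lam 0) - lam m * (F (y - z) - m).
have mq : measT q.
 apply: measurable_funB; first by apply: measurable_funB => //; exact: mshift.
 by apply: measurable_funM => //; apply: measurable_funB => //; exact: mshift.
have qb z : `|q z| <= k * (F (y - z) - m) ^+ 2.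
 rewrite /q HE; apply: le_trans (flux_taylor fb m01 (F01 (y - z))).
 by rewrite le_eqVlt; apply/orP; left; apply/eqP; congr (`|_|); ring.
have E : gaussian_mean H y - (Lam m - Lam 0) = \int[mu]_z (q z * gk w z).
 have iFm : mu.-integrable setT (fun z => ((F (y - z) - m) * gk w z)%:E).
  apply: (integrable_gaussian (c := 1 + `|m|)).
   by apply: measurable_funB => //; exact: mshift.
  by move=> z; apply: le_trans (ler_normB _ _) _; rewrite lerD2r.
 have e0 : \int[mu]_z ((F (y - z) - m) * gk w z) = 0.
  have -> : \int[mu]_z ((F (y - z) - m) * gk w z) = \int[mu]_z (F (y - z) * gk w z - m * gk w z).
   by apply: eq_Rintegral => z _; ring.
  rewrite RintegralB//; last by have := integrableZl measurableT m (integrable_gk w); apply: eq_integrable.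
  rewrite RintegralZl//; last exact: integrable_gk.
  by rewrite i1 mulr1 -/(gaussian_mean F y) -/m subrr.
 have iHm : mu.-integrable setT (fun z => ((H (y - z) - (Lam m - Lam 0)) * gk w z)%:E).
  apply: (integrable_gaussian (c := L + `|Lam m - Lam 0|)).
   by apply: measurable_funB => //; exact: mshift.
  by move=> z; apply: le_trans (ler_normB _ _) _; rewrite lerD2r.
 have -> : \int[mu]_z (q z * gk w z) = \int[mu]_z ((H (y - z) - (Lam m - Lam 0)) * gk w z - lam m * ((F (y - z) - m) * gk w z)).
  by apply: eq_Rintegral => z _; rewrite /q; ring.
 rewrite RintegralB//; last by have := integrableZl measurableT (lam m) iFm; apply: eq_integrable.
 rewrite RintegralZl// e0 mulr0 subr0.
 have -> : \int[mu]_z ((H (y - z) - (Lam m - Lam 0)) * gk w z) = \int[mu]_z (H (y - z) * gk w z - (Lam m - Lam 0) * gk w z).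
  by apply: eq_Rintegral => z _; ring.
 rewrite RintegralB//; last by have := integrableZl measurableT (Lam m - Lam 0) (integrable_gk w); apply: eq_integrable.
 by rewrite RintegralZl ?i1 ?mulr1//; exact: integrable_gk.
rewrite E; apply: le_trans (abs_Rintegral_le _ _) _.
 by apply: measurable_funM => //; exact: meas_gk.
have msq (a : R) : measT (fun z : R => ((F (y - z) - a) ^+ 2 * gk w z)%:E).
 unEFin; apply: measurable_funM; last exact: meas_gk.
 by apply: measurable_funX; apply: measurable_funB => //; exact: mshift.
have sq0 (a z : R) : (0 <= ((F (y - z) - a) ^+ 2 * gk w z)%:E)%E by rewrite lee_fin mulr_ge0 ?sqr_ge0 ?gk_ge0.
have k0' : (0 <= k%:E)%E by rewrite lee_fin.
apply: (@le_trans _ _ (k%:E * \int[mu]_z ((F (y - z) - m) ^+ 2 * gk w z)%:E)%E).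
 rewrite -(ge0_integralZl mu measurableT (msq m) (fun z _ => sq0 m z) k0').
 apply: ge0_le_integral => //.
 - mnorm; apply: measurable_funM => //; exact: meas_gk.
 - by apply: measurable_funeM; exact: msq.
 - move=> z _; rewrite -EFinM lee_fin normrM [X in _ * X]ger0_norm ?gk_ge0// mulrA.
  by rewrite ler_wpM2r ?gk_ge0.
apply: lee_wpmul2l => //.
exact: (variance_le (F y) (mshift y mF) (fun z => FB (y - z))).
Qed.

(** Integrating in [y] first makes the translation modulus appear for each [z]; the Gaussian second
    moment, at most [6 * w], does the rest. *)
Lemma integral_jensen_gap (C : R) : 0 <= C ->
 (forall a, \int[mu]_x ((F (x + a) - F x) ^+ 2)%:E <= (C * a ^+ 2)%:E)%E ->
 (\int[mu]_y `|gaussian_mean H y - (Lam (gaussian_mean F y) - Lam 0)|%:E <= (6 * k * C * w)%:E)%E.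
Proof.
move=> C0 hC.
pose g (q : R * R) := (F (q.1 - q.2) - F q.1) ^+ 2 * gk w q.2.
have mg : measT g.
 apply: measurable_funM; last by apply: measurableT_comp => //; exact: meas_gk.
 apply: measurable_funX; apply: measurable_funB; last exact: measurableT_comp.
 by apply: measurableT_comp => //; exact: measurable_funB.
have g0 q : 0 <= g q by rewrite mulr_ge0 ?sqr_ge0 ?gk_ge0.
have mi := @meas_integral1 _ _ _ _ R mu g mg g0.
have i0 (y : R) : (0 <= \int[mu]_z (g (y, z))%:E)%E by apply: integral_ge0 => z _; rewrite lee_fin.
have k0' : (0 <= k%:E)%E by rewrite lee_fin.
have mgm (f : R -> R) : measT f -> measT (gaussian_mean f).
 move=> mf; apply: (@meas_Rintegral1 _ _ _ _ R mu (fun q : R * R => f (q.1 - q.2) * gk w q.2)).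
 apply: measurable_funM; last by apply: measurableT_comp => //; exact: meas_gk.
 by apply: measurableT_comp => //; exact: measurable_funB.
have mLm : measT (fun y => Lam (gaussian_mean F y) - Lam 0).
 apply: measurable_funB => //.
 rewrite (_ : (fun y => Lam (gaussian_mean F y)) = (fun u => Lam (clip01 u)) \o gaussian_mean F); last first.
  by apply/funext => y; rewrite /= clip01_id// gaussian_mean_in01.
 apply: measurableT_comp; last exact: mgm.
 apply: continuous_measurable_fun => u; apply/cvgrPdist_le => e e0.
 have L1 : 0 < L + 1 by rewrite ltr_wpDl// (fluxL0 fb).
 near=> v; apply: le_trans (flux_Lam fb (clip01_in01 v) (clip01_in01 u)) _.
 apply: (@le_trans _ _ ((L + 1) * `|u - v|)); last first.
  by rewrite -ler_pdivlMl//; near: v; apply: cvgr_dist_le => //; rewrite mulr_gt0 ?invr_gt0.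
 apply: ler_pM => //; [exact: (fluxL0 fb)|by rewrite lerDl|].
 exact: clip01_lip.
apply: (@le_trans _ _ (\int[mu]_y (k%:E * \int[mu]_z (g (y, z))%:E))%E).
 apply: ge0_le_integral => //.
 - by mnorm; apply: measurable_funB => //; exact: mgm.
 - exact: measurable_funeM.
 - by move=> y _; exact: jensen_gap.
rewrite (ge0_integralZl mu measurableT mi (fun y _ => i0 y) k0').
rewrite (@integral_swap _ _ _ _ R mu mu g mg g0).
have -> : 6 * k * C * w = k * (C * (6 * w)) by ring.
rewrite EFinM lee_wpmul2l//.
have mzg : measT (fun z : R => (z ^+ 2 * gk w z)%:E).
 by unEFin; apply: measurable_funM => //; exact: meas_gk.
have zg0 (z : R) : (0 <= (z ^+ 2 * gk w z)%:E)%E by rewrite lee_fin mulr_ge0 ?sqr_ge0 ?gk_ge0.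
have C0' : (0 <= C%:E)%E by rewrite lee_fin.
apply: (@le_trans _ _ (\int[mu]_z (C%:E * (z ^+ 2 * gk w z)%:E))%E); last first.
 rewrite (ge0_integralZl mu measurableT mzg (fun z _ => zg0 z) C0') EFinM lee_wpmul2l//.
 exact: integral_sqr_gk.
apply: ge0_le_integral => //.
- by move=> z _; apply: integral_ge0 => y _; rewrite lee_fin.
- exact: (@meas_integral2 _ _ _ _ R mu g mg g0).
- exact: measurable_funeM.
move=> z _; rewrite /g/=.
have ms : measT (fun y : R => ((F (y - z) - F y) ^+ 2)%:E).
 unEFin; apply: measurable_funX; apply: measurable_funB => //.
 exact: meas_kshift2.
have s0 (y : R) : (0 <= ((F (y - z) - F y) ^+ 2)%:E)%E by rewrite lee_fin sqr_ge0.
have gz : (0 <= (gk w z)%:E)%E by rewrite lee_fin gk_ge0.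
have -> : (\int[mu]_x ((F (x - z) - F x) ^+ 2 * gk w z)%:E = \int[mu]_x ((gk w z)%:E * ((F (x - z) - F x) ^+ 2)%:E))%E.
 by apply: eq_integral => y _; rewrite -EFinM mulrC.
rewrite (ge0_integralZl mu measurableT ms (fun y _ => s0 y) gz).
apply: (@le_trans _ _ ((gk w z)%:E * (C * (- z) ^+ 2)%:E)%E).
 by apply: lee_wpmul2l => //; exact: hC.
by rewrite -!EFinM lee_fin sqrrN; lra.
Unshelve. all: by end_near. Qed.

End Jensen.

(** * $L^1$ bounds for distribution functions and mean kernels *)

Section CdfDifference.
Context d (Omega : measurableType d) (R : realType) (P : probability Omega R).
Notation mu := (@lebesgue_measure R).
Notation "''Ex' f" := (\int[P]_w f w) (at level 10, f at level 9).

Lemma integral_rcdf_diff (X Y : Omega -> R) (c : R) : measT X -> measT Y ->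
 0 <= c -> {ae P, forall w, `|X w - Y w| <= c} ->
 (\int[mu]_x `|rcdf P X x - rcdf P Y x|%:E <= c%:E)%E.
Proof.
move=> mX mY c0 ae.
pose f (q : Omega * R) := heav (X q.1) q.2 - heav (Y q.1) q.2.
have mf : measT f.
 by apply: measurable_funB; apply: meas_heav => //; exact: meas_fst_comp.
have -> : (\int[mu]_x `|rcdf P X x - rcdf P Y x|%:E = \int[mu]_x `|'Ex (fun w => f (w, x))|%:E)%E.
 by apply: eq_integral => x _; rewrite /rcdf -ExB//; exact: bmf_heav.
apply: le_trans (integral_Ex_le P mf) _.
have mnf : measT (fun q => `|f q|) by exact: measurableT_comp.
apply: (@le_trans _ _ (\int[P]_w c%:E)%E).
 apply: ae_ge0_le_integral => //.
 - by move=> w _; apply: integral_ge0 => x _; rewrite lee_fin.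
 - by apply: (@meas_integral1 _ _ _ _ R mu _ mnf) => q; exact: normr_ge0.
 - by apply: filterS ae => w h _; rewrite /f/= integral_heavB lee_fin.
by rewrite integral_cst//= probability_setT mule1.
Qed.

Lemma integral_norm_kernel (b X : Omega -> R) (v L : R) : 0 < v -> 0 <= L ->
 measT b -> (forall w, `|b w| <= L) -> measT X ->
 (\int[P]_w \int[mu]_x `|b w * gk v (x - X w)|%:E <= L%:E)%E.
Proof.
move=> v0 L0 mb bL mX.
pose f (q : Omega * R) := b q.1 * gk v (q.2 - X q.1).
have mf : measT f.
 apply: measurable_funM; first exact: meas_fst_comp.
 by apply: meas_joint_kernel => //; exact: meas_gk.
have mnf : measT (fun q => `|f q|) by exact: measurableT_comp.
apply: (@le_trans _ _ (\int[P]_w L%:E)%E); last by rewrite integral_cst//= probability_setT mule1.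
apply: ge0_le_integral => //.
- by move=> w _; apply: integral_ge0 => x _; rewrite lee_fin.
- by apply: (@meas_integral1 _ _ _ _ R mu _ mnf) => q; exact: normr_ge0.
move=> w _; rewrite /f/=.
have mg : measT (fun x : R => `|gk v (x - X w)|%:E).
 by mnorm; apply: meas_kshift2; exact: meas_gk.
have g0 x : (0 <= `|gk v (x - X w)|%:E)%E by rewrite lee_fin.
have b0 : (0 <= `|b w|%:E)%E by rewrite lee_fin.
have -> : (\int[mu]_x `|b w * gk v (x - X w)|%:E = \int[mu]_x (`|b w|%:E * `|gk v (x - X w)|%:E))%E.
 by apply: eq_integral => x _; rewrite normrM EFinM.
rewrite (ge0_integralZl mu measurableT mg (fun x _ => g0 x) b0).
rewrite integral_kshift2; last exact: meas_gk.
apply: (@le_trans _ _ (`|b w|%:E * 1%:E)%E); first by apply: lee_wpmul2l => //; exact: integral_norm_gk.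
by rewrite mule1 lee_fin.
Qed.

Lemma integral_norm_Ex_kernel (b X : Omega -> R) (v L : R) : 0 < v -> 0 <= L ->
 measT b -> (forall w, `|b w| <= L) -> measT X ->
 (\int[mu]_x `|'Ex (fun w => b w * gk v (x - X w))|%:E <= L%:E)%E.
Proof.
move=> v0 L0 mb bL mX.
apply: le_trans (integral_norm_kernel v0 L0 mb bL mX).
apply: (integral_Ex_le P (f := fun q => b q.1 * gk v (q.2 - X q.1))).
apply: measurable_funM; first exact: meas_fst_comp.
by apply: meas_joint_kernel => //; exact: meas_gk.
Qed.

End CdfDifference.

Section LamClip.
Context (R : realType) (Lam lam : R -> R) (L k : R).
Hypothesis fb : flux_bounds Lam lam L k.

Lemma continuous_Lam_clip01 : continuous (fun u => Lam (clip01 u)).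
Proof.
move=> u; apply/cvgrPdist_le => e e0.
have L1 : 0 < L + 1 by rewrite ltr_wpDl// (fluxL0 fb).
near=> v; apply: le_trans (flux_Lam fb (clip01_in01 v) (clip01_in01 u)) _.
apply: (@le_trans _ _ ((L + 1) * `|u - v|)); last first.
 by rewrite -ler_pdivlMl//; near: v; apply: cvgr_dist_le => //; rewrite mulr_gt0 ?invr_gt0.
apply: ler_pM => //; [exact: (fluxL0 fb)|by rewrite lerDl|].
exact: clip01_lip.
Unshelve. all: by end_near. Qed.

End LamClip.

Section BlockSums.
Context (R : realType).

Lemma sum_blocks (V : nmodType) (G : nat -> V) (n r : nat) :
 \sum_(0 <= j < n * r) G j = \sum_(0 <= k < n) \sum_(0 <= i < r) G (k * r + i)%N.
Proof.
elim: n => [|n IH]; first by rewrite mul0n !big_geq.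
rewrite big_nat_recr//= -IH mulSnr (big_cat_nat (n := (n * r)%N))//= ?leq_addr//.
congr (_ + _); rewrite -{1}(add0n (n * r)%N) big_addn addKn.
by apply: eq_big_nat => i _; rewrite addnC.
Qed.

End BlockSums.

(** * The drift of the limit at two times *)

Section LimitQuadrature.
Context d (Omega : measurableType d) (R : realType) (P : probability Omega R).
Notation mu := (@lebesgue_measure R).
Notation "''Ex' f" := (\int[P]_w f w) (at level 10, f at level 9).
Variables (T sigma L : R).
Hypotheses (T0 : 0 < T) (sigma0 : 0 < sigma).
Variables (past : R -> set (set Omega)) (W X : R -> Omega -> R) (b : R * Omega -> R) (B : R -> Omega -> R).
Hypothesis dv : driven P T sigma L past W X b B.
Hypothesis b_left : forall s (u : nat -> R), 0 < s < T -> (forall j, 0 <= u j <= s) ->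
 u @ \oo --> s -> {ae P, forall w, b (u j, w) @[j --> \oo] --> b (s, w)}.
Variables (Lam lam : R -> R) (k : R).
Hypothesis fb : flux_bounds Lam lam L k.
Hypothesis BE : forall s w, B s w = lamF P (X s) lam (X s w).

Notation kap := (kappa T sigma).
Notation sconst := (shift_const T sigma L).
Notation F := (fun s => rcdf P (X s)).
Notation H := (fun s => mean_flux P (X s) (B s)).

Let L0 : 0 <= L. Proof. exact: fluxL0 fb. Qed.
Let k0 : 0 <= k. Proof. exact: fluxk0 fb. Qed.
Let sc0 : 0 <= sconst. Proof. exact: (shift_const_ge0 T0 sigma0 dv). Qed.

Lemma mean_flux_lamF s y : 0 < s <= T -> H s y = Lam (F s y) - Lam 0.
Proof.
move=> sT; rewrite -(Ex_lamF_heav (dv_Xm dv s) fb (driven_unif_cont sigma0 dv sT)) /mean_flux.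
by apply: eq_Rintegral => w _; rewrite BE.
Qed.

Section Pair.
Variables (tau s : R).
Hypotheses (tau0 : 0 < tau) (taus : tau < s) (sT : s <= T).

Let w := sigma ^+ 2 * (s - tau).
Let Z := increment sigma W tau s.
(** The position at time [s] if the drift were switched off after [tau]: its distribution function
    is a Gaussian smoothing of the one at [tau]. *)
Let Xh o := X tau o + Z o.

Let w0 : 0 < w. Proof. by rewrite mulr_gt0 ?exprn_gt0// subr_gt0. Qed.
Let s0 : 0 < s. Proof. exact: lt_trans tau0 taus. Qed.
Let tauT : 0 <= tau <= T. Proof. by rewrite ltW//= (le_trans (ltW taus)). Qed.
Let mZ : measT Z. Proof. exact: (meas_increment dv). Qed.
Let indZ : gaussian_indep P (past tau) Z w.
Proof. by apply: (dv_ind dv) => //; exact: ltW. Qed.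
Let mXh : measT Xh.
Proof. by apply: measurable_funD => //; exact: (dv_Xm dv). Qed.

Let Hh_mean y : mean_flux P Xh (B tau) y = gaussian_mean w (H tau) y.
Proof.
exact: (gaussian_heav_mean (dv_past dv (s := tau)) mZ indZ (dv_X dv tauT) (dv_B dv tauT) (dv_BL dv tau)).
Qed.

Let Fh_mean y : rcdf P Xh y = gaussian_mean w (F tau) y.
Proof.
have s1 : sub_measurable (past tau) (fun _ : Omega => 1 : R) by apply/sub_measurableP; exact: measurable_cst.
have n1 (o : Omega) : `|1 : R| <= 1 by rewrite normr1.
have := gaussian_heav_mean (dv_past dv (s := tau)) mZ indZ (dv_X dv tauT) s1 n1 y.
have -> : 'Ex (fun o => 1 * heav (X tau o + Z o) y) = rcdf P Xh y.
 by apply: eq_Rintegral => o _; rewrite mul1r.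
move=> ->; rewrite /gaussian_mean; apply: eq_Rintegral => z _; congr (_ * _).
by apply: eq_Rintegral => o _; rewrite mul1r.
Qed.

(** With the drift switched off, the flux transported from [tau] misses the flux function of the
    smoothed distribution function by a Jensen gap, of order $(s-\tau)/\sqrt\tau$ by [shift_L2].
    Switching it on moves the distribution function by at most $L(s-\tau)$. *)
Lemma flux_diff_L1 : (\int[mu]_y `|H s y - mean_flux P Xh (B tau) y|%:E <=
 (L ^+ 2 * (s - tau) + 6 * k * (sconst / Num.sqrt tau) * (sigma ^+ 2 * (s - tau)))%:E)%E.
Proof.
have tT : 0 < tau <= T by rewrite tau0/=; case/andP: tauT.
have ssT : 0 < s <= T by rewrite s0.
have mHs : measT (H s) by apply: meas_mean_flux; [exact: (dv_Xm dv)|exact: (dv_Bm dv)].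
have mHt : measT (H tau) by apply: meas_mean_flux; [exact: (dv_Xm dv)|exact: (dv_Bm dv)].
have mHh : measT (mean_flux P Xh (B tau)) by apply: meas_mean_flux => //; exact: (dv_Bm dv).
have mFs : measT (F s) by apply: meas_rcdf; exact: (dv_Xm dv).
have mFt : measT (F tau) by apply: meas_rcdf; exact: (dv_Xm dv).
have mFh : measT (rcdf P Xh) by exact: meas_rcdf.
have Ft01 y : in01 (F tau y) by apply: rcdf_in01; exact: (dv_Xm dv).
have Fs01 y : in01 (F s y) by apply: rcdf_in01; exact: (dv_Xm dv).
have Fh01 y : in01 (rcdf P Xh y) by exact: rcdf_in01.
have HtE y : H tau y = Lam (F tau y) - Lam 0 by exact: mean_flux_lamF.
pose gap y := mean_flux P Xh (B tau) y - (Lam (rcdf P Xh y) - Lam 0).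
have gapE y : gap y = gaussian_mean w (H tau) y - (Lam (gaussian_mean w (F tau) y) - Lam 0).
 by rewrite /gap Hh_mean Fh_mean.
have C0 : 0 <= sconst / Num.sqrt tau by rewrite divr_ge0.
have hgap : (\int[mu]_y `|gap y|%:E <= (6 * k * (sconst / Num.sqrt tau) * w)%:E)%E.
 have -> : (\int[mu]_y `|gap y|%:E = \int[mu]_y `|gaussian_mean w (H tau) y - (Lam (gaussian_mean w (F tau) y) - Lam 0)|%:E)%E.
  by apply: eq_integral => y _; rewrite gapE.
 apply: (integral_jensen_gap fb w0 mFt mHt Ft01 HtE C0) => a.
 apply: le_trans (shift_L2 T0 sigma0 dv b_left a tT) _.
 by rewrite lee_fin le_eqVlt; apply/orP; left; apply/eqP; ring.
have hF : (\int[mu]_y `|F s y - rcdf P Xh y|%:E <= (L * (s - tau))%:E)%E.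
 apply: integral_rcdf_diff => //; first exact: (dv_Xm dv).
  by rewrite mulr_ge0// subr_ge0 ltW.
 by apply: filterS (driven_step dv) => o ho; apply: ho => //; exact: ltW.
have mdF : measT (fun y => `|F s y - rcdf P Xh y|%:E).
 by mnorm; exact: measurable_funB.
have mgap0 : measT gap.
 rewrite (_ : gap = fun y => mean_flux P Xh (B tau) y - (Lam (rcdf P Xh y) - Lam 0))//.
 apply: measurable_funB => //; apply: measurable_funB => //.
 rewrite (_ : (fun y => Lam (rcdf P Xh y)) = (fun u => Lam (clip01 u)) \o rcdf P Xh); last first.
  by apply/funext => y; rewrite /= clip01_id.
 apply: measurableT_comp => //; apply: continuous_measurable_fun; exact: continuous_Lam_clip01 fb.
have mgap : measT (fun y => `|gap y|%:E).
 by unEFin; exact: measurableT_comp.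
have L0' : (0 <= L%:E)%E by rewrite lee_fin.
have dF0 y : (0 <= `|F s y - rcdf P Xh y|%:E)%E by rewrite lee_fin.
have gap0 y : (0 <= `|gap y|%:E)%E by rewrite lee_fin.
have mLF : measT (fun y => L%:E * `|F s y - rcdf P Xh y|%:E)%E by exact: measurable_funeM.
have LF0 y : (0 <= L%:E * `|F s y - rcdf P Xh y|%:E)%E by rewrite mule_ge0.
apply: (@le_trans _ _ (\int[mu]_y (L%:E * `|F s y - rcdf P Xh y|%:E + `|gap y|%:E))%E).
 apply: ge0_le_integral => //.
 - by mnorm; exact: measurable_funB.
 - exact: emeasurable_funD.
 - move=> y _; rewrite -EFinM -EFinD lee_fin.
  have -> : H s y - mean_flux P Xh (B tau) y = (Lam (F s y) - Lam (rcdf P Xh y)) - gap y.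
   by rewrite /gap (mean_flux_lamF y ssT); ring.
  apply: le_trans (ler_normB _ _) _; rewrite lerD2r.
  exact: (flux_Lam fb (Fh01 y) (Fs01 y)).
rewrite (ge0_integralD mu measurableT (fun y _ => LF0 y) mLF (fun y _ => gap0 y) mgap).
rewrite (ge0_integralZl mu measurableT mdF (fun y _ => dF0 y) L0') EFinD; apply: leeD => //.
have -> : L ^+ 2 * (s - tau) = L * (L * (s - tau)) by ring.
by rewrite EFinM; apply: lee_wpmul2l.
Qed.

(** Given the past at [tau], the kernel of variance $\sigma^2(t-\tau)$ is the mean of the one of
    variance $\sigma^2(t-s)$ at [Xh]. Both terms thus become convolutions with the same [dgk], and
    only the fluxes differ. *)
Lemma psi_diff_L1 t : s < t ->
 (\int[mu]_x `|'Ex (fun o => B s o * gk (sigma ^+ 2 * (t - s)) (x - X s o)) -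
   'Ex (fun o => B tau o * gk (sigma ^+ 2 * (t - tau)) (x - X tau o))|%:E <=
  (3 / 2 / Num.sqrt (sigma ^+ 2 * (t - s)) *
   (L ^+ 2 * (s - tau) + 6 * k * (sconst / Num.sqrt tau) * (sigma ^+ 2 * (s - tau))))%:E)%E.
Proof.
move=> st; set v := sigma ^+ 2 * (t - s).
have v0 : 0 < v by rewrite mulr_gt0 ?exprn_gt0// subr_gt0.
have bB r : bmf (B r) by split; [exact: (dv_Bm dv)|exists L; exact: (dv_BL dv)].
have mHs : measT (H s) by apply: meas_mean_flux; [exact: (dv_Xm dv)|exact: (dv_Bm dv)].
have mHh : measT (mean_flux P Xh (B tau)) by apply: meas_mean_flux => //; exact: (dv_Bm dv).
have E1 x : 'Ex (fun o => B s o * gk v (x - X s o)) = conv (dgk v) (H s) x.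
 by rewrite Ex_drift_conv//; exact: (dv_Xm dv).
have E2 x : 'Ex (fun o => B tau o * gk (sigma ^+ 2 * (t - tau)) (x - X tau o)) = conv (dgk v) (mean_flux P Xh (B tau)) x.
 transitivity ('Ex (fun o => B tau o * gk v (x - Xh o))); last by rewrite Ex_drift_conv.
 have -> : sigma ^+ 2 * (t - tau) = v + w by rewrite /v /w; ring.
 exact/esym/(gaussian_kernel_mean (dv_past dv (s := tau)) w0 mZ indZ (dv_X dv tauT) (dv_B dv tauT) (dv_BL dv tau)).
have E x : 'Ex (fun o => B s o * gk v (x - X s o)) -
   'Ex (fun o => B tau o * gk (sigma ^+ 2 * (t - tau)) (x - X tau o)) =
  conv (dgk v) (fun y => H s y - mean_flux P Xh (B tau) y) x.
 rewrite E1 E2 (@convB R (dgk v) (H s) (mean_flux P Xh (B tau)) x L)//.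
 - exact: meas_dgk.
 - exact: integrable_dgk.
 - by move=> y; apply: norm_mean_flux; [exact: (dv_Xm dv)|exact: (dv_Bm dv)|exact: (dv_BL dv)].
 - by move=> y; apply: norm_mean_flux => //; [exact: (dv_Bm dv)|exact: (dv_BL dv)].
have -> : (\int[mu]_x `|'Ex (fun o => B s o * gk v (x - X s o)) -
   'Ex (fun o => B tau o * gk (sigma ^+ 2 * (t - tau)) (x - X tau o))|%:E =
  \int[mu]_x `|conv (dgk v) (fun y => H s y - mean_flux P Xh (B tau) y) x|%:E)%E.
 by apply: eq_integral => x _; rewrite E.
have hd : (\int[mu]_x `|dgk v x|%:E <= (3 / 2 / Num.sqrt v)%:E)%E.
 apply: le_trans (integral_dgk_le v0) _; rewrite lee_fin ler_wpM2r ?invr_ge0//.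
 exact: sqrt2_le.
apply: le_trans (conv_L1 (meas_dgk v) _ hd) _; first exact: measurable_funB.
rewrite (EFinM (3 / 2 / Num.sqrt v)); apply: lee_wpmul2l; first by rewrite lee_fin mulr_ge0 ?invr_ge0 ?divr_ge0.
exact: flux_diff_L1.
Qed.

End Pair.

End LimitQuadrature.

(** * Sums over blocks of a refined grid *)

Section ScaledBlocks.
Context (R : realType).
Notation mu := (@lebesgue_measure R).

Lemma integral_norm_sum2_le (n r : nat) (c : R) (f : nat -> nat -> R -> R) (bd : nat -> R) :
 0 <= c -> (forall k i, (k < n)%N -> (i < r)%N -> measT (f k i)) ->
 (forall k i, (k < n)%N -> (i < r)%N -> (\int[mu]_x `|f k i x|%:E <= (bd k)%:E)%E) ->
 (\int[mu]_x `|c * \sum_(0 <= k < n) \sum_(0 <= i < r) f k i x|%:E <=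
  (c * \sum_(0 <= k < n) r%:R * bd k)%:E)%E.
Proof.
move=> c0 mf hf.
pose g (k : 'I_n) (i : 'I_r) x := (c * `|f k i x|)%:E.
have mg k i : measT (g k i).
 by unEFin; apply: measurable_funM => //; apply: measurableT_comp => //; apply: mf.
have g0 k i x : (0 <= g k i x)%E by rewrite lee_fin mulr_ge0.
have mG k : measT (fun x => \sum_(i < r) g k i x)%E by exact: emeasurable_sum.
have G0 k x : (0 <= \sum_(i < r) g k i x)%E by exact: sume_ge0.
apply: (@le_trans _ _ (\int[mu]_x \sum_(k < n) \sum_(i < r) g k i x)%E).
 apply: ge0_le_integral => //.
 - mnorm; apply: measurable_funM => //.
  under eq_fun do rewrite big_mkord.
  apply: measurable_sum => k; under eq_fun do rewrite big_mkord.
  by apply: measurable_sum => i; exact: mf.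
 - by apply: emeasurable_sum.
 - move=> x _; rewrite /g.
  under [leRHS]eq_bigr do rewrite sumEFin.
  rewrite sumEFin lee_fin normrM ger0_norm//.
  under [leRHS]eq_bigr do rewrite -mulr_sumr.
  rewrite -mulr_sumr ler_wpM2l// big_mkord; apply: le_trans (ler_norm_sum _ _ _) _.
  by apply: ler_sum => k _; rewrite big_mkord; exact: ler_norm_sum.
rewrite (ge0_integral_sum mu measurableT mG (fun k x _ => G0 k x)) big_mkord mulr_sumr -sumEFin.
apply: lee_sum => k _.
rewrite (ge0_integral_sum mu measurableT (mg k) (fun i x _ => g0 k i x)).
apply: (@le_trans _ _ (\sum_(i < r) (c * bd k)%:E)%E); last first.
 by rewrite sumEFin lee_fin sumr_const card_ord -[(c * _) *+ _]mulr_natl [leLHS]mulrCA.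
apply: lee_sum => i _; rewrite /g.
have mfk : measT (fun x => `|f k i x|%:E).
 by mnorm; exact: mf.
have f0 x : (0 <= `|f k i x|%:E)%E by rewrite lee_fin.
have c0' : (0 <= c%:E)%E by rewrite lee_fin.
under eq_integral do rewrite (EFinM c).
rewrite (ge0_integralZl mu measurableT mfk (fun x _ => f0 x) c0') (EFinM c).
by apply: lee_wpmul2l => //; exact: hf.
Qed.

Lemma sum_const_sub (r : nat) (a : R) (f : nat -> R) :
 \sum_(0 <= i < r) (a - f i) = r%:R * a - \sum_(0 <= i < r) f i.
Proof. by rewrite sumrB sumr_const_nat subn0 mulr_natl. Qed.

(** The part with [e] is singular at both ends and is a beta sum; the value [isq 0 = 0] removes the
    end points. *)
Lemma sum_isq_beta (n : nat) (a e : R) : 0 <= a -> 0 <= e ->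
 \sum_(0 <= k < n) isq R (n.-1 - k) * (a + e * isq R k) <= 2 * a * Num.sqrt n%:R + 4 * e.
Proof.
move=> a0 e0; have isq0 : isq R 0 = 0 by rewrite /isq sqrtr0 invr0.
case: n => [|n]; first by rewrite big_geq// sqrtr0 mulr0 add0r mulr_ge0.
rewrite /= (eq_bigr (fun k => a * isq R (n - k) + e * (isq R (n - k) * isq R k))); last first.
 by move=> k _; ring.
rewrite big_split/= -!mulr_sumr; apply: lerD; last first.
 rewrite mulrC ler_wpM2r//.
 rewrite big_nat_recr//= subnn isq0 mul0r addr0.
 have [->|n0] := posnP n; first by rewrite big_geq.
 by rewrite big_ltn//= isq0 mulr0 add0r; exact: beta_sum_le.
rewrite mulrAC -mulrA mulrC mulrA ler_wpM2r//.
rewrite big_nat_recr//= subnn isq0 addr0.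
have [->|n0] := posnP n; first by rewrite big_geq// mulr_ge0.
rewrite (_ : \sum_(0 <= k < n) isq R (n - k) = \sum_(1 <= k < n.+1) isq R k); last first.
 by rewrite big_nat_rev/= big_add1/=; apply: eq_big_nat => k /andP[_ kn]; rewrite add0n subKn.
apply: le_trans (sum_isq R n) _; rewrite ler_wpM2l// ler_wsqrtr// ler_nat//.
Qed.

End ScaledBlocks.

(** The summand [4 * L] comes from the first and the last block, where only the trivial bound is
    available; the remainder is the sum over the inner blocks. *)
HB.lock Definition quad_const (R : realType) (T sigma L k : R) : R :=
 4 * L + 3 / 2 / sigma * (2 * L ^+ 2 * Num.sqrt T + 24 * k * shift_const T sigma L * sigma ^+ 2).

(** * Left-endpoint error for the limit *)

Section QuadratureError.
Context d (Omega : measurableType d) (R : realType) (P : probability Omega R).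
Notation mu := (@lebesgue_measure R).
Notation "''Ex' f" := (\int[P]_w f w) (at level 10, f at level 9).
Variables (T sigma L : R).
Hypotheses (T0 : 0 < T) (sigma0 : 0 < sigma).
Variables (past : R -> set (set Omega)) (W X : R -> Omega -> R) (b : R * Omega -> R) (B : R -> Omega -> R).
Hypothesis dv : driven P T sigma L past W X b B.
Hypothesis b_left : forall s (u : nat -> R), 0 < s < T -> (forall j, 0 <= u j <= s) ->
 u @ \oo --> s -> {ae P, forall w, b (u j, w) @[j --> \oo] --> b (s, w)}.
Variables (Lam lam : R -> R) (k : R).
Hypothesis fb : flux_bounds Lam lam L k.
Hypothesis BE : forall s w, B s w = lamF P (X s) lam (X s w).

Notation kap := (kappa T sigma).
Notation sconst := (shift_const T sigma L).
Notation F := (fun s => rcdf P (X s)).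
Notation H := (fun s => mean_flux P (X s) (B s)).

Let L0 : 0 <= L. Proof. exact: fluxL0 fb. Qed.
Let k0 : 0 <= k. Proof. exact: fluxk0 fb. Qed.
Let sc0 : 0 <= sconst. Proof. exact: (shift_const_ge0 T0 sigma0 dv). Qed.
Let kap0 : 0 <= kap. Proof. exact: kappa_ge0. Qed.

Lemma quad_const_ge0 : 0 <= quad_const T sigma L k.
Proof.
by rewrite quad_const.unlock !(addr_ge0, mulr_ge0)// ?sqr_ge0 ?invr_ge0// ltW.
Qed.

Definition mean_drift t s x := 'Ex (fun o => B s o * gk (sigma ^+ 2 * (t - s)) (x - X s o)).

(* The error made by the left-endpoint rule with [n] steps of length [h] in Duhamel's formula. *)
Definition quad_error (h : R) (n : nat) x := F (n%:R * h) x -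
 'Ex (fun o => Kc (sigma ^+ 2 * (n%:R * h)) (x - X 0 o)) +
 h * \sum_(0 <= j < n) mean_drift (n%:R * h) (j%:R * h) x.

Lemma meas_mean_drift t s : measT (mean_drift t s).
Proof.
apply: (meas_Ex P (f := fun q => B s q.1 * gk (sigma ^+ 2 * (t - s)) (q.2 - X s q.1))).
apply: measurable_funM; first exact: meas_fst_comp (dv_Bm dv s).
by apply: meas_joint_kernel; [exact: meas_gk|exact: dv_Xm dv s].
Qed.

Lemma mean_driftE t s x : s < t -> mean_drift t s x = conv (dgk (sigma ^+ 2 * (t - s))) (H s) x.
Proof.
move=> st; rewrite /mean_drift Ex_drift_conv//; last exact: (dv_Xm dv).
 by rewrite mulr_gt0 ?exprn_gt0// subr_gt0.
by split; [exact: (dv_Bm dv)|exists L; exact: (dv_BL dv)].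
Qed.

Section QuadratureGrid.
Variables (h : R) (n : nat).
Hypotheses (h0 : 0 < h) (nhT : n%:R * h <= T).
Notation GX := (fun k => X (k%:R * h)).
Notation GB := (fun k => B (k%:R * h)).
Notation Gz := (fun k => increment sigma W (k%:R * h) (k.+1%:R * h)).

Lemma quad_errorE x : quad_error h n x = 'Ex (fun o => grid_rest (sigma ^+ 2 * h) h GX GB Gz n (o, x)).
Proof.
rewrite /quad_error (driven_mean_expansion sigma0 dv h0 nhT x (leqnn n)) mul0r.
rewrite (_ : n%:R * (sigma ^+ 2 * h) = sigma ^+ 2 * (n%:R * h)); last by ring.
rewrite (_ : \sum_(0 <= j < n) mean_drift (n%:R * h) (j%:R * h) x =
 \sum_(0 <= j < n) conv (dgk ((n - j)%:R * (sigma ^+ 2 * h))) (H (j%:R * h)) x); first by ring.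
rewrite big_nat [RHS]big_nat; apply: eq_bigr => j /andP[_ jn].
have jh : j%:R * h < n%:R * h by rewrite ltr_pM2r// ltr_nat.
rewrite (mean_driftE x jh).
suff -> : sigma ^+ 2 * (n%:R * h - j%:R * h) = (n - j)%:R * (sigma ^+ 2 * h) by [].
by rewrite natrB; [ring|exact: ltnW].
Qed.

Lemma meas_quad_error : measT (quad_error h n).
Proof.
rewrite (_ : quad_error h n = fun x => 'Ex (fun o => grid_rest (sigma ^+ 2 * h) h GX GB Gz n (o, x))).
 exact: (meas_driven_rest dv h0 nhT n).
by apply/funext => x; exact: quad_errorE.
Qed.

End QuadratureGrid.

Section Blocks.
Variables (h : R) (n : nat).
Hypotheses (h0 : 0 < h) (nhT : n%:R * h <= T).

(** Bound for a difference within block [j]. The first and last blocks have the trivial bound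
    [2 * L]; inside, the kernel contributes an inverse root of the distance to the final time and
    the regularity of the law an inverse root of the distance to time 0. *)
Let bd j : R := (if j == 0%N then 2 * L else 0) + (if j.+1 == n then 2 * L else 0) +
 isq R (n.-1 - j) * (3 / 2 / (sigma * Num.sqrt h) * (L ^+ 2 * h) +
   3 / 2 / (sigma * Num.sqrt h) * (6 * k * sconst * sigma ^+ 2 * Num.sqrt h) * isq R j).

Let sum_bd : (0 < n)%N -> \sum_(0 <= j < n) bd j <= quad_const T sigma L k.
Proof.
move=> n0; have sh : 0 < Num.sqrt h by rewrite sqrtr_gt0.
rewrite /bd big_split big_split/= quad_const.unlock.
have s1 (c : R) : \sum_(0 <= j < n) (if j == 0%N then c else 0) = c.
 rewrite big_ltn//= big_nat_cond big1 ?addr0// => j /andP[/andP[j1 _] _].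
 by rewrite gtn_eqF.
have s2 (c : R) : \sum_(0 <= j < n) (if j.+1 == n then c else 0) = c.
 rewrite -{1}(prednK n0) big_nat_recr//= prednK// eqxx big_nat_cond big1 ?add0r//.
 by move=> j /andP[/andP[_ j1] _]; rewrite ltn_eqF// -ltn_predRL.
rewrite s1 s2.
pose a := 3 / 2 / (sigma * Num.sqrt h) * (L ^+ 2 * h).
pose e := 3 / 2 / (sigma * Num.sqrt h) * (6 * k * sconst * sigma ^+ 2 * Num.sqrt h).
have a0 : 0 <= a by rewrite !mulr_ge0 ?sqr_ge0 ?invr_ge0 ?mulr_ge0// ltW.
have e0 : 0 <= e by rewrite !mulr_ge0 ?sqr_ge0 ?invr_ge0 ?mulr_ge0// ltW.
have aE : a * Num.sqrt n%:R = 3 / 2 / sigma * L ^+ 2 * (Num.sqrt (n%:R * h)).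
 rewrite sqrtrM// /a -{2}(sqr_sqrtr (ltW h0)); field.
 by rewrite !gt_eqF.
have eE : e = 3 / 2 / sigma * (6 * k * sconst * sigma ^+ 2).
 by rewrite /e; field; rewrite !gt_eqF.
apply: le_trans (lerD (lexx _) (sum_isq_beta n a0 e0)) _.
rewrite -mulrA aE eE.
have : Num.sqrt (n%:R * h) <= Num.sqrt T by rewrite ler_wsqrtr.
have : 0 <= 3 / 2 / sigma * L ^+ 2 by rewrite !mulr_ge0 ?sqr_ge0 ?invr_ge0// ltW.
move=> p /(ler_wpM2l p); lra.
Qed.

Let block_bound r j i : (0 < r)%N -> (j < n)%N -> (i < r)%N ->
 (\int[mu]_x `|mean_drift (n%:R * h) (j%:R * h) x -
   mean_drift (n%:R * h) ((j * r + i)%N%:R * (h / r%:R)) x|%:E <= (bd j)%:E)%E.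
Proof.
move=> r0 jn ir.
set t := n%:R * h; set ta := j%:R * h; set s := (j * r + i)%N%:R * (h / r%:R).
have r0R : 0 < r%:R :> R by rewrite ltr0n.
have sE : s = ta + i%:R / r%:R * h by rewrite /s /ta natrD natrM; field; rewrite gt_eqF.
have i1 : 0 <= (i%:R / r%:R : R) < 1 by rewrite divr_ge0//= ltr_pdivrMr// mul1r ltr_nat.
have s_ta : 0 <= s - ta <= h.
 rewrite sE addrAC subrr add0r; case/andP: i1 => i1 /ltW i2.
 by rewrite mulr_ge0 ?(ltW h0)//= -[leRHS]mul1r ler_pM2r.
have tat : ta + h <= t.
 by rewrite /ta /t -{2}(mul1r h) -mulrDl ler_pM2r// natr1 ler_nat.
have st : s < t.
 apply: lt_le_trans tat; rewrite sE ltrD2l -[ltRHS]mul1r ltr_pM2r//; by case/andP: i1.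
have tat' : ta < t by apply: lt_le_trans tat; rewrite ltrDl.
have sh : 0 < Num.sqrt h by rewrite sqrtr_gt0.
have c0 : 0 <= 3 / 2 / (sigma * Num.sqrt h) by rewrite divr_ge0// mulr_ge0// ltW.
have g0 : 0 <= isq R (n.-1 - j) * (3 / 2 / (sigma * Num.sqrt h) * (L ^+ 2 * h) +
   3 / 2 / (sigma * Num.sqrt h) * (6 * k * sconst * sigma ^+ 2 * Num.sqrt h) * isq R j).
 have h0' := ltW h0; have sh' := ltW sh; have s0' := ltW sigma0.
 by rewrite mulr_ge0 ?isq_ge0// addr_ge0// !mulr_ge0// ?isq_ge0 ?sqr_ge0 ?invr_ge0 ?mulr_ge0.
have [edge|inner] := boolP ((j == 0%N) || (j.+1 == n)).
 apply: (@le_trans _ _ (2 * L)%:E); last first.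
  rewrite lee_fin /bd; case/orP: edge => -> /=.
   by case: ifP => _; rewrite ?addr0; [rewrite -addrA lerDl addr_ge0// mulr_ge0|rewrite lerDl].
  by case: ifP => _; rewrite ?add0r; [rewrite -addrA lerDl addr_ge0// mulr_ge0|rewrite lerDl].
 have hb u : u < t -> (\int[mu]_x `|mean_drift t u x|%:E <= L%:E)%E.
  move=> ut; apply: integral_norm_Ex_kernel => //; last 3 first.
  - exact: (dv_Bm dv).
  - exact: (dv_BL dv).
  - exact: (dv_Xm dv).
  by rewrite mulr_gt0 ?exprn_gt0// subr_gt0.
 have mm u : measT (fun x => `|mean_drift t u x|%:E).
  by mnorm; exact: meas_mean_drift.
 have m0 u x : (0 <= `|mean_drift t u x|%:E)%E by rewrite lee_fin.
 apply: (@le_trans _ _ (\int[mu]_x (`|mean_drift t ta x|%:E + `|mean_drift t s x|%:E))%E).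
  apply: ge0_le_integral => //.
  - by mnorm; apply: measurable_funB; exact: meas_mean_drift.
  - exact: (emeasurable_funD (mm ta) (mm s)).
  - by move=> x _; rewrite -EFinD lee_fin; exact: ler_normB.
 rewrite (ge0_integralD mu measurableT (fun x _ => m0 ta x) (mm ta) (fun x _ => m0 s x) (mm s)).
 by apply: le_trans (leeD (hb _ tat') (hb _ st)) _; rewrite -EFinD lee_fin; lra.
move: inner; rewrite negb_or => /andP[j0 jn'].
rewrite /bd (negbTE j0) (negbTE jn') !add0r.
have j1 : (0 < j)%N by rewrite lt0n.
have jn2 : (j.+1 < n)%N by rewrite ltn_neqAle jn'.
have [i0|i0] := posnP i.
 rewrite (_ : s = ta); last by rewrite sE i0 mul0r mul0r addr0.
 under eq_integral do rewrite subrr normr0.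
 by rewrite integral0 lee_fin.
have ta0 : 0 < ta by rewrite mulr_gt0// ltr0n.
have tas : ta < s by rewrite sE ltrDl mulr_gt0// divr_gt0// ltr0n.
have sT : s <= T by rewrite (le_trans (ltW st)).
under eq_integral do rewrite distrC.
apply: le_trans (psi_diff_L1 T0 sigma0 dv b_left fb BE ta0 tas sT st) _.
rewrite lee_fin.
have nj : 0 < (n.-1 - j)%N%:R :> R by rewrite ltr0n subn_gt0 -ltnS prednK// (leq_trans _ jn2).
(* A point of block [j] is at most $(j+1)h$, so its distance to the final time is at least
   $(n-1-j)h$. *)
have hsq : (Num.sqrt (sigma ^+ 2 * (t - s)))^-1 <= (sigma * Num.sqrt h)^-1 * isq R (n.-1 - j).
 have w0 : 0 < sigma ^+ 2 * (t - s) by rewrite mulr_gt0 ?exprn_gt0// subr_gt0.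
 rewrite /isq -invfM lef_pV2 ?posrE ?mulr_gt0 ?sqrtr_gt0//.
 rewrite sqrtrM ?sqr_ge0// sqrtr_sqr (gtr0_norm sigma0) -mulrA ler_pM2l// -sqrtrM ?(ltW h0)// ler_wsqrtr//.
 have -> : (n.-1 - j)%N%:R = n%:R - 1 - j%:R :> R.
  by rewrite natrB ?predn_sub// -?subn1 ?natrB// ?(leq_trans _ jn2)// -ltnS subn1 prednK ?(leq_trans _ jn2)// ltnW.
 by case/andP: s_ta => _; rewrite /t /ta; lra.
rewrite [leRHS](_ : _ = 3 / 2 * ((sigma * Num.sqrt h)^-1 * isq R (n.-1 - j)) * (L ^+ 2 * h + 6 * k * sconst * sigma ^+ 2 * Num.sqrt h * isq R j)); last by ring.
have y0 : 0 <= 6 * k * (sconst / Num.sqrt ta) by rewrite !mulr_ge0 ?invr_ge0.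
apply: ler_pM.
- by rewrite mulr_ge0 ?invr_ge0// divr_ge0.
- by case/andP: s_ta => sta _; apply: addr_ge0; apply: mulr_ge0 => //; rewrite ?sqr_ge0// mulr_ge0 ?sqr_ge0.
- by rewrite ler_wpM2l// divr_ge0.
case/andP: s_ta => _ s_ta; apply: lerD; first by rewrite ler_wpM2l ?sqr_ge0.
apply: (@le_trans _ _ (6 * k * (sconst / Num.sqrt ta) * (sigma ^+ 2 * h))).
 by rewrite ler_wpM2l// ler_wpM2l ?sqr_ge0.
rewrite /ta sqrtrM// /isq -{2}(sqr_sqrtr (ltW h0)) le_eqVlt; apply/orP; left; apply/eqP.
by field; rewrite !gt_eqF// sqrtr_gt0 ltr0n.
Qed.

(** Each cell is divided into [r] parts. The errors of the two rules differ by $h/r$ times a sum of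
    [r] differences per block, each at most [bd], which gives $h$ times the sum of [bd] whatever [r]
    is; the error of the refined rule tends to 0. *)
Lemma limit_quadrature : (0 < n)%N ->
 (\int[mu]_x `|quad_error h n x|%:E <= (quad_const T sigma L k * h)%:E)%E.
Proof.
move=> n0; apply/lee_addgt0Pr => e e0.
set t := n%:R * h.
have t0 : 0 < t by rewrite mulr_gt0// ltr0n.
have bl s (u : nat -> R) : 0 < s < t -> (forall j, 0 <= u j <= s) ->
  u @ \oo --> s -> {ae P, forall w, b (u j, w) @[j --> \oo] --> b (s, w)}.
 by move=> /andP[s0 st]; apply: b_left; rewrite s0/= (lt_le_trans st).
have e2 : 0 < e / 2 by rewrite divr_gt0.
have [r0 hr0] := cell_defect_eventually t0 (dv_b dv) (dv_bL dv) bl e2.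
(* For [r >= C] the Taylor part of the fine rest is at most [e / 2], which leaves the other half for
   the defects. *)
pose C := 6 * L ^+ 2 * kap * h / e.
have C0 : 0 <= C by rewrite !mulr_ge0 ?sqr_ge0 ?invr_ge0// ltW.
pose r := (maxn r0 (Num.trunc C).+1).
have r_gt0 : (0 < r)%N by rewrite leq_max orbT.
have rR : 0 < r%:R :> R by rewrite ltr0n.
have Cr : C <= r%:R.
 by apply: (le_trans (ltW (truncnS_gt _))); rewrite ler_nat leq_maxr.
have h'0 : 0 < h / r%:R by rewrite divr_gt0.
have tE : (n * r)%N%:R * (h / r%:R) = t by rewrite natrM /t; field; rewrite gt_eqF.
have ntT : (n * r)%N%:R * (h / r%:R) <= T by rewrite tE.
have hdef : (\sum_(j < n * r) cell_defect P b (h / r%:R) j <= (e / 2)%:E)%E.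
 have -> : h / r%:R = t / (n * r)%N%:R.
  by rewrite -tE natrM; field; rewrite !gt_eqF// ltr0n.
 apply: hr0; last by rewrite muln_gt0 n0.
 by apply: (@leq_trans r); [exact: leq_maxl|rewrite leq_pmull].
pose fine x := 'Ex (fun o => grid_rest (sigma ^+ 2 * (h / r%:R)) (h / r%:R) (fun k => X (k%:R * (h / r%:R)))
 (fun k => B (k%:R * (h / r%:R))) (fun k => increment sigma W (k%:R * (h / r%:R)) (k.+1%:R * (h / r%:R))) (n * r)%N (o, x)).
have hfine : (\int[mu]_x `|fine x|%:E <= e%:E)%E.
 apply: le_trans (integral_driven_rest sigma0 dv h'0 ntT hdef (leqnn _)) _.
 rewrite lee_fin; have : 3 * L ^+ 2 * kap * (h / r%:R) <= e / 2; last by lra.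
 rewrite mulrA ler_pdivrMr//.
 by move: Cr; rewrite /C ler_pdivrMr//; lra.
have mfine : measT fine by exact: (meas_driven_rest dv h'0 ntT (n * r)%N).
pose D j i x := mean_drift t (j%:R * h) x - mean_drift t ((j * r + i)%N%:R * (h / r%:R)) x.
have mD j i : measT (D j i) by apply: measurable_funB; exact: meas_mean_drift.
have E x : quad_error h n x = h / r%:R * (\sum_(0 <= j < n) \sum_(0 <= i < r) D j i x) + fine x.
 rewrite /fine -(quad_errorE h'0 ntT) /quad_error tE -/t.
 have rid (u v c S : R) : S = v - c -> u + v = S + (u + c) by move=> ->; ring.
 apply: rid.
 pose A j := mean_drift t (j%:R * h) x.
 pose A' l := mean_drift t (l%:R * (h / r%:R)) x.
 have -> : \sum_(0 <= j < n) \sum_(0 <= i < r) D j i x = r%:R * (\sum_(0 <= j < n) A j) - \sum_(0 <= l < n * r) A' l.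
  rewrite (sum_blocks A') mulr_sumr -sumrB; apply: eq_bigr => j _.
  rewrite (_ : \sum_(0 <= i < r) D j i x = \sum_(0 <= i < r) (A j - A' (j * r + i)%N))//.
  exact: sum_const_sub.
 by rewrite mulrBr mulrA divfK// gt_eqF.
have hDb j i : (j < n)%N -> (i < r)%N -> (\int[mu]_x `|D j i x|%:E <= (bd j)%:E)%E.
 by move=> jn ir; have := block_bound r_gt0 jn ir; rewrite /D.
have hD := @integral_norm_sum2_le R n r (h / r%:R) D bd (ltW h'0) (fun j i _ _ => mD j i) hDb.
pose S x := h / r%:R * (\sum_(0 <= j < n) \sum_(0 <= i < r) D j i x).
have mS : measT S.
 apply: measurable_funM => //; under eq_fun do rewrite big_mkord.
 by apply: measurable_sum => j; under eq_fun do rewrite big_mkord; exact: measurable_sum.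
have mnS : measT (fun x => `|S x|%:E) by unEFin; exact: measurableT_comp.
have mnf : measT (fun x => `|fine x|%:E) by unEFin; exact: measurableT_comp.
have S0 x : (0 <= `|S x|%:E)%E by rewrite lee_fin.
have f0 x : (0 <= `|fine x|%:E)%E by rewrite lee_fin.
apply: (@le_trans _ _ (\int[mu]_x (`|S x|%:E + `|fine x|%:E))%E).
 apply: ge0_le_integral => //.
 - by mnorm; exact: meas_quad_error.
 - exact: (emeasurable_funD mnS mnf).
 - by move=> x _; rewrite E -EFinD lee_fin; exact: ler_normD.
rewrite (ge0_integralD mu measurableT (fun x _ => S0 x) mnS (fun x _ => f0 x) mnf).
apply: leeD => //; apply: le_trans hD _; rewrite lee_fin -mulr_sumr mulrA divfK ?gt_eqF//.
by rewrite mulrC ler_wpM2r ?sum_bd// ltW.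
Qed.

End Blocks.
End QuadratureError.

(** * The limit and the particles as driven processes *)

Section DrivenFromIntegral.
Context d (Omega : measurableType d) (R : realType) (P : probability Omega R).
Notation mu := (@lebesgue_measure R).
Notation "''Ex' f" := (\int[P]_w f w) (at level 10, f at level 9).

Lemma drift_increments (T sigma L : R) (W X : R -> Omega -> R) (x0 : Omega -> R) (b : R * Omega -> R)
  (B : R -> Omega -> R) : measT b -> (forall q, `|b q| <= L) ->
 {ae P, forall w s, 0 <= s <= T -> b (s, w) = B s w} ->
 {ae P, forall w t, 0 <= t <= T -> X t w = x0 w + sigma * W t w + \int[mu]_(s in `[0, t]%classic) B s w} ->
 {ae P, forall w s t, 0 <= s -> s <= t -> t <= T ->
  X t w = X s w + sigma * (W t w - W s w) + \int[mu]_(u in `]s, t]) b (u, w)}.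
Proof.
move=> mb bL; apply: filterS2 => w hb hX s t s0 st tT.
have mbw : measT (fun u => b (u, w)) by exact: meas_slice2.
have hI r : 0 <= r <= T -> \int[mu]_(u in `[0, r]%classic) B u w = \int[mu]_(u in `[0, r]%classic) b (u, w).
 move=> /andP[r0 rT]; apply: eq_Rintegral => u; rewrite inE/= in_itv/= => /andP[u0 ur].
 by rewrite hb// u0 (le_trans ur).
have sT : 0 <= s <= T by rewrite s0 (le_trans st).
have tT' : 0 <= t <= T by rewrite tT (le_trans s0).
rewrite (hX t tT') (hX s sT) (hI t tT') (hI s sT).
rewrite -(@Rintegral_itvB R (fun u => b (u, w)) (BLeft 0) (BRight t) s) ?bnd_simp//; first by ring.
apply: measurable_bounded_integrable => //.
- rewrite -[X in (X < _)%E]/(mu `[0, t]) (lebesgue_measure_itv `[0, t]) /=.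
 by case: ifP => _; rewrite ?ltry// sube_lt_pinfty ?ltry.
- exact: measurable_funTS.
- by exists L; split => [|M LM u _]; [exact: num_real|apply: le_trans (bL (u, w)) _; exact: ltW].
Qed.

(** The indicator is locally constant off the diagonal, which is why atoms and ties have to be
    excluded. *)
Lemma heav_eventually (a y : nat -> R) (a' y' : R) : a @ \oo --> a' -> y @ \oo --> y' -> a' <> y' ->
 \forall j \near \oo, heav (a j) (y j) = heav a' y'.
Proof.
move=> ca cy /eqP ay.
have cd : (fun j => y j - a j) @ \oo --> y' - a' by exact: cvgB.
rewrite /heav; case: (ltgtP a' y') ay => // h _.
 have : 0 < y' - a' by rewrite subr_gt0.
 move=> /(cvgr_gt _ cd) H; apply: filterS H => j.
 by rewrite subr_gt0 => /ltW ->.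
have : y' - a' < 0 by rewrite subr_lt0.
move=> /(cvgr_lt _ cd) H; apply: filterS H => j.
by rewrite subr_lt0 ltNge => /negbTE ->.
Qed.

Lemma Ex_cvg (f : nat -> Omega -> R) (g : Omega -> R) (c : R) : (forall n, measT (f n)) ->
 measT g -> (forall n w, `|f n w| <= c) -> (forall w, `|g w| <= c) ->
 {ae P, forall w, f n w @[n --> \oo] --> g w} -> 'Ex (f n) @[n --> \oo] --> 'Ex g.
Proof.
move=> mf mg fc gc cv.
have bf n : bmf (f n) by split => //; exists c.
have bg : bmf g by split => //; exists c.
have H1 : {ae P, forall w, setT w -> (fun n => (f n w)%:E) @ \oo --> (g w)%:E}.
 by apply: filterS cv => w cw _; apply: cvg_EFin => //; exact: nearW.
have H2 : P.-integrable setT (fun=> c%:E) by apply: finite_measure_integrable_cst.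
have H3 : {ae P, forall w n, setT w -> (`| (f n w)%:E | <= c%:E)%E}.
 by apply: nearW => w n _; rewrite lee_fin.
have mf' n : measT (fun w => (f n w)%:E) by unEFin.
have mg' : measT (fun w => (g w)%:E) by unEFin.
have [_ _ h] := @dominated_convergence _ _ R P setT measurableT _ _ _ mf' mg' H1 H2 H3.
rewrite -(EFin_Ex P bg) in h.
have : (fun n => ('Ex (f n))%:E) @ \oo --> ('Ex g)%:E.
 by under eq_fun do rewrite (EFin_Ex P (bf _)).
by move/fine_cvgP => [_].
Qed.

End DrivenFromIntegral.

(** * The limit as a driven process *)

Section LimitDriven.
Context d (Omega : measurableType d) (R : realType) (P : probability Omega R).
Notation mu := (@lebesgue_measure R).
Notation "''Ex' f" := (\int[P]_w f w) (at level 10, f at level 9).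
Variables (T sigma : R) (Lam lam : R -> R) (L k : R) (m : probability R R) (W X : R -> {RV P >-> R}).
Hypotheses (T0 : 0 < T) (sigma0 : 0 < sigma).
Hypothesis BM : brownian_motion P W.
Hypothesis sol : limit_solution P T sigma lam m W X.
Hypothesis fb : flux_bounds Lam lam L k.

Definition limit_drift (s : R) (w : Omega) : R := lamF P (X s) lam (X s w).

Let mX s : measT (X s : Omega -> R). Proof. exact: measurable_funP. Qed.

Lemma cdf_rcdf s y : fine (cdf (X s) y) = rcdf P (X s) y.
Proof. by rewrite -[LHS]/(fine (P (X s @^-1` `]-oo, y]))) -(EFin_rcdf P (mX s)). Qed.

(** The drift is computed from a jointly measurable version of the path. Its left continuity follows
    from the absence of atoms, itself a consequence of the [driven] structure just established: the
    distribution function is then continuous in time and space along the path, by dominated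
    convergence. *)
Lemma limit_driven : exists b : R * Omega -> R,
 driven P T sigma L (limit_past W X) W X b limit_drift /\
 forall s (u : nat -> R), 0 < s < T -> (forall j, 0 <= u j <= s) ->
  u @ \oo --> s -> {ae P, forall w, b (u j, w) @[j --> \oo] --> b (s, w)}.
Proof.
have [_ _ _ Xc XE] := sol.
have [Y [mY YX]] := joint_version T0 Xc.
have mYs s : measT (fun w => Y (s, w)) by exact: meas_slice1.
pose f (z : (R * Omega) * Omega) := heav (Y (z.1.1, z.2)) (Y z.1).
have mf : measT f.
 apply: meas_heav; last exact: measurableT_comp.
 apply: (measurableT_comp mY); apply/measurable_fun_pairP; split => //=.
 - exact: (measurableT_comp measurable_fst measurable_fst).
 - exact: measurable_snd.
pose G (q : R * Omega) := rcdf P (fun w => Y (q.1, w)) (Y q).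
have mG : measT G by exact: (meas_Rintegral1 P mf).
have G01 q : in01 (G q) by exact: rcdf_in01.
pose b q := lam (clip01 (G q)).
have mb : measT b.
 apply: (measurableT_comp (f := fun u => lam (clip01 u))) => //.
 by apply: continuous_measurable_fun; exact: continuous_lam_clip01 fb.
have bL q : `|b q| <= L by apply: (flux_lam fb); exact: clip01_in01.
have YXs s : 0 <= s <= T -> {ae P, forall w, Y (s, w) = X s w} by move=> sT; apply: filterS YX => w; apply.
have rcdfYX s y : 0 <= s <= T -> rcdf P (fun w => Y (s, w)) y = rcdf P (X s) y.
 move=> sT; apply: Ex_ae_eq; [exact: meas_heav|exact: meas_heav|].
 by apply: filterS (YXs _ sT) => w ->.
have bB : {ae P, forall w s, 0 <= s <= T -> b (s, w) = limit_drift s w}.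
 apply: filterS YX => w hw s sT.
 rewrite /b clip01_id// /G /= rcdfYX// hw//.
have dv : driven P T sigma L (limit_past W X) W X b limit_drift.
 split => //.
 - exact: meas_limit_past.
 - by move=> s sT; exact: (limit_adapted sol sT).
 - move=> s sT; have /sub_measurableP h := limit_adapted sol sT.
  by apply/sub_measurableP; exact: (measurableT_comp (meas_lamF P (mX s) fb) h).
 - by move=> s; exact: (bmf_lamF P (mX s) fb).1.
 - by move=> s w; exact: (norm_lamF P (mX s) fb).
 - by move=> s t s0 st; exact: (limit_increment_indep BM sol).
 - apply: (drift_increments (x0 := X 0) mb bL bB).
  apply: filterS XE => w hw t tT; rewrite hw//; congr (_ + _).
  by apply: eq_Rintegral => s _; rewrite cdf_rcdf.
exists b; split => // s u sT us cu.
have sT' : 0 <= s <= T by case/andP: sT => /ltW -> /ltW ->.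
have uT j : 0 <= u j <= T by case/andP: (us j) => -> /= h; rewrite (le_trans h)//; case/andP: sT'.
have Yu : {ae P, forall w, Y (u j, w) @[j --> \oo] --> Y (s, w)}.
 apply: filterS2 Xc YX => w cw hw; rewrite hw//.
 under eq_fun do rewrite hw//.
 exact: (within_continuous_seq cw sT' uT cu).
have noatom : forall c, {ae P, forall w, Y (s, w) <> c}.
 move=> c; have sT2 : 0 < s <= T by case/andP: sT => -> /ltW.
 by apply: filterS2 (YXs _ sT') (driven_no_atom sigma0 dv c sT2) => w -> .
apply: (filterS _ Yu) => w cw.
have cG : G (u j, w) @[j --> \oo] --> G (s, w).
 apply: (@Ex_cvg _ Omega R P (fun j w' => heav (Y (u j, w')) (Y (u j, w))) (fun w' => heav (Y (s, w')) (Y (s, w))) 1).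
 - by move=> n; apply: meas_heav.
 - by apply: meas_heav.
 - by move=> n w'; rewrite ger0_norm ?heav_ge0 ?heav_le1.
 - by move=> w'; rewrite ger0_norm ?heav_ge0 ?heav_le1.
 - apply: filterS2 (Yu) (noatom (Y (s, w))) => w' cw' ne.
  by apply: cvg_near_cst; exact: heav_eventually.
have cl : (fun v => lam (clip01 v)) x @[x --> G (s, w)] --> lam (clip01 (G (s, w))).
 exact: (continuous_lam_clip01 fb).
exact: (cvg_comp (fun j => G (u j, w)) (fun v => lam (clip01 v)) cG cl).
Qed.

End LimitDriven.

(** * The drift as a function of the configuration *)

Section RankDrift.
Context (R : realType) (Lam : R -> R) (N : nat).

(* [lambdaN Lam N] extended to the reals so that measurability is visible. *)
Definition lambda_step (y : R) : R :=
 \sum_(r < N.+1) lambdaN Lam N r * (heav r%:R y - heav r.+1%:R y).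

Lemma lambda_stepE r : (r <= N)%N -> lambda_step r%:R = lambdaN Lam N r.
Proof.
move=> rN; rewrite /lambda_step (bigD1 (Ordinal (rN : r < N.+1)%N))//= big1 ?addr0.
 by rewrite /heav lexx ler_nat ltnn subr0 mulr1.
move=> i ir; rewrite /heav !ler_nat; case: (ltngtP i r) => h; rewrite ?subrr ?mulr0//.
by rewrite -val_eqE/= h eqxx in ir.
Qed.

Lemma meas_lambda_step : measT lambda_step.
Proof.
apply: measurable_sum => r; apply: measurable_funM => //.
by apply: measurable_funB; apply: meas_heav.
Qed.

Definition rank_drift (i : 'I_N) (x : 'I_N -> R) : R := lambda_step (\sum_(j < N) heav (x j) (x i)).

Lemma rank_driftE i x : rank_drift i x = lambdaN Lam N (rank_of x i).
Proof. by rewrite /rank_drift sum_heav_card lambda_stepE// rank_of_le. Qed.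

Lemma meas_rank_drift d (T' : measurableType d) i (x : 'I_N -> T' -> R) :
 (forall j, measT (x j)) -> measT (fun w => rank_drift i (x ^~ w)).
Proof.
move=> mx; apply: (measurableT_comp meas_lambda_step).
by apply: measurable_sum => j; exact: meas_heav.
Qed.

Lemma norm_rank_drift lam L k i x : flux_bounds Lam lam L k -> `|rank_drift i x| <= L.
Proof. by move=> fb; rewrite rank_driftE; apply: (norm_lambdaN fb); rewrite rank_of_gt0 rank_of_le. Qed.

Lemma rank_drift_cvg i (x : nat -> 'I_N -> R) (y : 'I_N -> R) :
 (forall j, x n j @[n --> \oo] --> y j) -> (forall j, j != i -> y j <> y i) ->
 rank_drift i (x n) @[n --> \oo] --> rank_drift i y.
Proof.
move=> cx yi; apply: cvg_near_cst.
have H : \forall n \near \oo, forall j, heav (x n j) (x n i) = heav (y j) (y i).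
 apply: filter_forall => j; have [->|ji] := eqVneq j i.
  by apply: nearW => n; rewrite /heav !lexx.
 by apply: heav_eventually => //; exact: yi.
by apply: filterS (H) => n hn; rewrite /rank_drift; congr lambda_step; apply: eq_bigr => j _; exact: hn.
Qed.

End RankDrift.

Section Tau.
Context (R : realType).

Lemma tau0 (s : R) : tau 0 s = s. Proof. by rewrite /tau eqxx. Qed.

Lemma tau_gfl (h s : R) : 0 < h -> 0 <= s -> tau h s = gfl h s.
Proof.
move=> h0 s0; rewrite /tau gt_eqF// /gfl; congr (_ * _).
rewrite truncn_floor divr_ge0 ?(ltW h0)// natr_absz ger0_norm// floor_ge0.
by rewrite divr_ge0// ltW.
Qed.

Lemma tau_itv (h s : R) : 0 <= h -> 0 <= s -> 0 <= tau h s <= s.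
Proof.
rewrite le_eqVlt => /orP[/eqP <- s0|h0 s0]; first by rewrite tau0 s0 lexx.
by rewrite tau_gfl// gfl_ge0//=; have /andP[] := gfl_itv h0 s0.
Qed.

End Tau.

(** * The particles as driven processes *)

Section ParticleDriven.
Context d (Omega : measurableType d) (R : realType) (P : probability Omega R).
Notation mu := (@lebesgue_measure R).
Notation "''Ex' f" := (\int[P]_w f w) (at level 10, f at level 9).
Variables (T sigma : R) (Lam lam : R -> R) (L k : R).
Variables (N : nat) (h : R) (X0 : forall N : nat, 'I_N -> {RV P >-> R}) (W : nat -> R -> {RV P >-> R}).
Variable X : 'I_N -> R -> {RV P >-> R}.
Hypotheses (T0 : 0 < T) (sigma0 : 0 < sigma) (h0 : 0 <= h).
Hypothesis BM : independent_brownian_motions P W.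
Hypothesis indep0 : independent_initial P X0 W.
Hypothesis sol : particle_solution P T sigma Lam h (@X0 N) W X.
Hypothesis fb : flux_bounds Lam lam L k.

Definition particle_drift (i : 'I_N) (s : R) (w : Omega) : R :=
 rank_drift Lam i (fun j => X j (tau h s) w).

Notation past := (particle_past W (@X0) N).

Lemma particle_adapted (i j : 'I_N) s : 0 <= s <= T -> sub_measurable (past i s) (X j s).
Proof.
move=> sT A mA; have [ad _ _] := sol j.
by apply: (@particle_filtration _ Omega R P W (@X0) N i s); exact: ad.
Qed.

Let tauT s : 0 <= s <= T -> 0 <= tau h s <= T.
Proof.
by move=> /andP[s0 sT]; have /andP[-> /le_trans ->] := tau_itv h0 s0.
Qed.

Let mB i s : measT (particle_drift i s).
Proof. by apply: meas_rank_drift => j; exact: measurable_funP. Qed.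

Let particle_driven_of (i : 'I_N) (b : R * Omega -> R) : measT b -> (forall q, `|b q| <= L) ->
 {ae P, forall w s, 0 <= s <= T -> b (s, w) = particle_drift i s w} ->
 driven P T sigma L (past i) (W i) (X i) b (particle_drift i).
Proof.
move=> mb bL bB; have [_ _ XE] := sol i.
split => //.
- exact: meas_particle_past.
- by move=> s sT; exact: particle_adapted.
- move=> s sT; have /andP[t0 ts] := tau_itv h0 (andP sT).1.
 have mono : <<s past i (tau h s) >> `<=` <<s past i s >> by exact: particle_past_mono.
 apply: (sub_measurable_mono mono).
 apply/sub_measurableP; apply: meas_rank_drift => j; apply/sub_measurableP.
 exact: particle_adapted (tauT sT).
- by move=> s w; exact: norm_rank_drift fb.
- by move=> s t s0 st; exact: (particle_increment_indep BM indep0).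
- apply: (drift_increments (x0 := X0 i) mb bL bB).
 apply: filterS XE => w hw t tT; rewrite hw//; congr (_ + _).
 by apply: eq_Rintegral => s _; rewrite /particle_drift rank_driftE.
Qed.

Let versions : exists Y : 'I_N -> R * Omega -> R, (forall i, measT (Y i)) /\
 forall i, {ae P, forall w s, 0 <= s <= T -> Y i (s, w) = X i s w}.
Proof.
have H i : exists Y : R * Omega -> R, measT Y /\
  {ae P, forall w s, 0 <= s <= T -> Y (s, w) = X i s w}.
 by have [_ Xc _] := sol i; exact: joint_version T0 Xc.
have [Y HY] := choice H.
by exists Y; split => i; case: (HY i).
Qed.

(** The drift of the scheme is constant on the cells of its own grid: an explicit step function is a
    jointly measurable version, and freezing it over these cells costs nothing. *)
Lemma euler_driven (i : 'I_N) : 0 < h -> exists b : R * Omega -> R,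
 driven P T sigma L (past i) (W i) (X i) b (particle_drift i) /\
 forall j, j.+1%:R * h <= T -> cell_defect P b h j = 0%E.
Proof.
move=> hp.
pose M := (Num.trunc (T / h)).+1.
have MT : T < M%:R * h by rewrite -ltr_pdivrMr// truncnS_gt.
pose b (q : R * Omega) := \sum_(j < M) \1_(cell h j) q.1 * particle_drift i (j%:R * h) q.2.
have mb : measT b.
 apply: measurable_sum => j; apply: measurable_funM.
  exact: (measurableT_comp (meas_cell_indic _ _)).
 exact: (measurableT_comp (mB i _)).
have bE s w : 0 <= s -> s < M%:R * h -> b (s, w) = particle_drift i (gfl h s) w.
 by move=> s0 sM; rewrite /b/= (@sum_cell R R^o h M (fun k => particle_drift i (k%:R * h) w)).
have bL q : `|b q| <= L.
 case: q => s w; have [/andP[s0 sM]|ns] := boolP (0 <= s < M%:R * h).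
  by rewrite bE//; exact: norm_rank_drift fb.
 rewrite /b big1 ?normr0 ?(fluxL0 fb)// => j _ /=.
 rewrite indicE; have [hj|] := boolP (s \in cell h j); last by rewrite mul0r.
 exfalso.
 move: hj ns; rewrite /cell inE/= in_itv/= => /andP[h1 h2] /negP; apply.
 rewrite (le_trans _ h1) ?mulr_ge0//=; apply: (lt_le_trans h2).
 by rewrite ler_pM2r// ler_nat.
have tg s : 0 <= s -> tau h (gfl h s) = tau h s.
 move=> s0; rewrite !tau_gfl ?gfl_ge0// /gfl mulfK ?gt_eqF//.
 by rewrite natrK.
have bB : {ae P, forall w s, 0 <= s <= T -> b (s, w) = particle_drift i s w}.
 apply: nearW => w s /andP[s0 sT]; rewrite bE//; last exact: le_lt_trans MT.
 by rewrite /particle_drift tg.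
exists b; split; first exact: particle_driven_of.
move=> j jT; rewrite /cell_defect integral0_eq// => w _.
apply: integral0_eq => s _; rewrite indicE; have [hs|] := boolP (s \in cell h j); last by rewrite mul0r.
have jM : j.+1%:R * h < M%:R * h by exact: le_lt_trans MT.
have hs' := hs; rewrite cellP// in hs'.
have /andP[s0 /eqP tr] := hs'.
move: hs; rewrite /cell inE/= in_itv/= => /andP[h1 h2].
rewrite !bE//.
- by rewrite /gfl tr mulfK ?gt_eqF// natrK subrr normr0 mulr0.
- by rewrite mulr_ge0.
- by apply: le_lt_trans jM; rewrite ler_pM2r// ler_nat.
- exact: lt_trans jM.
Qed.

Lemma continuous_driven (i : 'I_N) : h = 0 -> exists b : R * Omega -> R,
 driven P T sigma L (past i) (W i) (X i) b (particle_drift i).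
Proof.
move=> hE; have [Y [mY YX]] := versions.
exists (fun q => rank_drift Lam i (fun j => Y j q)); apply: particle_driven_of.
- exact: meas_rank_drift.
- by move=> q; exact: norm_rank_drift fb.
- have H : {ae P, forall w, forall j s, 0 <= s <= T -> Y j (s, w) = X j s w} by apply: filter_forall => j; exact: YX.
 apply: filterS (H) => w hw s sT; rewrite /particle_drift hE tau0; congr rank_drift.
 by apply/funext => j; exact: hw.
Qed.

Lemma particle_driven (i : 'I_N) : exists b : R * Omega -> R,
 driven P T sigma L (past i) (W i) (X i) b (particle_drift i).
Proof.
move: h0; rewrite le_eqVlt => /orP[/eqP hE|hp]; first exact/continuous_driven/esym.
by have [b []] := euler_driven i hp; exists b.
Qed.

Lemma particle_no_tie (i j : 'I_N) s : i != j -> 0 < s <= T -> {ae P, forall w, X i s w <> X j s w}.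
Proof.
move=> ij sT; have [b dv] := particle_driven i; have [b' dv'] := particle_driven j.
apply: (driven_no_tie sigma0 dv dv' _ _ sT) => [r rT|r u r0 u0]; first exact: particle_adapted.
apply: particle_past_brownian => //; left; apply/eqP.
by rewrite eq_sym.
Qed.

(** Left continuity uses the absence of ties, whose proof uses the [driven] structure; hence the
    weaker [continuous_driven] comes before. *)
Lemma continuous_driven_left (i : 'I_N) : h = 0 -> exists b : R * Omega -> R,
 driven P T sigma L (past i) (W i) (X i) b (particle_drift i) /\
 forall s (u : nat -> R), 0 < s < T -> (forall j, 0 <= u j <= s) ->
  u @ \oo --> s -> {ae P, forall w, b (u j, w) @[j --> \oo] --> b (s, w)}.
Proof.
move=> hE; have [Y [mY YX]] := versions.
have H : {ae P, forall w, forall j s, 0 <= s <= T -> Y j (s, w) = X j s w} by apply: filter_forall => j; exact: YX.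
exists (fun q => rank_drift Lam i (fun j => Y j q)); split.
 apply: particle_driven_of.
 - exact: meas_rank_drift.
 - by move=> q; exact: norm_rank_drift fb.
 apply: filterS (H) => w hw s sT; rewrite /particle_drift hE tau0; congr rank_drift.
 by apply/funext => j; exact: hw.
move=> s u sT us cu.
have sT' : 0 <= s <= T by case/andP: sT => /ltW -> /ltW ->.
have sT2 : 0 < s <= T by case/andP: sT => -> /ltW.
have uT j : 0 <= u j <= T by case/andP: (us j) => -> /= h'; rewrite (le_trans h')//; case/andP: sT'.
have cX : {ae P, forall w, forall j, {within `[0, T], continuous (X j ^~ w)}}.
 by apply: filter_forall => j; case: (sol j).
have nt : {ae P, forall w, forall j, j != i -> X j s w <> X i s w}.
 apply: filter_forall => j; have [->|ji] := eqVneq j i; first by apply: nearW.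
 by apply: filterS (particle_no_tie ji sT2) => w h' _.
apply: filterS3 H cX nt => w hw cw nw.
apply: (@rank_drift_cvg R Lam N i (fun n j => Y j (u n, w)) (fun j => Y j (s, w))) => [j|j ji].
 rewrite hw//; under eq_fun do rewrite hw//.
 exact: (within_continuous_seq (cw j) sT' uT cu).
by rewrite !hw//; exact: nw.
Qed.

End ParticleDriven.

(** * Comparison of the particle system with the limit *)

Section ConvolutionSums.
Context (R : realType).
Notation mu := (@lebesgue_measure R).

Lemma conv_lincomb (k f g : R -> R) (a x c : R) : measT k ->
 mu.-integrable setT (EFin \o k) -> measT f -> measT g ->
 (forall y, `|f y| <= c) -> (forall y, `|g y| <= c) ->
 conv k (fun y => a * f y + g y) x = a * conv k f x + conv k g x.
Proof.
move=> mk ik mf mg fc gc; have ikf := integrable_convker x mk ik mf fc.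
have ikg := integrable_convker x mk ik mg gc.
rewrite /conv -RintegralZl// -RintegralD//; last first.
 exact: (integrableZl measurableT a ikf).
by apply: eq_Rintegral => y _; ring.
Qed.

Lemma conv_sum (I : Type) (s : seq I) (k : R -> R) (f : I -> R -> R) (a : I -> R) (x c : R) :
 measT k -> mu.-integrable setT (EFin \o k) -> 0 <= c ->
 (forall i, measT (f i)) -> (forall i y, `|f i y| <= c) ->
 conv k (fun y => \sum_(i <- s) a i * f i y) x = \sum_(i <- s) a i * conv k (f i) x.
Proof.
move=> mk ik c0 mf fc; elim: s => [|i s IH].
 rewrite big_nil /conv (_ : (fun y => _) = cst 0); first by rewrite Rintegral_cst//= mul0r.
 by apply/funext => y; rewrite big_nil mulr0.
rewrite big_cons -IH.
rewrite (_ : (fun y => \sum_(j <- i :: s) a j * f j y) = (fun y => a i * f i y + \sum_(j <- s) a j * f j y)); last first.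
 by apply/funext => y; rewrite big_cons.
pose C := c + \sum_(j <- s) `|a j| * c.
have S0 : 0 <= \sum_(j <- s) `|a j| * c by apply: sumr_ge0 => j _; rewrite mulr_ge0.
apply: (@conv_lincomb k (f i) (fun y => \sum_(j <- s) a j * f j y) (a i) x C) => //.
- by apply: measurable_sum => j; exact: measurable_funM.
- by move=> y; rewrite (le_trans (fc i y))// lerDl.
- move=> y; apply: le_trans (ler_norm_sum _ _ _) _.
 by apply: (@le_trans _ _ (\sum_(j <- s) `|a j| * c)); [apply: ler_sum => j _; rewrite normrM ler_wpM2l|rewrite lerDr].
Qed.

End ConvolutionSums.

(** * Integrals over the probability space and the line *)

Section IteratedIntegral.
Context d (Omega : measurableType d) (R : realType) (P : probability Omega R).
Notation mu := (@lebesgue_measure R).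
Notation "''Ex' f" := (\int[P]_w f w) (at level 10, f at level 9).
Implicit Types f g : Omega * R -> R.

Definition iint f : \bar R := (\int[P]_o \int[mu]_x (f (o, x))%:E)%E.

Lemma iint_ge0 f : (forall q, 0 <= f q) -> (0 <= iint f)%E.
Proof. by move=> f0; apply: integral_ge0 => o _; apply: integral_ge0 => x _; rewrite lee_fin. Qed.

Let slice f o : measT f -> measT (fun x => (f (o, x))%:E).
Proof. by move=> mf; unEFin; exact: meas_slice1. Qed.

Lemma ae_le_iint f g : measT f -> measT g ->
 (forall q, 0 <= f q) -> (forall q, 0 <= g q) ->
 {ae P, forall o, (\int[mu]_x (f (o, x))%:E <= \int[mu]_x (g (o, x))%:E)%E} -> (iint f <= iint g)%E.
Proof.
move=> mf mg f0 g0 h; apply: ae_ge0_le_integral => //.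
- by move=> o _; apply: integral_ge0 => x _; rewrite lee_fin.
- exact: (@meas_integral1 _ _ _ _ R mu f mf f0).
- by move=> o _; apply: integral_ge0 => x _; rewrite lee_fin.
- exact: (@meas_integral1 _ _ _ _ R mu g mg g0).
- by apply: filterS h => o ho _.
Qed.

Lemma le_iint f g : measT f -> measT g ->
 (forall q, 0 <= f q) -> (forall q, 0 <= g q) ->
 {ae P, forall o x, f (o, x) <= g (o, x)} -> (iint f <= iint g)%E.
Proof.
move=> mf mg f0 g0 h; apply: ae_le_iint => //.
apply: filterS h => o ho; apply: ge0_le_integral => //.
- by move=> x _; rewrite lee_fin.
- exact: slice.
- exact: slice.
- by move=> x _; rewrite lee_fin.
Qed.

Lemma iintD f g : measT f -> measT g ->
 (forall q, 0 <= f q) -> (forall q, 0 <= g q) -> (iint (fun q => f q + g q)%R = iint f + iint g)%E.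
Proof.
move=> mf mg f0 g0; rewrite /iint.
have f0' o x : (0 <= (f (o, x))%:E)%E by rewrite lee_fin.
have g0' o x : (0 <= (g (o, x))%:E)%E by rewrite lee_fin.
have h o : (\int[mu]_x (f (o, x) + g (o, x))%:E = \int[mu]_x (f (o, x))%:E + \int[mu]_x (g (o, x))%:E)%E.
 exact: (ge0_integralD mu measurableT (fun x _ => f0' o x) (slice o mf) (fun x _ => g0' o x) (slice o mg)).
under eq_integral do rewrite h.
have F0 o : (0 <= \int[mu]_x (f (o, x))%:E)%E by exact: integral_ge0.
have G0 o : (0 <= \int[mu]_x (g (o, x))%:E)%E by exact: integral_ge0.
exact: (ge0_integralD P measurableT (fun o _ => F0 o) (@meas_integral1 _ _ _ _ R mu f mf f0)
 (fun o _ => G0 o) (@meas_integral1 _ _ _ _ R mu g mg g0)).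
Qed.

Lemma iintZ f c : measT f -> (forall q, 0 <= f q) -> 0 <= c ->
 (iint (fun q => c * f q)%R = c%:E * iint f)%E.
Proof.
move=> mf f0 c0; rewrite /iint.
have c0' : (0 <= c%:E)%E by rewrite lee_fin.
have f0' o x : (0 <= (f (o, x))%:E)%E by rewrite lee_fin.
have h o : (\int[mu]_x (c * f (o, x))%:E = c%:E * \int[mu]_x (f (o, x))%:E)%E.
 exact: (ge0_integralZl mu measurableT (slice o mf) (fun x _ => f0' o x) c0').
under eq_integral do rewrite h.
have F0 o : (0 <= \int[mu]_x (f (o, x))%:E)%E by exact: integral_ge0.
exact: (ge0_integralZl P measurableT (@meas_integral1 _ _ _ _ R mu f mf f0) (fun o _ => F0 o) c0').
Qed.

Lemma iint_sum (I : Type) (s : seq I) (F : I -> Omega * R -> R) : (forall i, measT (F i)) ->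
 (forall i q, 0 <= F i q) -> (iint (fun q => \sum_(i <- s) F i q)%R = \sum_(i <- s) iint (F i))%E.
Proof.
move=> mF F0; elim: s => [|i s IH].
 rewrite big_nil /iint integral0_eq// => o _; apply: integral0_eq => x _.
 by rewrite big_nil.
rewrite big_cons -IH -iintD//.
- by congr iint; apply/funext => q; rewrite big_cons.
- by apply: measurable_sum.
- by move=> q; exact: sumr_ge0.
Qed.

Lemma Ex_le_ae (f g : Omega -> R) : bmf f -> bmf g -> {ae P, forall w, f w <= g w} -> 'Ex f <= 'Ex g.
Proof.
move=> bf bg h; have [mf [c fc]] := bf; have [mg [c' gc]] := bg.
have bm : bmf (fun w => Num.max (f w) (g w)).
 split; first exact: measurable_maxr.
 exists (c + c') => w; have c0 := le_trans (normr_ge0 _) (fc w); have c0' := le_trans (normr_ge0 _) (gc w).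
 by rewrite /Num.max; case: ifP => _; [apply: le_trans (gc w) _; rewrite lerDr|apply: le_trans (fc w) _; rewrite lerDl].
apply: (@le_trans _ _ ('Ex (fun w => Num.max (f w) (g w)))).
 by apply: Ex_le => // w; rewrite le_max lexx.
rewrite le_eqVlt; apply/orP; left; apply/eqP; apply: Ex_ae_eq => //; first exact: bm.1.
by apply: filterS h => w /max_idPr.
Qed.

Lemma iint_sqr_sum4 (A B C D : Omega * R -> R) : measT A -> measT B ->
 measT C -> measT D ->
 (iint (fun q => (A q + B q + C q + D q) ^+ 2)%R <=
  4%:E * (iint (fun q => A q ^+ 2)%R + iint (fun q => B q ^+ 2)%R + iint (fun q => C q ^+ 2)%R + iint (fun q => D q ^+ 2)%R))%E.
Proof.
move=> mA mB mC mD.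
have mX (f : Omega * R -> R) : measT f -> measT (fun q => f q ^+ 2) by move=> ?; exact: measurable_funX.
have X0 (f : Omega * R -> R) q : 0 <= f q ^+ 2 by exact: sqr_ge0.
have m2 : measT (fun q => A q ^+ 2 + B q ^+ 2) by apply: measurable_funD; exact: mX.
have m3 : measT (fun q => A q ^+ 2 + B q ^+ 2 + C q ^+ 2) by apply: measurable_funD => //; exact: mX.
have m4 : measT (fun q => A q ^+ 2 + B q ^+ 2 + C q ^+ 2 + D q ^+ 2) by apply: measurable_funD => //; exact: mX.
have p2 q : 0 <= A q ^+ 2 + B q ^+ 2 by rewrite addr_ge0.
have p3 q : 0 <= A q ^+ 2 + B q ^+ 2 + C q ^+ 2 by rewrite addr_ge0.
have p4 q : 0 <= A q ^+ 2 + B q ^+ 2 + C q ^+ 2 + D q ^+ 2 by rewrite addr_ge0.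
rewrite -(iintD (mX A mA) (mX B mB) (X0 A) (X0 B)) -(iintD m2 (mX C mC) p2 (X0 C)) -(iintD m3 (mX D mD) p3 (X0 D)).
rewrite -iintZ//; apply: le_iint => //.
- by apply: mX; apply: measurable_funD => //; apply: measurable_funD => //; exact: measurable_funD.
- exact: measurable_funM.
- by move=> q; exact: sqr_ge0.
- by move=> q; rewrite mulr_ge0.
- by apply: nearW => o x; exact: sqr_sum4_le.
Qed.

Lemma iint_sqr_le f (c B : R) : measT f -> 0 <= c ->
 {ae P, forall o x, `|f (o, x)| <= c} -> (iint (fun q => `|f q|)%R <= B%:E)%E ->
 (iint (fun q => f q ^+ 2)%R <= (c * B)%:E)%E.
Proof.
move=> mf c0 fc fB.
have mnf : measT (fun q => `|f q|) by exact: measurableT_comp.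
apply: (@le_trans _ _ (iint (fun q => c * `|f q|)%R)).
 apply: le_iint => //.
 - exact: measurable_funX.
 - exact: measurable_funM.
 - by move=> q; exact: sqr_ge0.
 - by move=> q; rewrite mulr_ge0.
 - apply: filterS fc => o ho x; rewrite -(real_normK (num_real (f (o, x)))) expr2.
  by rewrite ler_wpM2r.
by rewrite iintZ// (EFinM c) lee_wpmul2l.
Qed.

Lemma iint_normD f g : measT f -> measT g ->
 (iint (fun q => `|f q + g q|)%R <= iint (fun q => `|f q|)%R + iint (fun q => `|g q|)%R)%E.
Proof.
move=> mf mg; rewrite -iintD//; try exact: measurableT_comp.
apply: le_iint => //; try by move=> q; rewrite addr_ge0.
- by apply: measurableT_comp => //; exact: measurable_funD.
- by apply: measurable_funD; exact: measurableT_comp.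
- by apply: nearW => o x; exact: ler_normD.
Qed.

Lemma iint_cst_fst (f : R -> R) : measT f -> (iint (fun q => `|f q.2|)%R = \int[mu]_x `|f x|%:E)%E.
Proof. by move=> mf; rewrite /iint/= integral_cst//= probability_setT mule1. Qed.

Lemma iint_swap f : measT f -> (forall q, 0 <= f q) ->
 (forall x, bmf (fun o => f (o, x))) ->
 (iint f = \int[mu]_x ('Ex (fun o => f (o, x)))%:E)%E.
Proof.
move=> mf f0 bf; rewrite /iint (@integral_swap _ _ _ _ R P mu f mf f0).
by apply: eq_integral => x _; rewrite (EFin_Ex P (bf x)).
Qed.

End IteratedIntegral.

Section Averages.
Context d (Omega : measurableType d) (R : realType) (P : probability Omega R).
Notation mu := (@lebesgue_measure R).

Lemma norm_avg_le (N : nat) (f : 'I_N -> R) (c : R) : (0 < N)%N -> (forall i, `|f i| <= c) ->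
 `|N%:R^-1 * \sum_(i < N) f i| <= c.
Proof.
move=> N0 fc; rewrite normrM ger0_norm ?invr_ge0// ler_pdivrMl ?ltr0n//.
apply: le_trans (ler_norm_sum _ _ _) _.
by apply: le_trans (ler_sum _ (fun i _ => fc i)) _; rewrite sumr_const card_ord mulr_natl.
Qed.

Lemma avg_expansion (N n : nat) (c : R) (a e : 'I_N -> R) (f g : 'I_N -> nat -> R) :
 N%:R^-1 * \sum_(i < N) (a i + \sum_(0 <= k < n) f i k - c * (\sum_(0 <= k < n) g i k) + e i) =
 N%:R^-1 * (\sum_(i < N) a i) + N%:R^-1 * (\sum_(i < N) \sum_(0 <= k < n) f i k) -
 c * (\sum_(0 <= k < n) N%:R^-1 * (\sum_(i < N) g i k)) + N%:R^-1 * (\sum_(i < N) e i).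
Proof.
have -> : \sum_(0 <= k < n) N%:R^-1 * (\sum_(i < N) g i k) = N%:R^-1 * \sum_(i < N) \sum_(0 <= k < n) g i k.
 by rewrite -mulr_sumr exchange_big.
rewrite big_split/= sumrB big_split/= -mulr_sumr; ring.
Qed.

Lemma iint_avg_le (N : nat) (f : 'I_N -> Omega * R -> R) (c : R) : (0 < N)%N ->
 (forall i, measT (f i)) -> (forall i, (iint P (fun q => `|f i q|)%R <= c%:E)%E) ->
 (iint P (fun q => `|N%:R^-1 * \sum_(i < N) f i q|)%R <= c%:E)%E.
Proof.
move=> N0 mf fc.
have mnf i : measT (fun q => `|f i q|) by exact: measurableT_comp.
have mS : measT (fun q => \sum_(i < N) `|f i q|) by exact: measurable_sum.
have S0 q : 0 <= \sum_(i < N) `|f i q| by exact: sumr_ge0.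
apply: (@le_trans _ _ (iint P (fun q => N%:R^-1 * \sum_(i < N) `|f i q|)%R)).
 apply: le_iint => //.
 - apply: measurableT_comp => //; apply: measurable_funM => //; exact: measurable_sum.
 - exact: measurable_funM.
 - by move=> q; rewrite mulr_ge0.
 - apply: nearW => o x; rewrite normrM ger0_norm ?invr_ge0// ler_wpM2l ?invr_ge0//.
  exact: ler_norm_sum.
rewrite iintZ ?invr_ge0// (iint_sum P _ (F := fun i q => `|f i q|))//.
apply: (@le_trans _ _ ((N%:R^-1)%:E * \sum_(i < N) c%:E)%E).
 by apply: lee_wpmul2l; [rewrite lee_fin invr_ge0|exact: lee_sum].
by rewrite sumEFin sumr_const card_ord -EFinM lee_fin -[c *+ N]mulr_natl mulKf ?pnatr_eq0// -lt0n.
Qed.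

End Averages.

(** * Recursions for the error of the distribution function *)

Section ParticleExpansion.
Context d (Omega : measurableType d) (R : realType) (P : probability Omega R).
Notation mu := (@lebesgue_measure R).
Notation "''Ex' f" := (\int[P]_w f w) (at level 10, f at level 9).
Variables (T sigma L k0 : R) (Lam lam : R -> R).
Hypotheses (T0 : 0 < T) (sigma0 : 0 < sigma).
Hypothesis fb : flux_bounds Lam lam L k0.

Variables (pastl : R -> set (set Omega)) (Wl Xl : R -> Omega -> R) (bl : R * Omega -> R) (Bl : R -> Omega -> R).
Hypothesis dvl : driven P T sigma L pastl Wl Xl bl Bl.
Hypothesis bl_left : forall s (u : nat -> R), 0 < s < T -> (forall j, 0 <= u j <= s) ->
 u @ \oo --> s -> {ae P, forall w, bl (u j, w) @[j --> \oo] --> bl (s, w)}.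
Hypothesis BlE : forall s w, Bl s w = lamF P (Xl s) lam (Xl s w).

Variables (N : nat) (past : 'I_N -> R -> set (set Omega)) (Wp Xp : 'I_N -> R -> Omega -> R).
Variables (bp : 'I_N -> R * Omega -> R) (Bp : 'I_N -> R -> Omega -> R).
Hypothesis N0 : (0 < N)%N.
Hypothesis dvp : forall i, driven P T sigma L (past i) (Wp i) (Xp i) (bp i) (Bp i).
Hypothesis crossX : forall i j r s, 0 <= r -> r <= s -> s <= T -> sub_measurable (past j s) (Xp i r).
Hypothesis crossB : forall i j r s, 0 <= r -> r <= s -> s <= T -> sub_measurable (past j s) (Bp i r).
Hypothesis crossW : forall i j r s, 0 <= r -> i <> j \/ r <= s -> sub_measurable (past j s) (Wp i r).
Hypothesis no_tie : forall i j s, i != j -> 0 < s <= T -> {ae P, forall w, Xp i s w <> Xp j s w}.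

Variables (h eta : R) (m : nat).
Hypotheses (h0 : 0 < h) (mhT : m%:R * h <= T) (eta0 : 0 <= eta).
Hypothesis def_eta : forall i, (\sum_(j < m) cell_defect P (bp i) h j <= eta%:E)%E.
Hypothesis BpE : forall i j w, (j < m)%N ->
 Bp i (j%:R * h) w = rank_drift Lam i (fun l => Xp l (j%:R * h) w).

Notation kap := (kappa T sigma).
Notation w := (sigma ^+ 2 * h).
Notation F := (fun s => rcdf P (Xl s)).
Notation GX := (fun i k => Xp i (k%:R * h)).
Notation GB := (fun i k => Bp i (k%:R * h)).
Notation Gz := (fun i k => increment sigma (Wp i) (k%:R * h) (k.+1%:R * h)).
Notation noise i n k := (grid_noise w h (GX i) (GB i) (Gz i) n k).
Notation drift i n k := (grid_drift w (GX i) (GB i) n k).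
Notation rest i n := (grid_rest w h (GX i) (GB i) (Gz i) n).
Notation mdrift n k := (mean_drift P sigma Xl Bl (n%:R * h) (k%:R * h)).
Notation qerr n := (quad_error P sigma Xl Bl h n).

Let L0 : 0 <= L. Proof. exact: fluxL0 fb. Qed.
Let kp0 : 0 <= k0. Proof. exact: fluxk0 fb. Qed.
Let kap0 : 0 <= kap. Proof. exact: kappa_ge0. Qed.
Let w0 : 0 < w. Proof. by rewrite mulr_gt0// exprn_gt0. Qed.
Let NV : N%:R != 0 :> R. Proof. by rewrite pnatr_eq0 -lt0n. Qed.

Let gp i : grid_process P w h L m (fun k => past i (k%:R * h)) (GX i) (GB i) (Gz i).
Proof. exact: (driven_grid (dvp i) h0 mhT). Qed.

Let kT j : (j <= m)%N -> 0 <= j%:R * h <= T.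
Proof.
move=> jm; rewrite mulr_ge0 ?(ltW h0)//=; apply: (le_trans _ mhT).
by rewrite ler_wpM2r ?ler_nat// ltW.
Qed.

Let mXl s : measT (Xl s). Proof. exact: (dv_Xm dvl). Qed.
Let mXp i s : measT (Xp i s). Proof. exact: (dv_Xm (dvp i)). Qed.

Definition mean_heav (s : R) (q : Omega * R) := N%:R^-1 * \sum_(i < N) heav (Xp i s q.1) q.2.
Definition cdf_error (n : nat) (q : Omega * R) := mean_heav (n%:R * h) q - F (n%:R * h) q.2.
Definition init_error (n : nat) (q : Omega * R) :=
 N%:R^-1 * \sum_(i < N) Kc (n%:R * w) (q.2 - GX i 0%N q.1) - 'Ex (fun o => Kc (n%:R * w) (q.2 - Xl (0%:R * h) o)).
Definition noise_error (n : nat) (q : Omega * R) :=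
 N%:R^-1 * \sum_(i < N) \sum_(0 <= k < n) noise i n k q.
Definition drift_error (n k : nat) (q : Omega * R) :=
 N%:R^-1 * (\sum_(i < N) drift i n k q) - mdrift n k q.2.
(** The sum starts at [k = 1]: at time 0 there may be ties and atoms, and the flux identity may
    fail. The term [k = 0], of order [h] in $L^1$, is counted in [rest_error]. *)
Definition sum_drift_error (n : nat) (q : Omega * R) := h * \sum_(1 <= k < n) drift_error n k q.
Definition rest_error (n : nat) (q : Omega * R) :=
 N%:R^-1 * (\sum_(i < N) rest i n q) - qerr n q.2 - h * drift_error n 0 q.

Lemma cdf_errorE n q : (0 < n)%N ->
 cdf_error n q = init_error n q + noise_error n q - sum_drift_error n q + rest_error n q.
Proof.
move=> n0; case: q => o x.
have FE : F (n%:R * h) x = 'Ex (fun o => Kc (n%:R * w) (x - Xl (0%:R * h) o)) -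
  h * \sum_(0 <= k < n) mdrift n k x + qerr n x.
 rewrite /quad_error (_ : n%:R * w = sigma ^+ 2 * (n%:R * h)); last by ring.
 by rewrite mul0r; ring.
have HE : mean_heav (n%:R * h) (o, x) = N%:R^-1 * (\sum_(i < N) Kc (n%:R * w) (x - GX i 0%N o)) +
  N%:R^-1 * (\sum_(i < N) \sum_(0 <= k < n) noise i n k (o, x)) -
  h * (\sum_(0 <= k < n) N%:R^-1 * (\sum_(i < N) drift i n k (o, x))) + N%:R^-1 * (\sum_(i < N) rest i n (o, x)).
 rewrite /mean_heav (eq_bigr (fun i => Kc (n%:R * w) (x - GX i 0%N o) + \sum_(0 <= k < n) noise i n k (o, x)
   - h * (\sum_(0 <= k < n) drift i n k (o, x)) + rest i n (o, x))); last first.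
  by move=> i _; rewrite -(grid_expansionE w h (GX i) (GB i) (Gz i) n (o, x)).
 exact: avg_expansion.
rewrite /cdf_error HE FE /init_error /noise_error /rest_error /sum_drift_error /=.
have dE : h * \sum_(1 <= k < n) drift_error n k (o, x) =
  h * (\sum_(0 <= k < n) N%:R^-1 * (\sum_(i < N) drift i n k (o, x))) - h * (\sum_(0 <= k < n) mdrift n k x)
  - h * drift_error n 0 (o, x).
 rewrite -mulrBr -sumrB [in RHS]big_ltn//= -mulrBr; congr (h * _).
 by rewrite -[drift_error n 0 (o, x)]/(N%:R^-1 * (\sum_(i < N) drift i n 0%N (o, x)) - mdrift n 0%N x) addrAC subrr add0r.
rewrite dE.
have rid (a b c e f g u v : R) : a + b - c + e - (f - g + u) = a - f + b - (c - g - v) + (e - u - v) by ring.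
exact: rid.
Qed.

Let bKp i v x : bmf (fun o => Kc v (x - GX i 0%N o)). Proof. exact: (bmf_KcX (gp i)). Qed.

Lemma meas_init_error n : measT (init_error n).
Proof.
apply: measurable_funB.
 apply: measurable_funM => //; apply: measurable_sum => i.
 by apply: meas_joint_kernel => //; exact: meas_Kc.
have mE : measT (fun x : R => 'Ex (fun o => Kc (n%:R * w) (x - Xl (0%:R * h) o))).
 apply: (meas_Ex P (f := fun q => Kc (n%:R * w) (q.2 - Xl (0%:R * h) q.1))).
 by apply: meas_joint_kernel => //; exact: meas_Kc.
exact: (measurableT_comp mE).
Qed.

Lemma meas_noise_error n : measT (noise_error n).
Proof.
apply: measurable_funM => //; apply: measurable_sum => i; apply: measurable_sum => k.
exact: (meas_grid_noise (gp i)).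
Qed.

Lemma meas_drift_error n k : measT (drift_error n k).
Proof.
apply: measurable_funB.
 by apply: measurable_funM => //; apply: measurable_sum => i; exact: (meas_grid_drift (gp i)).
exact: (measurableT_comp (meas_mean_drift dvl _ _)).
Qed.

Lemma meas_sum_drift_error n : measT (sum_drift_error n).
Proof.
apply: measurable_funM => //; apply: measurable_sum => k; exact: meas_drift_error.
Qed.

Lemma meas_rest_error n : (n <= m)%N -> measT (rest_error n).
Proof.
move=> nm; have /andP[_ nT] := kT nm.
apply: measurable_funB; [apply: measurable_funB|].
- by apply: measurable_funM => //; apply: measurable_sum => i; exact: (meas_grid_rest (gp i)).
- exact: (measurableT_comp (meas_quad_error sigma0 dvl h0 nT)).
- by apply: measurable_funM => //; exact: meas_drift_error.
Qed.

Lemma meas_mean_heav s : measT (mean_heav s).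
Proof.
apply: measurable_funM => //; apply: measurable_sum => i.
by apply: meas_heav => //; exact: meas_fst_comp.
Qed.

Lemma meas_cdf_error n : measT (cdf_error n).
Proof.
apply: measurable_funB; first exact: meas_mean_heav.
exact: (measurableT_comp (meas_rcdf P (mXl _))).
Qed.

Lemma mean_heav_in01 s q : in01 (mean_heav s q).
Proof. by case: q => o x; exact: (empcdf_in01 (fun i => Xp i s o) x). Qed.

Lemma norm_cdf_error n q : `|cdf_error n q| <= 1.
Proof.
have /andP[a0 a1] := mean_heav_in01 (n%:R * h) q.
have /andP[b0 b1] := rcdf_in01 P (mXl (n%:R * h)) q.2.
by rewrite ler_norml /cdf_error; apply/andP; split; lra.
Qed.

Lemma bmf_cdf_error n x : bmf (fun o => cdf_error n (o, x)).
Proof.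
split; first exact: (meas_slice2 x (meas_cdf_error n)).
by exists 1 => o; exact: norm_cdf_error.
Qed.

(** The initial contribution is the Gaussian smoothing of the error at time 0, so no norm of it
    exceeds that of the initial error, for any [n]. *)
Lemma init_error_conv n o x : (0 < n)%N ->
 init_error n (o, x) = conv (gk (n%:R * w)) (fun y => cdf_error 0 (o, y)) x.
Proof.
move=> n0; have nw : 0 < n%:R * w by rewrite mulr_gt0// ltr0n.
have mg := meas_gk (n%:R * w); have ig := integrable_gk (n%:R * w).
rewrite /init_error /=.
under eq_bigr do rewrite Kc_shift//.
rewrite (_ : 'Ex (fun o => Kc (n%:R * w) (x - Xl (0%:R * h) o)) = conv (gk (n%:R * w)) (F (0%:R * h)) x); last first.
 transitivity ('Ex (fun o => 1 * conv (gk (n%:R * w)) (heav (Xl (0%:R * h) o)) x)).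
  by apply: eq_Rintegral => o' _; rewrite mul1r Kc_shift.
 rewrite (Ex_conv P x mg ig (@bmf_cst _ Omega R 1) (mXl (0%:R * h))); congr (conv _ _ x).
 by apply/funext => y; apply: eq_Rintegral => o' _; rewrite mul1r.
rewrite mulr_sumr -(@conv_sum R 'I_N _ (gk (n%:R * w)) (fun i => heav (GX i 0%N o)) (fun=> N%:R^-1) x 1)//; last 2 first.
 by move=> i; exact: meas_heavr.
 by move=> i y; exact: norm_heav_le.
rewrite -(@convB R _ _ _ _ 1)//.
- by congr (conv _ _ x); apply/funext => y; rewrite /cdf_error /mean_heav /= mulr_sumr.
- by apply: measurable_sum => i; apply: measurable_funM => //; exact: meas_heavr.
- exact: meas_rcdf.
- move=> y; rewrite -mulr_sumr; apply: norm_avg_le => // i; exact: norm_heav_le.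
- by move=> y; have /andP[a b] := rcdf_in01 P (mXl (0%:R * h)) y; rewrite ger0_norm.
Qed.

Lemma mean_init_error_conv n x : (0 < n)%N ->
 'Ex (fun o => init_error n (o, x)) = conv (gk (n%:R * w)) (fun y => 'Ex (fun o => cdf_error 0 (o, y))) x.
Proof.
move=> n0; have nw : 0 < n%:R * w by rewrite mulr_gt0// ltr0n.
have mg := meas_gk (n%:R * w); have ig := integrable_gk (n%:R * w).
have Kconv (Z : Omega -> R) : measT Z -> 'Ex (fun o => Kc (n%:R * w) (x - Z o)) = conv (gk (n%:R * w)) (rcdf P Z) x.
 move=> mZ; transitivity ('Ex (fun o => 1 * conv (gk (n%:R * w)) (heav (Z o)) x)).
  by apply: eq_Rintegral => o' _; rewrite mul1r Kc_shift.
 rewrite (Ex_conv P x mg ig (@bmf_cst _ Omega R 1) mZ); congr (conv _ _ x).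
 by apply/funext => y; apply: eq_Rintegral => o' _; rewrite mul1r.
rewrite /init_error /= ExB; last 2 first.
 by apply: bmfZ; apply: bmf_sum => i; exact: bKp.
 exact: bmf_cst.
rewrite Ex_cst ExZ; last by apply: bmf_sum => i; exact: bKp.
rewrite Ex_sum; last by move=> i; exact: bKp.
rewrite Kconv//; under eq_bigr do rewrite Kconv//.
have r1 (Z : Omega -> R) y : measT Z -> `|rcdf P Z y| <= 1.
 by move=> mZ; have /andP[a b] := rcdf_in01 P mZ y; rewrite ger0_norm.
rewrite mulr_sumr -(@conv_sum R 'I_N _ (gk (n%:R * w)) (fun i => rcdf P (GX i 0%N)) (fun=> N%:R^-1) x 1)//; last 2 first.
 by move=> i; exact: meas_rcdf.
 by move=> i y; exact: r1.
rewrite -(@convB R _ _ _ _ 1)//.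
- congr (conv _ _ x); apply/funext => y; rewrite /cdf_error /mean_heav /= ExB; last 2 first.
  by apply: bmfZ; apply: bmf_sum => i; apply: bmf_heav.
  exact: bmf_cst.
 rewrite Ex_cst ExZ; last by apply: bmf_sum => i; apply: bmf_heav.
 by rewrite Ex_sum ?mulr_sumr// => i; apply: bmf_heav.
- by apply: measurable_sum => i; apply: measurable_funM => //; exact: meas_rcdf.
- exact: meas_rcdf.
- by move=> y; rewrite -mulr_sumr; apply: norm_avg_le => // i; exact: r1.
- by move=> y; exact: r1.
Qed.

Lemma iint_sqr_init_error n : (0 < n)%N ->
 (iint P (fun q => init_error n q ^+ 2)%R <= iint P (fun q => cdf_error 0 q ^+ 2)%R)%E.
Proof.
move=> n0; apply: ae_le_iint.
- by apply: measurable_funX; exact: meas_init_error.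
- by apply: measurable_funX; exact: meas_cdf_error.
- by move=> q; exact: sqr_ge0.
- by move=> q; exact: sqr_ge0.
apply: nearW => o; under eq_integral do rewrite init_error_conv//.
have m0 : measT (fun y => cdf_error 0 (o, y)) by exact: (meas_slice1 o (meas_cdf_error 0)).
apply: le_trans (conv_L2 (meas_gk _) m0 (integral_norm_gk _)) _.
by rewrite expr1n mul1e.
Qed.

Lemma integral_mean_init_error n : (0 < n)%N ->
 (\int[mu]_x `|'Ex (fun o => init_error n (o, x))|%:E <= \int[mu]_x `|'Ex (fun o => cdf_error 0 (o, x))|%:E)%E.
Proof.
move=> n0; under eq_integral do rewrite mean_init_error_conv//.
have m0 : measT (fun y => 'Ex (fun o => cdf_error 0 (o, y))) by exact: (meas_Ex P (meas_cdf_error 0)).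
apply: le_trans (conv_L1 (meas_gk _) m0 (integral_norm_gk _)) _.
by rewrite mul1e.
Qed.

Let hkap n : (n <= m)%N -> h * Num.sqrt n%:R / Num.sqrt w <= kap.
Proof.
move=> nm; apply: grid_kappa => //; apply: le_trans mhT.
by rewrite ler_wpM2r ?ler_nat// ltW.
Qed.

Let cross i j k l : (l < m)%N -> (k < l)%N \/ (k = l /\ i <> j) ->
 [/\ sub_measurable (past j (l%:R * h)) (GX i k), sub_measurable (past j (l%:R * h)) (GB i k) &
   sub_measurable (past j (l%:R * h)) (Gz i k)].
Proof.
move=> lm kl; have /andP[l0 lT] := kT (ltnW lm).
have k_le : (k <= l)%N by case: kl => [/ltnW|[->]].
have kh0 : 0 <= k%:R * h by rewrite mulr_ge0// ltW.
have klh : k%:R * h <= l%:R * h by rewrite ler_wpM2r ?ler_nat// ltW.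
split; [exact: crossX|exact: crossB|].
apply/sub_measurableP; apply: measurable_funM => //; apply: measurable_funB; apply/sub_measurableP.
 apply: crossW; first by rewrite mulr_ge0// ltW.
 by case: kl => [kl|[_ ij]]; [right; rewrite ler_wpM2r ?ler_nat// ltW|left].
by apply: crossW => //; right.
Qed.

Let bnoise i n k x : bmf (fun o => noise i n k (o, x)). Proof. exact: (bmf_grid_noise (gp i)). Qed.

Lemma iint_sqr_noise_error n : (0 < n <= m)%N ->
 (iint P (fun q => noise_error n q ^+ 2)%R <= (N%:R^-1 * (16 * sigma * Num.sqrt T))%:E)%E.
Proof.
move=> /andP[n0 nm]; rewrite iint_swap; last first.
 by move=> x; apply: bmfX; apply: bmfZ; apply: bmf_sum => i; apply: bmf_sum => k; exact: bnoise.
 by move=> q; exact: sqr_ge0.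
 by apply: measurable_funX; exact: meas_noise_error.
apply: le_trans (family_noise_variance w0 N0 gp cross nm) _.
rewrite lee_fin ler_wpM2l ?invr_ge0//.
have /andP[nh0 nT] := kT nm.
have sq : Num.sqrt w * Num.sqrt n%:R <= sigma * Num.sqrt T.
 rewrite sqrt_grid_var// -mulrA ler_wpM2l ?(ltW sigma0)// -sqrtrM ?(ltW h0)//.
 by rewrite ler_wsqrtr// mulrC.
(* This puts the last, unsmoothed step on the same footing as the others; the constant 16 is 4 +
   12. *)
have n1 : 1 <= Num.sqrt n%:R :> R by rewrite -[X in X <= _]sqrtr1 ler_wsqrtr// ler1n.
have : Num.sqrt w <= Num.sqrt w * Num.sqrt n%:R by rewrite ler_peMr.
by move: sq; lra.
Qed.

Lemma mean_noise_error n x : (n <= m)%N -> 'Ex (fun o => noise_error n (o, x)) = 0.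
Proof.
move=> nm; rewrite /noise_error ExZ; last by apply: bmf_sum => i; apply: bmf_sum => k; exact: bnoise.
rewrite Ex_sum; last by move=> i; apply: bmf_sum => k; exact: bnoise.
rewrite big1 ?mulr0// => i _.
rewrite Ex_sum; last by move=> k; exact: bnoise.
rewrite big_nat big1// => k /andP[_ kn]; apply: (Ex_grid_noise w0 (gp i) x kn).
exact: leq_trans nm.
Qed.

Definition flux_error (k : nat) (o : Omega) (y : R) :=
 Lam (mean_heav (k%:R * h) (o, y)) - Lam (F (k%:R * h) y).

Let no_ties k : (0 < k <= m)%N -> {ae P, forall o i j, GX i k o = GX j k o -> i = j}.
Proof.
move=> /andP[k1 km]; have /andP[_ kT'] := kT km.
have kh : 0 < k%:R * h <= T by rewrite mulr_gt0 ?ltr0n.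
apply: filter_forall => i; apply: filter_forall => j.
have [->|ij] := eqVneq i j; first by apply: nearW.
by apply: filterS (no_tie ij kh) => o ne E.
Qed.

Let sum_flux k o y : (0 < k < m)%N -> (forall i j, GX i k o = GX j k o -> i = j) ->
 N%:R^-1 * (\sum_(i < N) GB i k o * heav (GX i k o) y) = Lam (mean_heav (k%:R * h) (o, y)) - Lam 0.
Proof.
move=> /andP[k0' km] inj; rewrite -(sum_lambdaN_heav (x := fun i => GX i k o) Lam y N0 inj).
by congr (_ * _); apply: eq_bigr => i _; rewrite BpE// rank_driftE.
Qed.

Let HlE k y : (0 < k <= m)%N -> mean_flux P (Xl (k%:R * h)) (Bl (k%:R * h)) y = Lam (F (k%:R * h) y) - Lam 0.
Proof.
move=> /andP[k1 km]; have /andP[_ kT'] := kT km.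
by apply: (mean_flux_lamF sigma0 dvl fb BlE); rewrite mulr_gt0 ?ltr0n.
Qed.

Let gap k n : (k < n)%N -> sigma ^+ 2 * (n%:R * h - k%:R * h) = (n - k)%:R * w.
Proof. by move=> kn; rewrite natrB 1?ltnW//; ring. Qed.

Let mHl k : measT (mean_flux P (Xl (k%:R * h)) (Bl (k%:R * h))).
Proof. by apply: meas_mean_flux => //; exact: (dv_Bm dvl). Qed.

Let HlL k y : `|mean_flux P (Xl (k%:R * h)) (Bl (k%:R * h)) y| <= L.
Proof. by apply: norm_mean_flux => //; [exact: (dv_Bm dvl)|exact: (dv_BL dvl)]. Qed.

Let mdriftE n k x : (k < n)%N ->
 mdrift n k x = conv (dgk ((n - k)%:R * w)) (mean_flux P (Xl (k%:R * h)) (Bl (k%:R * h))) x.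
Proof.
move=> kn; have kh : k%:R * h < n%:R * h by rewrite ltr_pM2r// ltr_nat.
by rewrite (mean_driftE sigma0 dvl x kh) gap.
Qed.

(** Almost surely no two particles coincide at the grid time, so the averaged drift is the
    [dgk]-smoothing of a function of the empirical distribution function alone, and the limit has
    the same form. *)
Lemma drift_error_conv n k : (0 < k < n)%N -> (n <= m)%N ->
 {ae P, forall o x, drift_error n k (o, x) = conv (dgk ((n - k)%:R * w)) (flux_error k o) x}.
Proof.
move=> /andP[k1 kn] nm; have km := leq_trans kn nm.
have kp : (0 < k <= m)%N by rewrite k1 ltnW.
have v0 : 0 < (n - k)%:R * w by rewrite mulr_gt0// ltr0n subn_gt0.
apply: filterS (no_ties kp) => o inj x.
rewrite /drift_error /= mdriftE//.
have -> : N%:R^-1 * (\sum_(i < N) drift i n k (o, x)) =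
  conv (dgk ((n - k)%:R * w)) (fun y => \sum_(i < N) (N%:R^-1 * GB i k o) * heav (GX i k o) y) x.
 rewrite (@conv_sum R 'I_N _ (dgk ((n - k)%:R * w)) (fun i => heav (GX i k o)) (fun i => N%:R^-1 * GB i k o) x 1)//.
 - by rewrite mulr_sumr; apply: eq_bigr => i _; rewrite -[RHS]mulrA; congr (_ * _);
  congr (_ * _); exact: gk_conv_heav.
 - exact: meas_dgk.
 - exact: integrable_dgk.
 - by move=> i; exact: meas_heavr.
 - by move=> i y; exact: norm_heav_le.
rewrite -(@convB R _ _ _ _ L)//.
- congr (conv _ _ x); apply/funext => y; rewrite HlE//.
 under eq_bigr do rewrite -mulrA.
 by rewrite -mulr_sumr sum_flux ?k1// /flux_error; ring.
- exact: meas_dgk.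
- exact: integrable_dgk.
- by apply: measurable_sum => i; apply: measurable_funM => //; exact: meas_heavr.
- move=> y; under eq_bigr do rewrite -mulrA.
 rewrite -mulr_sumr; apply: norm_avg_le => // i.
 by rewrite normrM -[leRHS]mulr1 ler_pM// ?norm_heav_le// (dv_BL (dvp i)).
Qed.

Let mflux k o : measT (flux_error k o).
Proof.
have mL (g : R -> R) : measT g -> (forall y, in01 (g y)) -> measT (fun y => Lam (g y)).
 move=> mg g01; rewrite (_ : (fun y => Lam (g y)) = (fun u => Lam (clip01 u)) \o g); last first.
  by apply/funext => y; rewrite /= clip01_id.
 apply: measurableT_comp => //; apply: continuous_measurable_fun; exact: continuous_Lam_clip01 fb.
apply: measurable_funB; apply: mL.
- exact: (meas_slice1 o (meas_mean_heav _)).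
- by move=> y; exact: mean_heav_in01.
- exact: meas_rcdf.
- by move=> y; exact: rcdf_in01.
Qed.

Lemma norm_flux_error k o y : `|flux_error k o y| <= L * `|cdf_error k (o, y)|.
Proof. by apply: (flux_Lam fb); [exact: rcdf_in01|exact: mean_heav_in01]. Qed.

Lemma iint_sqr_sum_drift_error n : (0 < n <= m)%N ->
 (iint P (fun q => sum_drift_error n q ^+ 2)%R <=
  (9 / 2 * kap * (h / Num.sqrt w) * L ^+ 2)%:E *
   \sum_(1 <= k < n) (isq R (n - k))%:E * iint P (fun q => cdf_error k q ^+ 2)%R)%E.
Proof.
move=> /andP[n0 nm].
set c := 9 / 2 * kap * (h / Num.sqrt w).
have c0 : 0 <= c by rewrite /c !mulr_ge0 ?invr_ge0// ltW.
have hae : {ae P, forall o k, (0 < k < n)%N -> forall x,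
  drift_error n k (o, x) = conv (dgk ((n - k)%:R * w)) (flux_error k o) x}.
 apply: ae_foralln => k; case: (boolP (0 < k < n)%N) => kn; last by apply: nearW.
 by apply: filterS (drift_error_conv kn nm).
pose G k (q : Omega * R) := isq R (n - k) * cdf_error k q ^+ 2.
have mG k : measT (G k) by apply: measurable_funM => //; apply: measurable_funX; exact: meas_cdf_error.
have G0 k q : 0 <= G k q by rewrite mulr_ge0 ?isq_ge0 ?sqr_ge0.
have mD k : measT (fun q => cdf_error k q ^+ 2) by apply: measurable_funX; exact: meas_cdf_error.
have D0 k q : 0 <= cdf_error k q ^+ 2 by exact: sqr_ge0.
have iG k : (iint P (G k) = (isq R (n - k))%:E * iint P (fun q => cdf_error k q ^+ 2)%R)%E.
 by rewrite iintZ// isq_ge0.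
rewrite -(eq_bigr _ (fun k _ => iG k)) -iint_sum// -iintZ//; last 3 first.
 by apply: measurable_sum => k.
 by move=> q; apply: sumr_ge0.
 by rewrite mulr_ge0 ?sqr_ge0.
apply: ae_le_iint.
- by apply: measurable_funX; exact: meas_sum_drift_error.
- by apply: measurable_funM => //; apply: measurable_sum => k.
- by move=> q; exact: sqr_ge0.
- by move=> q; apply: mulr_ge0; [rewrite mulr_ge0 ?sqr_ge0|exact: sumr_ge0].
apply: filterS hae => o ho.
have -> : (\int[mu]_x (sum_drift_error n (o, x) ^+ 2)%:E = \int[mu]_x (drift_sum w h 1 n (fun k => flux_error k o) x ^+ 2)%:E)%E.
 apply: eq_integral => x _; rewrite /sum_drift_error /drift_sum; congr ((h * _) ^+ 2)%:E.
 by rewrite big_nat [RHS]big_nat; apply: eq_bigr => k kn; rewrite ho.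
apply: le_trans (@drift_L2 R w h kap 1 n (flux_error^~ o) w0 (ltW h0) (fun k => mflux k o) (hkap nm)) _.
rewrite -/c.
have mGo k : measT (fun x => (G k (o, x))%:E) by unEFin; exact: (meas_slice1 o (mG k)).
have Go0 k x : (0 <= (G k (o, x))%:E)%E by rewrite lee_fin.
have mSo : measT (fun x => \sum_(1 <= k < n) (G k (o, x))%:E)%E by apply: emeasurable_sum.
have So0 x : (0 <= \sum_(1 <= k < n) (G k (o, x))%:E)%E by apply: sume_ge0.
have cL0 : (0 <= (c * L ^+ 2)%:E)%E by rewrite lee_fin mulr_ge0 ?sqr_ge0.
have -> : (\int[mu]_x ((c * L ^+ 2) * \sum_(1 <= k < n) G k (o, x))%R%:E =
  (c * L ^+ 2)%:E * \sum_(1 <= k < n) \int[mu]_x (G k (o, x))%:E)%E.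
 rewrite -(ge0_integral_sum mu measurableT mGo (fun k x _ => Go0 k x)).
 rewrite -(ge0_integralZl mu measurableT mSo (fun x _ => So0 x) cL0).
 by apply: eq_integral => x _; rewrite EFinM sumEFin.
rewrite (EFinM c) -muleA; apply: lee_wpmul2l; first by rewrite lee_fin.
rewrite ge0_sume_distrr; last by move=> k _; apply: integral_ge0.
apply: lee_sum => k _.
have mDo : measT (fun x => (cdf_error k (o, x) ^+ 2)%:E) by unEFin; exact: (meas_slice1 o (mD k)).
have Do0 x : (0 <= (cdf_error k (o, x) ^+ 2)%:E)%E by rewrite lee_fin.
have is0 : (0 <= (isq R (n - k))%:E)%E by rewrite lee_fin isq_ge0.
have L20 : (0 <= (L ^+ 2)%:E)%E by rewrite lee_fin sqr_ge0.
have -> : (\int[mu]_x (G k (o, x))%:E = (isq R (n - k))%:E * \int[mu]_x (cdf_error k (o, x) ^+ 2)%:E)%E.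
 rewrite -(ge0_integralZl mu measurableT mDo (fun x _ => Do0 x) is0).
 by apply: eq_integral => x _; rewrite EFinM.
rewrite muleCA; apply: lee_wpmul2l => //.
rewrite -(ge0_integralZl mu measurableT mDo (fun x _ => Do0 x) L20).
apply: ge0_le_integral => //.
- by move=> x _; rewrite lee_fin sqr_ge0.
- by unEFin; apply: measurable_funX; exact: mflux.
- exact: measurable_funeM.
- move=> x _; rewrite -EFinM lee_fin -exprMn -(real_normK (num_real (flux_error k o x))).
 rewrite -[leRHS](real_normK (num_real _)) ler_sqr ?nnegrE// normrM (ger0_norm L0).
 exact: norm_flux_error.
Qed.

Let bdrift i n k x : (k < n)%N -> bmf (fun o => drift i n k (o, x)).
Proof. exact: (bmf_grid_drift w0 (gp i)). Qed.

Let bheav i k x : bmf (fun o => heav (GX i k o) x).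
Proof. exact: bmf_heav. Qed.

Let bBheav i k x : bmf (fun o => GB i k o * heav (GX i k o) x).
Proof.
apply: bmfM => //; split; first exact: (dv_Bm (dvp i)).
by exists L => o; exact: (dv_BL (dvp i)).
Qed.

Definition mean_flux_error (k : nat) (y : R) :=
 N%:R^-1 * (\sum_(i < N) mean_flux P (GX i k) (GB i k) y) - mean_flux P (Xl (k%:R * h)) (Bl (k%:R * h)) y.

Lemma mean_drift_error n k x : (k < n)%N ->
 'Ex (fun o => drift_error n k (o, x)) = conv (dgk ((n - k)%:R * w)) (mean_flux_error k) x.
Proof.
move=> kn; have v0 : 0 < (n - k)%:R * w by rewrite mulr_gt0// ltr0n subn_gt0.
rewrite /drift_error /= ExB; last 2 first.
 by apply: bmfZ; apply: bmf_sum => i; exact: bdrift.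
 exact: bmf_cst.
rewrite Ex_cst ExZ; last by apply: bmf_sum => i; exact: bdrift.
rewrite Ex_sum; last by move=> i; exact: bdrift.
have mfx i : measT (mean_flux P (GX i k) (GB i k)).
 by apply: meas_mean_flux => //; exact: (dv_Bm (dvp i)).
have fxL i y : `|mean_flux P (GX i k) (GB i k) y| <= L.
 by apply: norm_mean_flux => //; [exact: (dv_Bm (dvp i))|exact: (dv_BL (dvp i))].
have -> : N%:R^-1 * (\sum_(i < N) 'Ex (fun o => drift i n k (o, x))) =
  conv (dgk ((n - k)%:R * w)) (fun y => \sum_(i < N) N%:R^-1 * mean_flux P (GX i k) (GB i k) y) x.
 rewrite (@conv_sum R 'I_N _ (dgk ((n - k)%:R * w)) (fun i => mean_flux P (GX i k) (GB i k)) (fun=> N%:R^-1) x L)//.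
 - rewrite mulr_sumr; apply: eq_bigr => i _; congr (_ * _).
  apply: Ex_drift_conv => //; split; first exact: (dv_Bm (dvp i)).
  by exists L => o; exact: (dv_BL (dvp i)).
 - exact: meas_dgk.
 - exact: integrable_dgk.
rewrite mdriftE// -(@convB R _ _ _ _ L)//.
- by congr (conv _ _ x); apply/funext => y; rewrite -mulr_sumr.
- exact: meas_dgk.
- exact: integrable_dgk.
- by apply: measurable_sum => i; exact: measurable_funM.
- by move=> y; rewrite -mulr_sumr; exact: norm_avg_le.
Qed.

(** The tangent of [Lam] is taken at the deterministic value of the limit, so its slope leaves the
    expectation. The remainder is bounded almost surely only, since rewriting the particle flux
    needs the absence of ties. *)
Lemma norm_mean_flux_error k y : (0 < k < m)%N -> `|mean_flux_error k y| <=
 L * `|'Ex (fun o => cdf_error k (o, y))| + k0 * 'Ex (fun o => cdf_error k (o, y) ^+ 2).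
Proof.
move=> /[dup] km /andP[k1 km']; have kp : (0 < k <= m)%N by rewrite k1 ltnW.
pose xi o := N%:R^-1 * (\sum_(i < N) GB i k o * heav (GX i k o) y).
have bxi : bmf xi by apply: bmfZ; apply: bmf_sum => i; exact: bBheav.
set Fk := F (k%:R * h) y.
have Fk01 : in01 Fk by exact: rcdf_in01.
have bD := bmf_cdf_error k y.
have bD2 : bmf (fun o => cdf_error k (o, y) ^+ 2) by exact: bmfX.
have bC : bmf (fun o => lam Fk * cdf_error k (o, y)) by exact: bmfZ.
have bxc : bmf (fun o => xi o - (Lam Fk - Lam 0)) by apply: bmfB => //; exact: bmf_cst.
have bZ : bmf (fun o => xi o - (Lam Fk - Lam 0) - lam Fk * cdf_error k (o, y)) by exact: bmfB.
have E : mean_flux_error k y = lam Fk * 'Ex (fun o => cdf_error k (o, y)) +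
  'Ex (fun o => xi o - (Lam Fk - Lam 0) - lam Fk * cdf_error k (o, y)).
 rewrite (ExB P bxc bC) (ExB P bxi (@bmf_cst _ Omega R (Lam Fk - Lam 0))).
 rewrite Ex_cst (ExZ P _ bD) /xi ExZ; last by apply: bmf_sum => i; exact: bBheav.
 rewrite Ex_sum; last by move=> i; exact: bBheav.
 have rid (a b c : R) : a - b = c + (a - b - c) by ring.
 by rewrite /mean_flux_error HlE//; exact: rid.
rewrite E; apply: le_trans (ler_normD _ _) _; apply: lerD.
 by rewrite normrM ler_wpM2r//; exact: (flux_lam fb).
apply: le_trans (Ex_norm P bZ) _; rewrite -ExZ//.
apply: Ex_le_ae; [exact: bmf_norm|exact: bmfZ|].
apply: filterS (no_ties kp) => o inj; rewrite /xi sum_flux//.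
have := flux_taylor fb Fk01 (mean_heav_in01 (k%:R * h) (o, y)).
by rewrite /cdf_error /= -/Fk (_ : _ - Lam 0 - _ - _ = Lam (mean_heav (k%:R * h) (o, y)) - Lam Fk - lam Fk * (mean_heav (k%:R * h) (o, y) - Fk)); last by ring.
Qed.

Lemma meas_mean_flux_error k : measT (mean_flux_error k).
Proof.
apply: measurable_funB => //; apply: measurable_funM => //; apply: measurable_sum => i.
by apply: meas_mean_flux => //; exact: (dv_Bm (dvp i)).
Qed.

Notation u k := (\int[mu]_x `|'Ex (fun o => cdf_error k (o, x))|%:E)%E.
Notation v k := (iint P (fun q => cdf_error k q ^+ 2)).

Lemma integral_mean_flux_error k : (0 < k < m)%N ->
 (\int[mu]_y `|mean_flux_error k y|%:E <= L%:E * u k + k0%:E * v k)%E.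
Proof.
move=> km; have mD := meas_Ex P (meas_cdf_error k).
have mnD : measT (fun x => `|'Ex (fun o => cdf_error k (o, x))|%:E).
 by unEFin; exact: measurableT_comp.
have mD2 : measT (fun q => cdf_error k q ^+ 2) by apply: measurable_funX; exact: meas_cdf_error.
have mE2 : measT (fun x => ('Ex (fun o => cdf_error k (o, x) ^+ 2))%:E).
 by unEFin; exact: (meas_Ex P mD2).
have a0 x : (0 <= `|'Ex (fun o => cdf_error k (o, x))|%:E)%E by rewrite lee_fin.
have e0 x : (0 <= ('Ex (fun o => cdf_error k (o, x) ^+ 2))%:E)%E.
 by rewrite lee_fin; apply: Ex_ge0 => o; exact: sqr_ge0.
have L0' : (0 <= L%:E)%E by rewrite lee_fin.
have k0' : (0 <= k0%:E)%E by rewrite lee_fin.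
have la0 x : (0 <= L%:E * `|'Ex (fun o => cdf_error k (o, x))|%:E)%E by rewrite mule_ge0.
have le0 x : (0 <= k0%:E * ('Ex (fun o => cdf_error k (o, x) ^+ 2))%:E)%E by rewrite mule_ge0.
rewrite (iint_swap P mD2); last 2 first.
 by move=> q; exact: sqr_ge0.
 by move=> x; apply: bmfX; exact: bmf_cdf_error.
rewrite -(ge0_integralZl mu measurableT mnD (fun x _ => a0 x) L0').
rewrite -(ge0_integralZl mu measurableT mE2 (fun x _ => e0 x) k0').
rewrite -(ge0_integralD mu measurableT (fun x _ => la0 x) (measurable_funeM L%:E mnD) (fun x _ => le0 x) (measurable_funeM k0%:E mE2)).
apply: ge0_le_integral => //.
- by mnorm; exact: meas_mean_flux_error.
- by apply: emeasurable_funD; exact: measurable_funeM.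
- by move=> y _; rewrite -!EFinM -EFinD lee_fin; exact: norm_mean_flux_error.
Qed.

Lemma integral_mean_sum_drift_error n : (0 < n <= m)%N ->
 (\int[mu]_x `|'Ex (fun o => sum_drift_error n (o, x))|%:E <=
  (3 / 2 * (h / Num.sqrt w))%:E * \sum_(1 <= k < n) (isq R (n - k))%:E * (L%:E * u k + k0%:E * v k))%E.
Proof.
move=> /andP[n0 nm].
have bde k x : (k < n)%N -> bmf (fun o => drift_error n k (o, x)).
 move=> kn; rewrite /drift_error /=; apply: bmfB; last exact: (@bmf_cst _ Omega R (mdrift n k x)).
 by apply: bmfZ; apply: bmf_sum => i; exact: bdrift.
have E x : 'Ex (fun o => sum_drift_error n (o, x)) = drift_sum w h 1 n mean_flux_error x.
 have bde' k : bmf (fun o => (k < n)%N%:R * drift_error n k (o, x)).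
  have [kn|kn] := boolP (k < n)%N; first exact/bmfZ/bde.
  rewrite (_ : (fun o => _) = cst 0); first exact: bmf_cst.
  by apply/funext => o; rewrite mul0r.
 have -> : (fun o => sum_drift_error n (o, x)) = (fun o => h * \sum_(1 <= k < n) ((k < n)%N%:R * drift_error n k (o, x))).
  apply/funext => o; congr (h * _); rewrite big_nat [RHS]big_nat; apply: eq_bigr => k /andP[_ ->].
  by rewrite mul1r.
 rewrite ExZ; last exact: bmf_sum.
 rewrite Ex_sum// /drift_sum; congr (h * _); rewrite big_nat [RHS]big_nat; apply: eq_bigr => k /andP[_ kn].
 rewrite -mean_drift_error//; apply: eq_Rintegral => o _.
 by rewrite kn mul1r.
under eq_integral do rewrite E.
apply: le_trans (@drift_L1 R w h 1 n mean_flux_error w0 (ltW h0) meas_mean_flux_error) _.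
apply: lee_wpmul2l; first by rewrite lee_fin !mulr_ge0 ?invr_ge0// ltW.
rewrite big_nat [leRHS]big_nat; apply: lee_sum => k /andP[k1 kn].
apply: lee_wpmul2l; first by rewrite lee_fin isq_ge0.
by apply: integral_mean_flux_error; rewrite k1 (leq_trans kn).
Qed.

Notation qc := (quad_const T sigma L k0).
Notation qsup := (2 * (1 + 8 * L * kap) + 2 * L * Num.sqrt T / sigma).
Notation qint := (1 + 3 * L ^+ 2 * kap + qc + 2 * L).

Let hT n : (0 < n <= m)%N -> h <= T.
Proof.
move=> /andP[n0 nm]; apply: le_trans mhT; rewrite -[leLHS]mul1r ler_wpM2r ?(ltW h0)//.
by rewrite ler1n (leq_trans n0).
Qed.

(** Particle rests and quadrature error have the sup bound of the expansion. The drift at time 0 is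
    bounded through the peak of the kernel: $hL/\sqrt{nw}\le L\sqrt h/\sigma\le L\sqrt T/\sigma$. *)
Lemma ae_norm_rest_error n : (0 < n <= m)%N -> {ae P, forall o x, `|rest_error n (o, x)| <= qsup}.
Proof.
move=> /[dup] nn /andP[n0 nm]; have /andP[_ nT] := kT nm.
have hr : {ae P, forall o i x, `|rest i n (o, x)| <= 1 + 8 * L * kap}.
 by apply: filter_forall => i; exact: (ae_norm_grid_rest w0 (ltW h0) L0 (hkap (leqnn m)) (gp i) nm).
have nw : 0 < n%:R * w by rewrite mulr_gt0// ltr0n.
have hd : h * (L / Num.sqrt (n%:R * w)) <= L * Num.sqrt T / sigma.
 rewrite mulrCA -mulrA ler_wpM2l//; apply: (@le_trans _ _ (h / Num.sqrt w)).
  rewrite ler_wpM2l ?(ltW h0)// lef_pV2 ?posrE ?sqrtr_gt0// ler_wsqrtr// ler_peMl ?(ltW w0)//.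
  by rewrite ler1n.
 by rewrite div_grid_var// ler_wpM2r ?invr_ge0 ?(ltW sigma0)// ler_wsqrtr// (hT nn).
apply: filterS hr => o ho x; rewrite /rest_error /=.
have h1 : `|N%:R^-1 * (\sum_(i < N) rest i n (o, x))| <= 1 + 8 * L * kap by exact: norm_avg_le.
have h2 : `|qerr n x| <= 1 + 8 * L * kap.
 by rewrite (quad_errorE sigma0 dvl h0 nT); apply: (norm_driven_rest sigma0 dvl h0 nT x (leqnn n)).
have h3 : `|N%:R^-1 * (\sum_(i < N) drift i n 0%N (o, x))| <= L / Num.sqrt (n%:R * w).
 by apply: norm_avg_le => // i; have := norm_grid_drift w0 (gp i) (o, x) n0; rewrite subn0.
have h4 : `|mdrift n 0%N x| <= L / Num.sqrt (n%:R * w).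
 rewrite /mean_drift gap// subn0; apply: Ex_bound.
  apply: bmfM; first by split; [exact: (dv_Bm dvl)|exists L; exact: (dv_BL dvl _)].
  split; first exact: (meas_slice2 x (meas_joint_kernel (meas_gk (n%:R * w)) (mXl (0%:R * h)))).
  by exists (Num.sqrt (n%:R * w))^-1 => o'; rewrite ger0_norm ?gk_ge0//; exact: gk_ub.
 move=> o'; rewrite normrM (ger0_norm (gk_ge0 _ _)); apply: ler_pM => //; [exact: gk_ge0|exact: (dv_BL dvl)|exact: gk_ub].
have h5 : `|h * drift_error n 0 (o, x)| <= 2 * (L * Num.sqrt T / sigma).
 rewrite normrM (gtr0_norm h0) /drift_error /=.
 apply: (@le_trans _ _ (h * (L / Num.sqrt (n%:R * w) + L / Num.sqrt (n%:R * w)))); last by move: hd; lra.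
 by rewrite ler_wpM2l ?(ltW h0)//; apply: le_trans (ler_normB _ _) _; exact: lerD.
apply: le_trans (ler_normB _ _) _.
apply: le_trans (lerD (le_trans (ler_normB _ _) (lerD h1 h2)) h5) _.
by rewrite le_eqVlt; apply/orP; left; apply/eqP; ring.
Qed.

(** Four contributions: the particle rests with their defects, the quadrature error of the limit,
    and the drifts at time 0 of the particles and of the limit, each of the last two at most
    [L * h]. *)
Lemma iint_norm_rest_error n : (0 < n <= m)%N ->
 (iint P (fun q => `|rest_error n q|)%R <= (qint * (eta + h))%:E)%E.
Proof.
move=> /[dup] nn /andP[n0 nm]; have /andP[_ nT] := kT nm.
have nw : 0 < n%:R * w by rewrite mulr_gt0// ltr0n.
have mr i : measT (rest i n) by exact: (meas_grid_rest (gp i)).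
have mq : measT (qerr n) by exact: (meas_quad_error sigma0 dvl h0 nT).
have md : measT (fun x => mdrift n 0%N x) by exact: (meas_mean_drift dvl).
have mdi i : measT (drift i n 0%N) by exact: (meas_grid_drift (gp i)).
pose f1 (q : Omega * R) := N%:R^-1 * (\sum_(i < N) rest i n q).
pose f2 (q : Omega * R) := - qerr n q.2.
pose f3 (q : Omega * R) := - h * (N%:R^-1 * (\sum_(i < N) drift i n 0%N q)).
pose f4 (q : Omega * R) := h * mdrift n 0%N q.2.
have m1 : measT f1 by apply: measurable_funM => //; exact: measurable_sum.
have m2 : measT f2 by apply: measurableT_comp => //; exact: (measurableT_comp mq).
have m3 : measT f3 by apply: measurable_funM => //; apply: measurable_funM => //; exact: measurable_sum.
have m4 : measT f4 by apply: measurable_funM => //; exact: (measurableT_comp md).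
have E : rest_error n = (fun q => f1 q + f2 q + f3 q + f4 q).
 by apply/funext => q; rewrite /rest_error /drift_error /f1 /f2 /f3 /f4; ring.
have b1 : (iint P (fun q => `|f1 q|)%R <= (eta + 3 * L ^+ 2 * kap * h)%:E)%E.
 apply: iint_avg_le => // i.
 apply: (integral_grid_rest w0 (ltW h0) L0 (hkap (leqnn m)) (gp i) nm).
 by apply: (grid_defect_sum (dvp i) h0 mhT (def_eta i) nm).
have b2 : (iint P (fun q => `|f2 q|)%R <= (qc * h)%:E)%E.
 rewrite (_ : (fun q => `|f2 q|) = (fun q => `|qerr n q.2|)); last by apply/funext => q; rewrite normrN.
 by rewrite iint_cst_fst//; exact: (limit_quadrature T0 sigma0 dvl bl_left fb BlE h0 nT n0).
have b3 : (iint P (fun q => `|f3 q|)%R <= (L * h)%:E)%E.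
 pose g (q : Omega * R) := N%:R^-1 * (\sum_(i < N) drift i n 0%N q).
 have mg : measT g by apply: measurable_funM => //; exact: measurable_sum.
 have mng : measT (fun q => `|g q|) by exact: measurableT_comp.
 rewrite (_ : (fun q => `|f3 q|) = (fun q => h * `|g q|)); last first.
  by apply/funext => q; rewrite /f3 normrM normrN (gtr0_norm h0).
 rewrite iintZ ?(ltW h0)// [(L * h)%R]mulrC (EFinM h); apply: lee_wpmul2l; first by rewrite lee_fin ltW.
 apply: iint_avg_le => // i.
 have := integral_norm_kernel P nw L0 (dv_Bm (dvp i) (0%:R * h)) (dv_BL (dvp i) (0%:R * h)) (mXp i (0%:R * h)).
 by rewrite /iint /grid_drift /drift_term /= subn0.
have b4 : (iint P (fun q => `|f4 q|)%R <= (L * h)%:E)%E.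
 have mnd : measT (fun q : Omega * R => `|mdrift n 0%N q.2|).
  by apply: measurableT_comp => //; exact: (measurableT_comp md).
 rewrite (_ : (fun q => `|f4 q|) = (fun q => h * `|mdrift n 0%N q.2|)); last first.
  by apply/funext => q; rewrite /f4 normrM (gtr0_norm h0).
 rewrite iintZ ?(ltW h0)// [(L * h)%R]mulrC (EFinM h); apply: lee_wpmul2l; first by rewrite lee_fin ltW.
 rewrite iint_cst_fst// /mean_drift gap// subn0.
 apply: (integral_norm_Ex_kernel P nw L0); [exact: (dv_Bm dvl)|exact: (dv_BL dvl)|exact: mXl].
have m12 : measT (fun q => f1 q + f2 q) by exact: measurable_funD.
have m123 : measT (fun q => f1 q + f2 q + f3 q) by exact: measurable_funD.
rewrite E; apply: le_trans (iint_normD P m123 m4) _.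
apply: le_trans (leeD (le_trans (iint_normD P m12 m3) (leeD (le_trans (iint_normD P m1 m2) (leeD b1 b2)) b3)) b4) _.
rewrite -!EFinD lee_fin.
have qc0 : 0 <= qc by exact: (quad_const_ge0 T0 sigma0 dvl fb).
have := mulr_ge0 (mulr_ge0 (mulr_ge0 (ler0n R 3) (sqr_ge0 L)) kap0) eta0.
have := mulr_ge0 qc0 eta0; have := mulr_ge0 L0 eta0; have := h0.
rewrite -subr_ge0 => *; lra.
Qed.

Variables (V0 U0 : R).
Hypotheses (V0_ge0 : 0 <= V0) (U0_ge0 : 0 <= U0).
Hypothesis init_L2 : (iint P (fun q => cdf_error 0 q ^+ 2)%R <= V0%:E)%E.
Hypothesis init_L1 : (\int[mu]_x `|'Ex (fun o => cdf_error 0 (o, x))|%:E <= U0%:E)%E.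

Notation qtot := (V0 + U0 + N%:R^-1 + eta + h).
Notation vconst := (4 * (1 + 16 * sigma * Num.sqrt T + qsup * qint)).
Notation vrate := (18 * kap * L ^+ 2 / sigma).
Notation urate := (3 / 2 * L / sigma).

Let qc0 : 0 <= qc. Proof. exact: (quad_const_ge0 T0 sigma0 dvl fb). Qed.
Let qsup0 : 0 <= qsup. Proof. by rewrite addr_ge0 ?mulr_ge0 ?addr_ge0 ?mulr_ge0 ?invr_ge0// ltW. Qed.
Let qint0 : 0 <= qint. Proof. by rewrite !addr_ge0 ?mulr_ge0 ?sqr_ge0. Qed.
Let vrate0 : 0 <= vrate. Proof. by rewrite !mulr_ge0 ?sqr_ge0 ?invr_ge0// ltW. Qed.
Let urate0 : 0 <= urate. Proof. by rewrite !mulr_ge0 ?invr_ge0// ltW. Qed.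
Let qtot0 : 0 <= qtot. Proof. by rewrite !addr_ge0 ?invr_ge0// ltW. Qed.
Let vconst0 : 0 <= vconst.
Proof. by rewrite mulr_ge0// addr_ge0 ?mulr_ge0// addr_ge0// mulr_ge0// mulr_ge0// ltW. Qed.

(** Each of the four parts of the error enters by its square. The noise contributes the inverse of
    [N], and the rest the product of its sup bound [qsup] with its $L^1$ bound. *)
Lemma cdf_error_L2_recursion n : (0 < n <= m)%N ->
 (v n <= (vconst * qtot)%:E + (vrate * Num.sqrt h)%:E * \sum_(1 <= k < n) (isq R (n - k))%:E * v k)%E.
Proof.
move=> /[dup] nn /andP[n0 nm].
have mS : measT (fun q => - sum_drift_error n q).
 by apply: measurableT_comp => //; exact: meas_sum_drift_error.
rewrite (_ : (fun q => cdf_error n q ^+ 2) = (fun q => (init_error n q + noise_error n q + - sum_drift_error n q + rest_error n q) ^+ 2)); last first.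
 by apply/funext => q; rewrite cdf_errorE.
apply: le_trans (iint_sqr_sum4 P (meas_init_error n) (meas_noise_error n) mS (meas_rest_error nm)) _.
have hA := le_trans (iint_sqr_init_error n0) init_L2.
have hM := iint_sqr_noise_error nn.
have hS : (iint P (fun q => (- sum_drift_error n q) ^+ 2)%R <=
  (9 / 2 * kap * (h / Num.sqrt w) * L ^+ 2)%:E * \sum_(1 <= k < n) (isq R (n - k))%:E * v k)%E.
 rewrite (_ : (fun q => (- sum_drift_error n q) ^+ 2) = (fun q => sum_drift_error n q ^+ 2)); last first.
  by apply/funext => q; rewrite sqrrN.
 exact: iint_sqr_sum_drift_error.
have hQ := iint_sqr_le (meas_rest_error nm) qsup0 (ae_norm_rest_error nn) (iint_norm_rest_error nn).
have S0 : (0 <= \sum_(1 <= k < n) (isq R (n - k))%:E * v k)%E.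
 apply: sume_ge0 => k _; apply: mule_ge0; first by rewrite lee_fin isq_ge0.
 by apply: iint_ge0 => q; exact: sqr_ge0.
set S := (\sum_(1 <= k < n) _)%E in hS S0 *.
have four : (0 <= 4%:E :> \bar R)%E by rewrite lee_fin.
apply: le_trans (lee_wpmul2l four (leeD (leeD (leeD hA hM) hS) hQ)) _.
set c := 9 / 2 * kap * (h / Num.sqrt w) * L ^+ 2.
have c0 : 0 <= c by rewrite /c !mulr_ge0 ?sqr_ge0 ?invr_ge0// ltW.
(* The 4 of a sum of four squares times the $9/2$ of [drift_L2] gives the 18 in [vrate]. *)
have cE : 4 * c = vrate * Num.sqrt h by rewrite /c div_grid_var//; field; rewrite gt_eqF.
set e := qsup * _.
have -> : (V0%:E + (N%:R^-1 * (16 * sigma * Num.sqrt T))%:E + c%:E * S + e%:E =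
  (V0 + N%:R^-1 * (16 * sigma * Num.sqrt T) + e)%:E + c%:E * S)%E.
 by rewrite [in RHS]EFinD [in RHS]EFinD; exact: addeAC.
rewrite ge0_muleDr//; last 2 first.
 rewrite lee_fin !addr_ge0 ?mulr_ge0 ?invr_ge0 ?(ltW sigma0)// ?(ltW h0)// /e.
 by rewrite addr_ge0// ltW.
 by rewrite mule_ge0.
rewrite (muleA 4%:E c%:E) -EFinM -EFinM cE; apply: leeD => //; rewrite lee_fin /e.
have p1 : 0 <= 16 * sigma * Num.sqrt T by rewrite !mulr_ge0// ltW.
have p2 : 0 <= qsup * qint by exact: mulr_ge0.
move: p1 p2; set a1 := 16 * sigma * Num.sqrt T; set a2 := qsup; set a3 := qint => p1 p2.
have NV0 : 0 <= N%:R^-1 :> R by rewrite invr_ge0.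
have h0' := ltW h0.
have : 0 <= V0 + U0 + eta + h by rewrite !addr_ge0.
move=> s1; have t1 := mulr_ge0 p1 s1.
have s2 : 0 <= V0 + U0 + N%:R^-1 by rewrite !addr_ge0.
have t2 := mulr_ge0 p2 s2.
rewrite -subr_ge0 (_ : _ - _ = 4 * (U0 + N%:R^-1 + eta + h) + 4 * (a1 * (V0 + U0 + eta + h)) + 4 * (a2 * a3 * (V0 + U0 + N%:R^-1))); last by ring.
by rewrite !addr_ge0// mulr_ge0// !addr_ge0.
Qed.

Lemma cdf_error_L2 n : (0 < n <= m)%N -> (v n <= (gronwall_const vrate T * (vconst * qtot))%:E)%E.
Proof.
move=> nn.
have v0 k : (0 <= v k)%E by apply: iint_ge0 => q; exact: sqr_ge0.
have A0 : 0 <= vconst * qtot by exact: mulr_ge0.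
have := @esingular_gronwall R vrate T (vconst * qtot) 0 h m (fun k => v k) vrate0 (ltW T0) A0 (lexx _) (ltW h0) v0 mhT.
move=> /(_ _ n nn); rewrite mul0r addr0; apply => k kn.
by rewrite mul0r addr0; exact: cdf_error_L2_recursion.
Qed.

Notation gv := (gronwall_const vrate T).
Notation gu := (gronwall_const urate T).
Notation uconst := (1 + qint + 3 / sigma * Num.sqrt T * k0 * gv * vconst).

Let gv0 : 0 <= gv. Proof. by apply: gronwall_const_ge0 => //; exact: ltW. Qed.
Let uconst0 : 0 <= uconst.
Proof.
have p1 : 0 <= 3 / sigma * Num.sqrt T * k0 by rewrite !mulr_ge0 ?invr_ge0// ltW.
by apply: addr_ge0; [apply: addr_ge0|exact: mulr_ge0 (mulr_ge0 p1 gv0) vconst0].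
Qed.

(** The quadratic term is inhomogeneous here: with the uniform bound of [cdf_error_L2] its weights
    sum to at most $2\sqrt n$, and the prefactor $\sqrt h$ turns this into $2\sqrt T$. *)
Lemma cdf_error_L1_recursion n : (0 < n <= m)%N ->
 (u n <= (uconst * qtot)%:E + (urate * Num.sqrt h)%:E * \sum_(1 <= k < n) (isq R (n - k))%:E * u k)%E.
Proof.
move=> /[dup] nn /andP[n0 nm].
have mA := meas_Ex P (meas_init_error n).
have mS := meas_Ex P (meas_sum_drift_error n).
have mQ := meas_Ex P (meas_rest_error nm).
have bA x : bmf (fun o => init_error n (o, x)).
 rewrite /init_error /=; apply: bmfB; last exact: (@bmf_cst _ Omega R ('Ex (fun o => Kc (n%:R * w) (x - Xl (0%:R * h) o)))).
 by apply: bmfZ; apply: bmf_sum => i; exact: bKp.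
have bM x : bmf (fun o => noise_error n (o, x)).
 by apply: bmfZ; apply: bmf_sum => i; apply: bmf_sum => k; exact: bnoise.
have bde k x : (k < n)%N -> bmf (fun o => drift_error n k (o, x)).
 move=> kn; rewrite /drift_error /=; apply: bmfB; last exact: (@bmf_cst _ Omega R (mdrift n k x)).
 by apply: bmfZ; apply: bmf_sum => i; exact: bdrift.
have bS x : bmf (fun o => sum_drift_error n (o, x)).
 rewrite (_ : (fun o => _) = (fun o => h * \sum_(1 <= k < n) (if (k < n)%N then drift_error n k (o, x) else 0))).
  by apply: bmfZ; apply: bmf_sum => k; case: (boolP (k < n)%N) => kn; [exact: bde|exact: (@bmf_cst _ Omega R 0)].
 by apply/funext => o; congr (h * _); rewrite big_nat [RHS]big_nat; apply: eq_bigr => k /andP[_ ->].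
have bD x : bmf (fun o => cdf_error n (o, x)) by exact: bmf_cdf_error.
have bQ x : bmf (fun o => rest_error n (o, x)).
 rewrite (_ : (fun o => _) = (fun o => cdf_error n (o, x) - init_error n (o, x) - noise_error n (o, x) + sum_drift_error n (o, x))).
  by apply: bmfD => //; apply: bmfB => //; exact: bmfB.
 by apply/funext => o; rewrite cdf_errorE//; ring.
have E x : 'Ex (fun o => cdf_error n (o, x)) = 'Ex (fun o => init_error n (o, x)) -
  'Ex (fun o => sum_drift_error n (o, x)) + 'Ex (fun o => rest_error n (o, x)).
 have -> : (fun o => cdf_error n (o, x)) = (fun o => init_error n (o, x) + noise_error n (o, x) - sum_drift_error n (o, x) + rest_error n (o, x)).
  by apply/funext => o; rewrite cdf_errorE.
 have bAM := bmfD (bA x) (bM x); have bAMS := bmfB bAM (bS x).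
 by rewrite (ExD P bAMS (bQ x)) (ExB P bAM (bS x)) (ExD P (bA x) (bM x)) mean_noise_error// addr0.
have mn (f : R -> R) : measT f -> measT (fun x => `|f x|%:E).
 by move=> mf; unEFin; exact: measurableT_comp.
have n0' (f : R -> R) x : (0 <= `|f x|%:E)%E by rewrite lee_fin.
pose fA x := 'Ex (fun o => init_error n (o, x)); pose fS x := 'Ex (fun o => sum_drift_error n (o, x)).
pose fQ x := 'Ex (fun o => rest_error n (o, x)).
have p2 x : (0 <= `|fA x|%:E + `|fS x|%:E)%E by rewrite adde_ge0.
have m2 : measT (fun x => `|fA x|%:E + `|fS x|%:E)%E by apply: emeasurable_funD; exact: mn.
have step1 : (u n <= \int[mu]_x `|fA x|%:E + \int[mu]_x `|fS x|%:E + \int[mu]_x `|fQ x|%:E)%E.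
 rewrite -(ge0_integralD mu measurableT (fun x _ => n0' fA x) (mn fA mA) (fun x _ => n0' fS x) (mn fS mS)).
 rewrite -(ge0_integralD mu measurableT (fun x _ => p2 x) m2 (fun x _ => n0' fQ x) (mn fQ mQ)).
 apply: ge0_le_integral => //.
 - by apply: mn; exact: (meas_Ex P (meas_cdf_error n)).
 - by apply: emeasurable_funD => //; exact: mn.
 - move=> x _; rewrite E -!EFinD lee_fin; apply: le_trans (ler_normD _ _) _.
  by rewrite lerD2r; exact: ler_normB.
apply: le_trans step1 _.
have hA := le_trans (integral_mean_init_error n0) init_L1.
have hS := integral_mean_sum_drift_error nn.
have hQ := le_trans (integral_Ex_le P (meas_rest_error nm)) (iint_norm_rest_error nn).
apply: le_trans (leeD (leeD hA hS) hQ) _.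
have isq0 k : (0 <= (isq R (n - k))%:E)%E by rewrite lee_fin isq_ge0.
have u0 k : (0 <= u k)%E by apply: integral_ge0 => x _; rewrite lee_fin.
have v0 k : (0 <= v k)%E by apply: iint_ge0 => q; exact: sqr_ge0.
set S := (\sum_(1 <= k < n) (isq R (n - k))%:E * u k)%E.
have S0 : (0 <= S)%E by apply: sume_ge0 => k _; exact: mule_ge0.
set V := k0 * (gv * (vconst * qtot)).
have V0' : 0 <= V by rewrite /V; apply: mulr_ge0 => //; apply: mulr_ge0 => //; exact: mulr_ge0.
have hsum : (\sum_(1 <= k < n) (isq R (n - k))%:E * (L%:E * u k + k0%:E * v k) <=
  L%:E * S + (2 * Num.sqrt n%:R * V)%:E)%E.
 apply: (@le_trans _ _ (\sum_(1 <= k < n) (L%:E * ((isq R (n - k))%:E * u k) + (isq R (n - k) * V)%:E))%E).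
  rewrite big_nat [leRHS]big_nat; apply: lee_sum => k /andP[k1 kn].
  rewrite ge0_muleDr ?mule_ge0 ?lee_fin// muleCA leeD2l// (EFinM (isq R (n - k))).
  apply: lee_wpmul2l => //; rewrite /V (EFinM k0); apply: lee_wpmul2l; first by rewrite lee_fin.
  by apply: cdf_error_L2; rewrite k1 (leq_trans (ltnW kn)).
 rewrite big_split/= -ge0_sume_distrr; last by move=> k _; exact: mule_ge0.
 rewrite leeD2l// sumEFin lee_fin -mulr_suml ler_wpM2r//.
 exact: sum_isq_le.
set c := 3 / 2 * (h / Num.sqrt w).
have c0 : 0 <= c by rewrite /c !mulr_ge0 ?invr_ge0// ltW.
have hS2 : (c%:E * \sum_(1 <= k < n) (isq R (n - k))%:E * (L%:E * u k + k0%:E * v k) <=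
  (urate * Num.sqrt h)%:E * S + (3 / sigma * Num.sqrt T * V)%:E)%E.
 apply: (@le_trans _ _ (c%:E * (L%:E * S + (2 * Num.sqrt n%:R * V)%:E))%E).
  by apply: lee_wpmul2l => //; rewrite lee_fin.
 have LS0 : (0 <= L%:E * S)%E by rewrite mule_ge0// lee_fin.
 have X0 : (0 <= (2 * Num.sqrt n%:R * V)%:E)%E by rewrite lee_fin; apply: mulr_ge0 => //; exact: mulr_ge0.
 rewrite (ge0_muleDr c%:E LS0 X0) (muleA c%:E) -EFinM -EFinM; apply: leeD.
  by rewrite (_ : c * L = urate * Num.sqrt h)// /c div_grid_var//; ring.
 rewrite lee_fin mulrA ler_wpM2r//.
 have sq : Num.sqrt h * Num.sqrt n%:R <= Num.sqrt T.
  rewrite -sqrtrM ?(ltW h0)// ler_wsqrtr// mulrC; have /andP[_] := kT nm; exact.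
 have cE : c * (2 * Num.sqrt n%:R) = 3 / sigma * (Num.sqrt h * Num.sqrt n%:R).
  by rewrite /c div_grid_var//; field; rewrite gt_eqF.
 rewrite cE.
 by rewrite ler_wpM2l// divr_ge0// ltW.
apply: le_trans (leeD (leeD (lexx U0%:E) hS2) (lexx _)) _.
have rid (a b e : R) (s : \bar R) : (a%:E + (s + b%:E) + e%:E = (a + b + e)%:E + s)%E.
 by case: s => [s| |] //=; rewrite -!EFinD; congr (_%:E); ring.
rewrite rid; apply: leeD => //; rewrite lee_fin /V.
have t1 : 0 <= V0 + N%:R^-1 + eta + h by rewrite !addr_ge0 ?invr_ge0// ltW.
have t2 : 0 <= qint * (V0 + U0 + N%:R^-1) by apply: mulr_ge0 => //; rewrite !addr_ge0 ?invr_ge0.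
move: t2; set a1 := qint => t2; set a2 := vconst.
rewrite -subr_ge0 (_ : _ - _ = (V0 + N%:R^-1 + eta + h) + a1 * (V0 + U0 + N%:R^-1)); last by ring.
exact: addr_ge0.
Qed.

Lemma cdf_error_L1 n : (0 < n <= m)%N -> (u n <= (gu * (uconst * qtot))%:E)%E.
Proof.
move=> nn.
have u0 k : (0 <= u k)%E by apply: integral_ge0 => x _; rewrite lee_fin.
have A0 : 0 <= uconst * qtot by exact: mulr_ge0.
have := @esingular_gronwall R urate T (uconst * qtot) 0 h m (fun k => u k) urate0 (ltW T0) A0 (lexx _) (ltW h0) u0 mhT.
move=> /(_ _ n nn); rewrite mul0r addr0; apply => k kn.
by rewrite mul0r addr0; exact: cdf_error_L1_recursion.
Qed.

End ParticleExpansion.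

(** * Initial positions and conclusion *)

Section MeanGapStep.
Context d (Omega : measurableType d) (R : realType) (P : probability Omega R).
Notation mu := (@lebesgue_measure R).
Notation "''Ex' f" := (\int[P]_w f w) (at level 10, f at level 9).
Variables (T sigma L : R).
Hypothesis sigma0 : 0 < sigma.

Lemma rcdf_gaussian_step (past : R -> set (set Omega)) (W X : R -> Omega -> R) (b : R * Omega -> R)
  (B : R -> Omega -> R) (s t x : R) : driven P T sigma L past W X b B -> 0 <= s -> s < t -> s <= T ->
 rcdf P (fun o => X s o + increment sigma W s t o) x = conv (gk (sigma ^+ 2 * (t - s))) (rcdf P (X s)) x.
Proof.
move=> dv s0 st sT.
have s1 : sub_measurable (past s) (fun _ : Omega => 1 : R) by apply/sub_measurableP; exact: measurable_cst.
have n1 (o : Omega) : `|1 : R| <= 1 by rewrite normr1.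
have sT' : 0 <= s <= T by rewrite s0.
have w0 : 0 < sigma ^+ 2 * (t - s) by rewrite mulr_gt0 ?exprn_gt0// subr_gt0.
have := gaussian_heav_mean (dv_past dv (s := s)) (meas_increment dv s t) (dv_ind dv s0 st) (dv_X dv sT') s1 n1 x.
have -> : 'Ex (fun o => 1 * heav (X s o + sigma * (W t o - W s o)) x) = rcdf P (fun o => X s o + increment sigma W s t o) x.
 by apply: eq_Rintegral => o _; rewrite mul1r.
move=> ->.
have mF : measT (rcdf P (X s)) by apply: meas_rcdf; exact: (dv_Xm dv).
rewrite /conv -(@Rintegral_reflect R x (fun z => gk (sigma ^+ 2 * (t - s)) (x - z) * rcdf P (X s) z)); last first.
 by apply: measurable_funM => //; apply: meas_kshift; exact: meas_gk.
apply: eq_Rintegral => z _; rewrite subKr mulrC; congr (_ * _).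
by apply: eq_Rintegral => o _; rewrite mul1r.
Qed.

Variables (pastl : R -> set (set Omega)) (Wl Xl : R -> Omega -> R) (bl : R * Omega -> R) (Bl : R -> Omega -> R).
Hypothesis dvl : driven P T sigma L pastl Wl Xl bl Bl.
Variables (N : nat) (past : 'I_N -> R -> set (set Omega)) (Wp Xp : 'I_N -> R -> Omega -> R).
Variables (bp : 'I_N -> R * Omega -> R) (Bp : 'I_N -> R -> Omega -> R).
Hypothesis N0 : (0 < N)%N.
Hypothesis dvp : forall i, driven P T sigma L (past i) (Wp i) (Xp i) (bp i) (Bp i).

Definition mean_gap (s x : R) := N%:R^-1 * (\sum_(i < N) rcdf P (Xp i s) x) - rcdf P (Xl s) x.

Let mXl s : measT (Xl s). Proof. exact: (dv_Xm dvl). Qed.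
Let mXp i s : measT (Xp i s). Proof. exact: (dv_Xm (dvp i)). Qed.
Let r1 (Z : Omega -> R) y : measT Z -> `|rcdf P Z y| <= 1.
Proof. by move=> mZ; have /andP[a b] := rcdf_in01 P mZ y; rewrite ger0_norm. Qed.

Lemma meas_mean_gap s : measT (mean_gap s).
Proof.
apply: measurable_funB; last exact: meas_rcdf.
by apply: measurable_funM => //; apply: measurable_sum => i; exact: meas_rcdf.
Qed.

Lemma mean_cdf_error h n x : 'Ex (fun o => cdf_error P Xl Xp h n (o, x)) = mean_gap (n%:R * h) x.
Proof.
have bh i : bmf (fun o => heav (Xp i (n%:R * h) o) x) by exact: bmf_heav.
rewrite /cdf_error /mean_heav /= ExB; last 2 first.
 by apply: bmfZ; exact: bmf_sum.
 exact: bmf_cst.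
by rewrite Ex_cst ExZ ?Ex_sum//; exact: bmf_sum.
Qed.

(** Without drift both mean distribution functions undergo the same Gaussian smoothing, a
    contraction in $L^1$. Restoring the drifts costs $L(t-s)$ for the particles and as much for the
    limit. *)
Lemma mean_gap_step s t : 0 <= s -> s < t -> t <= T ->
 (\int[mu]_x `|mean_gap t x|%:E <= \int[mu]_x `|mean_gap s x|%:E + (2 * L * (t - s))%:E)%E.
Proof.
move=> s0 st tT; have sT := le_trans (ltW st) tT.
have L0 : 0 <= L by rewrite (le_trans _ (dv_bL dvl point)).
have Lts : 0 <= L * (t - s) by rewrite mulr_ge0// subr_ge0 ltW.
set w := sigma ^+ 2 * (t - s).
pose Xhp i o := Xp i s o + increment sigma (Wp i) s t o.
pose Xhl o := Xl s o + increment sigma Wl s t o.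
have mhp i : measT (Xhp i) by apply: measurable_funD => //; exact: (meas_increment (dvp i)).
have mhl : measT Xhl by apply: measurable_funD => //; exact: (meas_increment dvl).
pose f i (q : Omega * R) := rcdf P (Xp i t) q.2 - rcdf P (Xhp i) q.2.
pose g x := rcdf P (Xl t) x - rcdf P Xhl x.
pose A x := N%:R^-1 * \sum_(i < N) (rcdf P (Xp i t) x - rcdf P (Xhp i) x).
have mf i : measT (fun x : R => rcdf P (Xp i t) x - rcdf P (Xhp i) x).
 by apply: measurable_funB; exact: meas_rcdf.
have mA : measT A by apply: measurable_funM => //; exact: measurable_sum.
have mg : measT g by apply: measurable_funB; exact: meas_rcdf.
pose C x := conv (gk w) (mean_gap s) x.
have mC : measT C by apply: meas_conv; [exact: meas_gk|exact: meas_mean_gap].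
have CE x : N%:R^-1 * (\sum_(i < N) rcdf P (Xhp i) x) - rcdf P Xhl x = C x.
 under eq_bigr do rewrite (rcdf_gaussian_step x (dvp _) s0 st sT).
 rewrite (rcdf_gaussian_step x dvl s0 st sT) -/w mulr_sumr.
 rewrite -(@conv_sum R 'I_N _ (gk w) (fun i => rcdf P (Xp i s)) (fun=> N%:R^-1) x 1)//.
 - rewrite -(@convB R _ _ _ _ 1)//.
  + by congr (conv _ _ x); apply/funext => y; rewrite /mean_gap mulr_sumr.
  + exact: meas_gk.
  + exact: integrable_gk.
  + by apply: measurable_sum => i; apply: measurable_funM => //; exact: meas_rcdf.
  + exact: meas_rcdf.
  + by move=> y; rewrite -mulr_sumr; apply: norm_avg_le => // i; exact: r1.
  + by move=> y; exact: r1.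
 - exact: meas_gk.
 - exact: integrable_gk.
 - by move=> i; exact: meas_rcdf.
 - by move=> i y; exact: r1.
have E x : mean_gap t x = A x - g x + C x.
 rewrite -CE /A /g /mean_gap sumrB; ring.
have iA : (\int[mu]_x `|A x|%:E <= (L * (t - s))%:E)%E.
 rewrite -(iint_cst_fst P mA); apply: (@iint_avg_le _ _ _ P N f) => // [i|i].
  exact: (measurableT_comp (mf i)).
 rewrite (_ : (fun q : Omega * R => `|f i q|) = (fun q => `|(fun x : R => rcdf P (Xp i t) x - rcdf P (Xhp i) x) q.2|))//.
 rewrite (iint_cst_fst P (mf i)); apply: integral_rcdf_diff => //.
 by apply: filterS (driven_step (dvp i)) => o ho; apply: ho => //; exact: ltW.
have ig : (\int[mu]_x `|g x|%:E <= (L * (t - s))%:E)%E.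
 apply: integral_rcdf_diff => //.
 by apply: filterS (driven_step dvl) => o ho; apply: ho => //; exact: ltW.
have iC : (\int[mu]_x `|C x|%:E <= \int[mu]_x `|mean_gap s x|%:E)%E.
 apply: le_trans (conv_L1 (meas_gk w) (meas_mean_gap s) (integral_norm_gk w)) _.
 by rewrite mul1e.
have mn (k : R -> R) : measT k -> measT (fun x => `|k x|%:E).
 by move=> mk; unEFin; exact: measurableT_comp.
have n0 (k : R -> R) x : (0 <= `|k x|%:E)%E by rewrite lee_fin.
have p2 x : (0 <= `|A x|%:E + `|g x|%:E)%E by rewrite adde_ge0.
have m2 : measT (fun x => `|A x|%:E + `|g x|%:E)%E by apply: emeasurable_funD; exact: mn.
apply: (@le_trans _ _ (\int[mu]_x `|A x|%:E + \int[mu]_x `|g x|%:E + \int[mu]_x `|C x|%:E)%E).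
 rewrite -(ge0_integralD mu measurableT (fun x _ => n0 A x) (mn A mA) (fun x _ => n0 g x) (mn g mg)).
 rewrite -(ge0_integralD mu measurableT (fun x _ => p2 x) m2 (fun x _ => n0 C x) (mn C mC)).
 apply: ge0_le_integral => //.
 - by apply: mn; exact: meas_mean_gap.
 - by apply: emeasurable_funD => //; exact: mn.
 - move=> x _; rewrite E -!EFinD lee_fin; apply: le_trans (ler_normD _ _) _.
  by rewrite lerD2r; exact: ler_normB.
apply: le_trans (leeD (leeD iA ig) iC) _.
rewrite -EFinD addeC (_ : L * (t - s) + L * (t - s) = 2 * L * (t - s))//; by ring.
Qed.

End MeanGapStep.

(** * Distribution function of the mean empirical measure *)

Section MeanEmpiricalCdf.
Context d (Omega : measurableType d) (R : realType) (P : probability Omega R).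
Notation mu := (@lebesgue_measure R).
Notation "''Ex' f" := (\int[P]_w f w) (at level 10, f at level 9).

Lemma mean_empirical_cdf (N : nat) (X : 'I_N -> {RV P >-> R}) (x : R) :
 fine (mean_empirical P X `]-oo, x]%classic) = N%:R^-1 * \sum_(i < N) rcdf P (X i) x.
Proof.
have bh i : bmf (fun o => heav (X i o) x) by apply: bmf_heav => //; exact: measurable_funP.
rewrite -[LHS]/(fine (\int[P]_o empirical (X ^~ o) `]-oo, x]%classic)).
rewrite (_ : (fun o => _) = (fun o => (N%:R^-1 * \sum_(i < N) heav (X i o) x)%:E)); last first.
 apply/funext => o; rewrite -[LHS]/((N%:R^-1)%:E * \sum_(i < N) \d_(X i o) `]-oo, x])%E.
 rewrite EFinM -sumEFin; congr (_ * _)%E; apply: eq_bigr => i _.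
 by rewrite diracE /heav mem_setE in_itv.
rewrite -[LHS]/('Ex (fun o => N%:R^-1 * \sum_(i < N) heav (X i o) x)).
by rewrite ExZ ?Ex_sum//; exact: bmf_sum.
Qed.

Lemma cdf_of_distribution (X : {RV P >-> R}) (x : R) : cdf_of (distribution P X) x = rcdf P X x.
Proof.
rewrite -[LHS]/(fine (P (X @^-1` `]-oo, x]))) -(EFin_rcdf P)//.
Qed.

End MeanEmpiricalCdf.

(** * Error of the initial positions *)

Section InitialPositions.
Context d (Omega : measurableType d) (R : realType) (P : probability Omega R).
Notation mu := (@lebesgue_measure R).
Notation "''Ex' f" := (\int[P]_w f w) (at level 10, f at level 9).
Variables (m : probability R R) (N : nat) (x0 : 'I_N -> Omega -> R).
Hypotheses (N0 : (0 < N)%N) (mx0 : forall i, measT (x0 i)).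

Definition init_gap (q : Omega * R) := N%:R^-1 * (\sum_(i < N) heav (x0 i q.1) q.2) - cdf_of m q.2.

Let NV : N%:R != 0 :> R. Proof. by rewrite pnatr_eq0 -lt0n. Qed.
Let F x := cdf_of m x.
Let F01 x : 0 <= F x <= 1. Proof. by rewrite cdf_of_ge0 cdf_of_le1. Qed.

Lemma meas_cdf_of : measT (cdf_of m).
Proof. by apply: nondecreasing_measurable => // x y xy; exact: cdf_of_mono. Qed.

Lemma meas_init_gap : measT init_gap.
Proof.
apply: measurable_funB; last exact: (measurableT_comp meas_cdf_of).
apply: measurable_funM => //; apply: measurable_sum => i.
by apply: meas_heav => //; exact: meas_fst_comp.
Qed.

Section Iid.
Hypothesis law : forall i, has_law P (x0 i) m.
Hypothesis ind : forall i j (A B : set R), i != j -> measurable A -> measurable B ->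
 P (x0 i @^-1` A `&` x0 j @^-1` B) = (P (x0 i @^-1` A) * P (x0 j @^-1` B))%E.

Let bh i x : bmf (fun o => heav (x0 i o) x). Proof. exact: bmf_heav. Qed.
Let bc x : bmf (fun _ : Omega => F x). Proof. exact: bmf_cst. Qed.

Let Ehv i x : 'Ex (fun o => heav (x0 i o) x) = F x.
Proof.
rewrite -[LHS]/(rcdf P (x0 i) x) /F /cdf_of -(law i)//.
by rewrite -(EFin_rcdf P (mx0 i)).
Qed.

Let Ehv2 i j x : i != j -> 'Ex (fun o => heav (x0 i o) x * heav (x0 j o) x) = F x * F x.
Proof.
move=> ij; have bhh : bmf (fun o => heav (x0 i o) x * heav (x0 j o) x) by exact: bmfM.
apply: EFin_inj; rewrite (EFin_Ex P bhh).
have mI (k : 'I_N) : measurable (x0 k @^-1` `]-oo, x]).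
 by rewrite -[X in measurable X]setTI; apply: mx0.
transitivity (P (x0 i @^-1` `]-oo, x] `&` x0 j @^-1` `]-oo, x])).
 rewrite -[X in _ = P X]setIT -integral_indic//; last exact: measurableI.
 apply: eq_integral => o _; rewrite indicE /heav -natrM mulnb in_setI; congr (_ %:R %:E).
 have mE (l : 'I_N) : (o \in x0 l @^-1` `]-oo, x]) = (x0 l o <= x).
  by apply/idP/idP; rewrite inE/= in_itv/=.
 by rewrite !mE.
by rewrite ind// -!(EFin_rcdf P (mx0 _)) -EFinM -[rcdf P (x0 i) x]/('Ex (fun o => heav (x0 i o) x)) -[rcdf P (x0 j) x]/('Ex (fun o => heav (x0 j o) x)) !Ehv.
Qed.

Lemma iid_mean_init_gap x : 'Ex (fun o => init_gap (o, x)) = 0.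
Proof.
rewrite /init_gap /= (ExB P (bmfZ _ (bmf_sum _ (bh ^~ x))) (bc x)) Ex_cst (ExZ P _ (bmf_sum _ (bh ^~ x))).
rewrite (Ex_sum P _ (bh ^~ x)); under eq_bigr do rewrite Ehv.
by rewrite sumr_const card_ord -[X in _ * X]mulr_natl mulKf// subrr.
Qed.

(** The left-hand side equals $F(1-F)/N$. As $F(1-F)\le1$, it is bounded by its square root, the
    quantity whose integral is assumed finite. *)
Lemma iid_sqr_init_gap x : 'Ex (fun o => init_gap (o, x) ^+ 2) <= N%:R^-1 * Num.sqrt (F x * (1 - F x)).
Proof.
pose g i o := heav (x0 i o) x - F x.
have bg i : bmf (g i) by exact: bmfB.
have gE o : init_gap (o, x) = N%:R^-1 * \sum_(i < N) g i o.
 by rewrite /g sumrB sumr_const card_ord mulrBr -[F x *+ N]mulr_natl mulKf.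
have orth i j : i != j -> 'Ex (fun o => g i o * g j o) = 0.
 move=> ij; have bhh : bmf (fun o => heav (x0 i o) x * heav (x0 j o) x) by exact: bmfM.
 have bl1 : bmf (fun o => F x * heav (x0 i o) x) by exact: bmfZ.
 have bl2 : bmf (fun o => F x * heav (x0 j o) x) by exact: bmfZ.
 have b3 := bmfB (bmfB bhh bl1) bl2.
 rewrite (_ : (fun o => g i o * g j o) = (fun o => heav (x0 i o) x * heav (x0 j o) x - F x * heav (x0 i o) x - F x * heav (x0 j o) x + F x * F x)); last first.
  by apply/funext => o; rewrite /g; ring.
 rewrite (ExD P b3 (@bmf_cst _ Omega R (F x * F x))) (ExB P (bmfB bhh bl1) bl2) (ExB P bhh bl1) Ehv2// !(ExZ P _ (bh _ _)) !Ehv Ex_cst; ring.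
have sq i : 'Ex (fun o => g i o ^+ 2) = F x * (1 - F x).
 rewrite (_ : (fun o => g i o ^+ 2) = (fun o => (1 - 2 * F x) * heav (x0 i o) x + F x ^+ 2)); last first.
  by apply/funext => o; rewrite /g /heav; case: (_ <= _) => /=; ring.
 rewrite (ExD P (bmfZ _ (bh i x)) (@bmf_cst _ Omega R (F x ^+ 2))) (ExZ P _ (bh i x)) Ehv Ex_cst; ring.
rewrite (_ : (fun o => init_gap (o, x) ^+ 2) = (fun o => N%:R^-1 ^+ 2 * (\sum_(i < N) g i o) ^+ 2)); last first.
 by apply/funext => o; rewrite gE exprMn.
rewrite ExZ; last by apply: bmfX; exact: bmf_sum.
rewrite (Ex_sqr_sum bg orth); under eq_bigr do rewrite sq.
rewrite sumr_const card_ord -[(F x * (1 - F x)) *+ N]mulr_natl expr2 -mulrA mulKf// ler_wpM2l ?invr_ge0//.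
have /andP[a b] := F01 x; have p0 : 0 <= F x * (1 - F x) by rewrite mulr_ge0// subr_ge0.
have p1 : F x * (1 - F x) <= 1 by rewrite -[leRHS]mulr1; apply: ler_pM => //; [rewrite subr_ge0|lra].
rewrite -{1}(sqr_sqrtr p0) expr2 -[leRHS]mulr1 ler_wpM2l//.
by rewrite -[leRHS]sqrtr1 ler_wsqrtr.
Qed.

Lemma iid_iint_init_gap (c : R) : (\int[mu]_x (Num.sqrt (F x * (1 - F x)))%:E <= c%:E)%E ->
 (iint P (fun q => init_gap q ^+ 2)%R <= (N%:R^-1 * c)%:E)%E.
Proof.
move=> hc; have mF : measT F by exact: meas_cdf_of.
have bI x : bmf (fun o => init_gap (o, x)).
 by rewrite /init_gap /=; exact: (bmfB (bmfZ _ (bmf_sum _ (bh ^~ x))) (bc x)).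
have mI2 : measT (fun q => init_gap q ^+ 2) by apply: measurable_funX; exact: meas_init_gap.
have ms : measT (fun x => (Num.sqrt (F x * (1 - F x)))%:E).
 have msq : measT (@Num.sqrt R) by apply: continuous_measurable_fun; exact: sqrt_continuous.
 unEFin.
 exact: (measurableT_comp msq (measurable_funM mF (measurable_funB (measurable_cst (1 : R)) mF))).
rewrite (iint_swap P mI2); last 2 first.
 by move=> q; exact: sqr_ge0.
 by move=> x; exact: bmfX.
have s0 x : (0 <= (Num.sqrt (F x * (1 - F x)))%:E)%E by rewrite lee_fin.
have n0 : (0 <= (N%:R^-1)%:E :> \bar R)%E by rewrite lee_fin invr_ge0.
apply: (@le_trans _ _ (\int[mu]_x ((N%:R^-1)%:E * (Num.sqrt (F x * (1 - F x)))%:E))%E).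
 apply: ge0_le_integral => //.
 - by move=> x _; rewrite lee_fin; apply: Ex_ge0 => o; exact: sqr_ge0.
 - by unEFin; exact: (meas_Ex P mI2).
 - exact: measurable_funeM.
 - by move=> x _; rewrite -EFinM lee_fin; exact: iid_sqr_init_gap.
by rewrite (ge0_integralZl mu measurableT ms (fun x _ => s0 x) n0) (EFinM N%:R^-1) lee_wpmul2l.
Qed.

End Iid.
(** The number of half-integers $i+\frac12$ below [y] differs from [y] by at most $\frac12$ until
    the supply of [n] is exhausted; the minima let the induction pass through that point. *)
Lemma half_integer_count (y : R) (n : nat) : 0 <= y ->
 Num.min n%:R (y - 1 / 2) <= \sum_(i < n) ((i%:R + 1 / 2 : R) <= y)%R%:R <= Num.min n%:R (y + 1 / 2).
Proof.
move=> y0; elim: n => [|n /andP[lo hi]].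
 by rewrite big_ord0 ge_min lexx/= le_min lexx/=; lra.
rewrite big_ord_recr/= -natr1; set c := \sum_(i < n) _ in lo hi *.
move: hi; rewrite le_min => /andP[hi1 hi2].
have [h|h] := leP (n%:R + 1 / 2) y.
 have lo' : n%:R <= c.
  by apply: le_trans lo; rewrite le_min lexx/=; lra.
 by rewrite ge_min lerD2r lo'/= le_min; apply/andP; split; lra.
have lo' : y - 1 / 2 <= c by apply: le_trans lo; rewrite le_min lexx andbT; lra.
by rewrite addr0 ge_min lo' orbT le_min; apply/andP; split; lra.
Qed.

Section Optimal.
Hypothesis opt : forall i o, x0 i o = quantile m ((2 * i.+1%:R - 1) / (2 * N%:R)).
Variable M : R.
Hypothesis (M0 : 0 <= M) (F_left : forall x, x < - M -> cdf_of m x = 0) (F_right : forall x, M <= x -> cdf_of m x = 1).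

Let heav_opt i o x : heav (x0 i o) x = ((i%:R + 1 / 2 : R) <= N%:R * F x)%R%:R.
Proof.
have Np : 0 < N%:R :> R by rewrite ltr0n.
have iN : i%:R + 1 <= N%:R :> R by rewrite natr1 ler_nat.
have i0 : 0 <= i%:R :> R by [].
have uE : (2 * i.+1%:R - 1) / (2 * N%:R) = (i%:R + 1 / 2) / N%:R :> R by rewrite -natr1; field.
rewrite /heav opt quantile_le; last by rewrite uE divr_gt0 ?ltr_pdivrMr//; lra.
by rewrite uE ler_pdivrMr// [cdf_of m x * _]mulrC.
Qed.

Let sumE o x : init_gap (o, x) = N%:R^-1 * (\sum_(i < N) ((i%:R + 1 / 2 : R) <= N%:R * F x)%R%:R - N%:R * F x).
Proof. by rewrite /init_gap /= mulrBr mulKf// -/(F x); congr (_ * _ - _); apply: eq_bigr => i _; exact: heav_opt. Qed.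

Lemma optimal_norm_init_gap o x : `|init_gap (o, x)| <= N%:R^-1.
Proof.
have /andP[a b] := F01 x.
have y0 : 0 <= N%:R * F x by rewrite mulr_ge0.
have yN : N%:R * F x <= N%:R by rewrite ler_piMr.
have := half_integer_count N y0; rewrite sumE; set c := \sum_(i < N) _ => /andP[lo].
rewrite le_min => /andP[_ hi].
have lo' : N%:R * F x - 1 / 2 <= c by apply: le_trans lo; rewrite le_min lexx andbT; lra.
rewrite normrM ger0_norm ?invr_ge0// -[leRHS]mulr1 ler_wpM2l ?invr_ge0//.
by rewrite ler_norml; apply/andP; split; lra.
Qed.

Lemma optimal_init_gap0 o x : x < - M \/ M <= x -> init_gap (o, x) = 0.
Proof.
rewrite sumE; case => [/F_left E|/F_right E]; rewrite /F E.
 rewrite mulr0 subr0 big1 ?mulr0// => i _; rewrite leNgt ltr_wpDl//.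
rewrite mulr1 (eq_bigr (fun=> 1)); first by rewrite sumr_const card_ord subrr mulr0.
(* At full mass every one of the [N] half-integers is counted, because the largest is
   $N-\frac12$. *)
move=> i _; have : i%:R + 1 <= N%:R :> R by rewrite natr1 ler_nat.
by move=> iN; rewrite (_ : _ <= _ = true)//; lra.
Qed.

Lemma optimal_integral_init_gap o : (\int[mu]_x `|init_gap (o, x)|%:E <= (2 * M / N%:R)%:E)%E.
Proof.
have mI : measT (fun x => `|init_gap (o, x)|%:E).
 by mnorm; exact: (meas_slice1 o meas_init_gap).
apply: (@le_trans _ _ (\int[mu]_x ((N%:R^-1)%:E * (\1_(`[- M, M]%classic) x)%:E))%E).
 apply: ge0_le_integral => //.
 - by apply: measurable_funeM; unEFin; exact: measurable_indic.
 - move=> x _; rewrite -EFinM lee_fin indicE mem_setE in_itv/=.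
  have [xM|xM] := ltP x (- M); first by rewrite optimal_init_gap0 ?normr0 ?mulr_ge0 ?invr_ge0//; left.
  have [Mx|Mx] := leP M x; first by rewrite optimal_init_gap0 ?normr0 ?mulr_ge0 ?invr_ge0//; right.
  by rewrite (ltW Mx) mulr1; exact: optimal_norm_init_gap.
have n0 : (0 <= (N%:R^-1)%:E :> \bar R)%E by rewrite lee_fin invr_ge0.
have i0 x : (0 <= (\1_(`[- M, M]%classic) x)%:E :> \bar R)%E by rewrite lee_fin.
have mi : measT (fun x : R => (\1_(`[- M, M]%classic) x)%:E : \bar R) by unEFin; exact: measurable_indic.
rewrite (ge0_integralZl mu measurableT mi (fun x _ => i0 x) n0) integral_indic// setIT.
rewrite -[X in (_ * X)%E]/(mu `[- M, M]) (lebesgue_measure_itv `[- M, M]) /= lte_fin.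
case: ifP => _; last by rewrite mule0 lee_fin mulr_ge0 ?mulr_ge0 ?invr_ge0.
by rewrite -EFinB -EFinM lee_fin le_eqVlt; apply/orP; left; apply/eqP; ring.
Qed.

End Optimal.
End InitialPositions.

(** The constant of [cdf_error_L1] with the notations of that section spelled out: the Gronwall
    factor of the $L^1$ recursion times its inhomogeneity, into which that of the $L^2$ recursion is
    inserted. *)
HB.lock Definition rate_const (R : realType) (T sigma L k : R) : R :=
 gronwall_const (3 / 2 * L / sigma) T *
  (1 + (1 + 3 * L ^+ 2 * kappa T sigma + quad_const T sigma L k + 2 * L) +
   3 / sigma * Num.sqrt T * k * gronwall_const (18 * kappa T sigma * L ^+ 2 / sigma) T *
   (4 * (1 + 16 * sigma * Num.sqrt T + (2 * (1 + 8 * L * kappa T sigma) + 2 * L * Num.sqrt T / sigma) *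
    (1 + 3 * L ^+ 2 * kappa T sigma + quad_const T sigma L k + 2 * L)))).

(** * Rate of convergence at all times *)

Section Rate.
Context d (Omega : measurableType d) (R : realType) (P : probability Omega R).
Notation mu := (@lebesgue_measure R).
Notation "''Ex' f" := (\int[P]_w f w) (at level 10, f at level 9).
Variables (T sigma L k0 : R) (Lam lam : R -> R).
Hypotheses (T0 : 0 < T) (sigma0 : 0 < sigma).
Hypothesis fb : flux_bounds Lam lam L k0.
Variables (pastl : R -> set (set Omega)) (Wl Xl : R -> Omega -> R) (bl : R * Omega -> R) (Bl : R -> Omega -> R).
Hypothesis dvl : driven P T sigma L pastl Wl Xl bl Bl.
Hypothesis bl_left : forall s (u : nat -> R), 0 < s < T -> (forall j, 0 <= u j <= s) ->
 u @ \oo --> s -> {ae P, forall w, bl (u j, w) @[j --> \oo] --> bl (s, w)}.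
Hypothesis BlE : forall s w, Bl s w = lamF P (Xl s) lam (Xl s w).

Lemma rate_const_ge0 : 0 <= rate_const T sigma L k0.
Proof.
have L0 := fluxL0 fb; have kp0 := fluxk0 fb; have s0 := ltW sigma0.
have ka : 0 <= kappa T sigma by exact: kappa_ge0.
have qc : 0 <= quad_const T sigma L k0 by exact: (quad_const_ge0 T0 sigma0 dvl fb).
have qi : 0 <= 1 + 3 * L ^+ 2 * kappa T sigma + quad_const T sigma L k0 + 2 * L by rewrite !addr_ge0 ?mulr_ge0 ?sqr_ge0.
have qs : 0 <= 2 * (1 + 8 * L * kappa T sigma) + 2 * L * Num.sqrt T / sigma.
 by rewrite addr_ge0 ?mulr_ge0 ?addr_ge0 ?mulr_ge0 ?invr_ge0.
have g1 : 0 <= gronwall_const (3 / 2 * L / sigma) T.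
 by apply: gronwall_const_ge0; [rewrite !mulr_ge0 ?invr_ge0|exact: ltW].
have g2 : 0 <= gronwall_const (18 * kappa T sigma * L ^+ 2 / sigma) T.
 by apply: gronwall_const_ge0; [rewrite !mulr_ge0 ?sqr_ge0 ?invr_ge0|exact: ltW].
have p1 : 0 <= 3 / sigma * Num.sqrt T * k0 by rewrite !mulr_ge0 ?invr_ge0.
have p2 : 0 <= 16 * sigma * Num.sqrt T by rewrite !mulr_ge0.
rewrite rate_const.unlock; apply: mulr_ge0 => //; apply: addr_ge0; first exact: addr_ge0.
apply: mulr_ge0; first exact: mulr_ge0.
by apply: mulr_ge0 => //; apply: addr_ge0; [exact: addr_ge0|exact: mulr_ge0].
Qed.

Variables (N : nat) (h : R) (X0 : forall N : nat, 'I_N -> {RV P >-> R}) (W : nat -> R -> {RV P >-> R}).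
Variable X : 'I_N -> R -> {RV P >-> R}.
Hypotheses (N0 : (0 < N)%N) (h0 : 0 <= h).
Hypothesis BM : independent_brownian_motions P W.
Hypothesis indep0 : independent_initial P X0 W.
Hypothesis sol : particle_solution P T sigma Lam h (@X0 N) W X.

Notation Xp := (fun i s => X i s : Omega -> R).
Notation gapN := (mean_gap P Xl Xp).
Notation past := (particle_past W (@X0) N).
Notation Bp := (particle_drift Lam h X).

Variables (V0 U0 : R).
Hypotheses (V0_ge0 : 0 <= V0) (U0_ge0 : 0 <= U0).
Hypothesis init_L2 : forall h', (iint P (fun q => cdf_error P Xl Xp h' 0 q ^+ 2)%R <= V0%:E)%E.
Hypothesis init_L1 : (\int[mu]_x `|gapN 0 x|%:E <= U0%:E)%E.

(** The added 1 ensures [1 <= rate], which covers time 0, where the error is the initial one and the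
    recursion says nothing. *)
Notation rate := (rate_const T sigma L k0 + 1).
Let rate1 : 1 <= rate. Proof. by rewrite lerDr rate_const_ge0. Qed.

Section GridBound.
Variables (bp : 'I_N -> R * Omega -> R).
Hypothesis dvp : forall i : 'I_N, driven P T sigma L (past i) (W i) (X i) (bp i) (Bp i).

Lemma grid_bound (h' eta : R) (m : nat) : 0 < h' -> m%:R * h' <= T -> 0 <= eta ->
 (forall i, (\sum_(j < m) cell_defect P (bp i) h' j <= eta%:E)%E) ->
 (forall j, (j < m)%N -> tau h (j%:R * h') = j%:R * h') ->
 forall n, (n <= m)%N -> (\int[mu]_x `|gapN (n%:R * h') x|%:E <= (rate * (V0 + U0 + N%:R^-1 + eta + h'))%:E)%E.
Proof.
move=> h'0 mhT eta0 def_eta tauE n nm.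
have qt : 0 <= V0 + U0 + N%:R^-1 + eta + h' by rewrite !addr_ge0 ?invr_ge0// ltW.
have [->|n0] := posnP n.
 rewrite mul0r; apply: le_trans init_L1 _; rewrite lee_fin.
 apply: (@le_trans _ _ (V0 + U0 + N%:R^-1 + eta + h')); last by rewrite ler_peMl.
 have : 0 <= N%:R^-1 :> R by rewrite invr_ge0.
 by have := ltW h'0; move: V0_ge0 eta0; lra.
have crossX (i j : 'I_N) r s : 0 <= r -> r <= s -> s <= T -> sub_measurable (past j s) (Xp i r).
 move=> r0 rs sT; have mono : <<s past j r >> `<=` <<s past j s >> by exact: particle_past_mono.
 apply: (sub_measurable_mono mono).
 by apply: (particle_adapted sol); rewrite r0 (le_trans rs).
have crossB (i j : 'I_N) r s : 0 <= r -> r <= s -> s <= T -> sub_measurable (past j s) (Bp i r).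
 move=> r0 rs sT; apply/sub_measurableP; apply: meas_rank_drift => l; apply/sub_measurableP.
 have /andP[t0 tr] := tau_itv h0 r0.
 by apply: crossX => //; exact: le_trans rs.
have crossW (i j : 'I_N) r s : 0 <= r -> i <> j \/ r <= s -> sub_measurable (past j s) (W i r : Omega -> R).
 by move=> r0 ij; apply: particle_past_brownian => //; case: ij => [ij|]; [left => /val_inj|right].
have BpE i j w : (j < m)%N -> Bp i (j%:R * h') w = rank_drift Lam i (fun l => Xp l (j%:R * h') w).
 by move=> jm; rewrite /particle_drift tauE.
have init' : (\int[mu]_x `|'Ex (fun o => cdf_error P Xl Xp h' 0 (o, x))|%:E <= U0%:E)%E.
 by under eq_integral do rewrite (mean_cdf_error Xl dvp) mul0r.
have no_tie (i j : 'I_N) s : i != j -> 0 < s <= T -> {ae P, forall w, Xp i s w <> Xp j s w}.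
 exact: (particle_no_tie T0 sigma0 h0 BM indep0 sol fb).
have := cdf_error_L1 T0 sigma0 fb dvl bl_left BlE N0 dvp crossX crossB crossW no_tie h'0 mhT eta0 def_eta BpE
 V0_ge0 U0_ge0 (init_L2 h') init' (n := n).
rewrite n0 nm => /(_ isT).
under eq_integral do rewrite (mean_cdf_error Xl dvp).
move=> /le_trans; apply; rewrite lee_fin mulrA.
by rewrite rate_const.unlock ler_wpM2r// lerDl.
Qed.

End GridBound.

(** On the grid of the scheme the defects vanish and [eta] is 0. Between two grid times the error is
    propagated from the last one by [mean_gap_step], which accounts for the summand [2 * L]. *)
Lemma euler_gap t : 0 < h -> h <= T -> 0 <= t <= T ->
 (\int[mu]_x `|gapN t x|%:E <= ((rate + 2 * L) * (V0 + U0 + N%:R^-1 + h))%:E)%E.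
Proof.
move=> hp hT /andP[t0 tT].
have [bp Hb] := choice (fun i : 'I_N => euler_driven sigma0 h0 BM indep0 sol fb i hp).
have dvp (i : 'I_N) : driven P T sigma L (past i) (W i) (X i) (bp i) (Bp i) by case: (Hb i).
pose n := Num.trunc (t / h).
have th0 : 0 <= t / h by rewrite divr_ge0.
have nt : n%:R * h <= t by rewrite -ler_pdivlMr// truncn_le.
have tn : t < n.+1%:R * h by rewrite -ltr_pdivrMr// truncnS_gt.
have nT : n%:R * h <= T := le_trans nt tT.
have cd0 i : (\sum_(j < n) cell_defect P (bp i) h j <= 0%:E)%E.
 rewrite big1// => j _; case: (Hb i) => _; apply; apply: le_trans nT.
 by rewrite ler_wpM2r// ler_nat; exact: ltn_ord.
have tauE j : (j < n)%N -> tau h (j%:R * h) = j%:R * h.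
 by move=> _; rewrite tau_gfl ?mulr_ge0// /gfl mulfK ?gt_eqF// natrK.
have gb := grid_bound dvp hp nT (lexx 0) cd0 tauE (leqnn n).
rewrite addr0 in gb.
have L0 := fluxL0 fb.
have q0 : 0 <= V0 + U0 + N%:R^-1 by rewrite !addr_ge0 ?invr_ge0.
have Lq := mulr_ge0 L0 q0.
have Lh := mulr_ge0 L0 h0.
move: nt; rewrite le_eqVlt => /orP[/eqP E|nt].
 rewrite E in gb; apply: le_trans gb _; rewrite lee_fin; apply: ler_wpM2r; first exact: addr_ge0.
 by rewrite lerDl mulr_ge0.
have nh0 : 0 <= n%:R * h by rewrite mulr_ge0.
apply: le_trans (mean_gap_step sigma0 dvl N0 dvp nh0 nt tT) _.
apply: le_trans (leeD gb (lexx _)) _; rewrite -EFinD lee_fin (mulrDl rate) lerD2l.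
have : t - n%:R * h <= h by rewrite -natr1 mulrDl mul1r in tn; lra.
by move=> /(ler_wpM2l L0); lra.
Qed.

(** The grid is auxiliary and divides $[0,t]$ exactly; mesh and defect can be made arbitrarily
    small, so neither is left in the bound. *)
Lemma continuous_gap t : h = 0 -> 0 <= t <= T ->
 (\int[mu]_x `|gapN t x|%:E <= (rate * (V0 + U0 + N%:R^-1))%:E)%E.
Proof.
move=> hE /andP[t0 tT]; apply/lee_addgt0Pr => e e0.
have [bp Hb] := choice (fun i : 'I_N => continuous_driven_left T0 sigma0 h0 BM indep0 sol fb i hE).
have dvp (i : 'I_N) : driven P T sigma L (past i) (W i) (X i) (bp i) (Bp i) by case: (Hb i).
have tauE s : tau h s = s by rewrite hE tau0.
have rate0 : 0 < rate by exact: lt_le_trans rate1.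
move: t0; rewrite le_eqVlt => /orP[/eqP <-|t0].
 have T1 : 0%:R * T <= T by rewrite mul0r ltW.
 have z i : (\sum_(j < 0) cell_defect P (bp i) T j <= 0%:E)%E by rewrite big_ord0.
 apply: le_trans init_L1 _; rewrite -EFinD lee_fin.
 have q0 : 0 <= V0 + U0 + N%:R^-1 by rewrite !addr_ge0 ?invr_ge0.
 apply: (@le_trans _ _ (V0 + U0 + N%:R^-1)); last by have := ler_peMl q0 rate1; lra.
 by rewrite addrAC lerDr addr_ge0 ?invr_ge0.
(* Defect and mesh will both be at most [et], and [rate * (2 * et)] is [e]. *)
pose et := e / (2 * rate); have et0 : 0 < et by rewrite divr_gt0// mulr_gt0.
have bleft i s (u : nat -> R) : 0 < s < t -> (forall j, 0 <= u j <= s) -> u @ \oo --> s ->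
  {ae P, forall w, bp i (u j, w) @[j --> \oo] --> bp i (s, w)}.
 by move=> /andP[s0 st]; case: (Hb i) => _; apply; rewrite s0 (lt_le_trans st).
have [r Hr] := choice (fun i : 'I_N => cell_defect_eventually t0 (dv_b (dvp i)) (dv_bL (dvp i)) (bleft i) et0).
(* Fine enough for the defects of all particles at once; only finitely many thresholds are
   involved. *)
pose n := maxn (\max_(i < N) r i) (Num.trunc (t / et)).+1.
have n0 : (0 < n)%N by rewrite leq_max orbT.
have nR : 0 < n%:R :> R by rewrite ltr0n.
have nt : n%:R * (t / n%:R) = t by rewrite mulrCA mulfV ?mulr1// gt_eqF.
have ntT : n%:R * (t / n%:R) <= T by rewrite nt.
have hn : t / n%:R <= et.
 rewrite ler_pdivrMr// mulrC -ler_pdivrMr//; apply: le_trans (ltW (truncnS_gt _)) _.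
 by rewrite ler_nat leq_maxr.
have cd i : (\sum_(j < n) cell_defect P (bp i) (t / n%:R) j <= et%:E)%E.
 by apply: Hr => //; rewrite leq_max (leq_bigmax i).
have := grid_bound dvp (divr_gt0 t0 nR) ntT (ltW et0) cd (fun j _ => tauE _) (leqnn n).
rewrite nt => /le_trans; apply; rewrite -EFinD lee_fin.
rewrite -[V0 + U0 + N%:R^-1 + et + _]addrA mulrDr lerD2l.
apply: (@le_trans _ _ (rate * (2 * et))); first by rewrite ler_pM2l//; lra.
by rewrite /et le_eqVlt; apply/orP; left; apply/eqP; field; rewrite gt_eqF.
Qed.

Lemma particle_gap t : h <= T -> 0 <= t <= T ->
 (\int[mu]_x `|gapN t x|%:E <= ((rate + 2 * L) * (V0 + U0 + N%:R^-1 + h))%:E)%E.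
Proof.
move=> hT tT; move: h0; rewrite le_eqVlt => /orP[/eqP hE|hp]; last exact: euler_gap.
apply: le_trans (continuous_gap (esym hE) tT) _; rewrite lee_fin -hE addr0 ler_wpM2r//.
 by rewrite !addr_ge0 ?invr_ge0.
by rewrite lerDl mulr_ge0// (fluxL0 fb).
Qed.

End Rate.

(** * Error at time 0 *)

Section InitialError.
Context d (Omega : measurableType d) (R : realType) (P : probability Omega R).
Notation mu := (@lebesgue_measure R).
Notation "''Ex' f" := (\int[P]_w f w) (at level 10, f at level 9).
Variables (T sigma : R) (Lam lam : R -> R) (m : probability R R).
Variables (Wl Xl : R -> {RV P >-> R}) (X0 : forall N : nat, 'I_N -> {RV P >-> R}) (W : nat -> R -> {RV P >-> R}).
Hypothesis (T0 : 0 < T).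
Hypothesis soll : limit_solution P T sigma lam m Wl Xl.
Hypothesis BM : independent_brownian_motions P W.

Section Transfer.
Variables (N : nat) (h : R) (X : 'I_N -> R -> {RV P >-> R}).
Hypothesis sol : particle_solution P T sigma Lam h (@X0 N) W X.
Notation Xp := (fun i s => X i s : Omega -> R).
Notation Xlf := (fun s => Xl s : Omega -> R).
Notation x0 := (fun i => @X0 N i : Omega -> R).

Let mX i s : measT (Xp i s). Proof. exact: measurable_funP. Qed.
Let mx0 i : measT (x0 i). Proof. exact: measurable_funP. Qed.

Lemma rcdf_limit_initial x : rcdf P (Xl 0) x = cdf_of m x.
Proof.
have [law _ _ _ _] := soll; rewrite /cdf_of -(law `]-oo, x]%classic)// -(EFin_rcdf P)//.
Qed.

(** Only almost sure: it evaluates the equation at time 0, where the Brownian motion vanishes almost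
    surely and the drift is integrated over a single point. *)
Lemma ae_initial : {ae P, forall o i, X i 0 o = @X0 N i o}.
Proof.
apply: filter_forall => i; have [_ _ XE] := sol i; have [W0 _ _ _] := BM.1 i.
apply: filterS2 XE W0 => o hX hW; rewrite hX ?lexx ?ltW// hW mulr0 addr0.
by rewrite set_itv1 Rintegral_set1 addr0.
Qed.

Lemma ae_cdf_error0 h' : {ae P, forall o x, cdf_error P Xlf Xp h' 0 (o, x) = init_gap m x0 (o, x)}.
Proof.
apply: filterS ae_initial => o ho x; rewrite /cdf_error /mean_heav /init_gap /= mul0r rcdf_limit_initial.
by congr (_ * _ - _); apply: eq_bigr => i _; rewrite ho.
Qed.

Lemma iint_cdf_error0 h' (c : R) : (iint P (fun q => init_gap m x0 q ^+ 2)%R <= c%:E)%E ->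
 (iint P (fun q => cdf_error P Xlf Xp h' 0 q ^+ 2)%R <= c%:E)%E.
Proof.
apply: le_trans; apply: le_iint.
- apply: measurable_funX; apply: measurable_funB.
  by apply: measurable_funM => //; apply: measurable_sum => i; apply: meas_heav => //; exact: meas_fst_comp.
 by apply: (measurableT_comp (f := rcdf P (Xl (0%:R * h')))) => //; apply: meas_rcdf; exact: measurable_funP.
- by apply: measurable_funX; exact: meas_init_gap.
- by move=> q; exact: sqr_ge0.
- by move=> q; exact: sqr_ge0.
- by apply: filterS (ae_cdf_error0 h') => o ho x; rewrite ho.
Qed.

Lemma mean_gap0 x : mean_gap P Xlf Xp 0 x = 'Ex (fun o => init_gap m x0 (o, x)).
Proof.
have bh i : bmf (fun o => heav (x0 i o) x) by exact: bmf_heav.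
rewrite /init_gap /= (ExB P (bmfZ _ (bmf_sum _ bh)) (@bmf_cst _ Omega R (cdf_of m x))) Ex_cst.
rewrite (ExZ P _ (bmf_sum _ bh)) (Ex_sum P _ bh) /mean_gap rcdf_limit_initial; congr (_ * _ - _).
apply: eq_bigr => i _; apply: Ex_ae_eq; [exact: meas_heav|exact: meas_heav|].
by apply: filterS ae_initial => o ->.
Qed.

End Transfer.

Lemma compactly_supported_cdf : compactly_supported m -> exists2 M : R, 0 <= M &
 (forall x, x < - M -> cdf_of m x = 0) /\ (forall x, M <= x -> cdf_of m x = 1).
Proof.
move=> [K cK mK]; have [M0 [_ hM0]] := compact_bounded cK.
pose M := `|M0| + 1; have KM x : K x -> `|x| <= M by apply: hM0; rewrite /M (le_lt_trans (ler_norm _))// ltrDl.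
have mKK : measurable K by apply: closed_measurable; exact: compact_closed.
have mK1 : m K = 1%E.
 rewrite -[m K]adde0 -mK -measureU ?setICr ?setUv//; try exact: measurableC.
 exact: probability_setT.
exists M; first by rewrite addr_ge0.
split=> x hx; rewrite /cdf_of.
 have -> : m `]-oo, x]%classic = 0%E; last by [].
 apply/eqP; rewrite eq_le measure_ge0 andbT -mK; apply: le_measure; rewrite ?inE//; first exact: measurableC.
 move=> y /=; rewrite in_itv/= => yx /KM; rewrite ler_norml => /andP[My _].
 by move: (le_lt_trans yx hx); rewrite ltNge My.
have -> : m `]-oo, x]%classic = 1%E; last by [].
apply/eqP; rewrite eq_le probability_le1//= -mK1; apply: le_measure; rewrite ?inE//.
by move=> y /KM; rewrite /= in_itv/= => yM; apply: le_trans hx; apply: le_trans yM; exact: ler_norm.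
Qed.

(** In the i.i.d. case the mean error vanishes identically and only the variance, of order $1/N$,
    counts. In the deterministic case the error itself is of order $1/N$ in $L^1$, and being at most
    1 it has a square of the same order. *)
Lemma initial_errors :
 (iid_initial P m (@X0) /\ (\int[lebesgue_measure]_x (Num.sqrt (cdf_of m x * (1 - cdf_of m x)))%:E < +oo)%E)
  \/ (optimal_deterministic_initial P m (@X0) /\ compactly_supported m) ->
 exists2 c : R, 0 <= c & forall N, (0 < N)%N ->
  (iint P (fun q => init_gap m (fun i => @X0 N i : Omega -> R) q ^+ 2)%R <= (c / N%:R)%:E)%E /\
  (\int[mu]_x `|'Ex (fun o => init_gap m (fun i => @X0 N i : Omega -> R) (o, x))|%:E <= (c / N%:R)%:E)%E.
Proof.
have mx0 N i : measT (@X0 N i : Omega -> R) by exact: measurable_funP.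
case=> [[[Y [lawY indY X0Y]] hfin]|[opt /compactly_supported_cdf[M M0 [Fl Fr]]]].
 have s0 : (0 <= \int[mu]_x (Num.sqrt (cdf_of m x * (1 - cdf_of m x)))%:E)%E by apply: integral_ge0 => x _; rewrite lee_fin.
 have fin : (\int[mu]_x (Num.sqrt (cdf_of m x * (1 - cdf_of m x)))%:E)%E \is a fin_num by rewrite ge0_fin_numE.
 exists (fine (\int[mu]_x (Num.sqrt (cdf_of m x * (1 - cdf_of m x)))%:E)%E); first exact: fine_ge0.
 move=> N N0.
 have X0E i : (@X0 N i : Omega -> R) = Y i by apply/funext => o; exact: X0Y.
 have law i : has_law P (@X0 N i : Omega -> R) m by rewrite X0E; exact: lawY.
 have ind (i j : 'I_N) (A B : set R) : i != j -> measurable A -> measurable B ->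
   P ((@X0 N i : Omega -> R) @^-1` A `&` (@X0 N j : Omega -> R) @^-1` B) = (P ((@X0 N i : Omega -> R) @^-1` A) * P ((@X0 N j : Omega -> R) @^-1` B))%E.
  move=> ij mA mB; rewrite !X0E.
  have ij' : (i : nat) != j by [].
  pose S (l : nat) := if l == i then Y l @^-1` A else Y l @^-1` B.
  have hS l : l \in [fset (i : nat); (j : nat)]%fset -> generated_sigma_algebra [set: unit] (fun _ => Y l) (S l).
   by move=> _; rewrite /S; case: ifP => _; exact: (@generated_preimage _ Omega R unit setT (fun _ => Y l : Omega -> R) tt).
  have := indY [fset (i : nat); (j : nat)]%fset S hS.
  rewrite big_fsetU1 ?inE//= big_seq_fset1 /S eqxx eq_sym (negbTE ij') => <-.
  congr (P _); apply/seteqP; split=> o /=.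
   by move=> [Ai Bj] l /=; rewrite !inE => /orP[] /eqP ->; rewrite ?eqxx// eq_sym (negbTE ij').
  move=> H; split; first by have := H i; rewrite /= !inE !eqxx /=; apply.
  by have := H j; rewrite /= !inE !eqxx orbT eq_sym (negbTE ij'); apply.
 split.
  rewrite mulrC; apply: (iid_iint_init_gap N0 (mx0 N) law ind).
  by rewrite fineK.
 under eq_integral do rewrite (iid_mean_init_gap N0 (mx0 N) law) normr0.
 by rewrite integral0 lee_fin divr_ge0// fine_ge0.
exists (2 * M); first by rewrite mulr_ge0.
move=> N N0.
have opt' (i : 'I_N) o : (@X0 N i : Omega -> R) o = quantile m ((2 * i.+1%:R - 1) / (2 * N%:R)) by exact: opt.
have mI := meas_init_gap m (mx0 N).
have hI : (iint P (fun q => `|init_gap m (fun i => @X0 N i : Omega -> R) q|)%R <= (2 * M / N%:R)%:E)%E.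
 apply: (@le_trans _ _ (\int[P]_o (2 * M / N%:R)%:E)%E); last by rewrite integral_cst//= probability_setT mule1.
 apply: ge0_le_integral => //.
 - by move=> o _; apply: integral_ge0 => x _; rewrite lee_fin.
 - have mn : measT (fun q => `|init_gap m (fun i => @X0 N i : Omega -> R) q|) by exact: measurableT_comp.
  by apply: (@meas_integral1 _ _ _ _ R mu _ mn) => q; exact: normr_ge0.
 - by move=> o _; exact: (optimal_integral_init_gap N0 (mx0 N) opt' M0 Fl Fr).
split; last exact: le_trans (integral_Ex_le P mI) hI.
rewrite -[2 * M / N%:R]mul1r; apply: iint_sqr_le => //.
apply: nearW => o x; apply: le_trans (optimal_norm_init_gap N0 opt' o x) _.
by rewrite invf_le1 ?ltr0n// ler1n.
Qed.

End InitialError.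

Theorem corollary2p9 (R : realType) (T sigma : R) (Lam lam : R -> R)
  (m : probability R R)
  (d : measure_display) (Omega : measurableType d) (P : probability Omega R)
  (Wlim Xlim : R -> {RV P >-> R})
  (W : nat -> R -> {RV P >-> R}) (X0 : forall N : nat, 'I_N -> {RV P >-> R})
  (T_gt0 : 0 < T) (sigma_gt0 : 0 < sigma)
  (Lam_C1 : C1_on01 Lam lam)
  (Wlim_BM : brownian_motion P Wlim)
  (Xlim_sol : limit_solution P T sigma lam m Wlim Xlim)
  (W_BM : independent_brownian_motions P W)
  (X0_indep : independent_initial P X0 W)
  (lam_lipschitz : [lipschitz lam x | x in `[0, 1]%classic])
  (initial_positions :
    (iid_initial P m X0 /\
     (\int[lebesgue_measure]_x
        (Num.sqrt (cdf_of m x * (1 - cdf_of m x)))%:E < +oo)%E)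
    \/ (optimal_deterministic_initial P m X0 /\ compactly_supported m)) :
  exists Cb : R, forall (N : nat) (h : R), (0 < N)%N -> 0 <= h <= T ->
    forall X : 'I_N -> R -> {RV P >-> R},
      particle_solution P T sigma Lam h (X0 N) W X ->
      (ereal_sup [set wasserstein1 (mean_empirical P (X ^~ t))
                        (distribution P (Xlim t)) | t in `[0%R, T]%classic]
       <= (Cb * (N%:R^-1 + h))%:E)%E.
Proof.
have [L [k fb]] := flux_boundsP Lam_C1 lam_lipschitz.
have [bl [dvl bl_left]] := limit_driven T_gt0 sigma_gt0 Wlim_BM Xlim_sol fb.
have [c c0 init] := initial_errors initial_positions.
have L0 := fluxL0 fb; have r0 := rate_const_ge0 T_gt0 sigma_gt0 fb dvl.
(* Both initial errors are at most [c / N], so the total is $(2c+1)/N+h$, and this is at most $2c+1$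
   times $1/N+h$. *)
exists ((rate_const T sigma L k + 1 + 2 * L) * (2 * c + 1)) => N h N0 /andP[h0 hT] X sol.
have [iV iU] := init N N0.
have NV : 0 <= N%:R^-1 :> R by rewrite invr_ge0.
have cN : 0 <= c / N%:R by rewrite divr_ge0.
have iU' : (\int[lebesgue_measure]_x `|mean_gap P (fun s => Xlim s : Omega -> R) (fun i s => X i s : Omega -> R) 0 x|%:E <= (c / N%:R)%:E)%E.
  by under eq_integral do rewrite (mean_gap0 T_gt0 Xlim_sol W_BM sol).
apply: ge_ereal_sup => _ [t /= tT <-]; rewrite in_itv/= in tT.
apply: le_trans (wasserstein1_le _ (mean_empirical_setT (X ^~ t) N0)) _.
rewrite [leLHS](_ : _ = \int[lebesgue_measure]_x `|mean_gap P (fun s => Xlim s : Omega -> R) (fun i s => X i s : Omega -> R) t x|%:E)%E; last first.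
  by apply: eq_integral => x _; rewrite mean_empirical_cdf cdf_of_distribution.
apply: le_trans (particle_gap T_gt0 sigma_gt0 fb dvl bl_left (fun _ _ => erefl) N0 h0 W_BM X0_indep sol cN cN
  (fun h' => iint_cdf_error0 T_gt0 Xlim_sol W_BM sol h' iV) iU' hT tT) _.
rewrite lee_fin -mulrA ler_wpM2l ?addr_ge0 ?mulr_ge0//.
have := mulr_ge0 c0 h0; have := mulr_ge0 c0 NV; lra.
Qed.
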